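(* Let $T>0$ and $\nu\ge0$ be fixed. Let the pressure be $p(\rho)=\rho^\gamma$ with $\gamma>1$, and let $\mu(\rho)=\rho^{\frac{s+3}{2}}$ with $s\ge-1$ and $\gamma\ge s+2$. Assume condition A1): $\{b_{i,j}\}_{i,j=1}^n$ is symmetric, $b_{i,j}\ge0$ for $i\ne j$, and for any $\rho_1,\dots,\rho_n>0$ the solutions $(u_1,\dots,u_n)\in\mathbb{R}^n$ of $\sum_jb_{i,j}\rho_i\rho_j(u_i-u_j)=0$, $i=1,\dots,n$, are exactly the multiples of $(1,\dots,1)$. For every $\epsilon>0$ let $(\hat\rho^\epsilon,\hat m^\epsilon,\hat J^\epsilon)$ be a periodic dissipative weak solution, with finite total mass and finite total energy (with constant $K$ independent of $\epsilon$), of the Navier–Stokes–Korteweg multicomponent system (S$_\epsilon$) of the context. Let $(\bar{\hat\rho},\bar{\hat m},\bar{\hat J})$, with $\bar m_i=\bar\rho_i\bar u$ and $\bar J_i=\bar\rho_i\bar v_i$, be a smooth solution on $[0,T]$ of the equilibrium system (E) of the context. Assume there exist constants $k_*,N$ independent of $\epsilon$ such that $0<k_*\le\rho_i^\epsilon\le N$ on $\mathbb{T}^3\times(0,T)$ for all $i$. Let $$\Psi(t)=\int_{\mathbb{T}^3}\sum_{i=1}^n\left(\frac12\rho_i^\epsilon\left|\frac{m_i^\epsilon}{\rho_i^\epsilon}-\frac{\bar m_i}{\bar\rho_i}\right|^2+\frac12\rho_i^\epsilon\left|\frac{J_i^\epsilon}{\rho_i^\epsilon}-\frac{\bar J_i}{\bar\rho_i}\right|^2+h(\rho_i^\epsilon|\bar\rho_i)\right)dx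 .$$ Then for any $t\in[0,T]$ $$\Psi(t)\le\left(\Psi(0)+\epsilon\,C(\delta)(\nu^2+1)\right)e^{C(\nu^2+\nu+1)t},$$ where $C,C(\delta)>0$ are constants independent of $\epsilon$, $\nu$ and $t$, depending only on $T$, $K$, $k_*$, $N$, $n$, $s$, $\gamma$, $b_{i,j}$, on $\bar\rho_i,\bar u$ and their derivatives, and on $\delta$; here $\delta>0$ is a constant, depending only on $\{b_{i,j}\}$, $n$, $k_*$ and $N$, such that $\frac12\sum_{i,j}b_{i,j}\rho_i\rho_j|u_i-u_j|^2\ge\delta\sum_i\rho_i^2|u_i-u|^2$ for all $\rho_i\in[k_*,N]$ and $u_i\in\mathbb{R}^3$, with $u=\sum_i\rho_iu_i/\sum_i\rho_i$. Moreover, if $\Psi(0)\to0$ as $\epsilon\to0$, then $\sup_{t\in[0,T]}\Psi(t)\to0$ as $\epsilon\to0$.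
   Context: Notation. $\mathbb{T}^3$ is the 3-dimensional torus, $n$ is the number of components, $i=1,\dots,n$. For a vector field $\phi$, $(\nabla\phi)_{kl}=\partial_l\phi_k$, $D(\phi)=\frac12(\nabla\phi+{}^t\nabla\phi)$; for a matrix field $A$, $(\operatorname{div}A)_k=\sum_l\partial_lA_{kl}$; $(a\otimes b)_{kl}=a_kb_l$. $\hat\rho=(\rho_1,\dots,\rho_n)$, $\hat m=(m_1,\dots,m_n)$ with $m_i=\rho_iu_i$, $\hat J=(J_1,\dots,J_n)$ with $J_i=\rho_iv_i=\nabla\mu(\rho_i)$, where the drift velocity is $v_i=\nabla\mu(\rho_i)/\rho_i$. The function $\mu$ is related to the capillarity $k(\rho)\ge0$ by $\mu'(\rho)=\sqrt{\rho k(\rho)}$, and $\lambda(\rho)=2(\rho\mu'(\rho)-\mu(\rho))$. $p(\rho)=\rho^\gamma$, $h(\rho)=\rho^\gamma/(\gamma-1)$, and $h(\rho|\bar\rho)=h(\rho)-h(\bar\rho)-h'(\bar\rho)(\rho-\bar\rho)$. The Lamé coefficients are chosen equal to $\mu$ and $\lambda$. Define $\operatorname{div}S_i=\operatorname{div}(\mu(\rho_i)\nabla v_i)+\frac12\nabla(\lambda(\rho_i)\operatorname{div}v_i)$ and $\operatorname{div}K_i=\operatorname{div}(\mu(\rho_i)\,{}^t\nabla u_i)+\frac12\nabla(\lambda(\rho_i)\operatorname{div}u_i)$. System (S$_\epsilon$): $$\partial_t\rho_i+\operatorname{div}(\rho_iu_i)=0,$$ $$\partial_t(\rho_iu_i)+\operatorname{div}(\rho_iu_i\otimes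 u_i)-2\nu\operatorname{div}(\mu(\rho_i)D(u_i))-\nu\nabla(\lambda(\rho_i)\operatorname{div}u_i)+\nabla\rho_i^\gamma=\operatorname{div}S_i-\tfrac1\epsilon\sum_jb_{i,j}\rho_i\rho_j(u_i-u_j),$$ $$\partial_t(\rho_iv_i)+\operatorname{div}(\rho_iv_i\otimes u_i)+\operatorname{div}K_i=0.$$ Equilibrium system (E), for $\bar\rho_1,\dots,\bar\rho_n>0$ and a single velocity $\bar u$, with $\bar\rho=\sum_i\bar\rho_i$, $\bar v_i=\nabla\mu(\bar\rho_i)/\bar\rho_i$, and $\bar S_i$, $\bar K_i$ the expressions above evaluated at $(\bar\rho_i,\bar u,\bar v_i)$: $$\partial_t\bar\rho_i+\operatorname{div}(\bar\rho_i\bar u)=0,$$ $$\partial_t(\bar\rho_i\bar u)+\operatorname{div}(\bar\rho_i\bar u\otimes\bar u)-2\nu\operatorname{div}(\mu(\bar\rho_i)D(\bar u))-\nu\nabla(\lambda(\bar\rho_i)\operatorname{div}\bar u)+\nabla\bar\rho_i^\gamma=\operatorname{div}\bar S_i+\bar R_i,$$ $$\partial_t(\bar\rho_i\bar v_i)+\operatorname{div}(\bar\rho_i\bar v_i\otimes\bar u)+\operatorname{div}\bar K_i=0,$$ where $$\bar R_i=\frac{\bar\rho_i}{\bar\rho}\operatorname{div}\bar T-\operatorname{div}\bar T_i+\nu\frac{\bar\rho_i}{\bar\rho}\operatorname{div}\bar D-\nu\operatorname{div}\bar D_i,$$ $\operatorname{div}\bar T_i=\operatorname{div}\bar S_i-\nabla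 p(\bar\rho_i)$, $\operatorname{div}\bar T=\sum_j\operatorname{div}\bar T_j$, $\operatorname{div}\bar D_i=2\operatorname{div}(\mu(\bar\rho_i)D(\bar u))+\nabla(\lambda(\bar\rho_i)\operatorname{div}\bar u)$, $\operatorname{div}\bar D=\sum_j\operatorname{div}\bar D_j$. A smooth solution on $[0,T]$ means $\bar\rho_i>0$ and $\bar u$ smooth on $[0,T]\times\mathbb{T}^3$; in particular, with $\bar w_i=(\bar\rho_i,\bar\rho_i\bar u,\bar\rho_i\bar v_i)$, the functions $\bar w_i,\partial_t\bar w_i,\nabla\bar w_i,D^2\bar w_i,D^3\bar\rho_i$ are bounded. Weak solutions of (S$_\epsilon$). $(\hat\rho^\epsilon,\hat m^\epsilon,\hat J^\epsilon)$ is a periodic weak solution if for each $i$ (and every $T>0$): $0\le\rho_i^\epsilon\in C^0([0,\infty);L^1\cap L^\gamma(\mathbb{T}^3))$; $\rho_i^\epsilon u_i^\epsilon,\rho_i^\epsilon v_i^\epsilon\in C^0([0,\infty);L^1(\mathbb{T}^3)^3)$; $\sqrt{\rho_i^\epsilon}u_i^\epsilon,\sqrt{\rho_i^\epsilon}v_i^\epsilon\in L^\infty((0,T);L^2(\mathbb{T}^3)^3)$; $\mu(\rho_i^\epsilon)D(u_i^\epsilon)\in L^1((0,T)\times\mathbb{T}^3)^{3\times3}$; $\lambda(\rho_i^\epsilon)\operatorname{div}u_i^\epsilon\in L^1((0,T)\times\mathbb{T}^3)$; $(\rho_i^\epsilon)^2u_i^\epsilon\in L^\infty((0,T);L^1(\mathbb{T}^3)^3)$;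 and (omitting superscripts $\epsilon$; all integrals understood to be well defined) for all scalar $\psi_i$ and vector $\phi_i,\varphi_i$ that are $C^1$ in time, $C^2$ in space, periodic in $x$ and compactly supported in $[0,\infty)$ in time: $$-\int_0^\infty\!\!\int\sum_i\big(\rho_i\partial_t\psi_i+\rho_iu_i\cdot\nabla\psi_i\big)=\int\sum_i\rho_i(x,0)\psi_i(x,0)dx;$$ $$-\int_0^\infty\!\!\int\sum_i\Big(\rho_iu_i\cdot\partial_t\phi_i+\rho_iu_i\otimes u_i:\nabla\phi_i+\rho_i^\gamma\operatorname{div}\phi_i+\mu(\rho_i)v_i\cdot\nabla\operatorname{div}\phi_i+\nabla\mu(\rho_i)\cdot(\nabla\phi_i\,v_i)+\tfrac12\nabla\lambda(\rho_i)\cdot v_i\operatorname{div}\phi_i+\tfrac12\lambda(\rho_i)v_i\cdot\nabla\operatorname{div}\phi_i\Big)$$ $$+\nu\int_0^\infty\!\!\int\sum_i\Big(2\mu(\rho_i)D(u_i):\nabla\phi_i+\lambda(\rho_i)\operatorname{div}u_i\operatorname{div}\phi_i\Big)+\tfrac1\epsilon\int_0^\infty\!\!\int\sum_{i,j}b_{i,j}\rho_i\rho_j(u_i-u_j)\cdot\phi_i=\int\sum_i(\rho_iu_i)(x,0)\cdot\phi_i(x,0)dx;$$ $$-\int_0^\infty\!\!\int\sum_i\big(\rho_iv_i\cdot\partial_t\varphi_i+\rho_iv_i\otimes u_i:\nabla\varphi_i\big)+\int_0^\infty\!\!\int\sum_i\Big(\mu(\rho_i)u_i\cdot\nabla\operatorname{div}\varphi_i+\nabla\mu(\rho_i)\cdot(\nabla\varphi_i\,u_i)+\tfrac12\nabla\lambda(\rho_i)\cdot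 u_i\operatorname{div}\varphi_i+\tfrac12\lambda(\rho_i)u_i\cdot\nabla\operatorname{div}\varphi_i\Big)=\int\sum_i(\rho_iv_i)(x,0)\cdot\varphi_i(x,0)dx.$$ Let $\eta_{tot}(\hat\rho,\hat m,\hat J)=\sum_i\big(\frac12\frac{|m_i|^2}{\rho_i}+\frac12\frac{|J_i|^2}{\rho_i}+h(\rho_i)\big)$ and $\Sigma_{tot}=\int_{\mathbb{T}^3}\eta_{tot}dx$. The weak solution is dissipative if $\eta_{tot}(\hat\rho,\hat m,\hat J)\in C([0,\infty);L^1(\mathbb{T}^3))$ and for every nonnegative $\theta\in W^{1,\infty}([0,\infty))$ with compact support in $[0,\infty)$ $$-\int_0^\infty\Sigma_{tot}(t)\theta'(t)dt+\tfrac1{2\epsilon}\int_0^\infty\!\!\int\sum_{i,j}b_{i,j}\rho_i\rho_j|u_i-u_j|^2\theta+\nu\int_0^\infty\!\!\int\sum_i\big(2\mu(\rho_i)|D(u_i)|^2+\lambda(\rho_i)|\operatorname{div}u_i|^2\big)\theta\le\Sigma_{tot}(0)\theta(0).$$ It has finite total mass and energy if for every $T>0$ there is $K>0$ independent of $\epsilon$ with $\sup_{t\in(0,T)}\int\sum_i\rho_idx\le K$ and $\sup_{t\in(0,T)}\Sigma_{tot}(t)\le K$. *)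

(* Defs.v *)
From HB Require Import structures.
From mathcomp Require Import all_boot all_order all_algebra.
From mathcomp Require Import all_classical all_reals all_analysis.
Set Implicit Arguments.
Unset Strict Implicit.
Unset Printing Implicit Defensive.
Import Order.TTheory GRing.Theory Num.Theory numFieldNormedType.Exports.
Local Open Scope classical_set_scope.
Local Open Scope ring_scope.

(* Functions on the torus (R/Z)^3 are 1-periodic functions on R^3, integrated
   over the unit cube.  Points are triples, so that the product measure of the
   library applies; values of vector fields are columns. *)
Notation pt3 R := (R * R * R)%type.

(* The library does not export this instance: the canonical structure of \x
   is already taken by an instance that covers subprobabilities only. *)
Lemma sigma_finite_prod d1 d2 (T1 : measurableType d1)
    (T2 : measurableType d2) (R : realType)
    (m1 : {sigma_finite_measure set T1 -> \bar R})
    (m2 : {sigma_finite_measure set T2 -> \bar R}) :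
  sigma_finite setT (m1 \x m2)%E.
Proof.
have /sigma_finiteP[F [TF ndF Foo]] := sigma_finiteT m1.
have /sigma_finiteP[G [TG ndG Goo]] := sigma_finiteT m2.
exists (fun n => F n `*` G n).
  rewrite -setXTT TF TG predeqE => -[x y]; split.
    move=> [/= [n _ Fnx] [k _ Gky]]; exists (maxn n k) => //; split.
    - by move: x Fnx; exact/subsetPset/ndF/leq_maxl.
    - by move: y Gky; exact/subsetPset/ndG/leq_maxr.
  by move=> [n _ []/= ? ?]; split; exists n.
move=> k; have [? ?] := Foo k; have [? ?] := Goo k.
split; first exact: measurableX.
by rewrite product_measure1E// lte_mul_pinfty// ge0_fin_numE.
Qed.

Section Lebesgue.
Variable R : realType.

Definition leb2 := (@lebesgue_measure R \x @lebesgue_measure R)%E.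
HB.instance Definition _ := Measure.on leb2.
HB.instance Definition _ := @Measure_isSigmaFinite.Build _ _ _ leb2
  (sigma_finite_prod _ _).

Definition leb3 := (leb2 \x @lebesgue_measure R)%E.
HB.instance Definition _ := Measure.on leb3.
HB.instance Definition _ := @Measure_isSigmaFinite.Build _ _ _ leb3
  (sigma_finite_prod _ _).

(* time first, then the point *)
Definition leb4 := (@lebesgue_measure R \x leb3)%E.
HB.instance Definition _ := Measure.on leb4.
HB.instance Definition _ := @Measure_isSigmaFinite.Build _ _ _ leb4
  (sigma_finite_prod _ _).

End Lebesgue.
Arguments leb2 {R}.
Arguments leb3 {R}.
Arguments leb4 {R}.

Section Calculus.
Variable R : realType.
Implicit Types (k l : 'I_3) (x : pt3 R) (t : R).

Definition cube : set (pt3 R) :=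
  `[0, 1]%classic `*` `[0, 1]%classic `*` `[0, 1]%classic.
Definition halfline : set R := `[0, +oo[%classic.
Definition cylinder : set (R * pt3 R) := halfline `*` cube.
Definition slab (T : R) : set (R * pt3 R) := `]0, T[%classic `*` cube.

Definition integ3 (f : pt3 R -> R) : Prop :=
  leb3.-integrable cube (EFin \o f).
Definition integ4 (D : set (R * pt3 R)) (f : R -> pt3 R -> R) : Prop :=
  leb4.-integrable D (fun p => (f p.1 p.2)%:E).

Definition int3 (f : pt3 R -> R) : R := \int[leb3]_(x in cube) f x.
Definition int4 (f : R -> pt3 R -> R) : R :=
  \int[leb4]_(p in cylinder) f p.1 p.2.

Definition dir k : pt3 R :=
  ((k == 0 :> nat)%:R, (k == 1 :> nat)%:R, (k == 2 :> nat)%:R).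

Definition periodic (V : Type) (f : pt3 R -> V) : Prop :=
  forall x k, f (x + dir k) = f x.

Definition pd k (f : pt3 R -> R) x : R := 'D_(dir k) f x.
Definition dt (f : R -> pt3 R -> R) t x : R := derive1 (f ^~ x) t.

Definition grad (f : pt3 R -> R) x : 'cV[R]_3 := \col_k pd k f x.
Definition vgrad (F : pt3 R -> 'cV[R]_3) x : 'M[R]_3 :=
  \matrix_(k, l) pd l (fun y => F y k 0) x.
Definition sgrad (F : pt3 R -> 'cV[R]_3) x : 'M[R]_3 :=
  2^-1 *: (vgrad F x + (vgrad F x)^T).
Definition vdiv (F : pt3 R -> 'cV[R]_3) x : R :=
  \sum_k pd k (fun y => F y k 0) x.
Definition mdiv (A : pt3 R -> 'M[R]_3) x : 'cV[R]_3 :=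
  \col_k \sum_l pd l (fun y => A y k l) x.
Definition dtv (F : R -> pt3 R -> 'cV[R]_3) t x : 'cV[R]_3 :=
  \col_k dt (fun r y => F r y k 0) t x.

Definition dot (a b : 'cV[R]_3) : R := \sum_k a k 0 * b k 0.
Definition sqnorm (a : 'cV[R]_3) : R := dot a a.
Definition frob (A B : 'M[R]_3) : R := \sum_k \sum_l A k l * B k l.
Definition tensor (a b : 'cV[R]_3) : 'M[R]_3 := a *m b^T.

Fixpoint dirderiv (V : normedModType R) (vs : seq V) (f : V -> R) : V -> R :=
  if vs is v :: vs' then (fun z => 'D_v (dirderiv vs' f) z) else f.
Definition smooth (V : normedModType R) (f : V -> R) : Prop :=
  forall vs z, differentiable (dirderiv vs f) z.

(* smooth on the closed set [0, T] x torus: restriction of a smooth function *)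
Definition smooth_upto (T : R) (f : R -> pt3 R -> R) : Prop :=
  exists g : R -> pt3 R -> R,
    [/\ smooth (fun p : R * pt3 R => g p.1 p.2),
        forall t, periodic (g t) &
        forall t x, 0 <= t <= T -> f t x = g t x].

Definition C1_periodic (f : pt3 R -> R) : Prop :=
  [/\ periodic f, continuous f, forall x k, derivable f x (dir k) &
      forall k, continuous (pd k f)].

(* C^1 in time, C^2 in space, periodic; the restriction to nonnegative times
   is compactly supported *)
Definition test_fun (f : R -> pt3 R -> R) : Prop :=
  let cont (g : R -> pt3 R -> R) :=
    continuous (fun p : R * pt3 R => g p.1 p.2) in
  [/\ forall t, periodic (f t),
      exists T, forall t x, T <= t -> f t x = 0,
      cont f,
      (forall t x, derivable (f ^~ x) t 1) /\ cont (dt f) &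
      forall k,
        [/\ forall t x, derivable (f t) x (dir k),
            cont (fun t => pd k (f t)) &
            forall l, (forall t x, derivable (pd k (f t)) x (dir l)) /\
                      cont (fun t => pd l (pd k (f t)))]].
Definition test_field (F : R -> pt3 R -> 'cV[R]_3) : Prop :=
  forall k, test_fun (fun t x => F t x k 0).

(* C^0([0, oo); L^p(torus)) *)
Definition C0_Lp (p : R) (f : R -> pt3 R -> R) : Prop :=
  (forall t, 0 <= t -> measurable_fun cube (f t) /\
     (\int[leb3]_(x in cube) (`|f t x| `^ p)%:E < +oo)%E) /\
  (forall t0, 0 <= t0 ->
     (\int[leb3]_(x in cube) (`|f t x - f t0 x| `^ p)%:E)%E
       @[t --> within halfline (nbhs t0)] --> 0%E).

(* L^oo((0, T); L^p(torus)) *)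
Definition Linf_Lp (T p : R) (f : R -> pt3 R -> R) : Prop :=
  measurable_fun (slab T) (fun z => f z.1 z.2) /\
  exists M : R, {ae @lebesgue_measure R, forall t, 0 < t < T ->
    (\int[leb3]_(x in cube) (`|f t x| `^ p)%:E <= M%:E)%E}.

(* G is the distributional gradient of f on the torus *)
Definition weak_grad (f : pt3 R -> R) (G : pt3 R -> 'cV[R]_3) : Prop :=
  [/\ integ3 f, forall k, integ3 (fun x => G x k 0) &
      forall chi k, C1_periodic chi ->
        int3 (fun x => f x * pd k chi x) = - int3 (fun x => G x k 0 * chi x)].

(* th is (the continuous representative of) an element of W^{1,oo}([0, oo))
   with weak derivative dth *)
Definition W1inf (th dth : R -> R) : Prop :=
  [/\ {within halfline, continuous th},
      measurable_fun halfline dth,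
      exists M : R, (forall t, 0 <= t -> `|th t| <= M) /\
        {ae @lebesgue_measure R, forall t, 0 <= t -> `|dth t| <= M} &
      forall chi : R -> R,
        (forall t, derivable chi t 1) -> continuous (derive1 chi) ->
        (exists a c : R, 0 < a /\ forall t, ~~ (a <= t <= c) -> chi t = 0) ->
        \int[@lebesgue_measure R]_(t in halfline) (th t * derive1 chi t) =
        - \int[@lebesgue_measure R]_(t in halfline) (dth t * chi t)].

End Calculus.
Arguments cube {R}.
Arguments halfline {R}.
Arguments cylinder {R}.

Section Constitutive.
Variables (R : realType) (s gamma : R).
Implicit Types (r : R) (rho : pt3 R -> R) (u v : pt3 R -> 'cV[R]_3).

(* this choice of mu amounts to k(r) = ((s + 3) / 2)^2 r^s *)
Definition mu r : R := r `^ ((s + 3) / 2).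
Definition lam r : R := 2 * (r * derive1 mu r - mu r).

Definition press r : R := r `^ gamma.
Definition hh r : R := r `^ gamma / (gamma - 1).
Definition hrel r rb : R := hh r - hh rb - derive1 hh rb * (r - rb).

Definition drift rho (x : pt3 R) : 'cV[R]_3 :=
  (rho x)^-1 *: grad (mu \o rho) x.

Definition divS rho v (x : pt3 R) : 'cV[R]_3 :=
  mdiv (fun y => mu (rho y) *: vgrad v y) x
  + 2^-1 *: grad (fun y => lam (rho y) * vdiv v y) x.
Definition divK rho u (x : pt3 R) : 'cV[R]_3 :=
  mdiv (fun y => mu (rho y) *: (vgrad u y)^T) x
  + 2^-1 *: grad (fun y => lam (rho y) * vdiv u y) x.
Definition divD rho u (x : pt3 R) : 'cV[R]_3 :=
  2 *: mdiv (fun y => mu (rho y) *: sgrad u y) x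
  + grad (fun y => lam (rho y) * vdiv u y) x.
Definition divT rho v (x : pt3 R) : 'cV[R]_3 :=
  divS rho v x - grad (press \o rho) x.

End Constitutive.

Section Friction.
Variables (R : realType) (n : nat).

Definition conditionA1 (b : 'M[R]_n) : Prop :=
  [/\ forall i j, b i j = b j i,
      forall i j, i != j -> 0 <= b i j &
      forall r : 'I_n -> R, (forall i, 0 < r i) -> forall u : 'I_n -> R,
        (forall i, \sum_j b i j * r i * r j * (u i - u j) = 0) <->
        exists c, forall i, u i = c].

Definition coercive (b : 'M[R]_n) (kst N delta : R) : Prop :=
  forall (r : 'I_n -> R) (u : 'I_n -> 'cV[R]_3),
    (forall i, kst <= r i <= N) ->
    let ubar := (\sum_i r i)^-1 *: \sum_i r i *: u i in
    delta * \sum_i r i ^+ 2 * sqnorm (u i - ubar) <=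
    2^-1 * \sum_i \sum_j b i j * r i * r j * sqnorm (u i - u j).

End Friction.

Section Equilibrium.
Variables (R : realType) (n : nat) (T s gamma nu : R).
Variables (rhob : 'I_n -> R -> pt3 R -> R) (ub : R -> pt3 R -> 'cV[R]_3).

Definition smooth_data : Prop :=
  [/\ forall i, smooth_upto T (rhob i),
      forall k, smooth_upto T (fun t x => ub t x k 0) &
      forall i t x, 0 <= t <= T -> 0 < rhob i t x].

Definition vb i t : pt3 R -> 'cV[R]_3 := drift s (rhob i t).

Definition remainder i t x : 'cV[R]_3 :=
  let rtot := \sum_j rhob j t x in
  (rhob i t x / rtot) *: (\sum_j divT s gamma (rhob j t) (vb j t) x)
  - divT s gamma (rhob i t) (vb i t) x
  + (nu * (rhob i t x / rtot)) *: (\sum_j divD s (rhob j t) (ub t) x)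
  - nu *: divD s (rhob i t) (ub t) x.

(* the equations at t = 0 and t = T follow by continuity *)
Definition equilibrium_system : Prop :=
  forall i t x, 0 < t < T ->
  [/\ dt (rhob i) t x + vdiv (fun y => rhob i t y *: ub t y) x = 0,
      dtv (fun r y => rhob i r y *: ub r y) t x
      + mdiv (fun y => rhob i t y *: tensor (ub t y) (ub t y)) x
      - (2 * nu) *: mdiv (fun y => mu s (rhob i t y) *: sgrad (ub t) y) x
      - nu *: grad (fun y => lam s (rhob i t y) * vdiv (ub t) y) x
      + grad (press gamma \o rhob i t) x
      = divS s (rhob i t) (vb i t) x + remainder i t x &
      dtv (fun r y => rhob i r y *: vb i r y) t x
      + mdiv (fun y => rhob i t y *: tensor (vb i t y) (ub t y)) x
      + divK s (rhob i t) (ub t) x = 0].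

End Equilibrium.

(* Data of a weak solution.  Only the products of vel, drf, Dvel with functions
   of the density that vanish at 0 matter: their values on the vacuum set are
   irrelevant.  Dvel and glam stand for D(u_i) and grad lam(rho_i); they are tied
   to the other fields by weak_symgrad and weak_grad in weak_solution. *)
Record state (R : realType) (n : nat) := State {
  rho : 'I_n -> R -> pt3 R -> R;
  vel : 'I_n -> R -> pt3 R -> 'cV[R]_3;
  drf : 'I_n -> R -> pt3 R -> 'cV[R]_3;
  Dvel : 'I_n -> R -> pt3 R -> 'M[R]_3;
  glam : 'I_n -> R -> pt3 R -> 'cV[R]_3 }.

Section WeakSolution.
Variables (R : realType) (n : nat) (b : 'M[R]_n) (s gamma nu eps : R).
Variable w : state R n.
Implicit Types (i j : 'I_n) (t : R) (x : pt3 R).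

Definition mom i t x : 'cV[R]_3 := rho w i t x *: vel w i t x.
Definition cap i t x : 'cV[R]_3 := rho w i t x *: drf w i t x.

(* Distributional form of
     mu(rho) D(u) = sym (grad (mu(rho) u)) - sym (u (x) grad mu(rho)),
   with grad mu(rho) = rho v.  It makes sense also where the density vanishes,
   and amounts to Dvel = D(u) where the density is bounded away from 0. *)
Definition weak_symgrad i : Prop :=
  forall k l chi, test_fun chi ->
    let lhs t x := mu s (rho w i t x) * Dvel w i t x k l * chi t x in
    let rhs t x :=
      mu s (rho w i t x) * (vel w i t x k 0 * pd l (chi t) x
                            + vel w i t x l 0 * pd k (chi t) x)
      + (cap i t x l 0 * vel w i t x k 0
         + cap i t x k 0 * vel w i t x l 0) * chi t x in
    [/\ integ4 cylinder lhs, integ4 cylinder rhs &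
        int4 lhs = - (2^-1 * int4 rhs)].

Definition weak_class i : Prop :=
  [/\ [/\ forall t, periodic (rho w i t), forall t, periodic (vel w i t),
          forall t, periodic (drf w i t), forall t, periodic (Dvel w i t) &
          forall t, periodic (glam w i t)],
      [/\ measurable_fun cylinder (fun z => rho w i z.1 z.2),
          forall k, measurable_fun cylinder (fun z => vel w i z.1 z.2 k 0),
          forall k, measurable_fun cylinder (fun z => drf w i z.1 z.2 k 0),
          forall k l, measurable_fun cylinder (fun z => Dvel w i z.1 z.2 k l) &
          forall k, measurable_fun cylinder (fun z => glam w i z.1 z.2 k 0)],
      [/\ forall t, 0 <= t -> {ae @leb3 R, forall x, 0 <= rho w i t x},
          C0_Lp 1 (rho w i) /\ C0_Lp gamma (rho w i),
          forall k, C0_Lp 1 (fun t x => mom i t x k 0) &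
          forall k, C0_Lp 1 (fun t x => cap i t x k 0)],
      [/\ forall t, 0 <= t ->
            weak_grad (fun x => mu s (rho w i t x)) (cap i t),
          forall t, 0 <= t ->
            weak_grad (fun x => lam s (rho w i t x)) (glam w i t) &
          weak_symgrad i] &
      forall T : R, 0 < T ->
      [/\ forall k, Linf_Lp T 2
            (fun t x => Num.sqrt (rho w i t x) * vel w i t x k 0),
          forall k, Linf_Lp T 2
            (fun t x => Num.sqrt (rho w i t x) * drf w i t x k 0),
          forall k l, integ4 (slab T)
            (fun t x => mu s (rho w i t x) * Dvel w i t x k l),
          integ4 (slab T)
            (fun t x => lam s (rho w i t x) * \tr (Dvel w i t x)) &
          forall k, Linf_Lp T 1
            (fun t x => rho w i t x ^+ 2 * vel w i t x k 0)]].

Definition weak_mass : Prop :=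
  forall psi : 'I_n -> R -> pt3 R -> R, (forall i, test_fun (psi i)) ->
    let F t x := \sum_i (rho w i t x * dt (psi i) t x
                         + dot (mom i t x) (grad (psi i t) x)) in
    integ4 cylinder F /\
    - int4 F = int3 (fun x => \sum_i rho w i 0 x * psi i 0 x).

Definition weak_momentum : Prop :=
  forall phi : 'I_n -> R -> pt3 R -> 'cV[R]_3,
    (forall i, test_field (phi i)) ->
    let F t x := \sum_i
      (dot (mom i t x) (dtv (phi i) t x)
       + frob (rho w i t x *: tensor (vel w i t x) (vel w i t x))
              (vgrad (phi i t) x)
       + press gamma (rho w i t x) * vdiv (phi i t) x
       + mu s (rho w i t x) * dot (drf w i t x) (grad (vdiv (phi i t)) x)
       + dot (cap i t x) (vgrad (phi i t) x *m drf w i t x)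
       + 2^-1 * dot (glam w i t x) (drf w i t x) * vdiv (phi i t) x
       + 2^-1 * lam s (rho w i t x)
         * dot (drf w i t x) (grad (vdiv (phi i t)) x)) in
    let V t x := \sum_i
      (2 * mu s (rho w i t x) * frob (Dvel w i t x) (vgrad (phi i t) x)
       + lam s (rho w i t x) * \tr (Dvel w i t x) * vdiv (phi i t) x) in
    let B t x := \sum_i \sum_j b i j * rho w i t x * rho w j t x
      * dot (vel w i t x - vel w j t x) (phi i t x) in
    [/\ integ4 cylinder F, integ4 cylinder V, integ4 cylinder B &
        - int4 F + nu * int4 V + eps^-1 * int4 B
        = int3 (fun x => \sum_i dot (mom i 0 x) (phi i 0 x))].

Definition weak_drift : Prop :=
  forall phi : 'I_n -> R -> pt3 R -> 'cV[R]_3,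
    (forall i, test_field (phi i)) ->
    let F t x := \sum_i
      (dot (cap i t x) (dtv (phi i) t x)
       + frob (rho w i t x *: tensor (drf w i t x) (vel w i t x))
              (vgrad (phi i t) x)) in
    let G t x := \sum_i
      (mu s (rho w i t x) * dot (vel w i t x) (grad (vdiv (phi i t)) x)
       + dot (cap i t x) (vgrad (phi i t) x *m vel w i t x)
       + 2^-1 * dot (glam w i t x) (vel w i t x) * vdiv (phi i t) x
       + 2^-1 * lam s (rho w i t x)
         * dot (vel w i t x) (grad (vdiv (phi i t)) x)) in
    [/\ integ4 cylinder F, integ4 cylinder G &
        - int4 F + int4 G
        = int3 (fun x => \sum_i dot (cap i 0 x) (phi i 0 x))].

Definition weak_solution : Prop :=
  [/\ forall i, weak_class i, weak_mass, weak_momentum & weak_drift].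

(* division by zero yields 0, the usual convention on the vacuum set *)
Definition eta_tot t x : R :=
  \sum_i (2^-1 * (sqnorm (mom i t x) / rho w i t x)
          + 2^-1 * (sqnorm (cap i t x) / rho w i t x)
          + hh gamma (rho w i t x)).
Definition Sigma_tot t : R := int3 (eta_tot t).

(* Stated in the extended reals: the friction and viscous integrands are
   nonnegative, so that their integrals always make sense. *)
Definition dissipative : Prop :=
  C0_Lp 1 eta_tot /\
  forall th dth : R -> R, W1inf th dth -> (forall t, 0 <= t -> 0 <= th t) ->
    (exists T : R, forall t, T <= t -> th t = 0) ->
    ((- \int[@lebesgue_measure R]_(t in halfline) (Sigma_tot t * dth t)%R)%:E
     + (2 * eps)^-1%:E * (\int[leb4]_(z in cylinder)
         (\sum_i \sum_j b i j * rho w i z.1 z.2 * rho w j z.1 z.2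
            * sqnorm (vel w i z.1 z.2 - vel w j z.1 z.2) * th z.1)%:E)
     + nu%:E * (\int[leb4]_(z in cylinder)
         (\sum_i (2 * mu s (rho w i z.1 z.2)
                    * frob (Dvel w i z.1 z.2) (Dvel w i z.1 z.2)
                  + lam s (rho w i z.1 z.2) * (\tr (Dvel w i z.1 z.2)) ^+ 2)
          * th z.1)%:E)
     <= (Sigma_tot 0%R * th 0%R)%:E)%E.

Definition mass_energy_le (T K : R) : Prop :=
  forall t, 0 < t < T ->
    int3 (fun x => \sum_i rho w i t x) <= K /\ Sigma_tot t <= K.

Definition density_bounds (T kst N : R) : Prop :=
  forall i t, 0 < t < T ->
    {ae @leb3 R, forall x, kst <= rho w i t x <= N}.

Definition Psi (rhob : 'I_n -> R -> pt3 R -> R)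
    (ub : R -> pt3 R -> 'cV[R]_3) t : \bar R :=
  (\int[leb3]_(x in cube)
    (\sum_i
      (2^-1 * rho w i t x
         * sqnorm ((rho w i t x)^-1 *: mom i t x
                   - (rhob i t x)^-1 *: (rhob i t x *: ub t x))
       + 2^-1 * rho w i t x
         * sqnorm ((rho w i t x)^-1 *: cap i t x
                   - (rhob i t x)^-1 *: (rhob i t x *: vb s rhob i t x))
       + hrel gamma (rho w i t x) (rhob i t x)))%:E)%E.

End WeakSolution.

Definition finite_mass_energy (R : realType) (n : nat) (gamma : R)
    (w : R -> state R n) : Prop :=
  forall T : R, 0 < T -> exists K : R, 0 < K /\
    forall eps, 0 < eps -> mass_energy_le gamma (w eps) T K.

(* Main.v *)
(** The relative energy e of a weak solution with respect to (rhob, ub) equals eta_tot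
    plus terms linear in (rho, m, J) with smooth coefficients.  Its evolution is
    therefore controlled by the energy inequality and by the weak equations tested with
    a time cut-off times these coefficients.  After the equations satisfied by
    (rhob, ub) are used, only quadratic expressions in the differences and the terms
    (rho_i / rhob_i) (u_i - ub) . R_i are left, and the viscous cross terms are
    completed to a square in the dissipation.  Since the R_i sum to zero,
    u_i - ub may be replaced by u_i - u at the price of terms in rho_i - rhob_i, and
    Young's inequality then absorbs u_i - u into the friction at a cost of order eps.
    The bounds on the densities make e comparable to the squared differences, so that
    d e / dt <= C (1 + nu) e + eps C (1 + nu^2) in the weak sense, and Gronwall's
    lemma concludes.

    D(u_i) and grad lam(rho_i), known only as distributions, are identified almost
    everywhere by a fundamental lemma of the calculus of variations on the torus.
    The data rhob, ub are extended from [0, T] to smooth functions, and O is the open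
    set where the extended densities are positive. *)

(* The obstacle is the poor integrability of weak solutions: a weak equation makes its integrand
   integrable as a whole, not term by term, and the friction and viscous integrals of the energy
   inequality live in the extended reals. The tested integrands are therefore kept in whole groups
   until all are added, and only the sum is estimated pointwise. The dissipation enters through
   [2 A : B - B : B <= A : A] with A = D(u) and B = D(ub): this lower bound is affine in D(u), so
   the weak definition of D(u) computes its integral. The linear equations alone do not produce
   products of differences; the relation grad mu(rho) = rho v, tested with the fields [cap_flux] and
   [visc_field], adds zero and supplies the missing terms. Cut-offs are supported inside the open
   interval, where the density bounds and the equilibrium equations are assumed; the end points are
   reached by continuity in time. The constants have the stated growth in [nu] because the remainder
   is a field free of [nu] plus [nu] times another, and its square costs at most a multiple of
   [1 + nu ^+ 2]. *)
Require Import Defs.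
From HB Require Import structures.
From mathcomp Require Import all_boot all_order all_algebra.
From mathcomp Require Import all_classical all_reals all_analysis.
From mathcomp Require Import measurable_realfun.
From mathcomp Require Import ring lra.
Import Order.TTheory GRing.Theory Num.Theory numFieldNormedType.Exports.
Local Open Scope classical_set_scope.
Local Open Scope ring_scope.
Set Implicit Arguments.
Unset Strict Implicit.
Unset Printing Implicit Defensive.

(** * Smooth functions and the symmetry of second derivatives *)

Section SmoothOn.
Variables (R : realType) (V : normedModType R).
Implicit Types (O : set V) (f g : V -> R).

(** The remainder is zero near [x], so the zero map is the differential. With [near_differentiable]
    this makes differentiability a property of the germ, as needed for functions that agree only on
    an open set. *)
Lemma near0_differentiable f x : {near x, f =1 cst 0} -> differentiable f x.
Proof.
move=> f0.
have fx0 : f x = 0 by exact: (nbhs_singleton f0).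
have H : f \o shift x = cst (f x) + (\0 : V -> R) +o_ 0 id.
  apply/eqaddoP => _/posnumP[e]; near=> h.
  rewrite !fctE /= fx0 !addr0 subr0.
  suff -> : f (h + x) = 0 by rewrite normr0 mulr_ge0.
  near: h; have := f0; rewrite -[X in X -> _]/(\forall y \near x, f y = 0).
  by rewrite (near_shift 0)/= subr0.
have c0 : continuous (\0 : V -> R) by move=> ?; exact: cst_continuous.
by apply/diff_locallyP; rewrite (diff_unique c0 H).
Unshelve. all: by end_near. Qed.

Lemma near_differentiable f g x :
  {near x, f =1 g} -> differentiable f x -> differentiable g x.
Proof.
move=> fg df; have -> : g = f + (g - f) by rewrite addrC subrK.
apply: differentiableD => //; apply: near0_differentiable.
by near=> y; rewrite !fctE -(near fg y)// subrr.
Unshelve. all: by end_near. Qed.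

(** Recursion on the order, instead of lists of directions as in [smooth], lets products and powers
    be treated by induction; [O] is there because real powers are smooth only where the base is
    positive. The count is shifted: [Ck 0] is already differentiability, so [Ck k] allows [k + 1]
    successive differentiations. *)
Fixpoint Ck (k : nat) O f : Prop :=
  (forall z, O z -> differentiable f z) /\
  (if k is k'.+1 then forall v, Ck k' O (fun z => 'D_v f z) else True).

Definition smooth_on O f := forall k, Ck k O f.

Lemma CkW k O f : Ck k.+1 O f -> Ck k O f.
Proof.
elim: k f => [f []//|k IH f [df Df]]; split => // v; exact/IH/Df.
Qed.

Lemma Ck_ext k O f g : open O -> (forall z, O z -> f z = g z) ->
  Ck k O f -> Ck k O g.
Proof.
move=> oO; elim: k f g => [|k IH] f g fg.
  move=> [df _]; split => // z Oz; apply: near_differentiable (df z Oz).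
  by near=> y; apply: fg; near: y; exact: open_nbhs_nbhs.
move=> [df Df]; split.
  move=> z Oz; apply: near_differentiable (df z Oz).
  by near=> y; apply: fg; near: y; exact: open_nbhs_nbhs.
move=> v; apply: IH (Df v) => z Oz; apply: near_eq_derive.
by near=> y; apply: fg; near: y; exact: open_nbhs_nbhs.
Unshelve. all: by end_near. Qed.

Lemma smooth_on_ext O f g : open O -> (forall z, O z -> f z = g z) ->
  smooth_on O f -> smooth_on O g.
Proof. by move=> oO fg sf k; exact: Ck_ext (sf k). Qed.

Lemma CkD k O f g : open O -> Ck k O f -> Ck k O g -> Ck k O (f + g).
Proof.
move=> oO; elim: k f g => [|k IH] f g.
  by move=> [df _] [dg _]; split=> // z Oz; apply: differentiableD; auto.
move=> [df Df] [dg Dg]; split=> [z Oz|v].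
  by apply: differentiableD; auto.
apply: (@Ck_ext k O (fun z => 'D_v f z + 'D_v g z)) => //.
  by move=> z Oz; rewrite deriveD//; apply: diff_derivable; auto.
exact: (IH _ _ (Df v) (Dg v)).
Qed.

Lemma Ck_cst k O (a : R) : Ck k O (cst a).
Proof.
elim: k a => [|k IH] a; split => // [v]; have := IH 0.
by congr Ck; apply/funext => z; rewrite derive_cst.
Qed.

Lemma CkM k O f g : open O -> Ck k O f -> Ck k O g -> Ck k O (f * g).
Proof.
move=> oO; elim: k f g => [|k IH] f g.
  by move=> [df _] [dg _]; split=> // z Oz; apply: differentiableM; auto.
move=> cf cg; have [df Df] := cf; have [dg Dg] := cg; split=> [z Oz|v].
  by apply: differentiableM; auto.
apply: (@Ck_ext k O (f * (fun z => 'D_v g z) + g * (fun z => 'D_v f z))) => //.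
  by move=> z Oz; rewrite deriveM//; apply: diff_derivable; auto.
by apply: CkD => //; [apply: (IH f) (Dg v)|apply: (IH g) (Df v)] => //; apply: CkW.
Qed.

(** Induction on [k] for all exponents at once, since the derivative of the power [p] contains the
    power [p - 1]. *)
Lemma Ck_powR k O f p : open O -> (forall z, O z -> 0 < f z) ->
  Ck k O f -> Ck k O (fun z => f z `^ p).
Proof.
move=> oO f0; elim: k f f0 p => [|k IH] f f0 p.
  move=> [df _]; split => // z Oz.
  apply: (@differentiable_comp _ _ _ _ f (@powR R ^~ p)); first exact: df.
  by apply/derivable1_diffP; apply: derivable_powR; rewrite in_itv/= f0.
move=> cf; have [df Df] := cf; split=> [z Oz|v].
  apply: (@differentiable_comp _ _ _ _ f (@powR R ^~ p)); first exact: df.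
  by apply/derivable1_diffP; apply: derivable_powR; rewrite in_itv/= f0.
apply: (@Ck_ext k O (cst p * (fun z => f z `^ (p - 1)) * (fun z => 'D_v f z))) => //.
  move=> z Oz.
  have dfz := df z Oz.
  have dp : differentiable (@powR R ^~ p) (f z).
    by apply/derivable1_diffP; apply: derivable_powR; rewrite in_itv/= f0.
  have dc : differentiable ((@powR R ^~ p) \o f) z by exact: differentiable_comp.
  rewrite -[LHS]/(p * f z `^ (p - 1) * 'D_v f z).
  rewrite -[fun _ => _]/((@powR R ^~ p) \o f) (deriveE v dc) (deriveE v dfz).
  have E w : 'd (@powR R ^~ p) (f z) w = w * 'D_1 (@powR R ^~ p) (f z).
    by rewrite deriveE// -{1}[w]mulr1; exact: linearZ.
  have DD : 'd ((@powR R ^~ p) \o f) z v = 'd (@powR R ^~ p) (f z) ('d f z v).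
    by have /= -> := @diff_comp _ _ _ _ f (@powR R ^~ p) z dfz dp.
  apply/esym; apply: (etrans DD); apply: (etrans (E _)).
  by rewrite (@derive_val _ _ _ _ _ _ _ (is_derive1_powR p (f0 z Oz))) mulrC.
apply: CkM => //; last exact: Df.
by apply: CkM => //; [exact: Ck_cst|apply: IH => //; exact: CkW].
Qed.

Lemma smooth_smooth_on O f : smooth f -> smooth_on O f.
Proof.
move=> sf k.
(* All iterated derivatives are treated together, because the induction on [k] replaces [f] by one
   of its derivatives. *)
suff H : forall vs, Ck k O (dirderiv vs f) by exact: (H [::]).
elim: k => [|k IH] vs; first by split => // z _; exact: sf.
by split=> [z _|v]; [exact: sf|exact: (IH (v :: vs))].
Qed.

Lemma smooth_on_derive O f v : smooth_on O f -> smooth_on O (fun z => 'D_v f z).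
Proof. by move=> sf k; have [_] := sf k.+1; apply. Qed.

End SmoothOn.

Section Schwarz.
Variables (R : realType) (V : normedModType R).

(** Restriction to a line gives access to one-variable calculus: the mean value theorem, the chain
    rule and the fundamental theorem are all applied through it. *)
Lemma derive_line (f : V -> R) (z v : V) (t : R) :
  'D_v f (z + t *: v) = 'D_1 (fun s : R => f (z + s *: v)) t.
Proof.
rewrite /derive; congr (lim _).
suff -> : (fun h => h^-1 *: (f (h *: v + (z + t *: v)) - f (z + t *: v))) =
  (fun h => h^-1 *: (f (z + (h *: (1:R) + t) *: v) - f (z + t *: v))) by [].
apply/funext => h; congr (_ *: (f _ - _)).
have -> : h *: (1 : R) = h by exact: mulr1.
by rewrite scalerDl addrCA.
Qed.

Lemma derivable_line (f : V -> R) (z v : V) (t : R) :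
  derivable f (z + t *: v) v -> derivable (fun s : R => f (z + s *: v)) t 1.
Proof.
rewrite /derivable.
suff -> : (fun h => h^-1 *: (f (h *: v + (z + t *: v)) - f (z + t *: v))) =
  (fun h => h^-1 *: (f (z + (h *: (1:R) + t) *: v) - f (z + t *: v))) by [].
apply/funext => h; congr (_ *: (f _ - _)).
have -> : h *: (1 : R) = h by exact: mulr1.
by rewrite scalerDl addrCA.
Qed.

Lemma MVT_line (f : V -> R) (z v : V) (h : R) : 0 < h ->
  (forall t, 0 <= t <= h -> differentiable f (z + t *: v)) ->
  exists2 c, 0 <= c <= h & f (z + h *: v) - f z = h * 'D_v f (z + c *: v).
Proof.
move=> h0 df.
have d1 t : 0 <= t <= h -> derivable (fun s : R => f (z + s *: v)) t 1.
  by move=> /df dft; exact/derivable_line/diff_derivable.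
have [||c] := @MVT_segment R (fun s : R => f (z + s *: v))
   (fun t => 'D_v f (z + t *: v)) 0 h (ltW h0).
- move=> x; rewrite in_itv/= => /andP[x0 xh]; rewrite derive_line.
  by apply: derivableP; apply: d1; rewrite !ltW.
- apply: derivable_within_continuous => x; rewrite in_itv/= => xh.
  exact: d1.
rewrite in_itv/= scale0r addr0 subr0 => ch ->; exists c => //.
by rewrite mulrC.
Qed.

Lemma open_continuous2_ball (O : set V) (f g : V -> R) z (e : R) :
  open O -> O z -> {for z, continuous f} -> {for z, continuous g} -> 0 < e ->
  exists2 d : R, 0 < d & forall y, `|z - y| < d ->
    [/\ O y, `|f z - f y| < e & `|g z - g y| < e].
Proof.
move=> oO Oz cf cg e0.
have : \forall y \near z, [/\ O y, `|f z - f y| < e & `|g z - g y| < e].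
  near=> y; split.
  - by near: y; exact: open_nbhs_nbhs.
  - by near: y; move/cvgr_dist_lt : cf; apply.
  - by near: y; move/cvgr_dist_lt : cg; apply.
move=> /nbhs_ballP[d /= d0 Hd]; exists d => // y yd; apply: Hd.
by rewrite -ball_normE.
Unshelve. all: by end_near. Qed.

(* Both iterated derivatives are limits of the same second difference. *)
Lemma schwarz (O : set V) (f : V -> R) v w z : open O -> Ck 2 O f -> O z ->
  'D_v (fun y => 'D_w f y) z = 'D_w (fun y => 'D_v f y) z.
Proof.
move=> oO C2 Oz; apply/eqP; rewrite -subr_eq0 -normr_le0; apply/ler_addgt0Pr.
move=> e e0; rewrite add0r.
have [df Df] := C2; have [dDw _] := Df w; have [dDv _] := Df v.
have cvw : {for z, continuous (fun y => 'D_v (fun y => 'D_w f y) y)}.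
  by apply: differentiable_continuous; have [_ /(_ v)[]] := Df w; auto.
have cwv : {for z, continuous (fun y => 'D_w (fun y => 'D_v f y) y)}.
  by apply: differentiable_continuous; have [_ /(_ w)[]] := Df v; auto.
have [d d0 Hd] := open_continuous2_ball oO Oz cvw cwv (divr_gt0 e0 (ltr0Sn R 1)).
(* With this [h] the parallelogram spanned by [h v] and [h w] at [z] stays in the ball of radius
   [d]; the summand 1 keeps [M] positive when both vectors vanish. *)
pose M := `|v| + `|w| + 1; have M0 : 0 < M by rewrite ltr_wpDl// addr_ge0.
pose h := d / (2 * M); have h0 : 0 < h by rewrite divr_gt0// mulr_gt0.
have near_z a b : 0 <= a <= h -> 0 <= b <= h -> `|z - (z + a *: v + b *: w)| < d.
  move=> /andP[a0 ah] /andP[b0 bh].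
  rewrite -addrA opprD addrA subrr sub0r normrN.
  rewrite (le_lt_trans (ler_normD _ _))// !normrZ (ger0_norm a0) (ger0_norm b0).
  rewrite (@le_lt_trans _ _ (h * (`|v| + `|w|)))//.
    by rewrite mulrDr lerD// ler_wpM2r.
  rewrite (@le_lt_trans _ _ (h * M))//.
    by rewrite ler_pM2l// /M lerDl.
  by rewrite /h invfM mulrA divfK ?gt_eqF// ltr_pdivrMr// mulr_natr mulr2n ltrDl.
have hh : 0 <= h <= h by rewrite lexx ltW.
have h00 : 0 <= (0:R) <= h by rewrite lexx ltW.
have near_zv a : 0 <= a <= h -> `|z - (z + a *: v)| < d.
  by move=> ah; have := near_z a 0 ah h00; rewrite scale0r addr0.
have near_zw b : 0 <= b <= h -> `|z - (z + b *: w)| < d.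
  by move=> bh; have := near_z 0 b h00 bh; rewrite scale0r addr0.
have diffsh (u : V) y : O (y + u) -> differentiable (fun x => f (x + u)) y.
  move=> Oyu; apply: (@differentiable_comp _ _ _ _ (fun x => x + u) f).
    by apply: differentiableD => //; apply: differentiable_cst.
  exact: df.
have Dsh (u a : V) y : 'D_a (fun x => f (x + u)) y = 'D_a f (y + u).
  rewrite /derive.
  suff -> : (fun t => t^-1 *: (f (t *: a + y + u) - f (y + u))) =
    (fun t => t^-1 *: (f (t *: a + (y + u)) - f (y + u))) by [].
  by apply/funext => t; rewrite addrA.
have H1 : exists y, `|z - y| < d /\
  f (z + h *: v + h *: w) - f (z + h *: v) - (f (z + h *: w) - f z) =
  h * (h * 'D_w (fun y => 'D_v f y) y).
  have [|c ch E] := @MVT_line (fun x => f (x + h *: w) - f x) z v h h0.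
    move=> t th; apply: differentiableB.
      by apply: diffsh; have [|] := Hd (z + t *: v + h *: w); first exact: near_z.
    by apply: df; have [|] := Hd (z + t *: v); first exact: near_zv.
  have Dc : 'D_v (fun x => f (x + h *: w) - f x) (z + c *: v) =
      'D_v f (z + c *: v + h *: w) - 'D_v f (z + c *: v).
    have Oc : O (z + c *: v).
      by have [|] := Hd (z + c *: v); first exact: near_zv.
    have Och : O (z + c *: v + h *: w) by have [|] := Hd (z + c *: v + h *: w); first exact: near_z.
    rewrite -(Dsh (h *: w)).
    apply: (@deriveB _ _ _ (fun x => f (x + h *: w)) f (z + c *: v) v);
      apply: diff_derivable; [exact: diffsh|exact: df].
  have [|c' ch' E'] := @MVT_line (fun x => 'D_v f x) (z + c *: v) w h h0.
    by move=> t th; apply: dDv; have [|] := Hd (z + c *: v + t *: w); first exact: near_z.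
  exists (z + c *: v + c' *: w); split; first exact: near_z.
  by rewrite -E' -Dc -E.
have H2 : exists y, `|z - y| < d /\
  f (z + h *: v + h *: w) - f (z + h *: v) - (f (z + h *: w) - f z) =
  h * (h * 'D_v (fun y => 'D_w f y) y).
  have [|c ch E] := @MVT_line (fun x => f (x + h *: v) - f x) z w h h0.
    move=> t th; apply: differentiableB.
      by apply: diffsh; rewrite addrAC; have [|] := Hd (z + h *: v + t *: w); first exact: near_z.
    by apply: df; have [|] := Hd (z + t *: w); first exact: near_zw.
  have Dc : 'D_w (fun x => f (x + h *: v) - f x) (z + c *: w) =
      'D_w f (z + c *: w + h *: v) - 'D_w f (z + c *: w).
    have Oc : O (z + c *: w).
      by have [|] := Hd (z + c *: w); first exact: near_zw.
    have Och : O (z + c *: w + h *: v).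
      by rewrite addrAC; have [|] := Hd (z + h *: v + c *: w); first exact: near_z.
    rewrite -(Dsh (h *: v)).
    apply: (@deriveB _ _ _ (fun x => f (x + h *: v)) f (z + c *: w) w);
      apply: diff_derivable; [exact: diffsh|exact: df].
  have [|c' ch' E'] := @MVT_line (fun x => 'D_w f x) (z + c *: w) v h h0.
    by move=> t th; apply: dDw; rewrite addrAC; have [|] := Hd (z + t *: v + c *: w); first exact: near_z.
  exists (z + c' *: v + c *: w); split; first exact: near_z.
  rewrite [z + c' *: v + _]addrAC -E' -Dc -E /=.
  by rewrite [z + h *: w + h *: v]addrAC; ring.
have [y1 [/Hd[_ _ A1] E1]] := H1; have [y2 [/Hd[_ A2 _] E2]] := H2.
have E12 : 'D_w (fun y => 'D_v f y) y1 = 'D_v (fun y => 'D_w f y) y2.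
  move: E1; rewrite E2 => /(mulfI (lt0r_neq0 h0)) /(mulfI (lt0r_neq0 h0)) ->//.
rewrite -E12 in A2.
set a := 'D_v _ z in A2 *; set b := 'D_w _ z in A1 *; set c := 'D_w _ _ in A1 A2.
have -> : a - b = (a - c) - (b - c) by ring.
apply: (le_trans (ler_normB _ _)); rewrite (splitr e).
exact: lerD (ltW A2) (ltW A1).
Qed.

End Schwarz.

(** * Countable bases and classes of sets stable under countable unions *)

Definition countable_basis_in (T : topologicalType) (M : set (set T)) :=
  exists B : nat -> set T, (forall n, M (B n)) /\
    forall U x, nbhs x U -> exists n, B n x /\ B n `<=` U.

(** An open set is the union of the basic sets that it contains. The class [M] is used with two
    meanings: the measurable sets, and the sets exhausted by test functions in the fundamental
    lemma. *)
Lemma countable_basis_open (T : topologicalType) (M : set (set T)) :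
  countable_basis_in M -> M set0 -> (forall F : (set T)^nat,
    (forall n, M (F n)) -> M (\bigcup_n F n)) ->
  forall U, open U -> M U.
Proof.
move=> [B [MB HB]] M0 MU U oU.
have -> : U = \bigcup_n (if `[< B n `<=` U >] then B n else set0).
  rewrite eqEsubset; split => [x Ux|x [n _]].
    have [n [Bnx BU]] := HB U x (open_nbhs_nbhs (conj oU Ux)).
    by exists n => //; case: ifPn => //; rewrite asboolT.
  by case: ifPn => // /asboolP; apply.
by apply: MU => n; case: ifPn.
Qed.

Lemma countable_basis_prod (T1 T2 : topologicalType) M1 M2
    (M : set (set (T1 * T2))) :
  countable_basis_in M1 -> countable_basis_in M2 ->
  (forall A B, M1 A -> M2 B -> M (A `*` B)) -> countable_basis_in M.
Proof.
move=> [B1 [MB1 H1]] [B2 [MB2 H2]] MX.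
(* Pairs of indices are coded by natural numbers; a number that codes no pair gets an arbitrary box
   of the right kind. *)
exists (fun n => if unpickle n is Some p then B1 p.1 `*` B2 p.2
                 else B1 0%N `*` B2 0%N); split.
  by move=> n; case: unpickle => [p|]; exact: MX.
move=> U [x y] [[P Q] /= [Px Qy] PQU].
have [n1 [Bx BP]] := H1 _ _ Px; have [n2 [By BQ]] := H2 _ _ Qy.
exists (pickle (n1, n2)); rewrite pickleK/=; split => // -[a b] [/= aB bB].
by apply: PQU; split; [exact: BP|exact: BQ].
Qed.

(** * Borel sets and Fubini on the torus *)

Section Borel.
Variable R : realType.

Lemma countable_basis_itv :
  countable_basis_in [set B : set R | exists a b, B = `]a, b[%classic].
Proof.
exists (fun n => if unpickle n is Some p then `]ratr p.1, ratr p.2[%classic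
                 else `]0, 1[%classic : set R); split.
  by move=> n; case: unpickle => [p|]; [exists (ratr p.1), (ratr p.2)|exists 0, 1].
move=> U x /nbhs_ballP[e /= e0 eU].
have [q1 /andP[q1x xq1]] : exists q : rat, x - e < ratr q < x.
  by have := @rat_in_itvoo R (x - e) x; rewrite ltrBlDr ltrDl e0 => /(_ isT)[q];
    rewrite in_itv; exists q.
have [q2 /andP[q2x xq2]] : exists q : rat, x < ratr q < x + e.
  by have := @rat_in_itvoo R x (x + e); rewrite ltrDl e0 => /(_ isT)[q];
    rewrite in_itv; exists q.
exists (pickle (q1, q2)); rewrite pickleK /=; split.
  by rewrite in_itv/= xq1 q2x.
move=> y; rewrite /= in_itv/= => /andP[y1 y2]; apply: eU.
rewrite -ball_normE /= ltr_norml; apply/andP; split; lra.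
Qed.

Lemma countable_basis_R : countable_basis_in (@measurable _ R).
Proof.
have [B [HB nB]] := countable_basis_itv; exists B; split => // n.
by have [a [b ->]] := HB n; exact: measurable_itv.
Qed.

Lemma countable_basis_pt3 : countable_basis_in (@measurable _ (pt3 R)).
Proof.
apply: countable_basis_prod; last exact: measurableX.
  apply: countable_basis_prod; last exact: measurableX.
    exact: countable_basis_R.
  exact: countable_basis_R.
exact: countable_basis_R.
Qed.

Lemma open_measurable_pt3 (U : set (pt3 R)) : open U -> measurable U.
Proof.
apply: (countable_basis_open countable_basis_pt3) => // F mF.
by apply: bigcup_measurable => n _; exact: mF.
Qed.

Lemma open_measurable_pt4 (U : set (R * pt3 R)) : open U -> measurable U.
Proof.
apply: (@countable_basis_open _ (@measurable _ (R * pt3 R)%type)) => // [|F mF].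
  apply: countable_basis_prod; last exact: measurableX.
    exact: countable_basis_R.
  exact: countable_basis_pt3.
by apply: bigcup_measurable => n _; exact: mF.
Qed.

(** [P] stands for openness. On a product the topology and the sigma-algebra are built separately,
    and the first hypothesis is the link between them. *)
Lemma continuous_measurable_gen d (T : measurableType d) (O D : set T)
    (f : T -> R) (P : set T -> Prop) :
  (forall U, P U -> measurable U) ->
  (forall B, open B -> P (O `&` f @^-1` B)) -> measurable D -> D `<=` O ->
  measurable_fun D f.
Proof.
move=> mP cf mD DO; apply: (measurability _ (RGenOpens.measurableE R)).
move=> _ [_ [a [b ->] <-]].
have -> : D `&` f @^-1` `]a, b[%classic = D `&` (O `&` f @^-1` `]a, b[%classic).
  by rewrite setIA (setIidl DO).
apply: measurableI => //; apply/mP/cf; exact: interval_open.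
Qed.

Lemma open_continuous_preimage (T : topologicalType) (O : set T) (f : T -> R) B :
  open O -> (forall z, O z -> {for z, continuous f}) -> open B ->
  open (O `&` f @^-1` B).
Proof.
move=> oO cf oB; rewrite openE => z [Oz Bz]; apply: filterI.
  exact: open_nbhs_nbhs.
by apply: cf => //; exact: open_nbhs_nbhs.
Qed.

Lemma continuous_measurable_pt4 (O D : set (R * pt3 R)) (f : R * pt3 R -> R) :
  open O -> (forall z, O z -> {for z, continuous f}) -> measurable D ->
  D `<=` O -> measurable_fun D f.
Proof.
move=> oO cf; apply: (continuous_measurable_gen open_measurable_pt4) => B oB.
exact: open_continuous_preimage.
Qed.

Lemma continuous_measurable_pt3 (D : set (pt3 R)) (f : pt3 R -> R) :
  continuous f -> measurable D -> measurable_fun D f.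
Proof.
move=> cf mD.
have oT : open (@setT (pt3 R)) by exact: openT.
apply: (continuous_measurable_gen open_measurable_pt3 (O := @setT (pt3 R))) => //.
by move=> B oB; apply: (open_continuous_preimage oT) => // z _; exact: cf.
Qed.

End Borel.

(** * Tonelli and Fubini on rectangles *)

Section Rectangles.
Context d1 d2 (T1 : measurableType d1) (T2 : measurableType d2) (R : realType).
Variable m1 : {sigma_finite_measure set T1 -> \bar R}.
Variable m2 : {sigma_finite_measure set T2 -> \bar R}.
Variables (A : set T1) (B : set T2).
Hypotheses (mA : measurable A) (mB : measurable B).
Local Open Scope ereal_scope.

Let mAB : measurable (A `*` B). Proof. exact: measurableX. Qed.

Lemma patch_rectangle (f : T1 * T2 -> \bar R) x y :
  (f \_ (A `*` B)) (x, y) = ((fun a => ((fun b => f (a, b)) \_ B) y) \_ A) x.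
Proof.
rewrite /patch in_setX/=.
by case: (x \in A) => //=; case: (y \in B).
Qed.

Lemma tonelli_rectangle (f : T1 * T2 -> \bar R) : measurable_fun (A `*` B) f ->
  (forall z, (A `*` B) z -> 0 <= f z) ->
  \int[m1 \x m2]_(z in A `*` B) f z = \int[m1]_(x in A) \int[m2]_(y in B) f (x, y).
Proof.
move=> mf f0; rewrite integral_mkcond fubini_tonelli1.
- rewrite [RHS]integral_mkcond; apply: eq_integral => x _; rewrite /fubini_F.
  under eq_integral do rewrite patch_rectangle.
  rewrite patchE; case: ifPn => xA.
    rewrite [RHS]integral_mkcond; apply: eq_integral => y _.
    by rewrite !patchE xA.
  rewrite -[RHS](integral0 m2 setT); apply: eq_integral => y _.
  by rewrite !patchE (negbTE xA).
- by apply/(measurable_restrictT _ mAB).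
- move=> z; rewrite patchE; case: ifPn => // /set_mem; exact: f0.
Qed.

Lemma measurable_section_integral (f : T1 * T2 -> \bar R) :
  measurable_fun (A `*` B) f -> (forall z, (A `*` B) z -> 0 <= f z) ->
  measurable_fun A (fun x => \int[m2]_(y in B) f (x, y)).
Proof.
move=> mf f0.
have m : measurable_fun setT (f \_ (A `*` B)) by apply/(measurable_restrictT _ mAB).
have n z : 0 <= (f \_ (A `*` B)) z.
  by rewrite patchE; case: ifPn => // /set_mem; exact: f0.
have := @measurable_fun_fubini_tonelli_F _ _ _ _ _ m2 _ m n.
move=> /(@measurable_funTS _ _ _ _ A); apply: eq_measurable_fun => x xA.
rewrite /fubini_F [RHS]integral_mkcond; apply: eq_integral => y _.
by rewrite !patchE in_setX/= xA.
Qed.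

Lemma integrable_rectangle (f : T1 * T2 -> \bar R) :
  measurable_fun (A `*` B) f ->
  \int[m1]_(x in A) \int[m2]_(y in B) `|f (x, y)| < +oo ->
  (m1 \x m2).-integrable (A `*` B) f.
Proof.
move=> mf foo; apply/integrableP; split => //.
rewrite (tonelli_rectangle (f := abse \o f))//; first exact: measurableT_comp.
by move=> z _; exact: abse_ge0.
Qed.

Lemma fubini_rectangle12 (f : T1 * T2 -> \bar R) :
  (m1 \x m2).-integrable (A `*` B) f ->
  \int[m1 \x m2]_(z in A `*` B) f z = \int[m1]_(x in A) \int[m2]_(y in B) f (x, y).
Proof.
move=> itf; rewrite integral_mkcond -integral12_prod_meas1; last first.
  exact/(integrable_mkcond _ mAB).
rewrite [RHS]integral_mkcond; apply: eq_integral => x _; rewrite /fubini_F.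
under eq_integral do rewrite patch_rectangle.
rewrite patchE; case: ifPn => xA.
  rewrite [RHS]integral_mkcond; apply: eq_integral => y _.
  by rewrite !patchE xA.
rewrite -[RHS](integral0 m2 setT); apply: eq_integral => y _.
by rewrite !patchE (negbTE xA).
Qed.

Lemma fubini_rectangle21 (f : T1 * T2 -> \bar R) :
  (m1 \x m2).-integrable (A `*` B) f ->
  \int[m1 \x m2]_(z in A `*` B) f z = \int[m2]_(y in B) \int[m1]_(x in A) f (x, y).
Proof.
move=> itf; rewrite integral_mkcond -integral21_prod_meas1; last first.
  exact/(integrable_mkcond _ mAB).
rewrite [RHS]integral_mkcond; apply: eq_integral => y _; rewrite /fubini_G.
under eq_integral do rewrite patch_rectangle.
rewrite patchE; case: ifPn => yB.
  rewrite [RHS]integral_mkcond; apply: eq_integral => x _.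
  by rewrite !patchE yB.
rewrite -[RHS](integral0 m1 setT); apply: eq_integral => x _.
by rewrite !patchE (negbTE yB) if_same.
Qed.

(* Every section is assumed integrable, so that the inner [fine] is harmless. *)
Lemma Rfubini_rectangle12 (f : T1 * T2 -> R) :
  (m1 \x m2).-integrable (A `*` B) (EFin \o f) ->
  (forall x, A x -> m2.-integrable B (fun y => (f (x, y))%:E)) ->
  (\int[(m1 \x m2)%E]_(z in A `*` B) f z =
   \int[m1]_(x in A) \int[m2]_(y in B) f (x, y))%R.
Proof.
move=> itf its; rewrite /Rintegral; congr fine.
rewrite (fubini_rectangle12 (f := EFin \o f))//.
apply: eq_integral => x /set_mem Ax /=; rewrite fineK//.
by apply: integrable_fin_num => //; exact: its.
Qed.

Lemma Rfubini_rectangle21 (f : T1 * T2 -> R) :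
  (m1 \x m2).-integrable (A `*` B) (EFin \o f) ->
  (forall y, B y -> m1.-integrable A (fun x => (f (x, y))%:E)) ->
  (\int[(m1 \x m2)%E]_(z in A `*` B) f z =
   \int[m2]_(y in B) \int[m1]_(x in A) f (x, y))%R.
Proof.
move=> itf its; rewrite /Rintegral; congr fine.
rewrite (fubini_rectangle21 (f := EFin \o f))//.
apply: eq_integral => y /set_mem By /=; rewrite fineK//.
by apply: integrable_fin_num => //; exact: its.
Qed.

(** Every section of the exceptional set is negligible, so Tonelli gives it measure zero.
    Measurability on the rectangle is assumed because negligible sections alone do not make a set
    negligible. *)
Lemma ae_rectangle (P : set (T1 * T2)) : measurable (A `*` B `&` P) ->
  (forall x, A x -> {ae m2, forall y, B y -> P (x, y)}) ->
  {ae (m1 \x m2), forall z, (A `*` B) z -> P z}.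
Proof.
move=> mP aeP; set N := (A `*` B) `\` P.
have mN : measurable N.
  rewrite (_ : N = (A `*` B) `\` (A `*` B `&` P)); first exact: measurableD.
  by rewrite setDIr setDv set0U.
exists N; split => //; last first.
  by move=> z /= /not_implyP[].
have -> : (m1 \x m2) N = \int[m1 \x m2]_(z in A `*` B) (\1_N z)%:E.
  rewrite integral_indic//; congr (_ _); apply/esym/setIidl.
  by move=> z [].
rewrite (tonelli_rectangle (f := EFin \o \1_N)).
- rewrite integral0_eq// => x Ax.
  have [S [mS S0 PS]] := aeP x Ax.
  apply/eqP; rewrite eq_le integral_ge0 ?andbT//; last first.
    by move=> y _; rewrite lee_fin.
  rewrite -S0 -[X in _ <= m2 X]setIT -(integral_indic _ measurableT)//.
  apply: (@le_trans _ _ (\int[m2]_(y in B) (\1_S y)%:E)).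
    apply: ge0_le_integral => //=.
    - apply/measurable_EFinP; apply: measurable_funTS.
      have -> : (fun y => \1_N (x, y) : R) = \1_(xsection N x).
        apply/funext => y; rewrite !indicE; congr (_%:R); congr nat_of_bool.
        by rewrite mem_xsection.
      exact/measurable_indic/measurable_xsection.
    - by apply/measurable_EFinP; apply: measurable_funTS; exact: measurable_indic.
    - move=> y By; rewrite lee_fin !indicE ler_nat.
      have [Nxy|//] := boolP ((x, y) \in N); rewrite mem_set//.
      by apply: PS => /=; apply/not_implyP; split => //; case: (set_mem Nxy).
  apply: ge0_subset_integral => //.
    by apply/measurable_EFinP; exact: measurable_indic.
- by apply/measurable_EFinP; apply: measurable_funTS; exact: measurable_indic.
- by move=> z _; rewrite lee_fin.
Qed.

End Rectangles.

(** * Comparison of integrals under almost everywhere bounds *)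

Section Integrals.
Context d (T : measurableType d) (R : realType).
Variable mu : {measure set T -> \bar R}.
Variable D : set T.
Hypothesis mD : measurable D.

Lemma ae_imp (P Q : T -> Prop) : {ae mu, forall x, D x -> P x} ->
  (forall x, D x -> P x -> Q x) -> {ae mu, forall x, D x -> Q x}.
Proof. by move=> aeP PQ; apply: filterS aeP => x H Dx; apply: PQ => //; exact: H. Qed.

Lemma ae_and (P Q : T -> Prop) : {ae mu, forall x, D x -> P x} ->
  {ae mu, forall x, D x -> Q x} -> {ae mu, forall x, D x -> P x /\ Q x}.
Proof. by move=> aeP aeQ; apply: filterS2 aeP aeQ => x H1 H2 Dx; split; auto. Qed.

Lemma RintegrableD (f g : T -> R) :
  mu.-integrable D (EFin \o f) -> mu.-integrable D (EFin \o g) ->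
  mu.-integrable D (fun x => (f x + g x)%:E).
Proof.
by move=> itf itg; apply: eq_integrable (integrableD mD itf itg) => // x _.
Qed.

Lemma RintegrableB (f g : T -> R) :
  mu.-integrable D (EFin \o f) -> mu.-integrable D (EFin \o g) ->
  mu.-integrable D (fun x => (f x - g x)%:E).
Proof.
by move=> itf itg; apply: eq_integrable (integrableB mD itf itg) => // x _.
Qed.

Lemma RintegrableZl (f : T -> R) (a : R) :
  mu.-integrable D (EFin \o f) -> mu.-integrable D (fun x => (a * f x)%:E).
Proof.
by move=> itf; apply: eq_integrable (integrableZl mD a itf) => // x _.
Qed.

Lemma RintegrableMr (f g : T -> R) (M : R) :
  mu.-integrable D (EFin \o f) -> measurable_fun D g ->
  (forall x, D x -> `|g x| <= M) -> mu.-integrable D (fun x => (f x * g x)%:E).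
Proof.
move=> itf mg gM.
suff bg : [bounded g x | x in D].
  by apply: eq_integrable (integrableMl mD itf mg bg) => // x _.
exists M; split; first by rewrite num_real.
by move=> r Mr x Dx /=; rewrite (le_trans (gM x Dx))// ltW.
Qed.

Lemma Rintegrable_sum (I : Type) (s : seq I) (P : pred I) (f : I -> T -> R) :
  (forall i, mu.-integrable D (EFin \o f i)) ->
  mu.-integrable D (fun x => (\sum_(i <- s | P i) f i x)%:E).
Proof.
move=> itf.
have H : mu.-integrable D (fun x => (\sum_(i <- s | P i) (f i x)%:E)%E).
  by apply: integrable_sum => // i _; exact: itf.
by apply: eq_integrable H => // x _; rewrite sumEFin.
Qed.

(** The difference [g - f] agrees almost everywhere with its positive part, whose integral is
    nonnegative without any exceptional set. *)
Lemma ae_le_Rintegral (f g : T -> R) :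
  mu.-integrable D (EFin \o f) -> mu.-integrable D (EFin \o g) ->
  {ae mu, forall x, D x -> f x <= g x} ->
  \int[mu]_(x in D) f x <= \int[mu]_(x in D) g x.
Proof.
move=> itf itg fg.
rewrite -subr_ge0 -RintegralB//.
apply: fine_ge0.
have -> : (\int[mu]_(x in D) (g x - f x)%:E =
    \int[mu]_(x in D) (Num.max (g x - f x) 0)%:E)%E.
  have mgf : measurable_fun D (fun x => g x - f x).
    apply/measurable_EFinP.
    by have /= := measurable_int _ (integrableB mD itg itf).
  apply: ae_eq_integral => //.
  - exact/measurable_EFinP.
  - by apply/measurable_EFinP; exact: measurable_maxr.
  - apply: filterS fg => x + Dx => /(_ Dx) fgx; congr EFin.
    by rewrite max_l// subr_ge0.
by apply: integral_ge0 => x _; rewrite lee_fin le_max lexx orbT.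
Qed.

Lemma ae_eq_Rintegral (f g : T -> R) :
  measurable_fun D f -> measurable_fun D g ->
  {ae mu, forall x, D x -> f x = g x} ->
  \int[mu]_(x in D) f x = \int[mu]_(x in D) g x.
Proof.
move=> mf mg fg; rewrite /Rintegral; congr fine; apply: ae_eq_integral => //.
- exact/measurable_EFinP.
- exact/measurable_EFinP.
- by apply: filterS fg => x + Dx => /(_ Dx) ->.
Qed.

Lemma ae_le_integrable (f g : T -> R) :
  measurable_fun D f -> mu.-integrable D (EFin \o g) ->
  {ae mu, forall x, D x -> `|f x| <= g x} -> mu.-integrable D (EFin \o f).
Proof.
move=> mf itg fg; apply/integrableP; split; first exact/measurable_EFinP.
have /integrableP[mg] := itg; apply: le_lt_trans.
(* This truncation is below [|g|] everywhere and equals [|f|] almost everywhere, so the comparison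
   can be made at every point. *)
pose h x := Num.min `|f x| `|g x|.
have -> : (\int[mu]_(x in D) `|(EFin \o f) x| = \int[mu]_(x in D) (h x)%:E)%E.
  apply: ae_eq_integral => //.
  - by apply: measurableT_comp => //; exact/measurable_EFinP.
  - apply/measurable_EFinP; apply: measurable_minr.
      exact: measurableT_comp.
    by apply: measurableT_comp => //; exact/measurable_EFinP.
  - apply: filterS fg => x + Dx => /(_ Dx) fgx /=; congr EFin.
    by rewrite /h min_l// (le_trans fgx)// ler_norm.
apply: ge0_le_integral => //=.
- by move=> x _; rewrite lee_fin le_min !normr_ge0.
- apply/measurable_EFinP; apply: measurable_minr.
    exact: measurableT_comp.
  by apply: measurableT_comp => //; exact/measurable_EFinP.
- apply/measurable_EFinP; apply: measurableT_comp => //; exact/measurable_EFinP.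
- by move=> x _; rewrite lee_fin ge_min lexx orbT.
Qed.

(** The integral of [f] may be infinite. This is how integrable lower bounds are inserted into the
    energy inequality, which is stated in the extended reals; the positive part of [g] serves as
    intermediate function. *)
Lemma Rintegral_le_ge0_integral (f g : T -> R) :
  measurable_fun D f -> mu.-integrable D (EFin \o g) ->
  {ae mu, forall x, D x -> g x <= f x /\ 0 <= f x} ->
  ((\int[mu]_(x in D) g x)%:E <= \int[mu]_(x in D) (f x)%:E)%E.
Proof.
move=> mf itg gf.
have mg : measurable_fun D g by apply/measurable_EFinP; exact: measurable_int itg.
rewrite /Rintegral fineK; last exact: integrable_fin_num itg.
have -> : (\int[mu]_(x in D) (f x)%:E =
    \int[mu]_(x in D) (Num.max (f x) (Num.max (g x) 0))%:E)%E.
  apply: ae_eq_integral => //.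
  - exact/measurable_EFinP.
  - apply/measurable_EFinP; apply: measurable_maxr => //.
    exact: measurable_maxr.
  - apply: filterS gf => x + Dx => /(_ Dx)[gfx f0]; congr EFin.
    by rewrite max_l// ge_max gfx.
apply: (@le_trans _ _ (\int[mu]_(x in D) (Num.max (g x) 0)%:E)%E).
  rewrite integralE -[leRHS]sube0; apply: leeB; last exact: integral_ge0.
  rewrite le_eqVlt; apply/orP; left; apply/eqP/eq_integral => x _.
  by rewrite EFin_max funeposE.
apply: ge0_le_integral => //=.
- by move=> x _; rewrite lee_fin le_max lexx orbT.
- by apply/measurable_EFinP; exact: measurable_maxr.
- by apply/measurable_EFinP; apply: measurable_maxr => //; exact: measurable_maxr.
- by move=> x _; rewrite lee_fin le_max lexx orbT.
Qed.

End Integrals.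

Section OneDim.
Variable R : realType.

Lemma Rintegral_derive1 (g : R -> R) (a b : R) : a < b ->
  (forall t, derivable g t 1) -> continuous (derive1 g) ->
  \int[@lebesgue_measure R]_(t in `[a, b]) derive1 g t = g b - g a.
Proof.
move=> ab dg cg.
have cg0 : continuous g.
  by move=> t; apply: differentiable_continuous; exact/derivable1_diffP.
have cw : {within `[a, b], continuous (derive1 g)} by exact: continuous_subspaceT.
have dab : derivable_oo_LRcontinuous g a b.
  split.
  - by move=> t _; exact: dg.
  - by apply: cvg_at_right_filter; exact: cg0.
  - by apply: cvg_at_left_filter; exact: cg0.
exact: (congr1 fine (continuous_FTC2 ab cw dab (fun _ _ => erefl))).
Qed.

Lemma integrable_continuous_segment (g : R -> R) (a b : R) : continuous g ->
  (@lebesgue_measure R).-integrable `[a, b] (EFin \o g).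
Proof.
move=> cg; apply: continuous_compact_integrable; first exact: segment_compact.
exact: continuous_subspaceT.
Qed.

End OneDim.

(** * The unit cube and integration of derivatives over the torus *)

Section Cube.
Variable R : realType.
Let I : set R := `[0, 1]%classic.

Lemma open_measurable_pt2 (U : set (R * R)) : open U -> measurable U.
Proof.
apply: (@countable_basis_open _ (@measurable _ (R * R)%type)) => // [|F mF].
  apply: countable_basis_prod; last exact: measurableX.
    exact: countable_basis_R.
  exact: countable_basis_R.
by apply: bigcup_measurable => n _; exact: mF.
Qed.

Lemma continuous_measurable_pt2 (D : set (R * R)) (f : R * R -> R) :
  continuous f -> measurable D -> measurable_fun D f.
Proof.
move=> cf mD.
have oT : open (@setT (R * R)%type) by exact: openT.
apply: (continuous_measurable_gen open_measurable_pt2 (O := @setT (R * R)%type)) => //.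
by move=> B oB; apply: (open_continuous_preimage oT) => // z _; exact: cf.
Qed.

Lemma measurable_unit_square : measurable (I `*` I).
Proof. by apply: measurableX; exact: measurable_itv. Qed.

Lemma measurable_cube : measurable (@cube R).
Proof. by apply: measurableX; [exact: measurable_unit_square|exact: measurable_itv]. Qed.

Lemma measurable_slab (T : R) : measurable (slab T).
Proof. by apply: measurableX; [exact: measurable_itv|exact: measurable_cube]. Qed.

Lemma measurable_cylinder : measurable (@cylinder R).
Proof. by apply: measurableX; [exact: measurable_itv|exact: measurable_cube]. Qed.

Lemma slab_cylinder (T : R) : slab T `<=` cylinder.
Proof.
move=> [t x] [/= + cx]; rewrite in_itv/= => /andP[t0 _]; split => //=.
by rewrite /halfline/= in_itv/= andbT ltW.
Qed.

Lemma lebesgue_unit : @lebesgue_measure R I = 1%E.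
Proof. by rewrite /I lebesgue_measure_itv/= lte_fin ltr01 -EFinD subr0. Qed.

Lemma leb2_unit_square : leb2 (I `*` I) = 1%E.
Proof.
have mI : measurable I by exact: measurable_itv.
have -> : leb2 (I `*` I) = (@lebesgue_measure R I * @lebesgue_measure R I)%E.
  exact: product_measure1E.
by rewrite !lebesgue_unit mule1.
Qed.

Lemma leb3_cube : leb3 (@cube R) = 1%E.
Proof.
have mI : measurable I by exact: measurable_itv.
have msq := measurable_unit_square.
have -> : leb3 cube = (leb2 (I `*` I) * @lebesgue_measure R I)%E.
  exact: product_measure1E.
by rewrite leb2_unit_square lebesgue_unit mule1.
Qed.

Lemma leb4_slab (T : R) : 0 < T -> leb4 (slab T) = T%:E.
Proof.
move=> T0.
have mI : measurable (`]0, T[%classic : set R) by exact: measurable_itv.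
have mc := measurable_cube.
have -> : leb4 (slab T) = (@lebesgue_measure R (`]0%R, T[%classic : set R) * leb3 (@cube R))%E.
  exact: product_measure1E.
by rewrite leb3_cube mule1 lebesgue_measure_itv/= lte_fin T0 -EFinD subr0.
Qed.

Lemma leb2_unit_square_lty : (leb2 (I `*` I) < +oo)%E.
Proof. by rewrite leb2_unit_square ltry. Qed.

Lemma leb3_cube_lty : (leb3 (@cube R) < +oo)%E.
Proof. by rewrite leb3_cube ltry. Qed.

Lemma leb4_slab_lty (T : R) : 0 < T -> (leb4 (slab T) < +oo)%E.
Proof. by move=> T0; rewrite leb4_slab// ltry. Qed.

Lemma compact_cube : compact (@cube R).
Proof.
apply: compact_setX; last exact: segment_compact.
by apply: compact_setX; exact: segment_compact.
Qed.

Lemma compact_slab (T : R) : compact (`[0, T]%classic `*` @cube R).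
Proof. by apply: compact_setX; [exact: segment_compact|exact: compact_cube]. Qed.

Lemma compact_continuous_bounded (S : topologicalType) (K : set S) (f : S -> R) :
  compact K -> (forall z, K z -> {for z, continuous f}) ->
  exists2 M, 0 < M & forall z, K z -> `|f z| <= M.
Proof.
move=> cK cf; have [K0|/nonemptyPn K0] := pselect (K !=set0); last first.
  by exists 1 => // z; rewrite K0.
have cn : {within K, continuous (fun z => `|f z|)}.
  apply: continuous_in_subspaceT => z /set_mem Kz.
  by apply: continuous_comp; [exact: cf|exact: norm_continuous].
have [c cK' Hc] := compact_EVT_max K0 cK cn.
exists (`|f c| + 1); first by rewrite ltr_wpDl.
move=> z Kz; rewrite (le_trans (Hc z _)) ?inE// lerDl ler01 //.
Qed.

Lemma bounded_integrable d (T : measurableType d) (mu : {measure set T -> \bar R})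
    (D : set T) (f : T -> R) (M : R) : measurable D -> (mu D < +oo)%E ->
  measurable_fun D f -> (forall x, D x -> `|f x| <= M) ->
  mu.-integrable D (EFin \o f).
Proof.
move=> mD Doo mf fM; apply: measurable_bounded_integrable => //.
exists M; split; first by rewrite num_real.
by move=> r Mr x Dx /=; rewrite (le_trans (fM x Dx))// ltW.
Qed.

Lemma continuous_cube_integrable (f : pt3 R -> R) : continuous f -> integ3 f.
Proof.
move=> cf; have [M M0 fM] := compact_continuous_bounded compact_cube (fun z _ => cf z).
apply: (bounded_integrable (M := M)) => //; first exact: measurable_cube.
  exact: leb3_cube_lty.
by apply: continuous_measurable_pt3 => //; exact: measurable_cube.
Qed.

Lemma continuous_square_integrable (f : R * R -> R) : continuous f ->
  leb2.-integrable (I `*` I) (EFin \o f).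
Proof.
move=> cf.
have [||M M0 fM] := @compact_continuous_bounded _ (I `*` I) f.
- by apply: compact_setX; exact: segment_compact.
- by move=> z _; exact: cf.
apply: (bounded_integrable (M := M)) => //; first exact: measurable_unit_square.
  exact: leb2_unit_square_lty.
by apply: continuous_measurable_pt2 => //; exact: measurable_unit_square.
Qed.

Lemma continuous_pairl (A B C : topologicalType) (f : A * B -> C) (y : B) :
  continuous f -> continuous (fun x => f (x, y)).
Proof.
move=> cf x; apply: (@continuous_comp _ _ _ (fun x => (x, y)) f).
  by apply: cvg_pair; [exact: cvg_id|exact: cvg_cst].
exact: cf.
Qed.

Lemma continuous_pairr (A B C : topologicalType) (f : A * B -> C) (x : A) :
  continuous f -> continuous (fun y => f (x, y)).
Proof.
move=> cf y; apply: (@continuous_comp _ _ _ (fun y => (x, y)) f).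
  by apply: cvg_pair; [exact: cvg_cst|exact: cvg_id].
exact: cf.
Qed.

Lemma Rintegral_derive1_periodic (g : R -> R) : (forall t, derivable g t 1) ->
  continuous (derive1 g) -> g 1 = g 0 ->
  \int[@lebesgue_measure R]_(t in I) derive1 g t = 0.
Proof. by move=> dg cg g01; rewrite Rintegral_derive1// g01 subrr. Qed.

Lemma derive1_line (V : normedModType R) (f : V -> R) (z v : V) (t : R) :
  derive1 (fun s : R => f (z + s *: v)) t = 'D_v f (z + t *: v).
Proof. by rewrite derive1E derive_line. Qed.

Lemma Rintegral0 d (T : measurableType d) (mu : {measure set T -> \bar R}) D :
  \int[mu]_(x in D) (0 : R) = 0.
Proof. by rewrite /Rintegral integral0. Qed.

(* Along each axis the integral of the derivative telescopes by periodicity. *)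
Lemma int3_pd (f : pt3 R -> R) k : C1_periodic f -> int3 (pd k f) = 0.
Proof.
move=> [pf cf df cdf].
have line (z : pt3 R) : f (z + dir R k) = f z ->
    \int[@lebesgue_measure R]_(t in I) pd k f (z + t *: dir R k) = 0.
  move=> fz; rewrite -(@Rintegral_derive1_periodic (fun s : R => f (z + s *: dir R k))).
  - by apply: eq_Rintegral => t _; rewrite derive1_line.
  - by move=> t; apply: derivable_line; exact: df.
  - have -> : derive1 (fun s : R => f (z + s *: dir R k)) =
              (fun s : R => pd k f (z + s *: dir R k)).
      by apply/funext => s; rewrite derive1_line.
    move=> t; apply: (@continuous_comp _ _ _ (fun s : R => z + s *: dir R k) (pd k f));
      last exact: cdf.
    apply: continuousD; first exact: cvg_cst.
    by apply: continuousZl; exact: cvg_id.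
  - by rewrite scale1r scale0r addr0.
have ci := continuous_cube_integrable (cdf k).
have mI : measurable I by exact: measurable_itv.
have msq := measurable_unit_square.
(* In each of the three cases Fubini puts the variable of axis [k] innermost, where [line]
   applies. *)
case: k => -[|[|[|//]]] k3 in pf df cdf ci line *.
- rewrite /int3 /cube (Rfubini_rectangle21 (m1 := leb2) (m2 := @lebesgue_measure R) msq mI)//; last first.
    move=> z _; apply: (continuous_square_integrable (f := fun xy => pd _ f (xy, z))).
    exact: (continuous_pairl (cdf _)).
  rewrite -[RHS](@Rintegral0 _ _ (@lebesgue_measure R) I).
  apply: eq_Rintegral => z _.
  rewrite (Rfubini_rectangle21 (m1 := @lebesgue_measure R) (m2 := @lebesgue_measure R)
    (f := fun xy => pd _ f (xy, z)) mI mI); last 2 first.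
  + apply: continuous_square_integrable; exact: (continuous_pairl (cdf _)).
  + move=> y _; apply: (integrable_continuous_segment (g := fun x => pd _ f (x, y, z))).
    exact: (continuous_pairl (continuous_pairl (cdf _))).
  rewrite -[RHS](@Rintegral0 _ _ (@lebesgue_measure R) I).
  apply: eq_Rintegral => y _.
  rewrite -[RHS](line (0, y, z)); last exact: pf.
  apply: eq_Rintegral => x _; congr (pd _ f _).
  by congr (_, _, _); rewrite /= /GRing.scale/= ?mulr1 ?mulr0 ?add0r ?addr0.
- rewrite /int3 /cube (Rfubini_rectangle21 (m1 := leb2) (m2 := @lebesgue_measure R) msq mI)//; last first.
    move=> z _; apply: (continuous_square_integrable (f := fun xy => pd _ f (xy, z))).
    exact: (continuous_pairl (cdf _)).
  rewrite -[RHS](@Rintegral0 _ _ (@lebesgue_measure R) I).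
  apply: eq_Rintegral => z _.
  rewrite (Rfubini_rectangle12 (m1 := @lebesgue_measure R) (m2 := @lebesgue_measure R)
    (f := fun xy => pd _ f (xy, z)) mI mI); last 2 first.
  + apply: continuous_square_integrable; exact: (continuous_pairl (cdf _)).
  + move=> x _; apply: (integrable_continuous_segment (g := fun y => pd _ f (x, y, z))).
    exact: (continuous_pairr (continuous_pairl (cdf _))).
  rewrite -[RHS](@Rintegral0 _ _ (@lebesgue_measure R) I).
  apply: eq_Rintegral => x _.
  rewrite -[RHS](line (x, 0, z)); last exact: pf.
  apply: eq_Rintegral => y _; congr (pd _ f _).
  by congr (_, _, _); rewrite /= /GRing.scale/= ?mulr1 ?mulr0 ?add0r ?addr0.
- rewrite /int3 /cube (Rfubini_rectangle12 (m1 := leb2) (m2 := @lebesgue_measure R) msq mI)//; last first.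
    move=> xy _; apply: (integrable_continuous_segment (g := fun z => pd _ f (xy, z))).
    exact: (continuous_pairr (cdf _)).
  rewrite -[RHS](@Rintegral0 _ _ leb2 (I `*` I)).
  apply: eq_Rintegral => -[x y] _.
  rewrite -[RHS](line (x, y, 0)); last exact: pf.
  apply: eq_Rintegral => z _; congr (pd _ f _).
  by congr (_, _, _); rewrite /= /GRing.scale/= ?mulr1 ?mulr0 ?add0r ?addr0.
Qed.

Lemma Rintegral_oo_cc (a b : R) (f : R -> R) :
  (@lebesgue_measure R).-integrable `[a, b] (EFin \o f) ->
  \int[@lebesgue_measure R]_(t in `]a, b[) f t =
  \int[@lebesgue_measure R]_(t in `[a, b]) f t.
Proof.
move=> itf; rewrite Rintegral_itv_obnd_cbnd ?Rintegral_itv_bndo_bndc//.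
  apply: integrableS itf => // x /=.
  by rewrite !in_itv/= => /andP[-> p]; rewrite ltW.
apply: integrableS itf => // x /=.
by rewrite !in_itv/= => /andP[p q]; rewrite !ltW.
Qed.

Lemma bounded_slab_integrable (T : R) (f : R -> pt3 R -> R) (M : R) : 0 < T ->
  measurable_fun (slab T) (fun z => f z.1 z.2) ->
  (forall t x, 0 < t < T -> cube x -> `|f t x| <= M) -> integ4 (slab T) f.
Proof.
move=> T0 mf fM.
apply: (bounded_integrable (mu := leb4) (f := fun z : R * pt3 R => f z.1 z.2) (M := M)).
- exact: measurable_slab.
- exact: leb4_slab_lty.
- exact: mf.
- by move=> [t x] [/= tT cx]; apply: fM => //; move: tT; rewrite in_itv.
Qed.

Lemma slab_closed (T : R) : slab T `<=` `[0, T]%classic `*` @cube R.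
Proof.
by move=> [t x] [/= + cx]; rewrite in_itv/= => /andP[t0 tT]; split => //=;
  rewrite in_itv/= !ltW.
Qed.

Lemma continuous_slab_measurable (T : R) (O : set (R * pt3 R)) (f : R -> pt3 R -> R) :
  open O -> `[0, T]%classic `*` @cube R `<=` O ->
  (forall z, O z -> {for z, continuous (fun z => f z.1 z.2)}) ->
  measurable_fun (slab T) (fun z => f z.1 z.2).
Proof.
move=> oO TO cf; apply: (continuous_measurable_pt4 oO cf); first exact: measurable_slab.
exact: subset_trans (@slab_closed T) TO.
Qed.

Lemma continuous_slab_integrable (T : R) (O : set (R * pt3 R)) (f : R -> pt3 R -> R) :
  0 < T -> open O -> `[0, T]%classic `*` @cube R `<=` O ->
  (forall z, O z -> {for z, continuous (fun z => f z.1 z.2)}) -> integ4 (slab T) f.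
Proof.
move=> T0 oO TO cf.
have [M M0 fM] := compact_continuous_bounded (@compact_slab T) (fun z Kz => cf z (TO z Kz)).
apply: (bounded_slab_integrable (M := M)) => //.
  exact: continuous_slab_measurable cf.
by move=> t x tT cx; apply: (fM (t, x)); split => //=; rewrite in_itv/= !ltW//;
  case/andP: tT.
Qed.

Lemma slab_dt0 (T : R) (f : R -> pt3 R -> R) : 0 < T ->
  (forall t x, derivable (f ^~ x) t 1) ->
  continuous (fun p : R * pt3 R => dt f p.1 p.2) ->
  (forall x, f 0 x = 0) -> (forall x, f T x = 0) ->
  \int[leb4]_(z in slab T) dt f z.1 z.2 = 0.
Proof.
move=> T0 df cdf f0 fT.
have mI : measurable (`]0, T[%classic : set R) by exact: measurable_itv.
have cdx x : continuous (dt f ^~ x).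
  exact: (continuous_pairl (f := fun p : R * pt3 R => dt f p.1 p.2) cdf).
rewrite /slab (Rfubini_rectangle21 (m1 := @lebesgue_measure R) (m2 := leb3) mI measurable_cube (f := fun z => dt f z.1 z.2)).
- rewrite -[RHS](@Rintegral0 _ _ leb3 cube); apply: eq_Rintegral => x _ /=.
  rewrite Rintegral_oo_cc; last exact: integrable_continuous_segment.
  by rewrite (Rintegral_derive1 (g := f ^~ x) T0 (fun t => df t x) (cdx x)) f0 fT subrr.
- have oT : open (@setT (R * pt3 R)%type) by exact: openT.
  exact: (@continuous_slab_integrable T _ (dt f) T0 oT (@subsetT _ _) (fun z _ => cdf z)).
- move=> x _ /=.
  have H := @integrable_continuous_segment R (dt f ^~ x) 0 T (cdx x).
  by apply: (integrableS _ _ _ H) => //; exact: subset_itv_oo_cc.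
Qed.

End Cube.

(** * Integrals over the torus and over the space-time slab *)

Section TorusIntegral.
Variable R : realType.
Implicit Types f g : pt3 R -> R.
Let mc := @measurable_cube R.

Lemma integ3D f g : integ3 f -> integ3 g -> integ3 (fun x => f x + g x).
Proof. exact: (@RintegrableD _ _ _ leb3 cube mc f g). Qed.

Lemma integ3B f g : integ3 f -> integ3 g -> integ3 (fun x => f x - g x).
Proof. exact: (@RintegrableB _ _ _ leb3 cube mc f g). Qed.

Lemma integ3Zl f a : integ3 f -> integ3 (fun x => a * f x).
Proof. exact: (@RintegrableZl _ _ _ leb3 cube mc f a). Qed.

Lemma integ3_norm f : integ3 f -> integ3 (fun x => `|f x|).
Proof. exact: (@integrable_norm _ _ _ leb3 cube f). Qed.

Lemma integ3_sum (I : Type) (s : seq I) (P : pred I) (f : I -> pt3 R -> R) :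
  (forall i, integ3 (f i)) -> integ3 (fun x => \sum_(i <- s | P i) f i x).
Proof. exact: (@Rintegrable_sum _ _ _ leb3 cube mc I s P f). Qed.

Lemma integ3Mr f g M : integ3 f -> measurable_fun cube g ->
  (forall x, cube x -> `|g x| <= M) -> integ3 (fun x => f x * g x).
Proof. exact: (@RintegrableMr _ _ _ leb3 cube mc f g M). Qed.

Lemma integ3_measurable f : integ3 f -> measurable_fun cube f.
Proof. by move=> itf; apply/measurable_EFinP; exact: measurable_int itf. Qed.

Lemma le_norm_int3 f : integ3 f -> `|int3 f| <= int3 (fun x => `|f x|).
Proof. exact: (@le_normr_Rintegral _ _ _ leb3 cube f mc). Qed.

Lemma int3D f g : integ3 f -> integ3 g ->
  int3 (fun x => f x + g x) = int3 f + int3 g.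
Proof. exact: (@RintegralD _ _ _ leb3 cube f g mc). Qed.

Lemma int3B f g : integ3 f -> integ3 g ->
  int3 (fun x => f x - g x) = int3 f - int3 g.
Proof. exact: (@RintegralB _ _ _ leb3 cube f g mc). Qed.

Lemma int3Zl f a : integ3 f -> int3 (fun x => a * f x) = a * int3 f.
Proof. exact: (@RintegralZl _ _ _ leb3 cube f a mc). Qed.

Lemma int3_sum (I : Type) (s : seq I) (P : pred I) (f : I -> pt3 R -> R) :
  (forall i, integ3 (f i)) ->
  int3 (fun x => \sum_(i <- s | P i) f i x) = \sum_(i <- s | P i) int3 (f i).
Proof.
move=> itf; elim: s => [|i s IH].
  rewrite big_nil -[RHS](Rintegral0 leb3 cube); apply: eq_Rintegral => x _.
  by rewrite big_nil.
rewrite big_cons -IH; case: ifPn => Pi.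
  rewrite -int3D//; last exact: integ3_sum.
  by apply: eq_Rintegral => x _; rewrite big_cons Pi.
by apply: eq_Rintegral => x _; rewrite big_cons (negbTE Pi).
Qed.

Lemma int3_EFin f : integ3 f -> (int3 f)%:E = (\int[leb3]_(x in cube) (f x)%:E)%E.
Proof.
move=> itf; rewrite /int3 /Rintegral fineK//.
exact: (@integrable_fin_num _ _ _ leb3 cube mc (EFin \o f)).
Qed.

Lemma eq_int3 f g : (forall x, cube x -> f x = g x) -> int3 f = int3 g.
Proof. by move=> fg; apply: eq_Rintegral => x /set_mem; exact: fg. Qed.

Lemma eq_integ3 f g : (forall x, cube x -> f x = g x) -> integ3 f -> integ3 g.
Proof.
move=> fg itf; apply: (@eq_integrable _ _ _ leb3 cube mc (EFin \o f)) itf => x.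
by move=> /set_mem cx /=; rewrite fg.
Qed.

Lemma le_int3 f g : integ3 f -> integ3 g -> (forall x, cube x -> f x <= g x) ->
  int3 f <= int3 g.
Proof. exact: (@le_Rintegral _ _ _ leb3 cube f g mc). Qed.

End TorusIntegral.

Definition intS {R : realType} (T : R) (f : R -> pt3 R -> R) : R :=
  \int[leb4]_(z in slab T) f z.1 z.2.

Section SlabIntegral.
Variables (R : realType) (T : R).
Hypothesis T0 : 0 < T.
Implicit Types f g : R -> pt3 R -> R.
Let mS := @measurable_slab R T.
Let unc f := fun z : R * pt3 R => f z.1 z.2.
Local Notation integS := (integ4 (slab T)).

Lemma integSD f g : integS f -> integS g -> integS (fun t x => f t x + g t x).
Proof. exact: (@RintegrableD _ _ _ leb4 (slab T) mS (unc f) (unc g)). Qed.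

Lemma integSB f g : integS f -> integS g -> integS (fun t x => f t x - g t x).
Proof. exact: (@RintegrableB _ _ _ leb4 (slab T) mS (unc f) (unc g)). Qed.

Lemma integSZl f a : integS f -> integS (fun t x => a * f t x).
Proof. exact: (@RintegrableZl _ _ _ leb4 (slab T) mS (unc f) a). Qed.

Lemma integS_sum (I : Type) (s : seq I) (P : pred I) (f : I -> R -> pt3 R -> R) :
  (forall i, integS (f i)) -> integS (fun t x => \sum_(i <- s | P i) f i t x).
Proof. exact: (@Rintegrable_sum _ _ _ leb4 (slab T) mS I s P (fun i => unc (f i))). Qed.

Lemma integSMr f g M : integS f -> measurable_fun (slab T) (unc g) ->
  (forall t x, 0 < t < T -> cube x -> `|g t x| <= M) ->
  integS (fun t x => f t x * g t x).
Proof.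
move=> itf mg gM; apply: (@RintegrableMr _ _ _ leb4 (slab T) mS (unc f) (unc g) M) => //.
by move=> [t x] [/= tT cx]; apply: gM => //; move: tT; rewrite in_itv.
Qed.

Lemma integS_measurable f : integS f -> measurable_fun (slab T) (unc f).
Proof. by move=> itf; apply/measurable_EFinP; exact: measurable_int itf. Qed.

Lemma intSD f g : integS f -> integS g ->
  intS T (fun t x => f t x + g t x) = intS T f + intS T g.
Proof. exact: (@RintegralD _ _ _ leb4 (slab T) (unc f) (unc g) mS). Qed.

Lemma intSB f g : integS f -> integS g ->
  intS T (fun t x => f t x - g t x) = intS T f - intS T g.
Proof. exact: (@RintegralB _ _ _ leb4 (slab T) (unc f) (unc g) mS). Qed.

Lemma intSZl f a : integS f -> intS T (fun t x => a * f t x) = a * intS T f.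
Proof. exact: (@RintegralZl _ _ _ leb4 (slab T) (unc f) a mS). Qed.

Lemma eq_intS f g : (forall t x, 0 < t < T -> cube x -> f t x = g t x) ->
  intS T f = intS T g.
Proof.
by move=> fg; apply: eq_Rintegral => -[t x] /set_mem[/= tT cx]; exact: fg.
Qed.

Lemma eq_integS f g : (forall t x, 0 < t < T -> cube x -> f t x = g t x) ->
  integS f -> integS g.
Proof.
move=> fg; apply: (@eq_integrable _ _ _ leb4 (slab T) mS) => -[t x].
by move=> /set_mem[/= tT cx] /=; rewrite fg.
Qed.

Lemma intS_sum (I : Type) (s : seq I) (P : pred I) (f : I -> R -> pt3 R -> R) :
  (forall i, integS (f i)) ->
  intS T (fun t x => \sum_(i <- s | P i) f i t x) = \sum_(i <- s | P i) intS T (f i).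
Proof.
move=> itf; elim: s => [|i s IH].
  rewrite big_nil -[RHS](Rintegral0 leb4 (slab T)); apply: eq_Rintegral => x _.
  by rewrite big_nil.
rewrite big_cons -IH; case: ifPn => Pi.
  rewrite -intSD//; last exact: integS_sum.
  by apply: eq_Rintegral => x _; rewrite big_cons Pi.
by apply: eq_Rintegral => x _; rewrite big_cons (negbTE Pi).
Qed.

Definition ae_slab (P : R -> pt3 R -> Prop) :=
  {ae @leb4 R, forall z, slab T z -> P z.1 z.2}.

Lemma ae_slabT (P : R -> pt3 R -> Prop) :
  (forall t x, 0 < t < T -> cube x -> P t x) -> ae_slab P.
Proof.
by move=> HP; apply: aeW => -[t x] [/= tT cx]; exact: HP.
Qed.

Lemma ae_slabS (P Q : R -> pt3 R -> Prop) : ae_slab P ->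
  (forall t x, 0 < t < T -> cube x -> P t x -> Q t x) -> ae_slab Q.
Proof.
move=> aeP PQ; apply: (@ae_imp _ _ _ leb4 _ _ _ aeP) => -[t x] [/= tT cx].
exact: PQ.
Qed.

Lemma ae_slabI (P Q : R -> pt3 R -> Prop) : ae_slab P -> ae_slab Q ->
  ae_slab (fun t x => P t x /\ Q t x).
Proof. exact: (@ae_and _ _ _ leb4). Qed.

Lemma ae_slab_forall (I : finType) (P : I -> R -> pt3 R -> Prop) :
  (forall i, ae_slab (P i)) -> ae_slab (fun t x => forall i, P i t x).
Proof.
move=> aeP.
suff H (s : seq I) : ae_slab (fun t x => forall i, i \in s -> P i t x).
  by apply: ae_slabS (H (enum I)) _ => t x _ _ + i; apply; rewrite mem_enum.
elim: s => [|i s IH]; first exact: ae_slabT.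
apply: ae_slabS (ae_slabI (aeP i) IH) _ => t x _ _ [Pi Ps] j.
by rewrite inE => /predU1P[->//|/Ps].
Qed.

(** The density bounds and the gradient relations of a weak solution are known at each time
    separately; this turns them into statements almost everywhere in space-time. *)
Lemma ae_slab_sections (P : R -> pt3 R -> Prop) :
  measurable (slab T `&` [set z | P z.1 z.2]) ->
  (forall t, 0 < t < T -> {ae @leb3 R, forall x, cube x -> P t x}) -> ae_slab P.
Proof.
move=> mP aeP.
have mI : measurable (`]0, T[%classic : set R) by exact: measurable_itv.
have := @ae_rectangle _ _ _ _ _ (@lebesgue_measure R) (@leb3 R) _ _ mI
  (@measurable_cube R) [set z | P z.1 z.2] mP.
by apply=> t; rewrite /= in_itv/=; exact: aeP.
Qed.

Lemma ae_le_intS f g : integS f -> integS g ->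
  ae_slab (fun t x => f t x <= g t x) -> intS T f <= intS T g.
Proof. exact: (@ae_le_Rintegral _ _ _ leb4 (slab T) mS (unc f) (unc g)). Qed.

Lemma ae_eq_intS f g : measurable_fun (slab T) (unc f) ->
  measurable_fun (slab T) (unc g) ->
  ae_slab (fun t x => f t x = g t x) -> intS T f = intS T g.
Proof. exact: (@ae_eq_Rintegral _ _ _ leb4 (slab T) mS (unc f) (unc g)). Qed.

Lemma ae_le_integS f g : measurable_fun (slab T) (unc f) -> integS g ->
  ae_slab (fun t x => `|f t x| <= g t x) -> integS f.
Proof. exact: (@ae_le_integrable _ _ _ leb4 (slab T) mS (unc f) (unc g)). Qed.

Lemma intS_le_integral f g : measurable_fun (slab T) (unc f) -> integS g ->
  ae_slab (fun t x => g t x <= f t x /\ 0 <= f t x) ->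
  ((intS T g)%:E <= \int[leb4]_(z in slab T) (f z.1 z.2)%:E)%E.
Proof. exact: (@Rintegral_le_ge0_integral _ _ _ leb4 (slab T) mS (unc f) (unc g)). Qed.

Lemma intS_fubini f : integS f -> (forall t, 0 < t < T -> integ3 (f t)) ->
  intS T f = \int[@lebesgue_measure R]_(t in `]0, T[) int3 (f t).
Proof.
move=> itf its.
have mI : measurable (`]0, T[%classic : set R) by exact: measurable_itv.
have := @Rfubini_rectangle12 _ _ _ _ _ (@lebesgue_measure R) (@leb3 R) _ _ mI
  (@measurable_cube R) (unc f) itf.
apply=> t; rewrite /= in_itv/=; exact: its.
Qed.

Lemma int4_slab f : (forall t x, ~~ (0 < t < T) -> f t x = 0) ->
  int4 f = intS T f.
Proof.
move=> f0; rewrite /int4 /intS Rintegral_mkcond [RHS]Rintegral_mkcond.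
congr (\int[leb4]_(z in setT) _); apply/funext => -[t x]; rewrite !patchE.
have [tx|ntx] := boolP ((t, x) \in slab T).
  by rewrite mem_set//; apply: (@slab_cylinder R T); exact: set_mem.
case: ifPn => // /set_mem[/= _ cx]; apply: f0.
by apply: contra ntx => tT; rewrite mem_set.
Qed.

Lemma integ4_cylinder_slab f : integ4 cylinder f -> integS f.
Proof.
apply: (@integrableS _ _ _ leb4) => //.
- exact: measurable_cylinder.
- exact: slab_cylinder.
Qed.

End SlabIntegral.

(** * Continuity in time *)

Section TimeContinuity.
Variables (R : realType) (T : R).
Hypothesis T0 : 0 < T.
Implicit Types (f c : R -> pt3 R -> R).

Let mc := @measurable_cube R.

Lemma C0_L1_integrable f t : C0_Lp 1 f -> 0 <= t -> integ3 (f t).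
Proof.
move=> [/(_ t) H _] /H [mf foo]; apply/integrableP; split; first exact/measurable_EFinP.
apply: le_lt_trans foo; rewrite le_eqVlt; apply/orP; left; apply/eqP.
by apply: eq_integral => x _ /=; rewrite powRr1.
Qed.

Lemma C0_L1_cvg f t0 : C0_Lp 1 f -> 0 <= t0 ->
  int3 (fun x => `|f t x - f t0 x|) @[t --> within halfline (nbhs t0)] --> (0 : R).
Proof.
move=> fC t0p; have [_ /(_ t0 t0p) H] := fC.
have -> : (fun t => int3 (fun x => `|f t x - f t0 x|)) =
    (fun t => fine (\int[leb3]_(x in cube) (`|f t x - f t0 x| `^ 1)%:E)%E).
  apply/funext => t; rewrite /int3 /Rintegral; congr fine.
  by apply: eq_integral => x _ /=; rewrite powRr1.
exact: (fine_cvg H).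
Qed.

Section Weighted.
Variables (f c : R -> pt3 R -> R) (M L : R).
Hypotheses (fC : C0_Lp 1 f)
  (mcc : forall t, 0 <= t <= T -> measurable_fun cube (c t))
  (cM : forall t x, 0 <= t <= T -> cube x -> `|c t x| <= M)
  (cL : forall t s x, 0 <= t <= T -> 0 <= s <= T -> cube x ->
        `|c t x - c s x| <= L * `|t - s|).

Lemma integ3_weighted t : 0 <= t <= T -> integ3 (fun x => f t x * c t x).
Proof.
move=> tT; have t0 : 0 <= t by case/andP: tT.
have ift := C0_L1_integrable fC t0.
by apply: (integ3Mr ift (mcc tT)) => x; exact: cM.
Qed.

(** Both factors move with time: the L^1 modulus of continuity of [f] is charged to the bound [M] of
    the weight, and the Lipschitz constant [L] of the weight to the norm of [f]. *)
Lemma weighted_diff_le t t0 : 0 <= t <= T -> 0 <= t0 <= T ->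
  `|int3 (fun x => f t x * c t x) - int3 (fun x => f t0 x * c t0 x)| <=
  M * int3 (fun x => `|f t x - f t0 x|) + L * `|t - t0| * int3 (fun x => `|f t0 x|).
Proof.
move=> tT t0T; have t0p : 0 <= t0 by case/andP: t0T.
have tp : 0 <= t by case/andP: tT.
have it := C0_L1_integrable fC tp; have it0 := C0_L1_integrable fC t0p.
have wt := integ3_weighted tT; have wt0 := integ3_weighted t0T.
have id : integ3 (fun x => `|f t x - f t0 x|).
  by apply: integ3_norm; exact: integ3B.
have in0 : integ3 (fun x => `|f t0 x|) by exact: integ3_norm.
rewrite -int3B//.
have iw : integ3 (fun x => f t x * c t x - f t0 x * c t0 x).
  exact: integ3B.
apply: le_trans (le_norm_int3 iw) _.
rewrite -int3Zl// -int3Zl//.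
have i1 : integ3 (fun x => M * `|f t x - f t0 x|) by exact: integ3Zl.
have i2 : integ3 (fun x => L * `|t - t0| * `|f t0 x|) by exact: integ3Zl.
rewrite -int3D//.
apply: le_int3 => //.
- exact: integ3_norm.
- exact: integ3D.
- move=> x cx.
  have -> : f t x * c t x - f t0 x * c t0 x =
    c t x * (f t x - f t0 x) + (c t x - c t0 x) * f t0 x by ring.
  apply: le_trans (ler_normD _ _) _; rewrite !normrM.
  by apply: lerD; apply: ler_wpM2r => //; [exact: cM|exact: cL].
Qed.

Lemma weighted_continuous :
  {within `[0, T]%classic, continuous (fun t => int3 (fun x => f t x * c t x))}.
Proof.
apply/subspace_continuousP => t0 /=; rewrite in_itv/= => t0T.
have t0p : 0 <= t0 by case/andP: t0T.
apply/cvgrPdist_le => e e0.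
have H1 : M * int3 (fun x => `|f t x - f t0 x|) + L * `|t - t0| * int3 (fun x => `|f t0 x|)
   @[t --> within `[0, T]%classic (nbhs t0)] --> (0 : R).
  rewrite -[X in _ --> X](addr0 0); apply: cvgD.
    rewrite -[X in _ --> X](mulr0 M); apply: cvgMr.
    apply: cvg_trans (C0_L1_cvg fC t0p); apply: cvg_app; apply: within_subset.
    by move=> s; rewrite /= /halfline /= !in_itv/= => /andP[-> _].
  rewrite -[X in _ --> X](mul0r (int3 (fun x => `|f t0 x|))); apply: cvgMl.
  rewrite -[X in _ --> X](mulr0 L); apply: cvgMr.
  rewrite -[X in _ --> X](@normr0 R R); apply: cvg_norm.
  rewrite -(subrr t0); apply: cvgB; last exact: cvg_cst.
  by apply: cvg_within_filter; exact: cvg_id.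
have := H1 => /cvgr0_norm_le /(_ _ e0) H2.
near=> t.
rewrite distrC; apply: le_trans (weighted_diff_le _ t0T) _.
  have : (`[0, T]%classic : set R) t by near: t; exact: withinT.
  by rewrite /= in_itv.
apply: le_trans (ler_norm _) _; near: t; exact: H2.
Unshelve. all: by end_near. Qed.

End Weighted.

Lemma C0_L1_norm f : C0_Lp 1 f -> C0_Lp 1 (fun t x => `|f t x|).
Proof.
move=> fC; split => [t t0|t0 t0p].
  have [mf foo] := fC.1 t t0; split; first exact: measurableT_comp.
  by under eq_integral do rewrite normr_id.
have [_ /(_ t0 t0p) H] := fC.
apply: (squeeze_cvge _ (cvg_cst 0%E) H); near=> t.
have tp : 0 <= t.
  have : (@halfline R) t by near: t; exact: withinT.
  by rewrite /halfline /= in_itv/= andbT.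
have mt := (fC.1 t tp).1; have mt0 := (fC.1 t0 t0p).1.
apply/andP; split; first by apply: integral_ge0 => x _; rewrite lee_fin powR_ge0.
apply: ge0_le_integral => //=.
- apply/measurable_EFinP; under eq_fun do rewrite powRr1//.
  apply: measurableT_comp => //; apply: measurable_funB; exact: measurableT_comp.
- apply/measurable_EFinP; under eq_fun do rewrite powRr1//.
  by apply: measurableT_comp => //; exact: measurable_funB.
- by move=> x _; rewrite lee_fin !powRr1// ler_dist_dist.
Unshelve. all: by end_near. Qed.

Lemma C0_L1_int_continuous f : C0_Lp 1 f ->
  {within `[0, T]%classic, continuous (fun t => int3 (f t))}.
Proof.
move=> fC.
have := @weighted_continuous f (fun _ _ => 1) 1 0 fC.
have -> : (fun t => int3 (fun x => f t x * 1)) = (fun t => int3 (f t)).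
  by apply/funext => t; apply: eq_Rintegral => x _; rewrite mulr1.
apply=> //.
- by move=> t x _ _; rewrite normr1.
- by move=> t s x _ _ _; rewrite subrr normr0 mul0r.
Qed.

(** The L^1 norm is continuous in time, hence bounded on the compact interval, and Tonelli
    concludes. Joint measurability is a separate hypothesis, as continuity of a curve in L^1 says
    nothing about it. *)
Lemma C0_L1_slab_integrable f : C0_Lp 1 f ->
  measurable_fun (slab T) (fun z => f z.1 z.2) -> integ4 (slab T) f.
Proof.
move=> fC mf.
have cn := C0_L1_int_continuous (C0_L1_norm fC).
have K0 : (`[0, T]%classic : set R) !=set0 by exists 0; rewrite /= in_itv/= lexx ltW.
have [s _ Hs] := compact_EVT_max K0 (@segment_compact R 0 T) cn.
set M := int3 _ in Hs.
have mI : measurable (`]0, T[%classic : set R) by exact: measurable_itv.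
apply: (integrable_rectangle (m1 := @lebesgue_measure R) (m2 := leb3) mI mc
   (f := fun z => (f z.1 z.2)%:E)).
  exact/measurable_EFinP.
apply: (@le_lt_trans _ _ (\int[@lebesgue_measure R]_(t in `]0%R, T[) (M%:E))%E).
  apply: ge0_le_integral => //=.
  - by move=> t _; exact: integral_ge0.
  - apply: (@measurable_section_integral _ _ _ _ _ leb3 _ _ mI mc
      (fun z => `|f z.1 z.2|%:E)) => //.
    by apply/measurable_EFinP; exact: measurableT_comp.
  - move=> t tT.
    have tT' : t \in `[0, T]%classic.
      by rewrite inE /=; move: tT; rewrite /= !in_itv/= => /andP[/ltW -> /ltW ->].
    have t0 : 0 <= t by move: tT; rewrite /= in_itv/= => /andP[/ltW].
    have itt := integ3_norm (C0_L1_integrable fC t0).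
    by have := Hs t tT'; rewrite -lee_fin int3_EFin.
have -> : (\int[@lebesgue_measure R]_(t in `]0%R, T[) (M%:E))%E = (M * T)%:E.
  rewrite integral_cst//= lebesgue_measure_itv/= lte_fin T0.
  by rewrite -EFinD subr0.
by rewrite ltry.
Qed.

End TimeContinuity.

Section WithinContinuity.
Variables (R : realType) (A : set R) (f g : R -> R).
Hypotheses (cf : {within A, continuous f}) (cg : {within A, continuous g}).

Lemma within_continuousD : {within A, continuous (fun x => f x + g x)}.
Proof.
apply/subspace_continuousP => x Ax.
move/subspace_continuousP : cf => /(_ x Ax) cfx.
move/subspace_continuousP : cg => /(_ x Ax) cgx.
exact: cvgD cfx cgx.
Qed.

Lemma within_continuousB : {within A, continuous (fun x => f x - g x)}.
Proof.
apply/subspace_continuousP => x Ax.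
move/subspace_continuousP : cf => /(_ x Ax) cfx.
move/subspace_continuousP : cg => /(_ x Ax) cgx.
exact: cvgB cfx cgx.
Qed.

Lemma within_continuousM : {within A, continuous (fun x => f x * g x)}.
Proof.
apply/subspace_continuousP => x Ax.
move/subspace_continuousP : cf => /(_ x Ax) cfx.
move/subspace_continuousP : cg => /(_ x Ax) cgx.
exact: cvgM cfx cgx.
Qed.

End WithinContinuity.

(** * Time cut-offs and the weak Gronwall lemma *)

Section TimeBump.
Variable R : realType.
Implicit Types (T : R) (th : R -> R).

(** The support is compact in the open interval: no initial value appears in the tested equations,
    and only what is known for [0 < t < T] is used. *)
Definition time_bump T th := [/\ forall t, derivable th t 1,
  continuous (derive1 th), forall t, 0 <= th t &
  exists a c, [/\ 0 < a, c < T & forall t, ~~ (a <= t <= c) -> th t = 0]].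

Lemma time_bump_out T th : time_bump T th -> forall t, ~~ (0 < t < T) -> th t = 0.
Proof.
move=> [_ _ _ [a [c [a0 cT H]]]] t tT; apply: H; apply: contra tT.
by move=> /andP[at_ tc]; rewrite (lt_le_trans a0 at_) (le_lt_trans tc cT).
Qed.

Lemma time_bump_derive_out T th : time_bump T th ->
  forall t, ~~ (0 < t < T) -> derive1 th t = 0.
Proof.
move=> [_ _ _ [a [c [a0 cT H]]]] t tT; rewrite derive1E.
have : \forall s \near t, th s = (fun=> 0) s.
  have : t < a \/ c < t.
    case: (ltP t a) => [|at_]; first by left.
    right; rewrite ltNge; apply: contra tT => tc.
    by rewrite (lt_le_trans a0 at_) (le_lt_trans tc cT).
  case=> [ta|ct].
    near=> s; apply: H; apply/negP => /andP[as_ _].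
    suff : s < a by rewrite ltNge as_.
    by near: s; exact: lt_nbhsl.
  near=> s; apply: H; apply/negP => /andP[_ sc].
  suff : c < s by rewrite ltNge sc.
  by near: s; exact: lt_nbhsr.
by move=> H0; rewrite (@near_eq_derive _ _ _ th (cst 0) t 1 H0) derive_cst.
Unshelve. all: by end_near. Qed.

Lemma derivable_continuous th : (forall t, derivable th t 1) -> continuous th.
Proof. by move=> dth t; apply: differentiable_continuous; exact/derivable1_diffP. Qed.

Lemma time_bump_bounded T th : time_bump T th ->
  exists2 M, 0 < M & forall t, `|th t| <= M /\ `|derive1 th t| <= M.
Proof.
move=> bth; have [dth cdth _ _] := bth.
have cth := derivable_continuous dth.
have cK := @segment_compact R 0 T.
have [M1 M10 H1] := compact_continuous_bounded cK (fun z _ => cth z).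
have [M2 M20 H2] := compact_continuous_bounded cK (fun z _ => cdth z).
exists (M1 + M2); first exact: addr_gt0.
move=> t; have [tT|tT] := boolP (0 < t < T).
  have tT' : `[0, T]%classic t by case/andP: tT => ? ?; rewrite /= in_itv/= !ltW.
  split; first by rewrite (le_trans (H1 t tT'))// lerDl ltW.
  by rewrite (le_trans (H2 t tT'))// lerDr ltW.
rewrite (time_bump_out bth tT) (time_bump_derive_out bth tT) normr0.
by split; rewrite addr_ge0// ltW.
Qed.

Lemma Rintegral_halfline T (f : R -> R) : (forall t, ~~ (0 < t < T) -> f t = 0) ->
  \int[@lebesgue_measure R]_(t in halfline) f t =
  \int[@lebesgue_measure R]_(t in `]0, T[) f t.
Proof.
move=> f0; rewrite Rintegral_mkcond [RHS]Rintegral_mkcond.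
congr (Rintegral _ _ _); apply/funext => t; rewrite !patchE.
have [tT|tT] := boolP (0 < t < T).
  rewrite !mem_set//= /halfline /= ?in_itv//= ?andbT.
  by case/andP: tT => /ltW.
by rewrite f0//; do 2 case: ifP => // _.
Qed.

Lemma Rintegral_derive_bump T th : 0 < T -> (forall t, derivable th t 1) ->
  continuous (derive1 th) -> th 0 = 0 -> th T = 0 ->
  \int[@lebesgue_measure R]_(t in `]0, T[) derive1 th t = 0.
Proof.
move=> T0 dth cdth th0 thT.
rewrite Rintegral_oo_cc; last exact: integrable_continuous_segment.
by rewrite Rintegral_derive1// th0 thT subrr.
Qed.

Lemma integrable_within_oo T (f : R -> R) : {within `[0, T]%classic, continuous f} ->
  (@lebesgue_measure R).-integrable `]0, T[ (EFin \o f).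
Proof.
move=> cf.
have H : (@lebesgue_measure R).-integrable `[0, T] (EFin \o f).
  by apply: continuous_compact_integrable => //; exact: segment_compact.
by apply: (integrableS _ _ _ H) => //; exact: subset_itv_oo_cc.
Qed.

Lemma integrable_continuous_oo T (f : R -> R) : continuous f ->
  (@lebesgue_measure R).-integrable `]0, T[ (EFin \o f).
Proof. by move=> cf; apply: integrable_within_oo; exact: continuous_subspaceT. Qed.

Lemma derive1_mul (f g : R -> R) t : derivable f t 1 -> derivable g t 1 ->
  derive1 (fun s => f s * g s) t = f t * derive1 g t + derive1 f t * g t.
Proof.
move=> df dg; rewrite !derive1E; apply: (etrans (deriveM df dg)).
by rewrite ['D_1 f t * g t]mulrC.
Qed.

(** This makes the cut-offs admissible in [dissipative]. It is the classical integration by parts,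
    free of boundary terms because [th] vanishes at 0 and at [T]. *)
Lemma time_bump_W1inf T th : 0 < T -> time_bump T th -> W1inf th (derive1 th).
Proof.
move=> T0 bth; have [dth cdth _ _] := bth.
have cth := derivable_continuous dth.
have [M M0 HM] := time_bump_bounded bth.
split.
- exact: continuous_subspaceT.
- by apply: measurable_funTS; exact: continuous_measurable_fun.
- by exists M; split => [t _|]; [case: (HM t)|apply: aeW => t _; case: (HM t)].
move=> chi dchi cdchi _.
have cchi := derivable_continuous dchi.
have mI : measurable (`]0, T[%classic : set R) by exact: measurable_itv.
rewrite (@Rintegral_halfline T); last by move=> t /(time_bump_out bth) ->; rewrite mul0r.
rewrite (@Rintegral_halfline T); last by move=> t /(time_bump_derive_out bth) ->; rewrite mul0r.
apply/eqP; rewrite -addr_eq0 -RintegralD//; last 2 first.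
- by apply: integrable_continuous_oo => t; apply: continuousM; [exact: cth|exact: cdchi].
- by apply: integrable_continuous_oo => t; apply: continuousM; [exact: cdth|exact: cchi].
have E t : th t * derive1 chi t + derive1 th t * chi t = derive1 (fun s => th s * chi s) t.
  by rewrite derive1_mul.
have -> : \int[@lebesgue_measure R]_(t in `]0, T[)
    (th t * derive1 chi t + derive1 th t * chi t) =
   \int[@lebesgue_measure R]_(t in `]0, T[) derive1 (fun s => th s * chi s) t.
  by apply: eq_Rintegral => t _.
apply/eqP; apply: (@Rintegral_derive_bump T (fun s => th s * chi s) T0).
- by move=> t; apply: derivableM.
- have -> : derive1 (fun s => th s * chi s) =
      (fun t => th t * derive1 chi t + derive1 th t * chi t).
    by apply/funext => t; rewrite E.
  move=> t; apply: cvgD; apply: cvgM.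
  + exact: cth.
  + exact: cdchi.
  + exact: cdth.
  + exact: cchi.
- by rewrite (time_bump_out bth) ?mul0r// ltxx.
- by rewrite (time_bump_out bth) ?mul0r// ltxx andbF.
Qed.

End TimeBump.

(** * A continuously differentiable step function *)

Section SmoothStep.
Variable R : realType.

(** C^1 and zero on a half-line: second differences of it give the step function, products of it the
    bump functions of the fundamental lemma. *)
Definition pos2 (y : R) : R := Num.max y 0 ^+ 2.

Lemma is_derive_pos2 (y : R) : is_derive y 1 pos2 (2 * Num.max y 0).
Proof.
case: (ltrgtP y 0) => [y0|y0|->].
- rewrite mulr0.
  have D : is_derive y 1 (cst 0 : R -> R) 0 by exact: is_derive_cst.
  apply: near_eq_is_derive D.
  near=> z; rewrite /pos2 max_r ?expr0n//; apply/ltW; near: z; exact: lt_nbhsl.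
- have D : is_derive y 1 (fun z : R => z ^+ 2) (2 * y).
    have -> : (fun z : R => z ^+ 2) = (id : R -> R) * id.
      by apply/funext => z; rewrite expr2.
    by apply: is_derive_eq; rewrite /GRing.scale/= mulr1 mulr_natl.
  apply: near_eq_is_derive D.
  near=> z; rewrite /pos2 max_l//; apply/ltW; near: z; exact: lt_nbhsr.
- rewrite mulr0.
  have H : h^-1 *: (pos2 (h *: 1 + 0) - pos2 0) @[h --> (0 : R)^'] --> (0 : R).
    apply/cvgr0Pnorm_le => e e0; near=> h.
    rewrite /pos2 maxxx expr0n subr0 addr0 /GRing.scale/= mulr1 normrM normrX.
    have hh : `|Num.max h 0| <= `|h|.
      by case: (leP h 0) => _; rewrite ?normr0.
    have h0 : 0 < `|h| by rewrite normr_gt0; near: h; exact: nbhs_dnbhs_neq.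
    apply: (@le_trans _ _ `|h|).
      rewrite normrV ?unitfE -?normr_gt0// ler_pdivrMl//.
      by rewrite -expr2 lerXn2r ?nnegrE.
    near: h; apply: dnbhs0_le; exact: e0.
  by apply: DeriveDef; [apply/cvg_ex; exists 0; exact: H|exact/cvg_lim].
Unshelve. all: by end_near. Qed.

(** The second difference of [pos2] with mesh 1/2 is constantly 1/2 beyond 1, whence the factor 2.
    The derivative [tent] is the hat function over the unit interval, of integral one. *)
Definition step (y : R) : R := 2 * (pos2 y - 2 * pos2 (y - 2^-1) + pos2 (y - 1)).
Definition tent (y : R) : R :=
  4 * (Num.max y 0 - 2 * Num.max (y - 2^-1) 0 + Num.max (y - 1) 0).

Lemma is_derive_pos2_affine (a d y : R) :
  is_derive y 1 (fun z => pos2 (d * z + a)) (d * (2 * Num.max (d * y + a) 0)).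
Proof.
have H : is_derive y 1 (fun z => d * z + a) d.
  by apply: is_derive_eq; rewrite /GRing.scale/= ?(mulr1, mulr0, addr0, add0r).
have D := @is_derive1_comp R pos2 (fun z => d * z + a) y _ _ (is_derive_pos2 (d * y + a)) H.
by apply: is_derive_eq D _; rewrite mulrC.
Qed.

Lemma is_derive_step_affine (a d y : R) :
  is_derive y 1 (fun z => step (d * z + a)) (d * tent (d * y + a)).
Proof.
have H1 := is_derive_pos2_affine a d y.
have H2 := is_derive_pos2_affine (a - 2^-1) d y.
have H3 := is_derive_pos2_affine (a - 1) d y.
have E : (fun z => step (d * z + a)) = (fun z => 2 * (pos2 (d * z + a) -
   2 * pos2 (d * z + (a - 2^-1)) + pos2 (d * z + (a - 1)))).
  by apply/funext => z; rewrite /step !addrA.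
rewrite E; apply: is_derive_eq; rewrite /GRing.scale/= /tent !addrA; ring.
Qed.

Lemma continuous_tent : continuous tent.
Proof.
have cm (a : R) : continuous (fun y : R => Num.max (y + a) 0).
    move=> y; apply: (@continuous_max _ _ (fun y : R => y + a) (cst (0 : R))).
    by apply: cvgD; [exact: cvg_id|exact: cvg_cst].
  exact: cvg_cst.
move=> y; apply: cvgMr; apply: cvgD; last exact: cm.
apply: cvgB; last by apply: cvgMr; exact: cm.
have E : (fun y : R => Num.max (y + 0) 0) = (fun y => Num.max y 0).
  by apply/funext => z; rewrite addr0.
by have := cm 0; rewrite E; apply.
Qed.

Lemma tent_ge0 y : 0 <= tent y.
Proof.
by rewrite /tent; case: (leP y 0) => ?; case: (leP (y - 2^-1) 0) => ?;
  case: (leP (y - 1) 0) => ?; lra.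
Qed.

Lemma tent_out y : ~~ (0 <= y <= 1) -> tent y = 0.
Proof.
rewrite negb_and -!ltNge /tent.
by case: (leP y 0) => ?; case: (leP (y - 2^-1) 0) => ?;
  case: (leP (y - 1) 0) => ? /orP[] ?; lra.
Qed.

Lemma step_le0 y : y <= 0 -> step y = 0.
Proof.
move=> y0; rewrite /step /pos2 !max_r ?expr0n/= ?subr0 ?mulr0 ?addr0 ?mulr0//; lra.
Qed.

Lemma step_ge1 y : 1 <= y -> step y = 1.
Proof.
by move=> y1; rewrite /step /pos2 !max_l; lra.
Qed.

Lemma step_01 y : 0 <= step y <= 1.
Proof.
case: (leP y 0) => [/step_le0 ->|y0]; first by rewrite lexx ler01.
case: (leP 1 y) => [/step_ge1 ->|y1]; first by rewrite lexx ler01.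
rewrite /step /pos2 (max_l (ltW y0)) [Num.max (y - 1) 0]max_r; last lra.
case: (leP (y - 2^-1) 0) => ?; rewrite !expr2; apply/andP; split; nra.
Qed.

End SmoothStep.

(** * Gronwall's lemma for inequalities in the weak sense *)

Section Gronwall.
Variables (R : realType) (T : R).
Hypothesis T0 : 0 < T.
Local Notation mu := (@lebesgue_measure R).

Let mI : measurable (`]0, T[%classic : set R). Proof. exact: measurable_itv. Qed.

Lemma within_continuous_near (F : R -> R) (s m : R) (b : bool) :
  {within `[0, T]%classic, continuous F} -> 0 <= s <= T ->
  (if b then F s < m else m < F s) ->
  exists2 d, 0 < d & forall y, 0 <= y <= T -> `|s - y| < d ->
    if b then F y < m else m < F y.
Proof.
move=> /subspace_continuousP cF sT Fs.
have := cF s; rewrite /= in_itv/= => /(_ sT) cs.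
have : \forall y \near within `[0, T]%classic (nbhs s), if b then F y < m else m < F y.
  case: b Fs => Fs; first exact: (cvgr_lt _ cs).
  exact: (cvgr_gt _ cs).
rewrite /within/= => /nbhs_ballP[d /= d0 Hd]; exists d => // y yT yd.
by apply: Hd; rewrite -?ball_normE//= in_itv.
Qed.

(* Test against an increasing step just after [s] minus one just before [t]. *)
Lemma weak_nonincreasing (F : R -> R) : {within `[0, T]%classic, continuous F} ->
  (forall chi, time_bump T chi -> 0 <= \int[mu]_(t in `]0, T[) (derive1 chi t * F t)) ->
  forall s t, 0 <= s -> s <= t -> t <= T -> F t <= F s.
Proof.
move=> cF HF s t s0 st tT; rewrite leNgt; apply/negP => Fst.
have {}st : s < t.
  by rewrite lt_neqAle st andbT; apply/eqP => E; rewrite E ltxx in Fst.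
pose m1 := F s + (F t - F s) / 3; pose m2 := F t - (F t - F s) / 3.
have m12 : m1 < m2 by rewrite /m1 /m2; lra.
have Fs : F s < m1 by rewrite /m1; lra.
have Ft : m2 < F t by rewrite /m2; lra.
have [|d1 d10 H1] := @within_continuous_near F s m1 true cF _ Fs.
  by rewrite s0 (le_trans (ltW st)).
have [|d2 d20 H2] := @within_continuous_near F t m2 false cF _ Ft.
  by rewrite tT (le_trans s0 (ltW st)).
(* The two ramps of [chi] occupy [[s + d, s + 2 d]] and [[t - 2 d, t - d]]. The first bound on [d]
   keeps them apart, the others keep them where [F] is below [m1] and above [m2] respectively. *)
pose d := Num.min ((t - s) / 8) (Num.min (d1 / 8) (d2 / 8)).
have d0 : 0 < d by rewrite !lt_min !divr_gt0// subr_gt0.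
have dts : d <= (t - s) / 8 by rewrite ge_min lexx.
have dd1 : d <= d1 / 8 by rewrite !ge_min lexx orbT.
have dd2 : d <= d2 / 8 by rewrite !ge_min lexx !orbT.
pose f1 (y : R) : R := d^-1 * y + - (d^-1 * (s + d)).
pose f2 (y : R) : R := d^-1 * y + - (d^-1 * (t - 2 * d)).
have f1E (y : R) : f1 y = (y - (s + d)) / d by rewrite /f1 -mulrBr mulrC.
have f2E (y : R) : f2 y = (y - (t - 2 * d)) / d by rewrite /f2 -mulrBr mulrC.
pose chi (y : R) : R := step (f1 y) - step (f2 y).
have D1 (y : R) : is_derive y 1 (fun y : R => step (f1 y)) (d^-1 * tent (f1 y)).
  exact: is_derive_step_affine.
have D2 (y : R) : is_derive y 1 (fun y : R => step (f2 y)) (d^-1 * tent (f2 y)).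
  exact: is_derive_step_affine.
have Dchi (y : R) : is_derive y 1 chi (d^-1 * tent (f1 y) - d^-1 * tent (f2 y)).
  by apply: is_deriveB.
have chi' (y : R) : derive1 chi y = d^-1 * tent (f1 y) - d^-1 * tent (f2 y).
  by rewrite derive1E derive_val.
have caff (e a : R) : continuous (fun y : R => e * tent (e * y + a)).
  move=> y; apply: cvgMr; apply: (@continuous_comp _ _ _ (fun y : R => e * y + a) (@tent R)); last exact: continuous_tent.
  by apply: cvgD; [apply: cvgMr; exact: cvg_id|exact: cvg_cst].
have cchi : continuous (derive1 chi).
  have -> : derive1 chi = (fun y => d^-1 * tent (f1 y) - d^-1 * tent (f2 y)).
    by apply/funext.
  by move=> y; apply: cvgB; exact: caff.
have bchi : time_bump T chi.
  split; [by move=> y; case: (Dchi y)|exact: cchi| |].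
  - move=> y; rewrite subr_ge0.
    have /andP[p1 q1] := step_01 (f1 y); have /andP[p2 q2] := step_01 (f2 y).
    case: (leP y (t - 2 * d)) => yt.
      by rewrite (@step_le0 _ (f2 y)) // f2E pmulr_lle0 ?invr_gt0// subr_le0.
    rewrite (@step_ge1 _ (f1 y)) // f1E ler_pdivlMr// mul1r; lra.
  - exists (s + d), (t - d); split; [clear - s0 d0; lra|clear - tT d0; lra|move=> y].
    rewrite negb_and -!ltNge => /orP[ys|yt]; rewrite /chi.
      rewrite !step_le0 ?subrr//.
        by rewrite f2E pmulr_lle0 ?invr_gt0// subr_le0; lra.
      by rewrite f1E pmulr_lle0 ?invr_gt0// subr_le0 ltW.
    rewrite !step_ge1 ?subrr//.
      by rewrite f2E ler_pdivlMr// mul1r; lra.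
    by rewrite f1E ler_pdivlMr// mul1r; lra.
have := HF _ bchi; apply/negP; rewrite -ltNge.
have i1 : mu.-integrable `]0, T[ (EFin \o (fun y => d^-1 * tent (f1 y))).
  by apply: integrable_continuous_oo; exact: caff.
have i2 : mu.-integrable `]0, T[ (EFin \o (fun y => d^-1 * tent (f2 y))).
  by apply: integrable_continuous_oo; exact: caff.
have int1 (f : R -> R) (a : R) : (forall y : R, is_derive y 1 (fun y : R => step (f y)) (d^-1 * tent (f y))) ->
   (forall y, f y = (y - a) / d) -> 0 <= a -> a + d <= T ->
   \int[mu]_(y in `]0, T[) (d^-1 * tent (f y)) = 1.
  move=> Df fE a0 aT.
  have dE : derive1 (fun y : R => step (f y)) = (fun y => d^-1 * tent (f y)).
    by apply/funext => y; rewrite derive1E derive_val.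
  have cE : continuous (derive1 (fun y : R => step (f y))).
    rewrite dE; have -> : f = (fun y => d^-1 * y + (- (d^-1 * a))).
      by apply/funext => y; rewrite fE; field; rewrite gt_eqF.
    exact: caff.
  rewrite -dE Rintegral_oo_cc; last exact: integrable_continuous_segment.
  have df y : derivable (fun y : R => step (f y)) y 1 by case: (Df y).
  rewrite (Rintegral_derive1 T0 df cE).
  rewrite step_ge1 ?step_le0 ?subr0//.
    by rewrite fE sub0r pmulr_lle0 ?invr_gt0// oppr_le0.
  by rewrite fE ler_pdivlMr// mul1r; clear - aT; lra.
(* The derivative of [chi] is a unit mass near [s] minus a unit mass near [t], so the tested
   integral is at most [m1 - m2], which is negative. *)
apply: (@le_lt_trans _ _ (\int[mu]_(y in `]0, T[)
    (m1 * (d^-1 * tent (f1 y)) - m2 * (d^-1 * tent (f2 y))))); last first.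
  rewrite RintegralB//; last 2 first.
  - by apply: integrable_continuous_oo => y; apply: cvgMr; exact: caff.
  - by apply: integrable_continuous_oo => y; apply: cvgMr; exact: caff.
  have J1 : \int[mu]_(y in `]0, T[) (m1 * (d^-1 * tent (f1 y))) = m1.
    rewrite RintegralZl//.
    by rewrite (int1 f1 (s + d) D1 f1E) ?mulr1//; clear - s0 st tT d0 dts; lra.
  have J2 : \int[mu]_(y in `]0, T[) (m2 * (d^-1 * tent (f2 y))) = m2.
    rewrite RintegralZl//.
    by rewrite (int1 f2 (t - 2 * d) D2 f2E) ?mulr1//; clear - s0 st tT d0 dts; lra.
  by rewrite J1 J2 subr_lt0.
apply: le_Rintegral => //.
- apply: integrable_within_oo; apply: within_continuousM; last exact: cF.
  exact: continuous_subspaceT.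
- by apply: integrable_continuous_oo => y; apply: cvgB; apply: cvgMr; exact: caff.
move=> y; rewrite /= in_itv/= => /andP[y0 yT].
have yT' : 0 <= y <= T by rewrite !ltW.
rewrite chi' mulrBl; apply: lerB.
  have [f01|/tent_out ->] := boolP (0 <= f1 y <= 1); last by rewrite !mulr0 mul0r.
  rewrite [leRHS]mulrC; apply: ler_wpM2l.
    by rewrite mulr_ge0 ?tent_ge0// invr_ge0 ltW.
  have := H1 y yT'; rewrite /= => H; apply/ltW/H.
  move: f01; rewrite f1E ler_pdivlMr// mul0r ler_pdivrMr// mul1r => /andP[u v].
  by rewrite ltr_norml; clear - u v d0 dd1; apply/andP; split; lra.
have [f01|/tent_out ->] := boolP (0 <= f2 y <= 1); last by rewrite !mulr0 mul0r.
rewrite [leLHS]mulrC; apply: ler_wpM2l.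
  by rewrite mulr_ge0 ?tent_ge0// invr_ge0 ltW.
have := H2 y yT'; rewrite /= => H; apply/ltW/H.
move: f01; rewrite f2E ler_pdivlMr// mul0r ler_pdivrMr// mul1r => /andP[u v].
by rewrite ltr_norml; clear - u v d0 dd2; apply/andP; split; lra.
Qed.

Let arith (a c d e f : R) :
  f + e = 0 -> d <= f -> - (a - c) <= c + d -> 0 <= a - e.
Proof. by move=> H1 H2 H3; lra. Qed.

(** Cut-offs multiplied by the integrating factor [expR (- A t)] are again cut-offs, and testing
    with them shows that [E t * expR (- A t) - B * t] is nonincreasing in the weak sense; in the
    term with [B] the factor is bounded by 1. *)
Lemma weak_gronwall (E : R -> R) (A B : R) : 0 <= A -> 0 <= B ->
  {within `[0, T]%classic, continuous E} ->
  (forall th, time_bump T th ->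
    - (\int[mu]_(t in `]0, T[) (derive1 th t * E t)) <=
      \int[mu]_(t in `]0, T[) (th t * (A * E t + B))) ->
  forall t, 0 <= t <= T -> E t <= (E 0 + B * t) * expR (A * t).
Proof.
move=> A0 B0 cE H t /andP[t0 tT].
pose g (t : R) : R := expR (- A * t).
have Dg (y : R) : is_derive y 1 g (- A * g y).
  have D : is_derive y 1 (fun y : R => - A * y) (- A).
    by apply: is_derive_eq; rewrite /GRing.scale/= ?(mulr1, mulr0, addr0, add0r).
  have D2 := @is_derive1_comp R expR (fun z => - A * z) y _ _ (is_derive_expR (- A * y)) D.
  by apply: is_derive_eq D2 _; rewrite mulrC.
have dg (y : R) : derivable g y 1 by [].
have g' y : derive1 g y = - A * g y by rewrite derive1E derive_val.
have cg : continuous g by exact: derivable_continuous.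
pose F (t : R) : R := E t * g t - B * t.
have cF : {within `[0, T]%classic, continuous F}.
  apply: within_continuousB; first apply: within_continuousM => //.
    exact: continuous_subspaceT.
  by apply: continuous_subspaceT => z; apply: cvgMr; exact: cvg_id.
suff : F t <= F 0.
  rewrite /F mulr0 subr0 {2}/g mulr0 expR0 mulr1 lerBlDr.
  by rewrite /g mulNr expRN ler_pdivrMr// expR_gt0.
apply: (weak_nonincreasing cF) => // chi bchi.
have [dchi cdchi chi0 [a [c [a0 cT Hc]]]] := bchi.
have cchi := derivable_continuous dchi.
pose th (t : R) : R := chi t * g t.
have th' y : derive1 th y = chi y * (- A * g y) + derive1 chi y * g y.
  by rewrite /th derive1_mul// g'.
have bth : time_bump T th.
  split.
  - by move=> y; apply: derivableM.
  - have -> : derive1 th = (fun y => chi y * (- A * g y) + derive1 chi y * g y).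
      exact/funext.
    move=> y; apply: cvgD; apply: cvgM.
    + exact: cchi.
    + by apply: cvgMr; exact: cg.
    + exact: cdchi.
    + exact: cg.
  - by move=> y; rewrite mulr_ge0// expR_ge0.
  - by exists a, c; split => // y /Hc; rewrite /th => ->; rewrite mul0r.
have := H _ bth.
have W (f : R -> R) : continuous f -> {within `[0, T]%classic, continuous f}.
  exact: continuous_subspaceT.
have i1 : mu.-integrable `]0, T[ (EFin \o (fun y => derive1 chi y * (E y * g y))).
  apply: integrable_within_oo; apply: within_continuousM; first exact: (W _ cdchi).
  by apply: within_continuousM; [exact: cE|exact: (W _ cg)].
have i2 : mu.-integrable `]0, T[ (EFin \o (fun y => A * (chi y * g y * E y))).
  apply: integrable_within_oo; apply: within_continuousM.
    by apply: W; exact: cst_continuous.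
  apply: within_continuousM; last exact: cE.
  by apply: W => z; apply: cvgM; [exact: cchi|exact: cg].
have i3 : mu.-integrable `]0, T[ (EFin \o (fun y => B * chi y)).
  by apply: integrable_continuous_oo => y; apply: cvgMr; exact: cchi.
have i4 : mu.-integrable `]0, T[ (EFin \o (fun y => B * (y * derive1 chi y))).
  apply: integrable_continuous_oo => y; apply: cvgMr; apply: cvgM; first exact: cvg_id.
  exact: cdchi.
have i5 : mu.-integrable `]0, T[ (EFin \o (fun y => B * (chi y * g y))).
  apply: integrable_continuous_oo => y; apply: cvgMr; apply: cvgM; first exact: cchi.
  exact: cg.
have -> : \int[mu]_(t in `]0, T[) (derive1 th t * E t) =
  \int[mu]_(y in `]0, T[) (derive1 chi y * (E y * g y)) -
  \int[mu]_(y in `]0, T[) (A * (chi y * g y * E y)).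
  rewrite -RintegralB//; apply: eq_Rintegral => y _; rewrite th'; ring.
have -> : \int[mu]_(t in `]0, T[) (th t * (A * E t + B)) =
  \int[mu]_(y in `]0, T[) (A * (chi y * g y * E y)) +
  \int[mu]_(y in `]0, T[) (B * (chi y * g y)).
  rewrite -RintegralD//; apply: eq_Rintegral => y _; rewrite /th; ring.
have -> : \int[mu]_(t in `]0, T[) (derive1 chi t * F t) =
  \int[mu]_(y in `]0, T[) (derive1 chi y * (E y * g y)) -
  \int[mu]_(y in `]0, T[) (B * (y * derive1 chi y)).
  rewrite -RintegralB//; apply: eq_Rintegral => y _; rewrite /F; ring.
have I : \int[mu]_(y in `]0, T[) (B * chi y) +
    \int[mu]_(y in `]0, T[) (B * (y * derive1 chi y)) = 0.
  have D y : derivable (fun z : R => z * chi z) y 1.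
    by apply: derivableM => //; exact: derivable_id.
  have D' y : derive1 (fun z : R => z * chi z) y = y * derive1 chi y + chi y.
    by rewrite derive1_mul ?derive1_id ?mul1r//; exact: derivable_id.
  have E0 : \int[mu]_(y in `]0, T[) derive1 (fun z : R => z * chi z) y = 0.
    apply: (@Rintegral_derive_bump R T (fun z => z * chi z) T0 D).
    - have -> : derive1 (fun z => z * chi z) = (fun y => y * derive1 chi y + chi y).
        exact/funext.
      move=> y; apply: cvgD; last exact: cchi.
      by apply: cvgM; [exact: cvg_id|exact: cdchi].
    - by rewrite mul0r.
    - by rewrite (time_bump_out bchi) ?mulr0// ltxx andbF.
  rewrite -RintegralD//.
  transitivity (\int[mu]_(y in `]0, T[) (B * derive1 (fun z : R => z * chi z) y)).
    by apply: eq_Rintegral => y _; rewrite D'; ring.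
  rewrite RintegralZl ?E0 ?mulr0//; apply: integrable_continuous_oo.
  have -> : derive1 (fun z => z * chi z) = (fun y => y * derive1 chi y + chi y).
    exact/funext.
  by move=> y; apply: cvgD; last exact: cchi; apply: cvgM; [exact: cvg_id|exact: cdchi].
have I2 : \int[mu]_(y in `]0, T[) (B * (chi y * g y)) <= \int[mu]_(y in `]0, T[) (B * chi y).
  apply: le_Rintegral => // y; rewrite /= in_itv/= => /andP[y0 _].
  apply: ler_wpM2l => //; rewrite ler_piMr// /g -expR0 ler_expR mulNr oppr_le0.
  by rewrite mulr_ge0// ltW.
exact: arith I I2.
Qed.

End Gronwall.

(** * The pointwise algebra *)

Section VectorAlgebra.
Variable R : realType.
Implicit Types (a b u v : 'cV[R]_3) (A B : 'M[R]_3).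

Lemma sum3 (f : 'I_3 -> R) :
  \sum_k f k = f 0 + f 1 + f 2.
Proof.
by rewrite !big_ord_recl big_ord0 addr0 addrA; congr (_ + f _ + f _); exact/val_inj.
Qed.

Lemma dot3 a b : dot a b = a 0 0 * b 0 0 + a 1 0 * b 1 0 + a 2 0 * b 2 0.
Proof. by rewrite /dot sum3. Qed.

Lemma mulmx3 A b k : (A *m b) k 0 = A k 0 * b 0 0 + A k 1 * b 1 0 + A k 2 * b 2 0.
Proof. by rewrite !mxE sum3. Qed.

Lemma frob3 A B : frob A B =
  (A 0 0 * B 0 0 + A 0 1 * B 0 1 + A 0 2 * B 0 2) +
  (A 1 0 * B 1 0 + A 1 1 * B 1 1 + A 1 2 * B 1 2) +
  (A 2 0 * B 2 0 + A 2 1 * B 2 1 + A 2 2 * B 2 2).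
Proof. by rewrite /frob !sum3. Qed.

Lemma trmx3 A : \tr A = A 0 0 + A 1 1 + A 2 2.
Proof. by rewrite /mxtrace sum3. Qed.

Lemma tensorE a b k l : tensor a b k l = a k 0 * b l 0.
Proof. by rewrite /tensor !mxE big_ord1 !mxE. Qed.

Definition vecE := (dot3, frob3, mulmx3, tensorE, trmx3, mxE).

(** The terms linear in [u] recombine into the acceleration of [U] seen by [u - U]; the transport
    leaves one term quadratic in the difference. *)
Lemma inertial_identity (r : R) u U Ut (G : 'M[R]_3) :
  - (r * (dot u Ut + dot u (G *m u))) + r * dot U Ut + r * dot u (G^T *m U) =
  - (r * dot (u - U) (Ut + G *m U)) - r * dot (u - U) (G *m (u - U)).
Proof. by rewrite !vecE; ring. Qed.

Lemma drift_inertial_identity (r : R) u v U V Vt (W : 'M[R]_3) :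
  - (r * (dot v Vt + dot v (W *m u))) + r * dot V Vt + r * dot u (W^T *m V) =
  - (r * dot (v - V) (Vt + W *m U)) - r * dot (v - V) (W *m (u - U)).
Proof. by rewrite !vecE; ring. Qed.

(** The mass equation eliminates the time derivative of the density, and what survives is the second
    order Taylor remainder of the pressure times the divergence. *)
Lemma pressure_identity (r rb P Pb p' rbt d : R) u U (Gr : 'cV[R]_3) :
  rb != 0 -> rbt + dot Gr U + rb * d = 0 ->
  - (P * d) - (r / rb) * (p' * rbt) - (r / rb) * dot u (p' *: Gr) + p' * rbt
  + dot (p' *: Gr) U + Pb * d + (r / rb) * dot (u - U) (p' *: Gr) =
  - ((P - Pb - p' * (r - rb)) * d).
Proof.
move=> rb0 mass; have -> : rbt = - dot Gr U - rb * d by rewrite -[RHS]addr0 -mass; ring.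
by rewrite !vecE; field.
Qed.

(** All terms containing [W] cancel, and this uses its symmetry: it matters that the drift velocity
    is curl-free. The factor [m - r * mb / rb] is of first order in the difference of the densities,
    so every term on the right is quadratic. *)
Lemma capillary_identity (r rb m mb c d e : R) u v U V K H (G W : 'M[R]_3) :
  rb != 0 -> W^T = W ->
  - (r / rb) * dot (u - U) ((1 + c) * mb *: K + rb *: (W *m V) + c * rb * e *: V)
  + (r / rb) * dot (v - V) ((1 + c) * mb *: H + rb *: (G^T *m V) + c * rb * d *: V)
  - r * dot (v - V) (W *m (u - U))
  - (m * dot v H + r * dot v (G *m v) + c * r * dot v v * d + c * m * dot v H)
  + (m * dot u K + r * dot v (W *m u) + c * r * dot v u * e + c * m * dot u K)
  - (m * ((1 + c) * (dot U K - dot V H))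
     + r * dot v (W *m U - G *m V + c *: (e *: U - d *: V))) =
  (1 + c) * (m - r * mb / rb) * (dot (u - U) K - dot (v - V) H)
  - r * dot (v - V) (G *m (v - V))
  + c * r * (dot (v - V) (u - U) * e - sqnorm (v - V) * d).
Proof.
move=> rb0 WT.
have W01 : W 1 0 = W 0 1 by rewrite -{1}WT mxE.
have W02 : W 2 0 = W 0 2 by rewrite -{1}WT mxE.
have W12 : W 2 1 = W 1 2 by rewrite -{1}WT mxE.
by rewrite /sqnorm !vecE W01 W02 W12; field.
Qed.

Lemma viscous_identity (r rb m mb c d : R) u v U V LD H (S : 'M[R]_3) :
  rb != 0 -> S^T = S ->
  - (r / rb) * dot (u - U) (2 *: (mb *: LD + rb *: (S *m V)) + (2 * c) *: (mb *: H + rb * d *: V))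
  + 2 * m * dot (u - U) LD + 2 * c * m * dot (u - U) H
  + r * dot v (2 *: (S *m (u - U)) + 2 * c * d *: (u - U)) =
  dot (u - U) (2 * (m - r * mb / rb) *: LD + 2 * r *: (S *m (v - V))
   + 2 * c * (m - r * mb / rb) *: H + 2 * c * r * d *: (v - V)).
Proof.
move=> rb0 ST.
have S01 : S 1 0 = S 0 1 by rewrite -{1}ST mxE.
have S02 : S 2 0 = S 0 2 by rewrite -{1}ST mxE.
have S12 : S 2 1 = S 1 2 by rewrite -{1}ST mxE.
by rewrite !vecE S01 S02 S12; field.
Qed.

(* The letters stand for: P = p(rho), Pb = p(rhob), Ut = dt ub, Vt = dt vb, rbt = dt rhob,
   Gr = grad rhob, d = div ub, e = div vb, G = grad ub, W = grad vb, S = D(ub),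
   K = grad div vb, H = grad div ub, LD = div D(ub), c = (s + 1) / 2, so that
   lam = 2 c mu; SS, DD, KK and Rb are the fields of (E). *)
Lemma density_identity (r rb m mb P Pb p' rbt c nu d e : R)
    u v U Ut V Vt K H LD SS DD KK Gr Rb (G W S : 'M[R]_3) :
  rb != 0 -> W^T = W -> S^T = S ->
  rbt + dot Gr U + rb * d = 0 ->
  rb *: (Ut + G *m U) = nu *: DD + SS - p' *: Gr + Rb ->
  rb *: (Vt + W *m U) = - KK ->
  SS = (1 + c) * mb *: K + rb *: (W *m V) + c * rb * e *: V ->
  DD = 2 *: (mb *: LD + rb *: (S *m V)) + (2 * c) *: (mb *: H + rb * d *: V) ->
  KK = (1 + c) * mb *: H + rb *: (G^T *m V) + c * rb * d *: V ->
  (m * dot u K + r * dot v (W *m u) + c * r * dot v u * e + c * m * dot u K)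
  - (r * dot u Ut + r * dot u (G *m u) + P * d + m * dot v H + r * dot v (G *m v)
     + c * r * dot v v * d + c * m * dot v H)
  - (r * dot v Vt + r * dot v (W *m u))
  + (r * (dot U Ut + dot V Vt - p' / rb * rbt)
     + r * dot u (G^T *m U + W^T *m V - p' / rb *: Gr))
  + p' * rbt
  - (m * ((1 + c) * (dot U K - dot V H))
     + r * dot v (W *m U - G *m V + c *: (e *: U - d *: V)))
  + (dot (p' *: Gr) U + Pb * d)
  + nu * (2 * m * dot (u - U) LD + 2 * c * m * dot (u - U) H
     + r * dot v (2 *: (S *m (u - U)) + 2 * c * d *: (u - U))) =
  - r * dot (u - U) (G *m (u - U))
  + ((1 + c) * (m - r * mb / rb) * (dot (u - U) K - dot (v - V) H)
     - r * dot (v - V) (G *m (v - V))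
     + c * r * (dot (v - V) (u - U) * e - sqnorm (v - V) * d))
  + nu * dot (u - U) (2 * (m - r * mb / rb) *: LD + 2 * r *: (S *m (v - V))
     + 2 * c * (m - r * mb / rb) *: H + 2 * c * r * d *: (v - V))
  - (P - Pb - p' * (r - rb)) * d - r / rb * dot (u - U) Rb.
Proof.
move=> rb0 WT ST mass momentum driftE defS defD defK.
have := inertial_identity r u U Ut G.
have -> : dot (u - U) (Ut + G *m U) = rb^-1 * (nu * dot (u - U) DD + dot (u - U) SS
    - dot (u - U) (p' *: Gr) + dot (u - U) Rb).
  transitivity (rb^-1 * dot (u - U) (rb *: (Ut + G *m U))); first by rewrite !vecE; field.
  by rewrite momentum; congr (_ * _); rewrite !vecE; ring.
have := drift_inertial_identity r u v U V Vt W.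
have -> : dot (v - V) (Vt + W *m U) = rb^-1 * - dot (v - V) KK.
  transitivity (rb^-1 * dot (v - V) (rb *: (Vt + W *m U))); first by rewrite !vecE; field.
  by rewrite driftE; congr (_ * _); rewrite !vecE; ring.
have := pressure_identity r P Pb p' u rb0 mass.
have := capillary_identity r m mb c d e u v U V K H G rb0 WT.
rewrite -defS -defK.
have := viscous_identity r m mb c d u v U V LD H rb0 ST.
rewrite -defD => X5 X4 X3 X2 X1.
have {}X5 := congr1 (fun z => nu * z) X5.
have -> : dot u (G^T *m U + W^T *m V - p' / rb *: Gr) =
    dot u (G^T *m U) + dot u (W^T *m V) - dot u (p' *: Gr) / rb.
  by rewrite !vecE; field.
clear - X1 X2 X3 X4 X5.
lra.
Qed.

End VectorAlgebra.

(** * Bounds for power functions on a compact interval away from zero *)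

Section Powers.
Variables (R : realType) (lo hi : R).
Hypothesis lo0 : 0 < lo.

(** The order of [x] and [y] is left open. The last conclusion says that [xi] lies on the same side
    of [y] as [x], which the convexity estimate needs. *)
Lemma MVT_between (f df : R -> R) x y :
  (forall z, lo <= z <= hi -> is_derive z 1 f (df z)) ->
  lo <= x <= hi -> lo <= y <= hi ->
  exists xi, [/\ lo <= xi <= hi, f x - f y = df xi * (x - y) &
    0 <= (xi - y) * (x - y)].
Proof.
move=> Df /andP[x1 x2] /andP[y1 y2].
have D (a c : R) : lo <= a -> c <= hi -> forall z, a <= z <= c -> is_derive z 1 f (df z).
  by move=> la ch z /andP[az zc]; apply: Df; rewrite (le_trans la az) (le_trans zc ch).
have W (a c : R) : lo <= a -> c <= hi -> {within `[a, c], continuous f}.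
  move=> la ch; apply: derivable_within_continuous => z; rewrite in_itv/= => az.
  by have [] := D a c la ch z az.
have [yx|xy] := leP y x.
  have [|c] := @MVT_segment R f df y x yx _ (W _ _ y1 x2).
    by move=> z; rewrite in_itv/= => /andP[z1 z2]; apply: (D y x) => //; rewrite !ltW.
  rewrite in_itv/= => /andP[c1 c2] E; exists c; split => //.
    by rewrite (le_trans y1 c1) (le_trans c2 x2).
  by rewrite mulr_ge0// subr_ge0.
have [|c] := @MVT_segment R f df x y (ltW xy) _ (W _ _ x1 y2).
  by move=> z; rewrite in_itv/= => /andP[z1 z2]; apply: (D x y) => //; rewrite !ltW.
rewrite in_itv/= => /andP[c1 c2] E; exists c; split => //.
- by rewrite (le_trans x1 c1) (le_trans c2 y2).
- by rewrite -opprB E -mulrN opprB.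
- by rewrite mulr_le0// subr_le0// ltW.
Qed.

Lemma powR_bounded (p : R) :
  exists2 M, 0 < M & forall z, lo <= z <= hi -> z `^ p <= M.
Proof.
have cf z : `[lo, hi]%classic z -> {for z, continuous (@powR R ^~ p)}.
  rewrite /= in_itv/= => /andP[lz _].
  by apply/differentiable_continuous/derivable1_diffP/derivable_powR;
    rewrite in_itv/= (lt_le_trans lo0 lz).
have [M M0 H] := compact_continuous_bounded (@segment_compact R lo hi) cf.
exists M => // z zlh; rewrite (le_trans (ler_norm _))// H//= in_itv/=.
Qed.

Lemma powR_lipschitz (p : R) : exists2 L, 0 <= L &
  forall x y, lo <= x <= hi -> lo <= y <= hi -> `|x `^ p - y `^ p| <= L * `|x - y|.
Proof.
have [M M0 HM] := powR_bounded (p - 1).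
exists (`|p| * M); first by rewrite mulr_ge0// ltW.
move=> x y xlh ylh.
have D z : lo <= z <= hi -> is_derive z 1 (@powR R ^~ p) (p * z `^ (p - 1)).
  by move=> /andP[lz _]; apply: is_derive1_powR; exact: lt_le_trans lz.
have [xi [xih -> _]] := MVT_between D xlh ylh.
rewrite !normrM ler_wpM2r// ler_wpM2l// ger0_norm ?powR_ge0//.
exact: HM.
Qed.

(** Away from zero the second derivative [g z^(g - 2)] of [z^g / (g - 1)] has a positive lower bound
    [g / M]. After subtraction of the tangent and of the corresponding parabola, the derivative has
    the sign of [z - y], by a second use of the mean value theorem. *)
Lemma powR_tangent_lower (g : R) : 1 < g -> exists2 k, 0 < k &
  forall x y, lo <= x <= hi -> lo <= y <= hi ->
  k * (x - y) ^+ 2 <= x `^ g / (g - 1) - y `^ g / (g - 1)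
                      - g / (g - 1) * y `^ (g - 1) * (x - y).
Proof.
move=> g1; have g10 : 0 < g - 1 by rewrite subr_gt0.
(* An upper bound for the inverse power is a lower bound for [z^(g - 2)], whatever the sign of
   [g - 2]. *)
have [M M0 HM] := powR_bounded (- (g - 2)).
have g0 : 0 < g by lra.
exists (g / M / 2); first by rewrite !divr_gt0.
move=> x y xlh ylh.
pose k := g / M.
have D1 z : lo <= z <= hi -> is_derive z 1 (fun z => z `^ g / (g - 1) -
    g / (g - 1) * y `^ (g - 1) * z - k / 2 * (z - y) ^+ 2)
   (g / (g - 1) * z `^ (g - 1) - g / (g - 1) * y `^ (g - 1) - k * (z - y)).
  move=> /andP[lz _]; have z0 := lt_le_trans lo0 lz.
  have Dp := is_derive1_powR g z0.
  have -> : (fun z : R => z `^ g / (g - 1) - g / (g - 1) * y `^ (g - 1) * z -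
       k / 2 * (z - y) ^+ 2) =
     (fun z : R => z `^ g * (g - 1)^-1 - g / (g - 1) * y `^ (g - 1) * z -
       k / 2 * ((z - y) * (z - y))).
    by apply/funext => w; rewrite expr2.
  by apply: is_derive_eq; rewrite /GRing.scale/=; field; rewrite gt_eqF.
have D2 z : lo <= z <= hi -> is_derive z 1 (fun z => g / (g - 1) * z `^ (g - 1) -
    k * z) (g * z `^ (g - 2) - k).
  move=> /andP[lz _]; have z0 := lt_le_trans lo0 lz.
  have Dp := is_derive1_powR (g - 1) z0.
  apply: is_derive_eq; rewrite /GRing.scale/=.
  have -> : g - 1 - 1 = g - 2 by ring.
  by field; rewrite gt_eqF.
have [xi [xih E1 s1]] := MVT_between D1 xlh ylh.
have [eta [etah E2 _]] := MVT_between D2 xih ylh.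
have E3 : g / (g - 1) * xi `^ (g - 1) - g / (g - 1) * y `^ (g - 1) - k * (xi - y) =
    (g * eta `^ (g - 2) - k) * (xi - y).
  by rewrite -E2; ring.
have gk : 0 <= g * eta `^ (g - 2) - k.
  rewrite subr_ge0 /k; apply: ler_wpM2l; first exact: ltW.
  have := HM _ etah; rewrite powRN => H.
  have e0 : 0 < eta `^ (g - 2).
    by apply: powR_gt0; case/andP: etah => + _; exact: lt_le_trans.
  by rewrite -[leRHS]invrK lef_pV2 ?posrE ?invr_gt0.
have := mulr_ge0 gk s1; rewrite mulrA -E3 -E1 /k subrr expr0n/= mulr0 subr0 => H.
rewrite -subr_ge0; apply: le_trans H _; rewrite le_eqVlt; apply/orP; left; apply/eqP.
by field; rewrite !gt_eqF.
Qed.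

End Powers.

Section Constitutive.
Variable R : realType.

Lemma derive1_powR_mul (p k r : R) : 0 < r ->
  derive1 (fun x => x `^ p * k) r = p * r `^ (p - 1) * k.
Proof.
move=> r0; rewrite derive1E; have D := is_derive1_powR p r0.
have D2 : is_derive r 1 (fun x : R => x `^ p * k) (p * r `^ (p - 1) * k).
  by apply: is_derive_eq; rewrite /GRing.scale/= mulr0 add0r mulrC.
by rewrite derive_val.
Qed.

Lemma derive1_hh (g r : R) : 0 < r -> derive1 (hh g) r = g / (g - 1) * r `^ (g - 1).
Proof.
move=> r0; rewrite (_ : hh g = fun x => x `^ g * (g - 1)^-1)//.
by rewrite derive1_powR_mul//; ring.
Qed.

Lemma lamE (s r : R) : -1 <= s -> 0 <= r -> lam s r = (s + 1) * mu s r.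
Proof.
move=> s1; rewrite le_eqVlt => /predU1P[<-|r0].
  rewrite /lam mul0r sub0r /mu powR0 ?oppr0 ?mulr0//.
  by apply: lt0r_neq0; lra.
rewrite /lam.
have -> : derive1 (mu s) r = (s + 3) / 2 * r `^ ((s + 3) / 2 - 1).
  have := derive1_powR_mul ((s + 3) / 2) 1 r0; rewrite mulr1 => <-.
  by congr (derive1 _ r); apply/funext => x; rewrite mulr1.
rewrite mulrCA mulr_powRB1 ?ltW//; last lra.
by rewrite /mu; field.
Qed.

End Constitutive.

(** * Young-type estimates for the quadratic terms *)

Section Estimates.
Variable R : realType.
Implicit Types a b u v U V K H : 'cV[R]_3.

Lemma sqnorm_ge0 a : 0 <= sqnorm a.
Proof. by rewrite /sqnorm /dot sumr_ge0// => k _; rewrite -expr2 sqr_ge0. Qed.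

Lemma young (x y : R) : x * y <= (x ^+ 2 + y ^+ 2) / 2.
Proof. by have := sqr_ge0 (x - y); rewrite !expr2; nra. Qed.

(** Young's inequality for each component of [a]: the factor 3 counts the occurrences of
    [x ^+ 2]. *)
Lemma sum_dot_le (x : R) a K M : (forall k, `|K k 0| <= M) ->
  `|x * dot a K| <= M * (3 * x ^+ 2 + sqnorm a) / 2.
Proof.
move=> KM; rewrite /dot mulr_sumr (le_trans (ler_norm_sum _ _ _))//.
have M0 : 0 <= M by apply: le_trans (KM 0).
apply: (@le_trans _ _ (\sum_k (M * ((x ^+ 2 + a k 0 ^+ 2) / 2)))).
  apply: ler_sum => k _; rewrite mulrA normrM mulrC.
  apply: ler_pM => //.
  rewrite normrM; apply: le_trans (young _ _) _.
  by rewrite !real_normK ?num_real.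
by rewrite /sqnorm dot3 sum3 !expr2; lra.
Qed.

Lemma dot_mulmx_le a b (G : 'M[R]_3) M : (forall k l, `|G k l| <= M) ->
  `|dot a (G *m b)| <= 2 * M * (sqnorm a + sqnorm b).
Proof.
move=> GM; have M0 : 0 <= M by apply: le_trans (GM 0 0).
rewrite /dot (le_trans (ler_norm_sum _ _ _))//.
apply: (@le_trans _ _ (\sum_k \sum_l (M * ((a k 0 ^+ 2 + b l 0 ^+ 2) / 2)))).
  apply: ler_sum => k _; rewrite mxE mulr_sumr (le_trans (ler_norm_sum _ _ _))//.
  apply: ler_sum => l _; rewrite mulrCA normrM.
  apply: ler_pM => //.
  rewrite normrM; apply: le_trans (young _ _) _.
  by rewrite !real_normK ?num_real.
rewrite /sqnorm !dot3 !sum3 !expr2.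
have := sqr_ge0 (a 0 0); have := sqr_ge0 (a 1 0); have := sqr_ge0 (a 2 0).
have := sqr_ge0 (b 0 0); have := sqr_ge0 (b 1 0); have := sqr_ge0 (b 2 0).
rewrite !expr2; nra.
Qed.

End Estimates.

Section QuadraticBound.
Variable R : realType.
Implicit Types u v U V K H LD : 'cV[R]_3.

Lemma dotDl (a b c : 'cV[R]_3) : dot (a + b) c = dot a c + dot b c.
Proof. by rewrite !vecE; ring. Qed.

Lemma dotZl x (a b : 'cV[R]_3) : dot (x *: a) b = x * dot a b.
Proof. by rewrite !vecE; ring. Qed.

Lemma dotDr (a b c : 'cV[R]_3) : dot c (a + b) = dot c a + dot c b.
Proof. by rewrite !vecE; ring. Qed.

Lemma dotZr x (a b : 'cV[R]_3) : dot b (x *: a) = x * dot b a.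
Proof. by rewrite !vecE; ring. Qed.

Lemma dot_le (a b : 'cV[R]_3) : `|dot a b| <= (sqnorm a + sqnorm b) / 2.
Proof.
rewrite /sqnorm !dot3 ler_norml; apply/andP; split.
  have := sqr_ge0 (a 0 0 + b 0 0); have := sqr_ge0 (a 1 0 + b 1 0).
  by have := sqr_ge0 (a 2 0 + b 2 0); rewrite !expr2; nra.
have := sqr_ge0 (a 0 0 - b 0 0); have := sqr_ge0 (a 1 0 - b 1 0).
by have := sqr_ge0 (a 2 0 - b 2 0); rewrite !expr2; nra.
Qed.

Lemma le_abs_mul (x y a b : R) : `|x| <= a -> `|y| <= b -> `|x * y| <= a * b.
Proof. by move=> xa yb; rewrite normrM; apply: ler_pM. Qed.

(** Here [x] stands for [m - r * mb / rb] and [X] for the squared difference of the densities. The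
    point is a constant that is linear in [1 + nu] and otherwise depends only on bounds of the
    fields. *)
Lemma quadratic_bound (r x d e c M N L X nu : R) u v U V K H LD (G S : 'M[R]_3) :
  0 <= r <= N -> 0 <= c -> 0 <= nu -> 0 <= L -> 0 <= X -> x ^+ 2 <= L * X ->
  `|d| <= M -> `|e| <= M ->
  (forall k, `|K k 0| <= M) -> (forall k, `|H k 0| <= M) ->
  (forall k, `|LD k 0| <= M) ->
  (forall k l, `|G k l| <= M) -> (forall k l, `|S k l| <= M) ->
  - r * dot (u - U) (G *m (u - U))
  + ((1 + c) * x * (dot (u - U) K - dot (v - V) H)
     - r * dot (v - V) (G *m (v - V))
     + c * r * (dot (v - V) (u - U) * e - sqnorm (v - V) * d))
  + nu * dot (u - U) (2 * x *: LD + 2 * r *: (S *m (v - V))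
     + 2 * c * x *: H + 2 * c * r * d *: (v - V)) <=
  8 * (1 + c) * M * (N + 3 * L + 1) * (1 + nu)
    * (sqnorm (u - U) + sqnorm (v - V) + X).
Proof.
move=> /andP[r0 rN] c0 nu0 L0 X0 xL dM eM KM HM LM GM SM.
have M0 : 0 <= M by apply: le_trans dM.
set a := u - U; set b := v - V; clearbody a b.
have A0 := sqnorm_ge0 a; have B0 := sqnorm_ge0 b.
set A := sqnorm a in A0 *; set B := sqnorm b in B0 *.
have N0 : 0 <= N by exact: le_trans rN.
have nr : `|r| <= N by rewrite ger0_norm.
have := le_abs_mul nr (dot_mulmx_le a a GM); rewrite ler_norml => /andP[t1 _].
have := le_abs_mul nr (dot_mulmx_le b b GM); rewrite ler_norml => /andP[t2 _].
have := sum_dot_le x a KM; rewrite ler_norml => /andP[_ t3].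
have := sum_dot_le x b HM; rewrite ler_norml => /andP[t4 _].
have := le_abs_mul nr (le_abs_mul (dot_le b a) eM); rewrite ler_norml => /andP[_ t5].
have nB : `|B| <= B by rewrite ger0_norm.
have := le_abs_mul nr (le_abs_mul nB dM); rewrite ler_norml => /andP[t6 _].
have := sum_dot_le x a LM; rewrite ler_norml => /andP[_ t7].
have := le_abs_mul nr (dot_mulmx_le a b SM); rewrite ler_norml => /andP[_ t8].
have := sum_dot_le x a HM; rewrite ler_norml => /andP[_ t9].
have := le_abs_mul nr (le_abs_mul (dot_le a b) dM); rewrite ler_norml => /andP[_ t10].
rewrite !dotDr !dotZr -/A -/B in t1 t2 t3 t4 t5 t6 t7 t8 t9 t10 *.
clearbody A B.
have mx : M * (3 * x ^+ 2) <= M * (3 * (L * X)) by rewrite ler_wpM2l// ler_wpM2l.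
set y := M * (3 * (L * X)) in mx.
have y0 : 0 <= y by rewrite !mulr_ge0.
have e1 : (1 + c) * x * (dot a K - dot b H) <= (1 + c) * (y + M * (A + B) / 2).
  rewrite -mulrA; apply: ler_wpM2l; first by rewrite addr_ge0.
  have -> : x * (dot a K - dot b H) = x * dot a K - x * dot b H by ring.
  by move: t3 t4 mx; set p := x * dot a K; set q := x * dot b H; set z := x ^+ 2; clear - y0; lra.
have e2 : c * r * (dot b a * e - B * d) <= c * (2 * (N * (M * (A + B)))).
  rewrite -mulrA; apply: ler_wpM2l => //.
  have -> : r * (dot b a * e - B * d) = r * (dot b a * e) - r * (B * d) by ring.
  have : 0 <= N * (M * A) by rewrite !mulr_ge0.
  have : 0 <= N * (M * B) by rewrite !mulr_ge0.
  by move: t5 t6; set p := r * (dot b a * e); set q := r * (B * d); clear - y0; lra.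
have e3 : 2 * x * dot a LD + 2 * r * dot a (S *m b) + 2 * c * x * dot a H
    + 2 * c * r * d * dot a b <=
   y + M * A + 4 * (N * (M * (A + B))) + c * (y + M * A) + c * (N * (M * (A + B))).
  have h9 : 2 * c * x * dot a H <= c * (y + M * A).
    have -> : 2 * c * x * dot a H = c * (2 * (x * dot a H)) by ring.
    apply: ler_wpM2l => //.
    by move: t9 mx; set p := x * dot a H; set z := x ^+ 2; clear - y0; lra.
  have h10 : 2 * c * r * d * dot a b <= c * (N * (M * (A + B))).
    have -> : 2 * c * r * d * dot a b = c * (2 * (r * (dot a b * d))) by ring.
    apply: ler_wpM2l => //.
    by move: t10; set p := r * (dot a b * d); clear - y0; lra.
  have h7 : 2 * x * dot a LD <= y + M * A.
    have -> : 2 * x * dot a LD = 2 * (x * dot a LD) by ring.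
    by move: t7 mx; set p := x * dot a LD; set z := x ^+ 2; clear - y0; lra.
  have h8 : 2 * r * dot a (S *m b) <= 4 * (N * (M * (A + B))).
    have -> : 2 * r * dot a (S *m b) = 2 * (r * dot a (S *m b)) by ring.
    by move: t8; set p := r * dot a (S *m b); clear - y0; lra.
  by rewrite !lerD.
have e4 := ler_wpM2l nu0 e3.
have e5 : - r * dot a (G *m a) <= 4 * (N * (M * A)).
  by rewrite mulNr; move: t1; set p := r * dot a (G *m a); clear - y0; lra.
have e6 : - (r * dot b (G *m b)) <= 4 * (N * (M * B)).
  by move: t2; set p := r * dot b (G *m b); clear - y0; lra.
apply: (@le_trans _ _ (4 * (N * (M * A)) + ((1 + c) * (y + M * (A + B) / 2)
   + 4 * (N * (M * B)) + c * (2 * (N * (M * (A + B))))) +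
  nu * (y + M * A + 4 * (N * (M * (A + B))) + c * (y + M * A) + c * (N * (M * (A + B)))))).
  by rewrite !lerD.
rewrite /y; clear - c0 nu0 L0 X0 M0 N0 A0 B0.
have p1 := mulr_ge0 M0 A0; have p2 := mulr_ge0 M0 B0; have p3 := mulr_ge0 M0 X0.
(* Once every monomial that can occur is known to be nonnegative, the comparison is linear in the
   monomials. *)
have q z : 0 <= z -> [/\ 0 <= N * z, 0 <= L * z, 0 <= c * z, 0 <= nu * z & 0 <= z].
  by move=> z0; rewrite !mulr_ge0.
have [a1 a2 a3 a4 _] := q _ p1; have [b1 b2 b3 b4 _] := q _ p2; have [d1 d2 d3 d4 _] := q _ p3.
have [_ _ a13 a14 _] := q _ a1; have [_ _ a23 a24 _] := q _ a2; have [_ _ _ a34 _] := q _ a3.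
have [_ _ b13 b14 _] := q _ b1; have [_ _ b23 b24 _] := q _ b2; have [_ _ _ b34 _] := q _ b3.
have [_ _ d13 d14 _] := q _ d1; have [_ _ d23 d24 _] := q _ d2; have [_ _ _ d34 _] := q _ d3.
have [_ _ _ a134 _] := q _ a13; have [_ _ _ a234 _] := q _ a23.
have [_ _ _ b134 _] := q _ b13; have [_ _ _ b234 _] := q _ b23.
have [_ _ _ d134 _] := q _ d13; have [_ _ _ d234 _] := q _ d23.
lra.
Qed.

End QuadraticBound.

(** * Absorption of the remainder into the friction *)

Section FrictionBound.
Variables (R : realType) (n : nat).
Implicit Types (r rb : 'I_n -> R) (u Rb : 'I_n -> 'cV[R]_3) (U : 'cV[R]_3).

(** Jensen's inequality, obtained from the nonnegativity of the weighted variance; afterwards each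
    weight is bounded by the total [S]. *)
Lemma mean_square_le r (y : 'I_n -> R) (i0 : 'I_n) : (forall i, 0 < r i) ->
  ((\sum_i r i)^-1 * \sum_i r i * y i) ^+ 2 <= \sum_i y i ^+ 2.
Proof.
move=> r0; set S := \sum_i r i; set z := _ * _.
have rS i : r i <= S by rewrite /S (bigD1 i)//= lerDl sumr_ge0// => j _; rewrite ltW.
have S0 : 0 < S by exact: lt_le_trans (r0 i0) (rS i0).
have Sz : \sum_i r i * y i = S * z by rewrite /z mulrA mulfV ?mul1r// gt_eqF.
rewrite -(ler_pM2l S0); apply: (@le_trans _ _ (\sum_i r i * y i ^+ 2)); last first.
  rewrite mulr_sumr; apply: ler_sum => i _; apply: ler_wpM2r; first exact: sqr_ge0.
  exact: rS.
rewrite -subr_ge0.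
have -> : \sum_i r i * y i ^+ 2 - S * z ^+ 2 = \sum_i r i * (y i - z) ^+ 2.
  transitivity (\sum_i (r i * y i ^+ 2 - 2 * z * (r i * y i) + z ^+ 2 * r i)).
    rewrite big_split/= sumrB -!mulr_sumr Sz -/S; ring.
  by apply: eq_bigr => i _; ring.
by rewrite sumr_ge0// => i _; rewrite mulr_ge0// ?sqr_ge0// ltW.
Qed.

Lemma sqnorm_mean_le r u U (i0 : 'I_n) : (forall i, 0 < r i) ->
  sqnorm ((\sum_i r i)^-1 *: (\sum_i r i *: u i) - U) <= \sum_i sqnorm (u i - U).
Proof.
move=> r0; set S := \sum_i r i.
have S0 : 0 < S.
  by rewrite /S (bigD1 i0)//= ltr_wpDr// sumr_ge0// => j _; rewrite ltW.
rewrite /sqnorm /dot exchange_big/=; apply: ler_sum => k _.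
have -> : (S^-1 *: (\sum_i r i *: u i) - U) k 0 =
    S^-1 * \sum_i r i * (u i - U) k 0.
  rewrite !mxE summxE.
  under eq_bigr do rewrite mxE.
  under [in RHS]eq_bigr do rewrite !mxE mulrDr.
  by rewrite big_split/= -mulr_suml -/S mulrDr !mulrN mulrA mulVf ?gt_eqF// mul1r.
rewrite -expr2; under [leRHS]eq_bigr do rewrite -expr2.
exact: mean_square_le.
Qed.

(* Young's inequality against the friction for [u i - ubar]; for [ubar - U]
   the sum of the [Rb i] vanishes and only [r i - rb i] remains. *)
Lemma remainder_le (b : 'M[R]_n) (kst N delta eps b0 Mr : R) r rb u Rb U :
  coercive b kst N delta -> 0 < kst -> 0 < delta -> 0 < eps -> 0 < b0 ->
  (forall i, kst <= r i <= N) -> (forall i, b0 <= rb i) ->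
  \sum_i Rb i = 0 -> (forall i k, `|Rb i k 0| <= Mr) ->
  - (\sum_i (r i / rb i) * dot (u i - U) (Rb i))
  - (2 * eps)^-1 * \sum_i \sum_j b i j * r i * r j * sqnorm (u i - u j) <=
  eps / (4 * delta) * (3 * n%:R * (Mr / b0) ^+ 2)
  + Mr / (2 * b0) * \sum_i (n%:R * sqnorm (u i - U) + 3 * (r i - rb i) ^+ 2).
Proof.
move=> cb k0 d0 e0 b00 rN rb0 sR RM.
have r0 i : 0 < r i by case/andP: (rN i) => + _; exact: lt_le_trans.
have rbp i : 0 < rb i by exact: lt_le_trans (rb0 i).
have := cb r u rN => /=; set ub := _ *: _ => cu.
have fr : (2 * eps)^-1 * \sum_i \sum_j b i j * r i * r j * sqnorm (u i - u j) >=
    (delta / eps) * \sum_i r i ^+ 2 * sqnorm (u i - ub).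
  have -> : delta / eps = eps^-1 * delta by rewrite mulrC.
  have -> : (2 * eps)^-1 = eps^-1 * 2^-1 by rewrite invfM mulrC.
  by rewrite -[leLHS]mulrA -[leRHS]mulrA ler_pM2l ?invr_gt0.
have split1 : \sum_i (r i / rb i) * dot (u i - U) (Rb i) =
   \sum_i (r i / rb i) * dot (u i - ub) (Rb i)
   + \sum_i ((r i - rb i) / rb i) * dot (ub - U) (Rb i).
  have s0 : \sum_i dot (ub - U) (Rb i) = 0.
    transitivity (dot (ub - U) (\sum_i Rb i)); last by rewrite sR !vecE; ring.
    rewrite /dot exchange_big/=; apply: eq_bigr => k _.
    by rewrite summxE mulr_sumr.
  have -> : \sum_i ((r i - rb i) / rb i) * dot (ub - U) (Rb i) =
      \sum_i (r i / rb i) * dot (ub - U) (Rb i) - \sum_i dot (ub - U) (Rb i).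
    by rewrite -sumrB; apply: eq_bigr => i _; field; rewrite gt_eqF.
  rewrite s0 subr0 -big_split/=; apply: eq_bigr => i _.
  by rewrite !vecE; ring.
have first_part : - (\sum_i (r i / rb i) * dot (u i - ub) (Rb i)) <=
   (delta / eps) * (\sum_i r i ^+ 2 * sqnorm (u i - ub))
   + eps / (4 * delta) * (3 * n%:R * (Mr / b0) ^+ 2).
  have -> : 3 * n%:R * (Mr / b0) ^+ 2 = \sum_(i < n) (3 * (Mr / b0) ^+ 2).
    by rewrite sumr_const card_ord -mulr_natl; ring.
  rewrite -sumrN !mulr_sumr -big_split/=; apply: ler_sum => i _.
  have q k : (Rb i k 0 / rb i) ^+ 2 <= (Mr / b0) ^+ 2.
    rewrite -[leLHS]real_normK ?num_real// lerXn2r ?nnegrE//.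
      by apply: divr_ge0; [exact: le_trans (RM i k)|exact: ltW].
    rewrite normrM normfV (gtr0_norm (rbp i)); apply: ler_pM => //.
      by rewrite invr_ge0 ltW.
    by rewrite lef_pV2 ?posrE.
  (* The weight [delta / eps] is exactly what the coercivity of the friction can pay for; the price
     on the other factor is [eps / (4 delta)], the origin of the error of order [eps]. *)
  have yk (x y : R) : - (x * y) <= (delta / eps) * x ^+ 2 + eps / (4 * delta) * y ^+ 2.
    rewrite -subr_ge0.
    have -> : delta / eps * x ^+ 2 + eps / (4 * delta) * y ^+ 2 - - (x * y) =
      (delta / eps) * (x + eps / (2 * delta) * y) ^+ 2 by field; rewrite !gt_eqF.
    by rewrite mulr_ge0 ?sqr_ge0// divr_ge0 ?ltW.
  have -> : - (r i / rb i * dot (u i - ub) (Rb i)) =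
     \sum_k - ((r i * (u i - ub) k 0) * (Rb i k 0 / rb i)).
    by rewrite /dot mulr_sumr -sumrN; apply: eq_bigr => k _; ring.
  have -> : delta / eps * (r i ^+ 2 * sqnorm (u i - ub)) + eps / (4 * delta) * (3 * (Mr / b0) ^+ 2)
     = \sum_k (delta / eps * (r i * (u i - ub) k 0) ^+ 2 + eps / (4 * delta) * (Mr / b0) ^+ 2).
    by rewrite /sqnorm dot3 sum3; ring.
  apply: ler_sum => k _; apply: le_trans (yk _ _) _; rewrite lerD2l.
  apply: ler_wpM2l; last exact: q.
  by apply: divr_ge0; [|apply: mulr_ge0 => //]; exact: ltW.
have second_part : - (\sum_i ((r i - rb i) / rb i) * dot (ub - U) (Rb i)) <=
   Mr / (2 * b0) * \sum_i (n%:R * sqnorm (u i - U) + 3 * (r i - rb i) ^+ 2).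
  have -> : \sum_i (n%:R * sqnorm (u i - U) + 3 * (r i - rb i) ^+ 2) =
     \sum_(i < n) (\sum_j sqnorm (u j - U) + 3 * (r i - rb i) ^+ 2).
    rewrite !big_split/=; congr (_ + _).
    by rewrite sumr_const card_ord -mulr_sumr mulr_natl.
  rewrite -sumrN mulr_sumr; apply: ler_sum => i _.
  have Mr0 : 0 <= Mr by apply: le_trans (RM i 0).
  have := sum_dot_le (r i - rb i) (ub - U) (RM i).
  have := sqnorm_mean_le u U i r0; rewrite -/ub => h1 h2.
  have -> : - ((r i - rb i) / rb i * dot (ub - U) (Rb i)) =
     (rb i)^-1 * (- ((r i - rb i) * dot (ub - U) (Rb i))) by ring.
  apply: (@le_trans _ _ ((rb i)^-1 * (Mr * (3 * (r i - rb i) ^+ 2 + sqnorm (ub - U)) / 2))).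
    apply: ler_wpM2l; first by rewrite invr_ge0 ltW.
    by rewrite (le_trans _ h2)// -normrN ler_norm.
  have -> : Mr / (2 * b0) * (\sum_j sqnorm (u j - U) + 3 * (r i - rb i) ^+ 2) =
     b0^-1 * (Mr * (3 * (r i - rb i) ^+ 2 + \sum_j sqnorm (u j - U)) / 2).
    by field; rewrite gt_eqF.
  apply: ler_pM.
  - by rewrite invr_ge0 ltW.
  - by rewrite divr_ge0// mulr_ge0// addr_ge0// ?sqnorm_ge0// mulr_ge0// sqr_ge0.
  - by rewrite lef_pV2 ?posrE.
  - by rewrite ler_pM2r// ler_wpM2l// lerD2l.
rewrite split1; move: fr first_part second_part.
set f := (2 * eps)^-1 * _; set p := \sum_i _ * dot (u i - ub) _; set q := \sum_i _ * dot (ub - U) _.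
set g := delta / eps * _; set h := eps / _ * _; set z := Mr / _ * _; lra.
Qed.

End FrictionBound.

(** * Calculus of space-time fields *)

Section SpaceTime.
Variable R : realType.
Implicit Types (f g : R -> pt3 R -> R) (t : R) (x : pt3 R).

Definition uncurried f : R * pt3 R -> R := fun z => f z.1 z.2.
Definition edir k : R * pt3 R := (0, dir R k).
Definition etime : R * pt3 R := (1, 0).

(** Partial derivatives become directional derivatives on space-time, so one notion of smoothness
    there covers differentiation in time, in space and the exchange of the two. *)
Lemma pdE f k t x : pd k (f t) x = 'D_(edir k) (uncurried f) (t, x).
Proof.
rewrite /pd /derive.
suff -> : (fun h : R => h^-1 *: (f t (h *: dir R k + x) - f t x)) =
  (fun h : R => h^-1 *: (uncurried f (h *: edir k + (t, x)) - uncurried f (t, x))) by [].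
apply/funext => h; rewrite /uncurried /=.
by have -> : h *: (0 : R) + t = t by rewrite scaler0 add0r.
Qed.

Lemma derivable_pdE f k t x : derivable (uncurried f) (t, x) (edir k) ->
  derivable (f t) x (dir R k).
Proof.
rewrite /derivable.
suff -> : (fun h : R => h^-1 *: (f t (h *: dir R k + x) - f t x)) =
  (fun h : R => h^-1 *: (uncurried f (h *: edir k + (t, x)) - uncurried f (t, x))) by [].
apply/funext => h; rewrite /uncurried /=.
by have -> : h *: (0 : R) + t = t by rewrite scaler0 add0r.
Qed.

Lemma dtE f t x : dt f t x = 'D_etime (uncurried f) (t, x).
Proof.
rewrite /dt derive1E /derive.
suff -> : (fun h : R => h^-1 *: (f (h *: (1 : R) + t) x - f t x)) =
  (fun h : R => h^-1 *: (uncurried f (h *: etime + (t, x)) - uncurried f (t, x))) by [].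
apply/funext => h; rewrite /uncurried /=.
by have -> : h *: (0 : pt3 R) + x = x by rewrite scaler0 add0r.
Qed.

Lemma derivable_dtE f t x : derivable (uncurried f) (t, x) etime ->
  derivable (f ^~ x) t 1.
Proof.
rewrite /derivable.
suff -> : (fun h : R => h^-1 *: (f (h *: (1 : R) + t) x - f t x)) =
  (fun h : R => h^-1 *: (uncurried f (h *: etime + (t, x)) - uncurried f (t, x))) by [].
apply/funext => h; rewrite /uncurried /=.
by have -> : h *: (0 : pt3 R) + x = x by rewrite scaler0 add0r.
Qed.

End SpaceTime.

Section SmoothFields.
Variables (R : realType) (O : set (R * pt3 R)).
Hypothesis oO : open O.
Implicit Types (f g : R -> pt3 R -> R) (t : R) (x : pt3 R).
Implicit Types (F H : R -> pt3 R -> 'cV[R]_3) (A : R -> pt3 R -> 'M[R]_3).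

Definition sm f := smooth_on O (uncurried f).
Definition smv F := forall k, sm (fun t x => F t x k 0).
Definition smm A := forall k l, sm (fun t x => A t x k l).

Lemma sm_ext f g : (forall t x, O (t, x) -> f t x = g t x) -> sm f -> sm g.
Proof. by move=> fg; apply: smooth_on_ext => // -[t x]; exact: fg. Qed.

Lemma smD f g : sm f -> sm g -> sm (fun t x => f t x + g t x).
Proof. by move=> sf sg k; exact: (CkD oO (sf k) (sg k)). Qed.

Lemma smM f g : sm f -> sm g -> sm (fun t x => f t x * g t x).
Proof. by move=> sf sg k; exact: (CkM oO (sf k) (sg k)). Qed.

Lemma sm_cst (a : R) : sm (fun _ _ => a).
Proof. by move=> k; exact: (Ck_cst k O a). Qed.

Lemma smZ (a : R) f : sm f -> sm (fun t x => a * f t x).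
Proof. by move=> sf; apply: smM => //; exact: sm_cst. Qed.

Lemma smN f : sm f -> sm (fun t x => - f t x).
Proof.
by move=> /(smZ (-1)); apply: sm_ext => t x _; rewrite mulN1r.
Qed.

Lemma smB f g : sm f -> sm g -> sm (fun t x => f t x - g t x).
Proof. by move=> sf sg; apply: smD => //; exact: smN. Qed.

Lemma sm_sum (I : Type) (r : seq I) (f : I -> R -> pt3 R -> R) :
  (forall i, sm (f i)) -> sm (fun t x => \sum_(i <- r) f i t x).
Proof.
move=> sf; elim: r => [|i r IH].
  by apply: sm_ext (sm_cst 0) => t x _; rewrite big_nil.
by apply: sm_ext (smD (sf i) IH) => t x _; rewrite big_cons.
Qed.

Lemma sm_powR f p : (forall t x, O (t, x) -> 0 < f t x) -> sm f ->
  sm (fun t x => f t x `^ p).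
Proof.
move=> f0 sf k; apply: (@Ck_powR _ _ k O (uncurried f) p) => //.
by move=> [t x]; exact: f0.
Qed.

Lemma smV f : (forall t x, O (t, x) -> 0 < f t x) -> sm f ->
  sm (fun t x => (f t x)^-1).
Proof.
move=> f0 sf; have := @sm_powR f (-1) f0 sf; apply: sm_ext => t x Otx.
by rewrite powR_inv1// ltW// f0.
Qed.

Lemma sm_pd k f : sm f -> sm (fun t => pd k (f t)).
Proof.
move=> sf; apply: (smooth_on_ext oO _ (smooth_on_derive (edir R k) sf)) => -[t x] _.
by rewrite /uncurried /= pdE.
Qed.

Lemma sm_dt f : sm f -> sm (dt f).
Proof.
move=> sf; apply: (smooth_on_ext oO _ (smooth_on_derive (etime R) sf)) => -[t x] _.
by rewrite /uncurried /= dtE.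
Qed.

Lemma sm_differentiable f t x : sm f -> O (t, x) -> differentiable (uncurried f) (t, x).
Proof. by move=> /(_ 0%N) [df _] Otx; exact: df. Qed.

Lemma sm_continuous f z : sm f -> O z -> {for z, continuous (uncurried f)}.
Proof. by case: z => t x sf Otx; apply: differentiable_continuous; exact: sm_differentiable. Qed.

Lemma sm_derivable f k t x : sm f -> O (t, x) -> derivable (f t) x (dir R k).
Proof.
by move=> sf Otx; apply: derivable_pdE; apply: diff_derivable; exact: sm_differentiable.
Qed.

Lemma sm_derivablet f t x : sm f -> O (t, x) -> derivable (f ^~ x) t 1.
Proof.
by move=> sf Otx; apply: derivable_dtE; apply: diff_derivable; exact: sm_differentiable.
Qed.

Lemma pdC k l f t x : sm f -> O (t, x) -> pd k (pd l (f t)) x = pd l (pd k (f t)) x.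
Proof.
move=> sf Otx.
rewrite (pdE (fun t => pd l (f t))) (pdE (fun t => pd k (f t))).
have E j : uncurried (fun t => pd j (f t)) = (fun z => 'D_(edir R j) (uncurried f) z).
  by apply/funext => -[t' x']; rewrite /uncurried /= pdE.
rewrite !E; exact: (schwarz _ _ oO (sf 2%N)).
Qed.

Section PointRules.
Variables (f g : R -> pt3 R -> R) (t : R) (x : pt3 R).
Hypotheses (sf : sm f) (sg : sm g) (Otx : O (t, x)).

Lemma pdD k : pd k (fun y => f t y + g t y) x = pd k (f t) x + pd k (g t) x.
Proof. by apply: deriveD; exact: sm_derivable. Qed.

Lemma pdB k : pd k (fun y => f t y - g t y) x = pd k (f t) x - pd k (g t) x.
Proof. by apply: deriveB; exact: sm_derivable. Qed.

Lemma pdM k : pd k (fun y => f t y * g t y) x =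
  f t x * pd k (g t) x + g t x * pd k (f t) x.
Proof. by apply: deriveM; exact: sm_derivable. Qed.

Lemma pdZ k a : pd k (fun y => a * f t y) x = a * pd k (f t) x.
Proof. by apply: (@deriveZ _ _ _ (f t) a); exact: sm_derivable. Qed.

Lemma dtD : dt (fun r y => f r y + g r y) t x = dt f t x + dt g t x.
Proof.
by rewrite /dt !derive1E; apply: (@deriveD _ _ _ (f ^~ x) (g ^~ x)); exact: sm_derivablet.
Qed.

Lemma dtM : dt (fun r y => f r y * g r y) t x = f t x * dt g t x + g t x * dt f t x.
Proof.
by rewrite /dt !derive1E; apply: (@deriveM _ _ (f ^~ x) (g ^~ x)); exact: sm_derivablet.
Qed.

(** By [derive_line] the derivative is taken along a line, where the one-variable chain rule
    applies. *)
Lemma pd_powR k p : (forall t x, O (t, x) -> 0 < f t x) ->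
  pd k (fun y => f t y `^ p) x = p * f t x `^ (p - 1) * pd k (f t) x.
Proof.
move=> f0; rewrite /pd.
have df : derivable (f t) x (dir R k) by exact: sm_derivable.
have D := is_derive1_powR p (f0 t x Otx).
have H := derivable_line (f := f t) (z := x) (v := dir R k) (t := 0).
rewrite scale0r addr0 in H; have {}H := H df.
have E0 : f t (x + (0 : R) *: dir R k) = f t x by rewrite scale0r addr0.
have DE := @derive_line R _ (fun y => f t y `^ p) x (dir R k) 0.
rewrite scale0r addr0 in DE; rewrite DE.
have DE' := @derive_line R _ (f t) x (dir R k) 0.
rewrite scale0r addr0 in DE'; rewrite DE'.
rewrite -E0 in D; rewrite -E0.
have H' := @derivableP _ _ _ _ _ _ H.
have := @is_derive1_comp R (@powR R ^~ p) (fun s => f t (x + s *: dir R k)) 0 _ _ D H'.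
by move=> [_ ->]; rewrite E0.
Qed.

Lemma dt_powR p : (forall t x, O (t, x) -> 0 < f t x) ->
  dt (fun r y => f r y `^ p) t x = p * f t x `^ (p - 1) * dt f t x.
Proof.
move=> f0; rewrite /dt !derive1E.
have D := is_derive1_powR p (f0 t x Otx).
have H := derivableP (sm_derivablet sf Otx).
by have [_ ->] := @is_derive1_comp R (@powR R ^~ p) (f ^~ x) t _ _ D H.
Qed.

End PointRules.

Lemma pd_sum (I : Type) (r : seq I) (f : I -> R -> pt3 R -> R) k t x :
  (forall i, sm (f i)) -> O (t, x) ->
  pd k (fun y => \sum_(i <- r) f i t y) x = \sum_(i <- r) pd k (f i t) x.
Proof.
move=> sf Otx; elim: r => [|i r IH].
  rewrite big_nil /pd (_ : (fun y => _) = cst 0) ?derive_cst//.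
  by apply/funext => y; rewrite big_nil.
rewrite big_cons -IH -(@pdD (f i) (fun t y => \sum_(j <- r) f j t y))//; last exact: sm_sum.
by congr (pd k _ x); apply/funext => y; rewrite big_cons.
Qed.

Lemma dt_sum (I : Type) (r : seq I) (f : I -> R -> pt3 R -> R) t x :
  (forall i, sm (f i)) -> O (t, x) ->
  dt (fun s y => \sum_(i <- r) f i s y) t x = \sum_(i <- r) dt (f i) t x.
Proof.
move=> sf Otx; elim: r => [|i r IH].
  rewrite big_nil /dt (_ : (fun y => _) = cst 0) ?derive1_cst//.
  by apply/funext => y; rewrite big_nil.
rewrite big_cons -IH -(@dtD (f i) (fun t y => \sum_(j <- r) f j t y))//; last exact: sm_sum.
by congr (dt _ t x); apply/funext => s; apply/funext => y; exact: big_cons.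
Qed.

Lemma smv_grad f : sm f -> smv (fun t => grad (f t)).
Proof.
move=> sf k; apply: sm_ext (sm_pd k sf) => t x _; by rewrite mxE.
Qed.

Lemma smm_vgrad F : smv F -> smm (fun t => vgrad (F t)).
Proof.
by move=> sF k l; apply: sm_ext (sm_pd l (sF k)) => t x _; rewrite mxE.
Qed.

Lemma smm_tr A : smm A -> smm (fun t x => (A t x)^T).
Proof. by move=> sA k l; apply: sm_ext (sA l k) => t x _; rewrite mxE. Qed.

Lemma smm_sgrad F : smv F -> smm (fun t => sgrad (F t)).
Proof.
move=> sF k l; have sG := smm_vgrad sF.
apply: sm_ext (smZ 2^-1 (smD (sG k l) (sG l k))) => t x _.
by rewrite !mxE.
Qed.

Lemma sm_vdiv F : smv F -> sm (fun t => vdiv (F t)).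
Proof. by move=> sF; apply: sm_sum => k; exact: sm_pd. Qed.

Lemma smv_mdiv A : smm A -> smv (fun t => mdiv (A t)).
Proof.
move=> sA k; apply: (sm_ext (f := fun t x => \sum_l pd l (fun y => A t y k l) x)).
  by move=> t x _; rewrite mxE.
by apply: sm_sum => l; exact: (sm_pd l (sA k l)).
Qed.

Lemma sm_dot F H : smv F -> smv H -> sm (fun t x => dot (F t x) (H t x)).
Proof. by move=> sF sH; apply: sm_sum => k; apply: smM. Qed.

Lemma sm_frob A B : smm A -> smm B -> sm (fun t x => frob (A t x) (B t x)).
Proof.
move=> sA sB; apply: sm_sum => k.
by apply: (@sm_sum _ _ (fun l t x => A t x k l * B t x k l)) => l; apply: smM.
Qed.

Lemma smvD F H : smv F -> smv H -> smv (fun t x => F t x + H t x).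
Proof. by move=> sF sH k; apply: sm_ext (smD (sF k) (sH k)) => t x _; rewrite mxE. Qed.

Lemma smvZ f F : sm f -> smv F -> smv (fun t x => f t x *: F t x).
Proof. by move=> sf sF k; apply: sm_ext (smM sf (sF k)) => t x _; rewrite mxE. Qed.

Lemma smmZ f A : sm f -> smm A -> smm (fun t x => f t x *: A t x).
Proof. by move=> sf sA k l; apply: sm_ext (smM sf (sA k l)) => t x _; rewrite mxE. Qed.

Lemma smvN F : smv F -> smv (fun t x => - F t x).
Proof. by move=> sF k; apply: sm_ext (smN (sF k)) => t x _; rewrite mxE. Qed.

Lemma smvB F H : smv F -> smv H -> smv (fun t x => F t x - H t x).
Proof. by move=> sF sH; apply: smvD => //; exact: smvN. Qed.

Lemma smv_sum (I : Type) (r : seq I) (F : I -> R -> pt3 R -> 'cV[R]_3) :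
  (forall i, smv (F i)) -> smv (fun t x => \sum_(i <- r) F i t x).
Proof.
move=> sF k; apply: (sm_ext (f := fun t x => \sum_(i <- r) F i t x k 0)).
  by move=> t x _; rewrite summxE.
by apply: sm_sum => i; exact: sF.
Qed.

Lemma smv_mulmx A F : smm A -> smv F -> smv (fun t x => A t x *m F t x).
Proof.
move=> sA sF k; apply: (sm_ext (f := fun t x => \sum_l A t x k l * F t x l 0)).
  by move=> t x _; rewrite mxE.
by apply: sm_sum => l; apply: smM; [exact: sA|exact: sF].
Qed.

Section VectorRules.
Variables (f g : R -> pt3 R -> R) (F H : R -> pt3 R -> 'cV[R]_3)
  (A : R -> pt3 R -> 'M[R]_3) (t : R) (x : pt3 R).
Hypotheses (sf : sm f) (sg : sm g) (sF : smv F) (sH : smv H) (sA : smm A)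
  (Otx : O (t, x)).

Lemma gradM : grad (fun y => f t y * g t y) x =
  f t x *: grad (g t) x + g t x *: grad (f t) x.
Proof. by apply/colP => k; rewrite !mxE pdM. Qed.

Lemma gradD : grad (fun y => f t y + g t y) x = grad (f t) x + grad (g t) x.
Proof. by apply/colP => k; rewrite !mxE pdD. Qed.

Lemma gradB : grad (fun y => f t y - g t y) x = grad (f t) x - grad (g t) x.
Proof. by apply/colP => k; rewrite !mxE pdB. Qed.

Lemma gradZ a : grad (fun y => a * f t y) x = a *: grad (f t) x.
Proof. by apply/colP => k; rewrite !mxE pdZ. Qed.

Lemma pd_scale_entry k l : pd l (fun y => (f t y *: F t y) k 0) x =
  f t x * pd l (fun y => F t y k 0) x + F t x k 0 * pd l (f t) x.
Proof.
rewrite -(pdM sf (sF k) Otx); congr (pd l _ x).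
by apply/funext => y; rewrite mxE.
Qed.

Lemma vdivZ : vdiv (fun y => f t y *: F t y) x =
  f t x * vdiv (F t) x + dot (F t x) (grad (f t) x).
Proof.
rewrite /vdiv /dot mulr_sumr -big_split/=; apply: eq_bigr => k _.
by rewrite pd_scale_entry mxE.
Qed.

Lemma mdivZ : mdiv (fun y => f t y *: A t y) x =
  f t x *: mdiv (A t) x + A t x *m grad (f t) x.
Proof.
apply/colP => k; rewrite !mxE mulr_sumr -big_split/=; apply: eq_bigr => l _.
rewrite mxE -(pdM sf (sA k l) Otx); congr (pd l _ x).
by apply/funext => y; rewrite mxE.
Qed.

Lemma mdiv_tensor : mdiv (fun y => tensor (F t y) (H t y)) x =
  vgrad (F t) x *m H t x + vdiv (H t) x *: F t x.
Proof.
apply/colP => k; rewrite !mxE /vdiv mulr_suml -big_split/=; apply: eq_bigr => l _.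
rewrite mxE; transitivity (pd l (fun y => F t y k 0 * H t y l 0) x).
  by congr (pd l _ x); apply/funext => y; rewrite tensorE.
rewrite (pdM (sF k) (sH l) Otx); ring.
Qed.

Lemma dtvZ : dtv (fun r y => f r y *: F r y) t x =
  f t x *: dtv F t x + dt f t x *: F t x.
Proof.
apply/colP => k; rewrite !mxE.
transitivity (dt (fun r y => f r y * F r y k 0) t x).
  by congr (dt _ t x); apply/funext => r; apply/funext => y; exact: mxE.
by rewrite (dtM sf (sF k) Otx); ring.
Qed.

Lemma grad_dot : grad (fun y => dot (F t y) (H t y)) x =
  (vgrad (F t) x)^T *m H t x + (vgrad (H t) x)^T *m F t x.
Proof.
apply/colP => k; rewrite !mxE /dot.
rewrite (@pd_sum _ _ (fun l t y => F t y l 0 * H t y l 0))//; last first.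
  by move=> l; apply: smM; [exact: sF|exact: sH].
rewrite -big_split/=; apply: eq_bigr => l _.
by rewrite (pdM (sF l) (sH l) Otx) !mxE; ring.
Qed.

Lemma dt_dot : dt (fun r y => dot (F r y) (H r y)) t x =
  dot (F t x) (dtv H t x) + dot (H t x) (dtv F t x).
Proof.
rewrite /dot (@dt_sum _ _ (fun l t y => F t y l 0 * H t y l 0))//; last first.
  by move=> l; apply: smM; [exact: sF|exact: sH].
rewrite -big_split/=; apply: eq_bigr => l _.
by rewrite (dtM (sF l) (sH l) Otx) !mxE.
Qed.

Lemma vdivD : vdiv (fun y => F t y + H t y) x = vdiv (F t) x + vdiv (H t) x.
Proof.
rewrite /vdiv -big_split/=; apply: eq_bigr => k _.
rewrite -(pdD (sF k) (sH k) Otx); congr (pd k _ x).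
by apply/funext => y; rewrite mxE.
Qed.

Lemma vdivB : vdiv (fun y => F t y - H t y) x = vdiv (F t) x - vdiv (H t) x.
Proof.
rewrite /vdiv -sumrB; apply: eq_bigr => k _.
rewrite -(pdB (sF k) (sH k) Otx); congr (pd k _ x).
by apply/funext => y; rewrite !mxE.
Qed.

Lemma vdivZc a : vdiv (fun y => a *: F t y) x = a * vdiv (F t) x.
Proof.
rewrite /vdiv mulr_sumr; apply: eq_bigr => k _.
rewrite -(pdZ (sF k) Otx); congr (pd k _ x).
by apply/funext => y; rewrite mxE.
Qed.

Lemma vdiv_mulmx : vdiv (fun y => A t y *m F t y) x =
  dot (mdiv (fun y => (A t y)^T) x) (F t x) + frob (A t x)^T (vgrad (F t) x).
Proof.
have E k : pd k (fun y => (A t y *m F t y) k 0) x =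
   \sum_l (A t x k l * pd k (fun y => F t y l 0) x + F t x l 0 * pd k (fun y => A t y k l) x).
  transitivity (pd k (fun y => \sum_l A t y k l * F t y l 0) x).
    by congr (pd k _ x); apply/funext => y; rewrite mxE.
  rewrite (@pd_sum _ _ (fun l t y => A t y k l * F t y l 0))//; last first.
    by move=> l; apply: smM; [exact: sA|exact: sF].
  by apply: eq_bigr => l _; rewrite (pdM (sA k l) (sF l) Otx).
rewrite /vdiv; under eq_bigr do rewrite E; rewrite exchange_big/= /dot /frob -big_split/=.
apply: eq_bigr => l _; rewrite !mxE mulr_suml -big_split/=; apply: eq_bigr => k _.
rewrite !mxE addrC [F t x l 0 * _]mulrC; congr (_ * _ + _).
by congr (pd k _ x * _); apply/funext => y; rewrite mxE.
Qed.

Lemma mdiv_tr_vgrad : mdiv (fun y => (vgrad (F t) y)^T) x = grad (vdiv (F t)) x.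
Proof.
apply/colP => k; rewrite !mxE /vdiv.
rewrite (@pd_sum _ _ (fun l t y => pd l (fun y => F t y l 0) y))//; last first.
  by move=> l; exact: (sm_pd l (sF l)).
apply: eq_bigr => l _.
rewrite -(@pdC l k (fun t y => F t y l 0) t x (sF l) Otx); congr (pd l _ x).
by apply/funext => y; rewrite !mxE.
Qed.

End VectorRules.

End SmoothFields.

(** * Smooth fields times a cut-off as test functions *)

Section CutOff.
Variables (R : realType) (T : R) (O : set (R * pt3 R)).
Hypotheses (T0 : 0 < T) (oO : open O)
  (TO : forall t x, 0 <= t <= T -> O (t, x)).
Implicit Types (f g : R -> pt3 R -> R) (t : R) (x : pt3 R).
Local Notation sm := (sm O).
Local Notation smv := (smv O).

Let oTO t x : 0 < t < T -> O (t, x).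
Proof. by move=> /andP[t0 tT]; apply: TO; rewrite !ltW. Qed.

(** Nothing is known of [f] outside [O], but there the cut-off vanishes on a neighbourhood in time,
    so the product is locally zero. *)
Lemma cut_continuous (th : R -> R) (a c : R) f : 0 < a -> c < T ->
  (forall t, ~~ (a <= t <= c) -> th t = 0) -> continuous th -> sm f ->
  continuous (uncurried (fun t x => th t * f t x)).
Proof.
move=> a0 cT th0 cth sf [t x].
have [tT|tT] := boolP (0 < t < T).
  apply: (@cvgM _ _ _ _ (fun z : R * pt3 R => th z.1) (uncurried f)).
    apply: (@continuous_comp _ _ _ fst th); first exact: cvg_fst.
    exact: cth.
  exact: (sm_continuous sf (oTO x tT)).
have : \forall z \near (t, x), th z.1 = 0.
  have : t < a \/ c < t.
    case: (ltP t a) => [|at_]; first by left.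
    right; rewrite ltNge; apply: contra tT => tc.
    by rewrite (lt_le_trans a0 at_) (le_lt_trans tc cT).
  case=> [ta|ct].
    have : \forall s \near t, th s = 0.
      near=> s; apply: th0; rewrite negb_and -ltNge.
      by apply/orP; left; near: s; exact: lt_nbhsl.
    by move=> H; exact: (@cvg_fst _ _ (nbhs t) (nbhs x) _ _ H).
  have : \forall s \near t, th s = 0.
    near=> s; apply: th0; rewrite negb_and -!ltNge.
    by apply/orP; right; near: s; exact: lt_nbhsr.
  by move=> H; exact: (@cvg_fst _ _ (nbhs t) (nbhs x) _ _ H).
move=> H0; have tht : th t = 0 by exact: (nbhs_singleton H0).
rewrite /continuous_at {2}/uncurried /= tht mul0r.
apply: cvg_near_cst; apply: filterS H0 => -[s y] /= Hs.
by rewrite /uncurried /= Hs mul0r.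
Unshelve. all: by end_near. Qed.

Section Bump.
Variable th : R -> R.
Hypothesis bth : time_bump T th.

Let dth t : derivable th t 1. Proof. by case: bth. Qed.

Lemma cut_pd f k t x : sm f ->
  pd k (fun y => th t * f t y) x = th t * pd k (f t) x.
Proof.
move=> sf; have [tT|tT] := boolP (0 < t < T).
  by rewrite (pdZ sf (oTO x tT)).
rewrite (time_bump_out bth tT) mul0r /pd.
rewrite (_ : (fun y => _) = cst 0) ?derive_cst//.
by apply/funext => y; rewrite mul0r.
Qed.

Lemma cut_derivable f k t x : sm f -> derivable (fun y => th t * f t y) x (dir R k).
Proof.
move=> sf; have [tT|tT] := boolP (0 < t < T).
  apply: (@derivableZ _ _ _ (f t) (th t)).
  exact: sm_derivable sf (oTO x tT).
rewrite (_ : (fun y => _) = cst 0); first exact: derivable_cst.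
by apply/funext => y; rewrite (time_bump_out bth tT) mul0r.
Qed.

Lemma near_out t : ~~ (0 < t < T) -> \forall s \near t, th s = 0.
Proof.
move=> tT; have [_ _ _ [a [c [a0 cT th0]]]] := bth.
have : t < a \/ c < t.
  case: (ltP t a) => [|at_]; first by left.
  right; rewrite ltNge; apply: contra tT => tc.
  by rewrite (lt_le_trans a0 at_) (le_lt_trans tc cT).
case=> [ta|ct].
  near=> s; apply: th0; rewrite negb_and -ltNge.
  by apply/orP; left; near: s; exact: lt_nbhsl.
near=> s; apply: th0; rewrite negb_and -!ltNge.
by apply/orP; right; near: s; exact: lt_nbhsr.
Unshelve. all: by end_near. Qed.

Lemma cut_derivablet f t x : sm f -> derivable (fun s => th s * f s x) t 1.
Proof.
move=> sf; have [tT|tT] := boolP (0 < t < T).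
  apply: derivableM; first exact: dth.
  exact: (sm_derivablet sf (oTO x tT)).
apply: (@near_eq_derivable _ _ _ (cst 0)); last exact: derivable_cst.
by apply: filterS (near_out tT) => s /= ->; rewrite mul0r.
Qed.

Lemma cut_dt f t x : sm f ->
  dt (fun s y => th s * f s y) t x = derive1 th t * f t x + th t * dt f t x.
Proof.
move=> sf; rewrite /dt; have [tT|tT] := boolP (0 < t < T).
  have df := sm_derivablet sf (oTO x tT).
  by rewrite (@derive1_mul _ th (f ^~ x) t (@dth t) df) addrC.
rewrite (time_bump_out bth tT) (time_bump_derive_out bth tT) !mul0r addr0 derive1E.
rewrite (@near_eq_derive _ _ _ _ (cst 0)) ?derive_cst//.
by apply: filterS (near_out tT) => s /= ->; rewrite mul0r.
Qed.

(** Test functions must be regular on the whole of space-time, whereas the coefficients are only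
    controlled on [[0, T]]; multiplication by the cut-off makes them admissible in the weak
    equations. *)
Lemma cut_test_fun f : sm f -> (forall t, 0 <= t <= T -> Defs.periodic (f t)) ->
  test_fun (fun t x => th t * f t x).
Proof.
move=> sf pf; have [_ cdth th_ge0 [a [c [a0 cT th0]]]] := bth.
have cth := derivable_continuous dth.
have dth0 t : ~~ (a <= t <= c) -> derive1 th t = 0.
  rewrite negb_and -!ltNge => tac; rewrite derive1E.
  rewrite (@near_eq_derive _ _ _ th (cst 0)) ?derive_cst//.
  case/orP: tac => [ta|ct].
    near=> s; apply: th0; rewrite negb_and -ltNge.
    by apply/orP; left; near: s; exact: lt_nbhsl.
  near=> s; apply: th0; rewrite negb_and -!ltNge.
  by apply/orP; right; near: s; exact: lt_nbhsr.
have cut0 := cut_continuous a0 cT th0 cth.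
have cut1 := cut_continuous a0 cT dth0 cdth.
split.
- move=> t x k; have [tT|tT] := boolP (0 < t < T).
    by rewrite pf//; case/andP: tT => ? ?; rewrite !ltW.
  by rewrite (time_bump_out bth tT) !mul0r.
- exists T => t x Tt; rewrite (time_bump_out bth) ?mul0r//.
  by rewrite negb_and -!leNgt Tt orbT.
- exact: cut0.
- split; first by move=> t x; exact: cut_derivablet.
  have -> : (fun p : R * pt3 R => dt (fun t x => th t * f t x) p.1 p.2) =
    (fun p => uncurried (fun t x => derive1 th t * f t x) p +
              uncurried (fun t x => th t * dt f t x) p).
    by apply/funext => -[t x]; rewrite /= cut_dt.
  move=> z; apply: cvgD; first exact: cut1.
  by apply: cut0; exact: sm_dt.
- move=> k; have sk := sm_pd oO k sf.
  have E : (fun t => pd k (fun x => th t * f t x)) = (fun t x => th t * pd k (f t) x).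
    by apply/funext => t; apply/funext => x; exact: cut_pd.
  have E2 l : (fun t => pd l (pd k (fun x => th t * f t x))) =
      (fun t x => th t * pd l (pd k (f t)) x).
    apply/funext => t; apply/funext => x.
    have -> : pd k (fun x => th t * f t x) = (fun x => th t * pd k (f t) x).
      exact: (congr1 (@^~ t) E).
    exact: (cut_pd _ _ _ sk).
  split.
  + by move=> t x; exact: cut_derivable.
  + have -> : (fun p : R * pt3 R => pd k (fun x => th p.1 * f p.1 x) p.2) =
      uncurried (fun t x => th t * pd k (f t) x).
      by apply/funext => -[t x]; rewrite /= (cut_pd _ _ _ sf).
    exact: cut0.
  + move=> l; split.
      move=> t x.
      have -> : pd k (fun x => th t * f t x) = (fun x => th t * pd k (f t) x).
        exact: (congr1 (@^~ t) E).
      exact: (@cut_derivable (fun t => pd k (f t)) l t x sk).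
    have -> : (fun p : R * pt3 R => pd l (pd k (fun x => th p.1 * f p.1 x)) p.2) =
      uncurried (fun t x => th t * pd l (pd k (f t)) x).
      by apply/funext => -[t x]; rewrite /= -[RHS]/((fun t x => th t * pd l (pd k (f t)) x) t x) -E2.
    by apply: cut0; exact: sm_pd.
Unshelve. all: by end_near. Qed.

Lemma cut_test_field F : smv F -> (forall t, 0 <= t <= T -> Defs.periodic (F t)) ->
  test_field (fun t x => th t *: F t x).
Proof.
move=> sF pF k.
have -> : (fun t x => (th t *: F t x) k 0) = (fun t x => th t * F t x k 0).
  by apply/funext => t; apply/funext => x; rewrite mxE.
apply: cut_test_fun; first exact: sF.
by move=> t tT x l; rewrite pF.
Qed.

Lemma cut_grad f t x : sm f -> grad (fun y => th t * f t y) x = th t *: grad (f t) x.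
Proof. by move=> sf; apply/colP => k; rewrite !mxE cut_pd. Qed.

Lemma cut_entry_pd F k l t x : smv F ->
  pd l (fun y => (th t *: F t y) k 0) x = th t * pd l (fun y => F t y k 0) x.
Proof.
move=> sF; rewrite -(@cut_pd (fun t y => F t y k 0))//.
by congr (pd l _ x); apply/funext => y; rewrite mxE.
Qed.

Lemma cut_vgrad F t x : smv F -> vgrad (fun y => th t *: F t y) x = th t *: vgrad (F t) x.
Proof. by move=> sF; apply/matrixP => k l; rewrite !mxE cut_entry_pd. Qed.

Lemma cut_vdiv F t x : smv F -> vdiv (fun y => th t *: F t y) x = th t * vdiv (F t) x.
Proof.
by move=> sF; rewrite /vdiv mulr_sumr; apply: eq_bigr => k _; rewrite cut_entry_pd.
Qed.

Lemma cut_grad_vdiv F t x : smv F ->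
  grad (vdiv (fun y => th t *: F t y)) x = th t *: grad (vdiv (F t)) x.
Proof.
move=> sF; rewrite -(@cut_grad (fun t => vdiv (F t))); last exact: sm_vdiv.
by congr (grad _ x); apply/funext => y; exact: cut_vdiv.
Qed.

Lemma cut_dtv F t x : smv F ->
  dtv (fun s y => th s *: F s y) t x = derive1 th t *: F t x + th t *: dtv F t x.
Proof.
move=> sF; apply/colP => k; rewrite !mxE -(@cut_dt (fun s y => F s y k 0))//.
by congr (dt _ t x); apply/funext => s; apply/funext => y; rewrite mxE.
Qed.

End Bump.

End CutOff.

Section SmallVectorFacts.
Variable R : realType.
Implicit Types a b : 'cV[R]_3.

Lemma dotC a b : dot a b = dot b a.
Proof. by rewrite !dot3; ring. Qed.

Lemma tensor_mulmx a b e : tensor a b *m e = dot e b *: a.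
Proof. by apply/colP => k; rewrite !vecE; ring. Qed.

End SmallVectorFacts.

(** * The equilibrium system *)

Section EquilibriumFields.
Variables (R : realType) (n : nat) (T s gamma : R).
Variables (rhob : 'I_n -> R -> pt3 R -> R) (ub : R -> pt3 R -> 'cV[R]_3).
Variable O : set (R * pt3 R).
Hypotheses (s1 : -1 <= s) (oO : open O) (TO : forall t x, 0 <= t <= T -> O (t, x))
  (rhob0 : forall i t x, O (t, x) -> 0 < rhob i t x)
  (srho : forall i, sm O (rhob i)) (sU : smv O ub).
Implicit Types (i : 'I_n) (t : R) (x : pt3 R).
Local Notation sm := (sm O).
Local Notation smv := (smv O).
Local Notation smm := (smm O).
Local Notation V := (vb s rhob).
Local Notation c := ((s + 1) / 2).

Definition mub i t x := mu s (rhob i t x).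

Lemma sm_mub i : sm (mub i).
Proof. by apply: sm_powR => // t x; exact: rhob0. Qed.

Lemma vbE i t x : V i t x = (rhob i t x)^-1 *: grad (mub i t) x.
Proof. by []. Qed.

Lemma sm_rhobV i : sm (fun t x => (rhob i t x)^-1).
Proof. by apply: smV => // t x; exact: rhob0. Qed.

Lemma smv_vb i : smv (V i).
Proof.
by apply: (smvZ oO (sm_rhobV i)); apply: smv_grad => //; exact: sm_mub.
Qed.

Lemma grad_mub i t x : O (t, x) -> grad (mub i t) x = rhob i t x *: V i t x.
Proof.
by move=> Otx; rewrite vbE scalerA mulfV ?scale1r// gt_eqF// rhob0.
Qed.

Lemma vb_gradient i t x k : O (t, x) -> V i t x k 0 =
  (rhob i t x)^-1 * ((s + 3) / 2 * rhob i t x `^ ((s + 3) / 2 - 1)) * pd k (rhob i t) x.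
Proof.
move=> Otx; rewrite vbE !mxE -mulrA; congr (_ * _).
by rewrite /mub /mu (pd_powR (srho i) Otx)// => t' x'; exact: rhob0.
Qed.

(* grad mu(rhob) is a gradient and grad rhob is parallel to vb *)
Lemma vgrad_vb_sym i t x : O (t, x) -> (vgrad (V i t) x)^T = vgrad (V i t) x.
Proof.
move=> Otx; apply/matrixP => k l; rewrite !mxE.
have r0 : rhob i t x != 0 by rewrite gt_eqF// rhob0.
have E k' l' : rhob i t x * pd l' (fun y => V i t y k' 0) x =
    pd l' (pd k' (mub i t)) x - V i t x k' 0 * pd l' (rhob i t) x.
  have H := pdM (srho i) (smv_vb i k') Otx l'.
  rewrite -[LHS](addrK (V i t x k' 0 * pd l' (rhob i t) x)) -H; congr (_ - _).
  have D : pd l' (fun y => rhob i t y * V i t y k' 0) x = pd l' (pd k' (mub i t)) x.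
    rewrite /pd; apply: near_eq_derive.
    have : \forall z \near (t, x), O z by exact: open_nbhs_nbhs.
    move=> /nbhs_ballP[e /= e0 He]; apply/nbhs_ballP; exists e => //= y xy.
    have Oty : O (t, y) by apply: He; split => //=; exact: ballxx.
    have := congr1 (fun M : 'cV[R]_3 => M k' 0) (grad_mub i Oty).
    by rewrite [X in X = _]mxE [X in _ = X]mxE => /esym.
  exact: D.
apply: (mulfI r0); rewrite !E (pdC oO k l (sm_mub i) Otx).
by congr (_ - _); rewrite (vb_gradient i k Otx) (vb_gradient i l Otx) [LHS]mulrAC.
Qed.

(** The Laplacian of a curl-free field is the gradient of its divergence. The hypothesis concerns a
    whole time slice because functions on the slice are rewritten under the derivative. *)
Lemma mdiv_vgrad_vb i t x : 0 <= t <= T ->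
  mdiv (vgrad (V i t)) x = grad (vdiv (V i t)) x.
Proof.
move=> tT; rewrite -(mdiv_tr_vgrad oO (smv_vb i) (TO x tT)).
congr (mdiv _ x); apply/funext => y; rewrite vgrad_vb_sym//; exact: TO.
Qed.

Lemma sgrad_sym t x : (sgrad (ub t) x)^T = sgrad (ub t) x.
Proof. by rewrite /sgrad linearZ/= linearD/= trmxK addrC. Qed.

Lemma lamb_vdivE (F : R -> pt3 R -> 'cV[R]_3) i t : 0 <= t <= T ->
  (fun y => lam s (rhob i t y) * vdiv (F t) y) =
  (fun y => (s + 1) * (mub i t y * vdiv (F t) y)).
Proof.
move=> tT; apply/funext => y; rewrite lamE// ?mulrA//.
by apply/ltW/rhob0/TO.
Qed.

Lemma grad_lamb_vdiv (F : R -> pt3 R -> 'cV[R]_3) i t x : smv F -> 0 <= t <= T ->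
  grad (fun y => lam s (rhob i t y) * vdiv (F t) y) x =
  (s + 1) *: (mub i t x *: grad (vdiv (F t)) x
              + (rhob i t x * vdiv (F t) x) *: V i t x).
Proof.
move=> sF tT; have Otx := TO x tT; rewrite lamb_vdivE//.
have sd := sm_vdiv oO sF; have smu := sm_mub i.
rewrite (@gradZ _ _ (fun t y => mub i t y * vdiv (F t) y) t x _ Otx (s + 1)); last exact: smM.
rewrite (gradM (g := fun t => vdiv (F t)) smu sd Otx) grad_mub// scalerA.
by rewrite [vdiv _ _ * _]mulrC.
Qed.

Lemma mdiv_mub (A : R -> pt3 R -> 'M[R]_3) i t x : smm A -> O (t, x) ->
  mdiv (fun y => mu s (rhob i t y) *: A t y) x =
  mub i t x *: mdiv (A t) x + rhob i t x *: (A t x *m V i t x).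
Proof.
move=> sA Otx; rewrite (mdivZ (sm_mub i) sA Otx) grad_mub//.
by congr (_ + _); rewrite scalemxAr.
Qed.

(** Together with [divK_ub] and [divD_ub] this puts the stresses in the shape expected by
    [density_identity]: grad mu becomes [rhob *: V], and second derivatives appear only through
    gradients of divergences and the divergence of D(ub). *)
Lemma divS_vb i t x : 0 <= t <= T -> divS s (rhob i t) (V i t) x =
  (1 + c) * mub i t x *: grad (vdiv (V i t)) x
  + rhob i t x *: (vgrad (V i t) x *m V i t x)
  + c * rhob i t x * vdiv (V i t) x *: V i t x.
Proof.
move=> tT; have Otx := TO x tT; rewrite /divS.
rewrite (grad_lamb_vdiv i x (smv_vb i) tT).
rewrite (mdiv_mub i (smm_vgrad oO (smv_vb i)) Otx) mdiv_vgrad_vb//.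
move: (grad (vdiv (V i t)) x) (vgrad (V i t) x *m V i t x) (vdiv (V i t) x) (V i t x).
by move=> K W e v; apply/colP => k; rewrite !mxE; field.
Qed.

Lemma divK_ub i t x : 0 <= t <= T -> divK s (rhob i t) (ub t) x =
  (1 + c) * mub i t x *: grad (vdiv (ub t)) x
  + rhob i t x *: ((vgrad (ub t) x)^T *m V i t x)
  + c * rhob i t x * vdiv (ub t) x *: V i t x.
Proof.
move=> tT; have Otx := TO x tT; rewrite /divK (grad_lamb_vdiv i x sU tT).
rewrite (mdiv_mub i (smm_tr oO (smm_vgrad oO sU)) Otx) (mdiv_tr_vgrad oO sU Otx).
move: (grad (vdiv (ub t)) x) ((vgrad (ub t) x)^T *m V i t x) (vdiv (ub t) x) (V i t x).
by move=> K W e v; apply/colP => k; rewrite !mxE; field.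
Qed.

Lemma divD_ub i t x : 0 <= t <= T -> divD s (rhob i t) (ub t) x =
  2 *: (mub i t x *: mdiv (sgrad (ub t)) x
        + rhob i t x *: (sgrad (ub t) x *m V i t x))
  + (2 * c) *: (mub i t x *: grad (vdiv (ub t)) x
        + rhob i t x * vdiv (ub t) x *: V i t x).
Proof.
move=> tT; have Otx := TO x tT; rewrite /divD (grad_lamb_vdiv i x sU tT).
rewrite (mdiv_mub i (smm_sgrad oO sU) Otx).
move: (grad (vdiv (ub t)) x) (sgrad (ub t) x *m V i t x) (vdiv (ub t) x) (V i t x) (mdiv _ x).
by move=> K W e v A; apply/colP => k; rewrite !mxE; field.
Qed.

Lemma smm_tensor (F H : R -> pt3 R -> 'cV[R]_3) : smv F -> smv H ->
  smm (fun t x => tensor (F t x) (H t x)).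
Proof.
by move=> sF sH k l; apply: sm_ext (smM oO (sF k) (sH l)) => // t x _; rewrite tensorE.
Qed.

Definition dpress i t x := gamma * rhob i t x `^ (gamma - 1).

Lemma grad_press i t x : O (t, x) ->
  grad (press gamma \o rhob i t) x = dpress i t x *: grad (rhob i t) x.
Proof.
move=> Otx; apply/colP => k; rewrite !mxE.
by rewrite [LHS](pd_powR (srho i) Otx)// => t' x'; exact: rhob0.
Qed.

Lemma dt_press i t x : O (t, x) ->
  dt (fun t x => press gamma (rhob i t x)) t x = dpress i t x * dt (rhob i) t x.
Proof.
by move=> Otx; rewrite [LHS](dt_powR (srho i) Otx)// => t' x'; exact: rhob0.
Qed.

Section Equations.
Variable nu : R.
Hypothesis eqs : equilibrium_system T s gamma nu rhob ub.

Let tT0 t : 0 < t < T -> 0 <= t <= T.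
Proof. by move=> /andP[t0 tT]; rewrite !ltW. Qed.

Lemma equilibrium_mass i t x : 0 < t < T ->
  dt (rhob i) t x + dot (grad (rhob i t) x) (ub t x) + rhob i t x * vdiv (ub t) x = 0.
Proof.
move=> tT; have [+ _ _] := eqs i x tT.
rewrite (vdivZ (srho i) sU (TO x (tT0 tT))) => <-.
by rewrite dotC -addrA [dot _ _ + _]addrC.
Qed.

(** The mass equation turns the conservative form of the transport into the advective one. *)
Lemma transport_mdiv (F : R -> pt3 R -> 'cV[R]_3) i t x : smv F -> 0 < t < T ->
  dtv (fun r y => rhob i r y *: F r y) t x
  + mdiv (fun y => rhob i t y *: tensor (F t y) (ub t y)) x =
  rhob i t x *: (dtv F t x + vgrad (F t) x *m ub t x).
Proof.
move=> sF tT; have Otx := TO x (tT0 tT).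
rewrite (dtvZ (srho i) sF Otx) (mdivZ (srho i) (smm_tensor sF sU) Otx).
rewrite (mdiv_tensor sF sU Otx).
have mass := equilibrium_mass i x tT.
rewrite tensor_mulmx.
have -> : dt (rhob i) t x = - dot (grad (rhob i t) x) (ub t x) - rhob i t x * vdiv (ub t) x.
  by rewrite -[RHS]addr0 -mass; ring.
move: (dtv F t x) (vgrad (F t) x *m ub t x) (F t x) (dot _ _) (vdiv _ _) => A B e f g.
by apply/colP => k; rewrite !mxE; ring.
Qed.

Lemma equilibrium_momentum i t x : 0 < t < T ->
  rhob i t x *: (dtv ub t x + vgrad (ub t) x *m ub t x) =
  nu *: divD s (rhob i t) (ub t) x + divS s (rhob i t) (V i t) x
  - dpress i t x *: grad (rhob i t) x + remainder s gamma nu rhob ub i t x.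
Proof.
move=> tT; have [_ + _] := eqs i x tT.
rewrite (transport_mdiv i x sU tT) grad_press; last exact/TO/tT0.
rewrite /divD; move: (mdiv _ x) (grad (fun y => lam s _ * _) x) (divS _ _ _ _).
move: (remainder _ _ _ _ _ _ _ _) (dpress _ _ _ *: _) (_ *: (_ + _)).
move=> Z P X A B Y E; suff -> : nu *: (2 *: A + B) + Y - P + Z = Y + Z + nu *: (2 *: A + B) - P.
  by rewrite -E; apply/colP => k; rewrite !mxE; ring.
by apply/colP => k; rewrite !mxE; ring.
Qed.

Lemma equilibrium_drift i t x : 0 < t < T ->
  rhob i t x *: (dtv (V i) t x + vgrad (V i t) x *m ub t x) =
  - divK s (rhob i t) (ub t) x.
Proof.
move=> tT; have [_ _] := eqs i x tT.
by rewrite (transport_mdiv i x (smv_vb i) tT) => /eqP; rewrite addr_eq0 => /eqP.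
Qed.

End Equations.

Section Remainder.

(** Separating this part from the viscous part [remD] isolates the dependence of the remainder on
    [nu]: both fields have bounds free of it. *)
Definition remT i t x : 'cV[R]_3 :=
  (rhob i t x / \sum_j rhob j t x) *: (\sum_j divT s gamma (rhob j t) (V j t) x)
  - divT s gamma (rhob i t) (V i t) x.

Definition remD i t x : 'cV[R]_3 :=
  (rhob i t x / \sum_j rhob j t x) *: (\sum_j divD s (rhob j t) (ub t) x)
  - divD s (rhob i t) (ub t) x.

Lemma remainderE nu i t x :
  remainder s gamma nu rhob ub i t x = remT i t x + nu *: remD i t x.
Proof. by rewrite /remainder /remT /remD scalerBr scalerA addrA. Qed.

Lemma sum_rhob_gt0 i t x : O (t, x) -> 0 < \sum_j rhob j t x.
Proof.
move=> Otx; rewrite (bigD1 i)//= ltr_wpDr// ?rhob0// sumr_ge0// => j _.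
by rewrite ltW// rhob0.
Qed.

Lemma sum_remainder nu t x : O (t, x) ->
  \sum_i remainder s gamma nu rhob ub i t x = 0.
Proof.
move=> Otx.
have H (E : 'I_n -> 'cV[R]_3) :
    \sum_i ((rhob i t x / \sum_j rhob j t x) *: (\sum_j E j) - E i) = 0.
  rewrite sumrB -scaler_suml -mulr_suml.
  (* Without species the sum is empty; otherwise some index witnesses that the total density is
     positive and the fractions sum to one. *)
  have [z|nz] := eqVneq n 0%N.
    suff -> : \sum_j E j = 0 by rewrite scaler0 subr0.
    by rewrite big1// => i _; have := ltn_ord i; rewrite [X in (_ < X)%N]z.
  have i0 : 'I_n by rewrite -(prednK (n := n)) ?lt0n//; exact: ord0.
  by rewrite mulfV ?scale1r ?subrr// gt_eqF// (sum_rhob_gt0 i0).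
under eq_bigr do rewrite remainderE.
by rewrite big_split/= -scaler_sumr !H scaler0 addr0.
Qed.

Lemma sm_lamb i : sm (fun t x => lam s (rhob i t x)).
Proof.
apply: sm_ext (smZ oO (s + 1) (sm_mub i)) => // t x Otx.
by rewrite lamE// ltW// rhob0.
Qed.

Lemma smv_divT i : smv (fun t => divT s gamma (rhob i t) (V i t)).
Proof.
have sV := smv_vb i.
apply: smvB => //; last first.
  by apply: smv_grad => //; apply: sm_powR => // t x; exact: rhob0.
apply: smvD => //.
  by apply: smv_mdiv => //; apply: smmZ => //; [exact: sm_mub|exact: smm_vgrad].
apply: (smvZ oO (sm_cst O 2^-1)); apply: smv_grad => //.
by apply: smM => //; [exact: sm_lamb|exact: sm_vdiv].
Qed.

Lemma smv_divD i : smv (fun t => divD s (rhob i t) (ub t)).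
Proof.
apply: smvD => //.
  apply: (smvZ oO (sm_cst O 2)).
  by apply: smv_mdiv => //; apply: smmZ => //; [exact: sm_mub|exact: smm_sgrad].
apply: smv_grad => //.
by apply: smM => //; [exact: sm_lamb|exact: sm_vdiv].
Qed.

Lemma sm_fraction i : sm (fun t x => rhob i t x / \sum_j rhob j t x).
Proof.
apply: smM => //; apply: smV => //; last exact: sm_sum.
by move=> t x; exact: sum_rhob_gt0.
Qed.

Lemma smv_remT i : smv (remT i).
Proof.
apply: smvB => //; last exact: smv_divT.
apply: (smvZ oO (sm_fraction i)).
by apply: smv_sum => // j; exact: smv_divT.
Qed.

Lemma smv_remD i : smv (remD i).
Proof.
apply: smvB => //; last exact: smv_divD.
apply: (smvZ oO (sm_fraction i)).
by apply: smv_sum => // j; exact: smv_divD.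
Qed.

End Remainder.

Section Bounds.

Lemma sm_bounded f : sm f -> exists2 M, 0 < M &
  forall t x, 0 <= t <= T -> cube x -> `|f t x| <= M.
Proof.
move=> sf; have [z|M M0 H] := @compact_continuous_bounded R _ _ (uncurried f) (@compact_slab R T).
  move=> [/= zT cz]; apply: (sm_continuous sf); case: z zT cz => t x /= tT _.
  by apply: TO; move: tT; rewrite in_itv.
by exists M => // t x tT cx; apply: (H (t, x)); split.
Qed.

Lemma sm_bounded_family (I : finType) (f : I -> R -> pt3 R -> R) :
  (forall a, sm (f a)) -> exists2 M, 0 < M &
  forall a t x, 0 <= t <= T -> cube x -> `|f a t x| <= M.
Proof.
move=> sf.
have /choice[M HM] : forall a, exists M, 0 < M /\
    forall t x, 0 <= t <= T -> cube x -> `|f a t x| <= M.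
  by move=> i; have [M M0 H] := sm_bounded (sf i); exists M.
exists (1 + \sum_i M i).
  by rewrite ltr_wpDr// sumr_ge0// => i _; rewrite ltW//; case: (HM i).
move=> i t x tT cx; apply: le_trans ((HM i).2 t x tT cx) _.
rewrite (bigD1 i)//= addrCA lerDl addr_ge0// sumr_ge0// => j _.
by rewrite ltW//; case: (HM j).
Qed.

(** The positive lower bound is the inverse of an upper bound for [1 / rhob], which is smooth on [O]
    too. *)
Lemma rhob_bounds : exists b0 b1, [/\ 0 < b0, 0 < b1 &
  forall i t x, 0 <= t <= T -> cube x -> b0 <= rhob i t x <= b1].
Proof.
have [M1 M10 H1] := sm_bounded_family srho.
have [M2 M20 H2] := sm_bounded_family sm_rhobV.
exists M2^-1, M1; split => //; first by rewrite invr_gt0.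
move=> i t x tT cx; have r0 := rhob0 i (TO x tT); apply/andP; split.
  have := H2 i t x tT cx; rewrite normfV (gtr0_norm r0) => h.
  by rewrite -[leRHS]invrK lef_pV2 ?posrE// invr_gt0.
exact: le_trans (ler_norm _) (H1 i t x tT cx).
Qed.

Lemma sm_time_lipschitz f : sm f -> exists2 L, 0 < L &
  forall t r x, 0 <= t <= T -> 0 <= r <= T -> cube x -> `|f t x - f r x| <= L * `|t - r|.
Proof.
move=> sf; have [L L0 HL] := sm_bounded (sm_dt oO sf); exists L => //.
suff H t r x : r <= t -> 0 <= t <= T -> 0 <= r <= T -> cube x ->
    `|f t x - f r x| <= L * `|t - r|.
  move=> t r x tT rT cx; have [rt|tr] := leP r t; first exact: H.
  by rewrite distrC [`|t - r|]distrC; apply: H => //; exact: ltW.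
move=> rt tT rT cx.
have D u : 0 <= u <= T -> is_derive u 1 (f ^~ x) (dt f u x).
  move=> uT; have d := sm_derivablet sf (TO x uT).
  by rewrite /dt derive1E; exact: derivableP.
have rtT u : r <= u <= t -> 0 <= u <= T.
  move=> /andP[ru ut]; case/andP: tT => _ tT'; case/andP: rT => r0 _.
  by rewrite (le_trans r0 ru) (le_trans ut tT').
have [||u] := @MVT_segment R (f ^~ x) (fun u => dt f u x) r t rt.
- by move=> u; rewrite in_itv/= => /andP[ru ut]; apply: D; apply: rtT; rewrite !ltW.
- by apply: derivable_within_continuous => u; rewrite in_itv/= => /rtT/D[].
rewrite in_itv/= => /rtT uT ->; rewrite normrM ler_wpM2r//.
exact: HL.
Qed.

End Bounds.

End EquilibriumFields.

(** * Coercivity of the friction *)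

Section Coercivity.
Variables (R : realType) (n : nat) (b : 'M[R]_n).
Implicit Types (i j : 'I_n) (u : 'I_n -> 'cV[R]_3).

Let edge : rel 'I_n := [rel i j | (i != j) && (0 < b i j)].

(* Otherwise the indicator of a connected component would solve the linear
   system of condition A1 for unit densities. *)
Lemma conditionA1_connected : conditionA1 b -> forall i j, connect edge i j.
Proof.
move=> [sb b0 ker] i0 j0; apply/negPn/negP => nij.
pose v j : R := (connect edge i0 j)%:R.
have [+ _] := ker (fun=> 1) (fun=> ltr01) v.
case=> [i|c vc]; last first.
  have /eqP : v i0 = v j0 by rewrite !vc.
  by rewrite /v connect0 (negbTE nij) oner_eq0.
apply: big1 => j _; rewrite !mulr1.
have [<-|ij] := eqVneq i j; first by rewrite subrr mulr0.
have [bij|] := ltP 0 (b i j); last first.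
  by move=> bij; rewrite (le_anti (y := 0) (x := b i j)) ?mul0r// bij b0.
suff -> : v i = v j by rewrite subrr mulr0.
have eij : edge i j by apply/andP.
have eji : edge j i by apply/andP; split; rewrite 1?eq_sym// sb.
congr (nat_of_bool _)%:R; apply/idP/idP => h; apply: connect_trans h _; exact: connect1.
Qed.

Let Q u := \sum_i \sum_j b i j * sqnorm (u i - u j).

Lemma sqnorm_sub_le (x y z : 'cV[R]_3) :
  sqnorm (x - z) <= 2 * sqnorm (x - y) + 2 * sqnorm (y - z).
Proof.
rewrite /sqnorm !dot3 !mxE.
have := sqr_ge0 (x 0 0 - y 0 0 - (y 0 0 - z 0 0)).
have := sqr_ge0 (x 1 0 - y 1 0 - (y 1 0 - z 1 0)).
have := sqr_ge0 (x 2 0 - y 2 0 - (y 2 0 - z 2 0)).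
by rewrite !expr2; nra.
Qed.

Lemma sqnorm0 : sqnorm (0 : 'cV[R]_3) = 0.
Proof. by rewrite /sqnorm dot3 !mxE !mul0r !addr0. Qed.

Lemma friction_term_ge0 (r : 'I_n -> R) u i j : conditionA1 b ->
  (forall i, 0 <= r i) -> 0 <= b i j * r i * r j * sqnorm (u i - u j).
Proof.
move=> [_ b0 _] r0; have [<-|ij] := eqVneq i j.
  by rewrite subrr sqnorm0 mulr0.
by rewrite mulr_ge0 ?sqnorm_ge0// mulr_ge0// mulr_ge0// b0.
Qed.

(** Induction along a path of positive coefficients from [i] to [j]: each edge costs one term of
    [Q], divided by its coefficient. *)
Lemma difference_le : conditionA1 b -> forall i j,
  exists2 C, 0 <= C & forall u, sqnorm (u i - u j) <= C * Q u.
Proof.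
move=> A1; have bsq u i j : 0 <= b i j * sqnorm (u i - u j).
  by have := friction_term_ge0 u i j A1 (r := fun=> 1) (fun=> ler01); rewrite !mulr1.
have Qe u i j : b i j * sqnorm (u i - u j) <= Q u.
  rewrite /Q (bigD1 i)//= (bigD1 j)//= -addrA lerDl addr_ge0// ?sumr_ge0// => k _.
  by rewrite sumr_ge0.
have Q0 u : 0 <= Q u by apply: sumr_ge0 => i _; apply: sumr_ge0.
move=> i j; have /connectP[p] := conditionA1_connected A1 i j.
elim: p i => [|k p IH] i /=.
  by move=> _ ->; exists 0 => // u; rewrite subrr sqnorm0 mul0r.
move=> /andP[/andP[_ bik] /IH{}IH] /IH[C C0 H].
exists (2 * (b i k)^-1 + 2 * C).
  by rewrite addr_ge0// mulr_ge0// invr_ge0 ltW.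
move=> u; apply: le_trans (sqnorm_sub_le _ (u k) _) _.
rewrite [leRHS]mulrDl -[leRHS]/(_ + _); apply: lerD; rewrite -mulrA ler_pM2l//.
by rewrite -(ler_pM2l bik) [leRHS]mulrA mulfV ?mul1r ?gt_eqF.
Qed.

Lemma conditionA1_coercive (kst N : R) : conditionA1 b -> 0 < kst ->
  exists delta, 0 < delta /\ coercive b kst N delta.
Proof.
move=> A1 k0.
have /choice[C HC] : forall ij : 'I_n * 'I_n, exists C, 0 <= C /\
    forall u, sqnorm (u ij.1 - u ij.2) <= C * Q u.
  by move=> [i j]; have [C C0 H] := difference_le A1 i j; exists C.
pose A := 1 + \sum_i \sum_j C (j, i).
have A0 : 0 < A.
  rewrite ltr_pwDl// sumr_ge0// => i _; rewrite sumr_ge0// => j _.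
  by case: (HC (j, i)).
have NN : 0 < N ^+ 2 + 1 by rewrite ltr_wpDl// sqr_ge0.
(* The friction is compared with [Q], its value at unit densities: [kst ^+ 2] comes from the lower
   bound of the densities, [N ^+ 2] from the upper one, [A] from the path constants. The added ones
   keep the denominator positive in all cases. *)
exists (2^-1 * kst ^+ 2 / ((N ^+ 2 + 1) * A)); split.
  by rewrite divr_gt0 ?mulr_gt0 ?exprn_gt0// invr_gt0.
move=> r u rN; set U := _ *: _.
have r0 i : 0 < r i by have /andP[+ _] := rN i; exact: lt_le_trans.
have bsq i j : 0 <= b i j * sqnorm (u i - u j).
  by have := friction_term_ge0 u i j A1 (r := fun=> 1) (fun=> ler01); rewrite !mulr1.
have Q0 : 0 <= Q u by apply: sumr_ge0 => i _; apply: sumr_ge0.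
have up : \sum_i r i ^+ 2 * sqnorm (u i - U) <= (N ^+ 2 + 1) * (A * Q u).
  apply: (@le_trans _ _ (\sum_i (N ^+ 2 + 1) * \sum_j C (j, i) * Q u)).
    apply: ler_sum => i _; apply: ler_pM; rewrite ?sqr_ge0 ?sqnorm_ge0//.
      apply: ler_wpDr => //; have /andP[_ riN] := rN i; have ri := ltW (r0 i).
      by rewrite !expr2; apply: ler_pM.
    have -> : sqnorm (u i - U) = sqnorm (U - u i).
      by rewrite /sqnorm !dot3 !mxE; ring.
    apply: le_trans (sqnorm_mean_le u (u i) i r0) _.
    by apply: ler_sum => j _; case: (HC (j, i)).
  rewrite -mulr_sumr ler_pM2l//; under eq_bigr do rewrite -mulr_suml.
  by rewrite -mulr_suml ler_wpM2r// /A lerDr.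
have low : kst ^+ 2 * Q u <= \sum_i \sum_j b i j * r i * r j * sqnorm (u i - u j).
  rewrite mulr_sumr; apply: ler_sum => i _; rewrite mulr_sumr; apply: ler_sum => j _.
  have -> : b i j * r i * r j * sqnorm (u i - u j) =
      r i * r j * (b i j * sqnorm (u i - u j)) by ring.
  apply: ler_wpM2r => //; have k1 := ltW k0; rewrite expr2; apply: ler_pM => //.
    by case/andP: (rN i).
  by case/andP: (rN j).
apply: le_trans (ler_wpM2l _ up) _.
  by rewrite ltW// divr_gt0 ?mulr_gt0 ?exprn_gt0// invr_gt0.
rewrite [leLHS]mulrA.
have -> : 2^-1 * kst ^+ 2 / ((N ^+ 2 + 1) * A) * (N ^+ 2 + 1) * (A * Q u) =
    2^-1 * (kst ^+ 2 * Q u) by field; rewrite !gt_eqF.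
by rewrite ler_pM2l// invr_gt0.
Qed.

End Coercivity.

(** * The fundamental lemma on the torus *)

Section Periodization.
Variable R : realType.
Implicit Types (g : R -> R) (x y : R).

Definition periodization g y : R := g (y - (Num.floor y)%:~R).

Lemma periodizationD1 g y : periodization g (y + 1) = periodization g y.
Proof.
rewrite /periodization floorDrz// floor1; congr g.
by rewrite intrD opprD addrACA subrr addr0.
Qed.

Lemma periodizationE g y : 0 <= y < 1 -> periodization g y = g y.
Proof.
move=> y01; rewrite /periodization (_ : Num.floor y = 0) ?subr0//.
by apply: floor_def; rewrite add0r.
Qed.

(** Near [x] the floor of [y] is that of [x] or one less. In the second case both arguments of [g]
    fall outside []lo, hi[], one beyond [hi] and one below [lo], so both values are zero. Hence a
    periodization is locally a translate of [g] and inherits its regularity. *)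
Lemma near_periodization g lo hi x : 0 < lo -> hi < 1 ->
  (forall y, ~~ (lo < y < hi) -> g y = 0) ->
  \forall y \near x, g (y - (Num.floor x)%:~R) = periodization g y.
Proof.
move=> lo0 hi1 g0; have := floor_itv x; set m := Num.floor x.
rewrite intrD => /andP[mx xm].
near=> y.
have y1 : y < m%:~R + 1 by near: y; exact: lt_nbhsl.
have y0 : m%:~R - (1 - hi) < y.
  by near: y; apply: lt_nbhsr; lra.
have y2 : m%:~R - 1 < y by near: y; apply: lt_nbhsr; lra.
rewrite /periodization; have [my|ym] := leP m%:~R y.
  by rewrite (_ : Num.floor y = m)//; apply: floor_def; rewrite my intrD.
have -> : Num.floor y = m - 1.
  by apply: floor_def; rewrite subrK ym intrB andbT; exact: ltW.
by rewrite intrB !g0//; rewrite negb_and -!leNgt; apply/orP; [right|left]; lra.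
Unshelve. all: by end_near. Qed.

Lemma is_derive_periodization g dg lo hi x : 0 < lo -> hi < 1 ->
  (forall y, is_derive y 1 g (dg y)) ->
  (forall y, ~~ (lo < y < hi) -> g y = 0) ->
  is_derive x 1 (periodization g) (periodization dg x).
Proof.
move=> lo0 hi1 Dg g0.
apply: near_eq_is_derive (near_periodization x lo0 hi1 g0) _.
have D : is_derive x 1 (fun y => y - (Num.floor x)%:~R) (1 - 0).
  exact: is_deriveB.
have := @is_derive1_comp R g (fun y => y - (Num.floor x)%:~R) x _ _ (Dg _) D.
by rewrite subr0 mulr1.
Qed.

Lemma continuous_periodization g lo hi : 0 < lo -> hi < 1 -> continuous g ->
  (forall y, ~~ (lo < y < hi) -> g y = 0) -> continuous (periodization g).
Proof.
move=> lo0 hi1 cg g0 x.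
apply: cvg_trans (near_eq_cvg (near_periodization x lo0 hi1 g0)) _.
apply: (@continuous_comp _ _ _ (fun y => y - (Num.floor x)%:~R) g); last exact: cg.
by apply: cvgB; [exact: cvg_id|exact: cvg_cst].
Qed.

End Periodization.

(** * Continuously differentiable functions of the space variable *)

Section C1.
Variable R : realType.
Implicit Types f g : pt3 R -> R.

Definition C1 f :=
  (forall x, differentiable f x) /\ forall v, continuous (fun x => 'D_v f x).

Lemma C1_C1_periodic f : C1 f -> Defs.periodic f -> C1_periodic f.
Proof.
move=> [df cf] pf; split => //.
- by move=> x; exact: differentiable_continuous.
- by move=> x k; exact: diff_derivable.
- by move=> k; exact: cf.
Qed.

Lemma C1D f g : C1 f -> C1 g -> C1 (fun x => f x + g x).
Proof.
move=> [df cf] [dg cg]; split => [x|v]; first exact: differentiableD.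
have -> : (fun x => 'D_v (fun x => f x + g x) x) = (fun x => 'D_v f x + 'D_v g x).
  by apply/funext => x; rewrite deriveD//; exact: diff_derivable.
by move=> x; apply: cvgD; [exact: cf|exact: cg].
Qed.

Lemma C1M f g : C1 f -> C1 g -> C1 (fun x => f x * g x).
Proof.
move=> [df cf] [dg cg]; split => [x|v]; first exact: differentiableM.
have -> : (fun x => 'D_v (fun x => f x * g x) x) =
    (fun x => f x * 'D_v g x + g x * 'D_v f x).
  by apply/funext => x; rewrite deriveM//; exact: diff_derivable.
move=> x; apply: cvgD; apply: cvgM.
- exact: differentiable_continuous.
- exact: cg.
- exact: differentiable_continuous.
- exact: cf.
Qed.

Lemma C1_cst (a : R) : C1 (fun=> a).
Proof.
split=> [x|v]; first exact: differentiable_cst.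
have -> : (fun x => 'D_v (fun=> a) x) = (fun=> 0 : R).
  by apply/funext => x; exact: derive_cst.
exact: cst_continuous.
Qed.

Lemma C1_sum (I : Type) (s : seq I) (f : I -> pt3 R -> R) :
  (forall i, C1 (f i)) -> C1 (fun x => \sum_(i <- s) f i x).
Proof.
move=> cf; elim: s => [|i s IH].
  have -> : (fun x => \sum_(i <- [::]) f i x) = (fun=> 0).
    by apply/funext => x; rewrite big_nil.
  exact: C1_cst.
have -> : (fun x => \sum_(j <- i :: s) f j x) =
    (fun x => f i x + \sum_(j <- s) f j x).
  by apply/funext => x; rewrite big_cons.
exact: C1D.
Qed.

Lemma C1_comp (phi dphi : R -> R) f : (forall y : R, is_derive y 1 phi (dphi y)) ->
  continuous dphi -> C1 f -> C1 (fun x => phi (f x)).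
Proof.
move=> Dphi cdphi [df cf].
have dp y : differentiable phi y by apply/derivable1_diffP; case: (Dphi y).
have dc x : differentiable (phi \o f) x by exact: differentiable_comp.
split=> // v.
have -> : (fun x => 'D_v (phi \o f) x) = (fun x => dphi (f x) * 'D_v f x).
  apply/funext => x; rewrite (deriveE v (dc x)) (deriveE v (df x)).
  have E w : 'd phi (f x) w = w * dphi (f x).
    rewrite -(@derive_val _ _ _ _ _ _ _ (Dphi (f x))) deriveE// -{1}[w]mulr1.
    exact: linearZ.
  rewrite [RHS]mulrC; apply: etrans (E _).
  by have /= -> := @diff_comp _ _ _ _ f phi x (df x) (dp (f x)).
move=> x; apply: cvgM; last exact: cf.
apply: (@continuous_comp _ _ _ f dphi); last exact: cdphi.
exact: differentiable_continuous.
Qed.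

Lemma C1_linear (f : {linear pt3 R -> R}) : continuous f -> C1 f.
Proof.
move=> cf; split=> [x|v]; first exact: linear_differentiable.
have -> : (fun x => 'D_v f x) = (fun=> f v).
  apply/funext => x; rewrite deriveE ?diff_lin//; exact: linear_differentiable.
exact: cst_continuous.
Qed.

Lemma C1_coord1 : C1 (fun x => x.1.1).
Proof.
apply: (@C1_linear (fst \o fst : {linear pt3 R -> R})) => x /=.
apply: (@continuous_comp _ _ _ fst fst); exact: cvg_fst.
Qed.

Lemma C1_coord2 : C1 (fun x => x.1.2).
Proof.
apply: (@C1_linear (snd \o fst : {linear pt3 R -> R})) => x /=.
apply: (@continuous_comp _ _ _ fst snd); [exact: cvg_fst|exact: cvg_snd].
Qed.

Lemma C1_coord3 : C1 (fun x => x.2).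
Proof.
by apply: (@C1_linear (snd : {linear pt3 R -> R})) => x /=; exact: cvg_snd.
Qed.

End C1.

(** * Periodic bump functions and the exhaustion of open sets *)

Section PeriodicBoxes.
Variable R : realType.
Implicit Types (a b x y : R).

Definition bump a b y : R := pos2 (1 * y + - a) * pos2 (- 1 * y + b).
Definition dbump a b y : R :=
  pos2 (1 * y + - a) * (- 1 * (2 * Num.max (- 1 * y + b) 0))
  + pos2 (- 1 * y + b) * (1 * (2 * Num.max (1 * y + - a) 0)).

Lemma pos2_gt0 y : (0 < pos2 y) = (0 < y).
Proof.
rewrite /pos2; case: (leP y 0) => y0; first by rewrite expr0n ltxx.
by rewrite exprn_gt0.
Qed.

Lemma pos2_ge0 y : 0 <= pos2 y.
Proof. exact: sqr_ge0. Qed.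

Lemma bump_ge0 a b y : 0 <= bump a b y.
Proof. by rewrite mulr_ge0// pos2_ge0. Qed.

Lemma bump_gt0 a b y : (0 < bump a b y) = (a < y < b).
Proof.
rewrite lt_def mulf_eq0 negb_or mulr_ge0 ?pos2_ge0// andbT.
have P (z : R) : (pos2 z != 0) = (0 < z) by rewrite -(pos2_gt0 z) lt_def pos2_ge0 andbT.
by rewrite !P mul1r mulN1r subr_gt0 addrC subr_gt0.
Qed.

Lemma bump_out a b y : ~~ (a < y < b) -> bump a b y = 0.
Proof. by rewrite -bump_gt0 -leNgt => h; apply/eqP; rewrite eq_le h bump_ge0. Qed.

Lemma dbump_out a b y : ~~ (a < y < b) -> dbump a b y = 0.
Proof.
rewrite negb_and -!leNgt /dbump => /orP[ya|by_]; rewrite /pos2.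
  by rewrite (max_r (x := 1 * y + - a)) ?expr0n/=; [ring|lra].
by rewrite (max_r (x := - 1 * y + b)) ?expr0n/=; [ring|lra].
Qed.

Lemma is_derive_bump a b y : is_derive y 1 (bump a b) (dbump a b y).
Proof.
exact: is_deriveM (is_derive_pos2_affine (- a) 1 y) (is_derive_pos2_affine b (- 1) y).
Qed.

Lemma continuous_dbump a b : continuous (dbump a b).
Proof.
have caff (d e : R) : continuous (fun y : R => d * y + e).
  move=> y; apply: cvgD; last exact: cvg_cst.
  by apply: cvgMr; exact: cvg_id.
have cmax (d e : R) : continuous (fun y : R => Num.max (d * y + e) 0).
  move=> y; apply: (@continuous_max _ _ (fun y : R => d * y + e) (cst (0 : R))).
    exact: caff.
  exact: cst_continuous.
have cpos (d e : R) : continuous (fun y : R => pos2 (d * y + e)).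
  have -> : (fun y : R => pos2 (d * y + e)) =
      (fun y => Num.max (d * y + e) 0 * Num.max (d * y + e) 0).
    by apply/funext => y; rewrite /pos2 expr2.
  by move=> y; apply: cvgM; exact: cmax.
move=> y; apply: cvgD; apply: cvgM; do ?exact: cpos; apply: cvgMr; apply: cvgMr; exact: cmax.
Qed.

(** With [inner_hi] this keeps the support at distance [1 / (n + 1)] from 0 and 1, since periodizing
    preserves regularity only for supports inside the unit interval. As [n] grows the whole of []a,
    b[] inside the unit interval is recovered. *)
Definition inner_lo a (n : nat) : R := Num.max a n.+1%:R^-1.
Definition inner_hi b (n : nat) : R := Num.min b (1 - n.+1%:R^-1).
Definition pbump a b n : R -> R := periodization (bump (inner_lo a n) (inner_hi b n)).

Let lo0 a n : 0 < inner_lo a n.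
Proof. by rewrite /inner_lo lt_max invr_gt0 ltr0Sn orbT. Qed.

Let hi1 b n : inner_hi b n < 1.
Proof. by rewrite /inner_hi gt_min ltrBlDr ltrDl invr_gt0 ltr0Sn orbT. Qed.

Lemma C1_pbump a b n (f : pt3 R -> R) : C1 f -> C1 (fun z => pbump a b n (f z)).
Proof.
apply: (@C1_comp _ _ (periodization (dbump (inner_lo a n) (inner_hi b n)))).
  move=> y; apply: (is_derive_periodization _ (lo0 a n) (hi1 b n)).
    exact: is_derive_bump.
  exact: bump_out.
apply: (continuous_periodization (lo0 a n) (hi1 b n)); last exact: dbump_out.
exact: continuous_dbump.
Qed.

Lemma pbumpD1 a b n y : pbump a b n (y + 1) = pbump a b n y.
Proof. exact: periodizationD1. Qed.

Lemma pbump_ge0 a b n y : 0 <= pbump a b n y.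
Proof. exact: bump_ge0. Qed.

Lemma pbump_gt0 a b n y : 0 < y < 1 ->
  (0 < pbump a b n y) = (inner_lo a n < y < inner_hi b n).
Proof.
by move=> /andP[y0 y1]; rewrite /pbump periodizationE ?bump_gt0// (ltW y0) y1.
Qed.

Lemma pbump_gt0_in a b n y : 0 < y < 1 -> 0 < pbump a b n y -> a < y < b.
Proof.
move=> y01; rewrite pbump_gt0// /inner_lo /inner_hi gt_max lt_min.
by move=> /andP[/andP[-> _] /andP[-> _]].
Qed.

Lemma near_pbump_gt0 a b y : 0 < y < 1 -> a < y < b ->
  \forall n \near \oo, 0 < pbump a b n y.
Proof.
move=> y01 /andP[ay yb]; have /andP[y0 y1] := y01.
have y10 : 0 < 1 - y by rewrite subr_gt0.
near=> n; rewrite pbump_gt0// /inner_lo /inner_hi gt_max lt_min ay yb/=.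
have h1 : n.+1%:R^-1 < y by near: n; apply: near_infty_natSinv_lt (PosNum y0).
have h2 : n.+1%:R^-1 < 1 - y.
  by near: n; apply: near_infty_natSinv_lt (PosNum y10).
by rewrite h1/= ltrBrDr -ltrBrDl.
Unshelve. all: by end_near. Qed.

(* the open sets of the torus that are unions of supports of C1 functions *)
Definition open_cube : set (pt3 R) :=
  `]0, 1[%classic `*` `]0, 1[%classic `*` `]0, 1[%classic.

Definition C1_exhausted (U : set (pt3 R)) :=
  exists F : nat -> pt3 R -> R,
    (forall n, [/\ C1 (F n), Defs.periodic (F n) & forall x : pt3 R, 0 <= F n x]) /\
    forall x : pt3 R, open_cube x -> U x <-> exists n, 0 < F n x.

(** Countable unions are handled by enumerating pairs of indices, and open boxes by products of
    periodic bumps; [countable_basis_open] does the rest. *)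
Lemma open_C1_exhausted U : open U -> C1_exhausted U.
Proof.
apply: countable_basis_open; last first.
- move=> A HA.
  have /choice[F HF] : forall n, exists F : nat -> pt3 R -> R,
      (forall n, [/\ C1 (F n), Defs.periodic (F n) & forall x : pt3 R, 0 <= F n x]) /\
      forall x : pt3 R, open_cube x -> A n x <-> exists n, 0 < F n x by [].
  exists (fun k => if unpickle k is Some p then F p.1 p.2 else F 0%N 0%N); split.
    by move=> k; case: unpickle => [p|]; apply: (HF _).1.
  move=> x cx; split=> [[n _ /((HF n).2 x cx)[m Fm]]|[k]].
    by exists (pickle (n, m)); rewrite pickleK.
  case: unpickle => [p|] F0; [exists p.1|exists 0%N] => //; apply/(HF _).2 => //.
    by exists p.2.
  by exists 0%N.
- exists (fun _ _ => 0); split; last by move=> x _; split => // -[n]; rewrite ltxx.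
  by move=> n; split => //; exact: C1_cst.
pose itv := [set B : set R | exists a b, B = `]a, b[%classic].
apply: (@countable_basis_prod _ _ [set B | exists A1 A2, [/\ itv A1, itv A2 & B = A1 `*` A2]] itv).
- apply: countable_basis_prod; [exact: countable_basis_itv..|].
  by move=> A B HA HB; exists A, B.
- exact: countable_basis_itv.
move=> _ _ [_ [_ [[a1 [b1 ->]] [a2 [b2 ->]] ->]]] [a3 [b3 ->]].
exists (fun n (x : pt3 R) => pbump a1 b1 n x.1.1 * pbump a2 b2 n x.1.2 * pbump a3 b3 n x.2).
have g0 n (x : pt3 R) : 0 <= pbump a1 b1 n x.1.1 * pbump a2 b2 n x.1.2 by rewrite mulr_ge0// pbump_ge0.
split=> [n|x [[/= x1 x2] x3]].
  split.
  - apply: C1M; first by apply: C1M; apply: C1_pbump; [exact: C1_coord1|exact: C1_coord2].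
    by apply: C1_pbump; exact: C1_coord3.
  - have P a b y (c : bool) : pbump a b n (y + c%:R) = pbump a b n y.
      by case: c; rewrite ?addr0// pbumpD1.
    by move=> x k /=; rewrite !P.
  - by move=> x; rewrite mulr_ge0// pbump_ge0.
move: x1 x2 x3; rewrite !in_itv/= => x1 x2 x3; split.
  move=> [[y1 y2] y3].
  have H : \forall n \near \oo, 0 < pbump a1 b1 n x.1.1 * pbump a2 b2 n x.1.2 * pbump a3 b3 n x.2.
    near=> n; apply: mulr_gt0; first apply: mulr_gt0.
    + by near: n; exact: near_pbump_gt0.
    + by near: n; exact: near_pbump_gt0.
    + by near: n; exact: near_pbump_gt0.
  by have [n] := filter_ex H; exists n.
move=> [n F0].
have [p1 [p2 p3]] : [/\ 0 < pbump a1 b1 n x.1.1, 0 < pbump a2 b2 n x.1.2 & 0 < pbump a3 b3 n x.2].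
  by split; rewrite lt_def pbump_ge0 andbT; apply: contraTN F0 => /eqP->;
    rewrite ?mulr0 ?mul0r ?ltxx.
split; [split|].
- exact: pbump_gt0_in p1.
- exact: pbump_gt0_in p2.
- exact: pbump_gt0_in p3.
Unshelve. all: by end_near. Qed.

End PeriodicBoxes.

(** Dynkin's argument: the sets over which [f] integrates to zero are stable under complement and
    disjoint countable union, so they contain the sigma-algebra generated by the pi-system. *)
Lemma pi_system_ae0 d (T : measurableType d) (R : realType)
    (mu : {measure set T -> \bar R}) (D : set T) (f : T -> \bar R) (G : set (set T)) :
  measurable D -> mu.-integrable D f -> @measurable _ T = <<s G >> ->
  setI_closed G -> G setT -> (forall U, G U -> \int[mu]_(x in D `&` U) f x = 0)%E ->
  ae_eq mu D f (cst 0%E).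
Proof.
move=> mD itf mG GI GT G0.
have mf : measurable_fun D f by exact: measurable_int itf.
have H (A : set T) : measurable A -> (\int[mu]_(x in D `&` A) f x = 0)%E.
  rewrite [X in X A -> _]mG; move: A; apply: (dynkin_induction mG) => //.
  - exact: G0.
  - move=> A mA HA; have := G0 _ GT.
    have -> : D `&` setT = (D `&` A) `|` (D `&` ~` A) by rewrite -setIUr setUv.
    rewrite integral_setU; last 4 first.
    + exact: measurableI.
    + by apply: measurableI => //; exact: measurableC.
    + by rewrite -setIUr setUv setIT.
    + by apply/disj_setPS => x [[_ Ax] [_ nAx]].
    by rewrite HA add0e.
  - move=> F mF tF HF; rewrite setI_bigcupr integral_bigcup.
    + by rewrite eseries0// => n _ _; exact: HF.
    + exact: trivIset_setIl.
    + by move=> k; exact: measurableI.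
    + apply: integrableS itf => //.
        by apply: bigcupT_measurable => k; exact: measurableI.
      by rewrite -setI_bigcupr => x [].
apply: (integral_ae_eq mD itf) => [|E ED mE]; first exact: measurable_cst.
by rewrite integral0 -[RHS](H E mE); congr integral; apply/esym/setIidr.
Qed.

Lemma ae_trans d (T : measurableType d) (R : realType) (mu : {measure set T -> \bar R})
    (D E P : T -> Prop) : {ae mu, forall x, D x -> E x} ->
  {ae mu, forall x, E x -> P x} -> {ae mu, forall x, D x -> P x}.
Proof. by move=> aeD aeE; apply: filterS2 aeD aeE => x H1 H2 Dx; exact/H2/H1. Qed.

(** * Vanishing of an integrable function that is orthogonal to test functions *)

Section FundamentalLemma.
Variable R : realType.

(** A measurable rectangle is the intersection of two preimages under the coordinates. The maps [e1]
    and [e2] will be identities: they join the topological and the measurable structure of one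
    carrier. *)
Lemma measurable_sub_open_prod d1 d2 (T1 : measurableType d1) (T2 : measurableType d2)
    (S1 S2 : topologicalType) (e1 : S1 -> T1) (e2 : S2 -> T2)
    (G1 : set (set T1)) (G2 : set (set T2)) (M : set (set (S1 * S2))) :
  sigma_algebra setT M -> @measurable _ T1 = <<s G1 >> -> @measurable _ T2 = <<s G2 >> ->
  (forall A, G1 A -> M ((e1 \o fst) @^-1` A)) ->
  (forall A, G2 A -> M ((e2 \o snd) @^-1` A)) ->
  forall A, @measurable _ (T1 * T2)%type A -> M ((fun z => (e1 z.1, e2 z.2)) @^-1` A).
Proof.
move=> [M0 MC MU] m1 m2 H1 H2.
have pre (T : Type) (f : S1 * S2 -> T) : sigma_algebra setT [set A | M (f @^-1` A)].
  split; first by rewrite /= preimage_set0.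
    by move=> A /= MA; rewrite setTD preimage_setC -setTD; exact: MC.
  by move=> F MF /=; rewrite preimage_bigcup; exact: MU.
rewrite measurable_prod_measurableType.
apply: (@smallest_sub _ _ _ [set A | M ((fun z => (e1 z.1, e2 z.2)) @^-1` A)]).
  exact: pre.
move=> _ [B mB [C mC <-]] /=.
have -> : (fun z : S1 * S2 => (e1 z.1, e2 z.2)) @^-1` (B `*` C) =
    ((e1 \o fst) @^-1` B) `&` ((e2 \o snd) @^-1` C) by [].
have MI A D : M A -> M D -> M (A `&` D).
  move=> MA MD; have -> : A `&` D = setT `\` ((setT `\` A) `|` (setT `\` D)).
    by rewrite !setTD setCU !setCK.
  apply: (MC _ _); rewrite -bigcup2E; apply: (MU _ _) => -[|[|n]] //=; exact: MC.
apply: MI.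
  move: B mB; rewrite m1.
  by apply: (@smallest_sub _ _ _ [set A | M ((e1 \o fst) @^-1` A)]); [exact: pre|].
move: C mC; rewrite m2.
by apply: (@smallest_sub _ _ _ [set A | M ((e2 \o snd) @^-1` A)]); [exact: pre|].
Qed.

Lemma measurable_pt3_open : @measurable _ (pt3 R) = <<s [set U : set (pt3 R) | open U] >>.
Proof.
apply/seteqP; split; last first.
  apply: smallest_sub; last by move=> U /= oU; exact: open_measurable_pt3.
  by split => //; [move=> A mA; exact: measurableD|move=> F mF; exact: bigcupT_measurable].
have sO (S : topologicalType) : sigma_algebra setT <<s [set U : set S | open U] >>.
  exact: smallest_sigma_algebra.
have idE (S1 S2 : Type) (A : set (S1 * S2)) : (fun z => (id z.1, id z.2)) @^-1` A = A.
  by apply/seteqP; split => -[].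
have mR := RGenOpens.measurableE R.
have oR (A : set R) : @RGenOpens.G R A -> open A.
  by move=> [x [y ->]]; exact: interval_open.
have m2 A : @measurable _ (R * R)%type A -> <<s [set U : set (R * R) | open U] >> A.
  move=> mA; rewrite -[A](idE _ _ A); move: A mA.
  apply: (@measurable_sub_open_prod _ _ _ _ R R id id _ _ _ _ mR mR) => //.
    move=> B oB; apply: sub_sigma_algebra => /=; apply: open_comp; last exact: oR.
    by move=> z _; exact: cvg_fst.
  move=> B oB; apply: sub_sigma_algebra => /=; apply: open_comp; last exact: oR.
  by move=> z _; exact: cvg_snd.
have m2E : @measurable _ (R * R)%type = <<s [set U : set (R * R) | open U] >>.
  apply/seteqP; split => //; apply: smallest_sub; last by move=> U /= oU; exact: open_measurable_pt2.
  by split => //; [move=> A mA; exact: measurableD|move=> F mF; exact: bigcupT_measurable].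
move=> A mA; rewrite -[A](idE _ _ A); move: A mA.
apply: (@measurable_sub_open_prod _ _ _ _ (R * R)%type R id id _ _ _ _ m2E mR) => //.
  move=> B oB; apply: sub_sigma_algebra => /=; apply: open_comp; last exact: oB.
  by move=> z _; exact: cvg_fst.
move=> B oB; apply: sub_sigma_algebra => /=; apply: open_comp; last exact: oR.
by move=> z _; exact: cvg_snd.
Qed.

Lemma measurable_open_cube : measurable (@open_cube R).
Proof.
by apply: measurableX; [apply: measurableX|]; exact: measurable_itv.
Qed.

Lemma open_cube_sub : @open_cube R `<=` cube.
Proof.
move=> x [[/= x1 x2] x3]; move: x1 x2 x3; rewrite !in_itv/=.
move=> /andP[a1 b1] /andP[a2 b2] /andP[a3 b3].
by split; [split|]; rewrite /= in_itv/= !ltW.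
Qed.

Lemma leb3_open_cube : leb3 (@open_cube R) = 1%E.
Proof.
have mI : measurable (`]0, 1[%classic : set R) by exact: measurable_itv.
have msq : measurable ((`]0, 1[%classic : set R) `*` (`]0, 1[%classic : set R)).
  exact: measurableX.
pose I : set R := `]0, 1[%classic.
have -> : leb3 (@open_cube R) = (leb2 (I `*` I) * @lebesgue_measure R I)%E.
  exact: product_measure1E.
have -> : leb2 (I `*` I) = (@lebesgue_measure R I * @lebesgue_measure R I)%E.
  exact: product_measure1E.
have -> : @lebesgue_measure R I = 1%E.
  by rewrite /I lebesgue_measure_itv/= lte_fin ltr01 -EFinD subr0.
by rewrite !mule1.
Qed.

(** The cube and its interior both have measure one, so the faces are negligible; test functions
    exhaust open sets only inside the open cube. *)
Lemma ae_open_cube : {ae @leb3 R, forall x, cube x -> open_cube x}.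
Proof.
have mc := @measurable_cube R; have mo := measurable_open_cube.
exists (cube `\` @open_cube R); split.
- exact: measurableD.
- apply: (@etrans _ _ (leb3 cube - leb3 (cube `&` @open_cube R))%E).
    by apply: measureD => //; exact: leb3_cube_lty.
  have -> : cube `&` @open_cube R = @open_cube R by apply/setIidr/open_cube_sub.
  by rewrite leb3_open_cube leb3_cube subee.
- by move=> x /= /not_implyP.
Qed.

Lemma expR_decay (S : R) : 0 < S -> expR (- n%:R * S) @[n --> \oo] --> (0 : R).
Proof.
move=> S0; have -> : (fun n => expR (- n%:R * S)) = (fun n => expR (- S) ^+ n).
  by apply/funext => n; rewrite -expRM_natl mulNr -mulrN.
by apply: cvg_expr; rewrite ger0_norm ?expR_ge0// expR_lt1 oppr_lt0.
Qed.

Lemma C1_one_sub_expR (f : pt3 R -> R) (c : R) : C1 f ->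
  C1 (fun x => 1 - expR (- c * f x)).
Proof.
apply: (@C1_comp _ (fun y => 1 - expR (- c * y)) (fun y => c * expR (- c * y))).
  move=> y; have D : is_derive y 1 (fun y : R => - c * y) (- c).
    by apply: is_derive_eq; rewrite /GRing.scale/= ?(mulr1, mulr0, addr0, add0r).
  have D2 := @is_derive1_comp R expR (fun z => - c * z) y _ _ (is_derive_expR (- c * y)) D.
  have D3 := is_deriveB (is_derive_cst (1 : R) y 1) D2.
  by apply: is_derive_eq D3 _; ring.
move=> y; apply: cvgMr; apply: (@continuous_comp _ _ _ (fun y => - c * y) expR).
  by apply: cvgMr; exact: cvg_id.
exact: continuous_expR.
Qed.

Section Test.
Variable G : pt3 R -> R.
Hypotheses (iG : integ3 G)
  (G0 : forall chi, C1_periodic chi -> int3 (fun x => G x * chi x) = 0).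
Let D := @open_cube R.

(** The functions [h n] are admissible, take values in [[0, 1]] and converge on the open cube to the
    indicator of [U]: where some [F m] is positive the exponent tends to minus infinity, elsewhere
    it is zero. Dominated convergence then passes the orthogonality to the indicator. *)
Lemma test_open0 (U : set (pt3 R)) : open U ->
  (\int[leb3]_(x in D `&` U) (G x)%:E = 0)%E.
Proof.
move=> oU; have [F [HF UF]] := open_C1_exhausted oU.
have mc := @measurable_cube R.
pose S n x := \sum_(k < n) F k x.
pose h n x := 1 - expR (- n%:R * S n x).
have S0 n x : 0 <= S n x by apply: sumr_ge0 => k _; have [_ _] := HF k; apply.
have C1h n : C1 (h n).
  by apply: C1_one_sub_expR; apply: C1_sum => k; have [] := HF k.
have hE n : int3 (fun x => G x * h n x) = 0.
  apply: G0; apply: C1_C1_periodic => // x k; rewrite /h /S.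
  by under eq_bigr do rewrite (let: And3 _ p _ := HF _ in p).
have h01 n x : 0 <= h n x <= 1.
  rewrite /h subr_ge0 gerBl expR_ge0 andbT -expR0 ler_expR mulNr oppr_le0.
  by rewrite mulr_ge0.
have mh n : measurable_fun cube (h n).
  apply: continuous_measurable_pt3 => // x.
  by apply: differentiable_continuous; have [] := C1h n.
have ih n : integ3 (fun x => G x * h n x).
  apply: (integ3Mr (M := 1) iG) => // x _.
  by have /andP[h0 h1] := h01 n x; rewrite ger0_norm.
have mG := integ3_measurable iG.
have mA : measurable (D `&` U).
  by apply: measurableI; [exact: measurable_open_cube|exact: open_measurable_pt3].
have := @dominated_convergence _ _ _ leb3 cube mc (fun n x => (G x * h n x)%:E)
  ((EFin \o G) \_ (D `&` U)) (fun x => `|(G x)%:E|%E).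
case.
- by move=> n; apply/measurable_EFinP; exact: integ3_measurable.
- apply/(measurable_restrict _ mA mc); apply: measurable_funS mc (@subIsetl _ _ _) _.
  exact/measurable_EFinP.
- apply: (@ae_imp _ _ _ leb3 _ _ _ ae_open_cube) => x cx ox.
  rewrite patchE; have [xA|xA] := boolP (x \in D `&` U).
    have [_ Ux] := set_mem xA.
    have [m Fm] := (UF x ox).1 Ux.
    apply/cvg_EFin; first exact: nearW.
    rewrite /= -[X in _ --> X]mulr1; apply: cvgMr; rewrite -[X in _ --> X]subr0.
    apply: cvgB; first exact: cvg_cst.
    have c0 : (fun=> 0 : R) @ \oo --> (0 : R) by exact: cvg_cst.
    apply: (squeeze_cvgr _ c0 (expR_decay Fm)).
    near=> n; rewrite expR_ge0/= ler_expR !mulNr lerN2; apply: ler_wpM2l => //.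
    have mn : (m < n)%N by near: n; exact: nbhs_infty_gt.
    rewrite /S (bigD1 (Ordinal mn))//= lerDl sumr_ge0// => k _.
    by have [_ _] := HF k; apply.
  have F0 k : F k x = 0.
    apply/eqP; rewrite eq_le; have [_ _ ->] := HF k; rewrite andbT leNgt.
    apply: contra xA => Fk; apply/mem_set; split => //.
    by apply/(UF x ox); exists k.
  have -> : (fun n => (G x * h n x)%:E) = (fun=> 0%E).
    apply/funext => n; rewrite /h /S big1 => [|k _]; last exact: F0.
    by rewrite mulr0 expR0 subrr mulr0.
  exact: cvg_cst.
- exact: (@integrable_abse _ _ _ leb3 cube (EFin \o G)).
- apply: aeW => x n cx /=; rewrite lee_fin normrM ler_piMr//.
  by have /andP[h0 h1] := h01 n x; rewrite ger0_norm.
move=> _ _; have -> : [sequence (\int[leb3]_(x in cube) (G x * h n x)%:E)%E]_n = (fun=> 0%E).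
  by apply/funext => n /=; rewrite -int3_EFin// hE.
move=> H; have -> : D `&` U = cube `&` (D `&` U).
  by apply/esym/setIidr => x [/open_cube_sub].
rewrite integral_mkcondr; apply: (@cvg_unique _ _ _ _ _ _ H) => //.
exact: cvg_cst.
Unshelve. all: by end_near. Qed.

Lemma test_ae0 : {ae @leb3 R, forall x, cube x -> G x = 0}.
Proof.
have iD : leb3.-integrable D (EFin \o G).
  apply: (@integrableS _ _ _ leb3 cube) iG => //; first exact: measurable_cube.
    exact: measurable_open_cube.
  exact: open_cube_sub.
have mo := measurable_open_cube.
have := @pi_system_ae0 _ _ _ leb3 D (EFin \o G) _ mo iD measurable_pt3_open.
move=> /(_ _ openT test_open0) H.
have GI : setI_closed [set U : set (pt3 R) | open U].
  by move=> U W /= oU oW; exact: openI.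
have {}H : {ae @leb3 R, forall x, D x -> G x = 0}.
  by apply: (@ae_imp _ _ _ leb3 _ _ _ (H GI)) => x _ [].
exact: (@ae_trans _ _ _ leb3 _ _ _ ae_open_cube H).
Qed.

End Test.

End FundamentalLemma.

(** * The weak equations tested with smooth fields *)

Section SlabWeights.
Variables (R : realType) (T : R) (O : set (R * pt3 R)).
Hypotheses (T0 : 0 < T) (oO : open O) (TO : forall t x, 0 <= t <= T -> O (t, x)).
Implicit Types (f g : R -> pt3 R -> R) (th : R -> R).
Local Notation integS := (integ4 (slab T)).
Local Notation measS f := (measurable_fun (slab T) (fun z => f z.1 z.2)).

Lemma closed_slab_sub : `[0, T]%classic `*` @cube R `<=` O.
Proof. by move=> [t x] [/= + _]; rewrite in_itv/=; exact: TO. Qed.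

Lemma sm_slab_measurable f : sm O f -> measS f.
Proof.
move=> sf; apply: (continuous_slab_measurable oO closed_slab_sub) => z Oz.
exact: (sm_continuous sf Oz).
Qed.

Lemma sm_slab_integrable f : sm O f -> integS f.
Proof.
move=> sf; apply: (continuous_slab_integrable T0 oO closed_slab_sub) => z Oz.
exact: (sm_continuous sf Oz).
Qed.

Lemma integS_sm f g : integS f -> sm O g -> integS (fun t x => f t x * g t x).
Proof.
move=> itf sg; have [M M0 HM] := sm_bounded TO sg.
apply: (integSMr (M := M)) => //; first exact: sm_slab_measurable.
by move=> t x /andP[t0 tT] cx; apply: HM => //; rewrite !ltW.
Qed.

Lemma time_factor_measurable (c : R -> R) : continuous c -> measS (fun t (_ : pt3 R) => c t).
Proof.
move=> cc; apply: (@continuous_slab_measurable _ _ setT) => //; first exact: openT.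
move=> z _; apply: (@continuous_comp _ _ _ fst c); [exact: cvg_fst|exact: cc].
Qed.

Lemma integS_time (c : R -> R) f M : continuous c -> (forall t, `|c t| <= M) ->
  integS f -> integS (fun t x => c t * f t x).
Proof.
move=> cc cM itf.
have := integSMr (M := M) itf (time_factor_measurable cc) (fun t x _ _ => cM t).
by congr integrable; apply/funext => z; rewrite mulrC.
Qed.

Lemma integS_bump th f : time_bump T th -> integS f -> integS (fun t x => th t * f t x).
Proof.
move=> bth; have [dth _ _ _] := bth; have [M _ HM] := time_bump_bounded bth.
by apply: (integS_time (M := M)); [exact: derivable_continuous|move=> t; case: (HM t)].
Qed.

Lemma integS_dbump th f : time_bump T th -> integS f ->
  integS (fun t x => derive1 th t * f t x).
Proof.
move=> bth; have [_ cdth _ _] := bth; have [M _ HM] := time_bump_bounded bth.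
by apply: (integS_time (M := M)) => // t; case: (HM t).
Qed.

(* A space-time weak equation tested with a product: the part that does not see
   the time derivative of the cut-off is integrable, being a difference. *)
Lemma cut_split th F A B : time_bump T th -> integ4 cylinder F -> integS A ->
  (forall t x, F t x = derive1 th t * A t x + th t * B t x) ->
  [/\ integS (fun t x => th t * B t x) &
      int4 F = intS T (fun t x => derive1 th t * A t x) + intS T (fun t x => th t * B t x)].
Proof.
move=> bth iF iA FE; have iF' := integ4_cylinder_slab T iF.
have iA' := integS_dbump bth iA.
have iB : integS (fun t x => th t * B t x).
  apply: eq_integS (integSB iF' iA') => // t x _ _; by rewrite FE addrAC subrr add0r.
split => //; rewrite (@int4_slab _ T F); last first.
  move=> t x tT; rewrite FE (time_bump_out bth tT) (time_bump_derive_out bth tT).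
  by rewrite !mul0r addr0.
by rewrite -intSD//; apply: eq_intS => t x _ _; rewrite FE.
Qed.

Lemma cut_plain th F B : time_bump T th -> integ4 cylinder F ->
  (forall t x, F t x = th t * B t x) ->
  [/\ integS (fun t x => th t * B t x) & int4 F = intS T (fun t x => th t * B t x)].
Proof.
move=> bth iF FE; have iF' := integ4_cylinder_slab T iF.
have E : (fun t x => th t * B t x) = F by apply/funext => t; apply/funext => x; rewrite FE.
rewrite E; split => //; apply: int4_slab => t x tT.
by rewrite FE (time_bump_out bth tT) mul0r.
Qed.

End SlabWeights.

Section TestedEquations.
Variables (R : realType) (n : nat) (b : 'M[R]_n) (T s gamma nu eps : R) (w : state R n).
Variables (rhob : 'I_n -> R -> pt3 R -> R) (ub : R -> pt3 R -> 'cV[R]_3).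
Variable O : set (R * pt3 R).
Hypotheses (T0 : 0 < T) (s1 : -1 <= s) (g1 : 1 < gamma) (oO : open O)
  (TO : forall t x, 0 <= t <= T -> O (t, x))
  (rhob0 : forall i t x, O (t, x) -> 0 < rhob i t x)
  (srho : forall i, sm O (rhob i)) (sU : smv O ub)
  (prho : forall i t, 0 <= t <= T -> Defs.periodic (rhob i t))
  (pU : forall t, 0 <= t <= T -> Defs.periodic (ub t)).
Hypotheses (sb : forall i j, b i j = b j i) (ws : weak_solution b s gamma nu eps w).
Variable th : R -> R.
Hypothesis bth : time_bump T th.
Implicit Types (i : 'I_n) (t : R) (x : pt3 R).
Local Notation sm := (sm O).
Local Notation smv := (smv O).
Local Notation V := (vb s rhob).
Local Notation c := ((s + 1) / 2).
Local Notation integS := (integ4 (slab T)).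
Local Notation measS f := (measurable_fun (slab T) (fun z => f z.1 z.2)).
Local Notation r := (rho w).
Local Notation u := (vel w).
Local Notation v := (drf w).

Let sV i : smv (V i). Proof. exact: smv_vb. Qed.

Lemma periodic_pd (f : pt3 R -> R) k : Defs.periodic f -> Defs.periodic (pd k f).
Proof.
move=> pf x l; rewrite /pd /derive; congr (lim _).
suff -> : (fun h : R => h^-1 *: (f (h *: dir R k + (x + dir R l)) - f (x + dir R l))) =
          (fun h => h^-1 *: (f (h *: dir R k + x) - f x)) by [].
by apply/funext => h; rewrite addrA !pf.
Qed.

Lemma pV i t : 0 <= t <= T -> Defs.periodic (V i t).
Proof.
move=> tT x l; have E y j : rhob i t (y + dir R j) = rhob i t y := prho i tT y j.
rewrite !vbE E; congr (_ *: _); apply/colP => k; rewrite [LHS]mxE [RHS]mxE.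
by apply: (@periodic_pd (mub s rhob i t) k) => y j; rewrite /mub E.
Qed.

Let slab_meas (f : R -> pt3 R -> R) :
  measurable_fun cylinder (fun z => f z.1 z.2) -> measS f.
Proof.
apply: measurable_funS; [exact: measurable_cylinder|exact: slab_cylinder].
Qed.

Lemma rho_measurable i : measS (r i).
Proof. by have [/(_ i)[_ [mr _ _ _ _] _ _ _] _ _ _] := ws; exact: (@slab_meas (r i)). Qed.

Lemma vel_measurable i k : measS (fun t x => u i t x k 0).
Proof. by have [/(_ i)[_ [_ mu _ _ _] _ _ _] _ _ _] := ws; exact: (@slab_meas (fun t x => u i t x k 0)). Qed.

Lemma drf_measurable i k : measS (fun t x => v i t x k 0).
Proof. by have [/(_ i)[_ [_ _ mv _ _] _ _ _] _ _ _] := ws; exact: (@slab_meas (fun t x => v i t x k 0)). Qed.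

Lemma glam_measurable i k : measS (fun t x => glam w i t x k 0).
Proof. by have [/(_ i)[_ [_ _ _ _ mg] _ _ _] _ _ _] := ws; exact: (@slab_meas (fun t x => glam w i t x k 0)). Qed.

Lemma mom_measurable i k : measS (fun t x => mom w i t x k 0).
Proof.
have -> : (fun z : R * pt3 R => mom w i z.1 z.2 k 0) =
    (fun z => r i z.1 z.2 * u i z.1 z.2 k 0) by apply/funext => z; rewrite /mom mxE.
by apply: measurable_funM; [exact: rho_measurable|exact: vel_measurable].
Qed.

Lemma cap_measurable i k : measS (fun t x => cap w i t x k 0).
Proof.
have -> : (fun z : R * pt3 R => cap w i z.1 z.2 k 0) =
    (fun z => r i z.1 z.2 * v i z.1 z.2 k 0) by apply/funext => z; rewrite /cap mxE.
by apply: measurable_funM; [exact: rho_measurable|exact: drf_measurable].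
Qed.

Lemma rho_C0 i : C0_Lp 1 (r i).
Proof. by have [/(_ i)[_ _ [_ [+ _] _ _] _ _] _ _ _] := ws. Qed.

Lemma mom_C0 i k : C0_Lp 1 (fun t x => mom w i t x k 0).
Proof. by have [/(_ i)[_ _ [_ _ + _] _ _] _ _ _] := ws. Qed.

Lemma cap_C0 i k : C0_Lp 1 (fun t x => cap w i t x k 0).
Proof. by have [/(_ i)[_ _ [_ _ _ +] _ _] _ _ _] := ws. Qed.

Lemma integS_rho i : integS (r i).
Proof. exact: C0_L1_slab_integrable (rho_C0 i) (rho_measurable i). Qed.

Lemma integS_mom i k : integS (fun t x => mom w i t x k 0).
Proof. exact: C0_L1_slab_integrable (mom_C0 i k) (mom_measurable i k). Qed.

Lemma integS_cap i k : integS (fun t x => cap w i t x k 0).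
Proof. exact: C0_L1_slab_integrable (cap_C0 i k) (cap_measurable i k). Qed.

Lemma integS_mom_dot i F : smv F -> integS (fun t x => dot (mom w i t x) (F t x)).
Proof.
move=> sF; apply: (@integS_sum _ _ _ _ _ (fun k t x => mom w i t x k 0 * F t x k 0)) => k.
by apply: (integS_sm oO TO); [exact: integS_mom|exact: sF].
Qed.

Lemma integS_cap_dot i F : smv F -> integS (fun t x => dot (cap w i t x) (F t x)).
Proof.
move=> sF; apply: (@integS_sum _ _ _ _ _ (fun k t x => cap w i t x k 0 * F t x k 0)) => k.
by apply: (integS_sm oO TO); [exact: integS_cap|exact: sF].
Qed.

(* the coefficient of the density in the relative energy, see [rel_energyE] *)
Definition apot i t x : R :=
  2^-1 * sqnorm (ub t x) + 2^-1 * sqnorm (V i t x)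
  - gamma / (gamma - 1) * rhob i t x `^ (gamma - 1).

Definition dapot i t x : R :=
  dot (ub t x) (dtv ub t x) + dot (V i t x) (dtv (V i) t x)
  - dpress gamma rhob i t x / rhob i t x * dt (rhob i) t x.

Definition gapot i t x : 'cV[R]_3 :=
  (vgrad (ub t) x)^T *m ub t x + (vgrad (V i t) x)^T *m V i t x
  - (dpress gamma rhob i t x / rhob i t x) *: grad (rhob i t) x.

Lemma sm_rhob_powR i p : sm (fun t x => rhob i t x `^ p).
Proof. by apply: sm_powR => // t x; exact: rhob0. Qed.

Lemma sm_apot i : sm (apot i).
Proof.
apply: smB => //; first apply: smD => //.
- by apply: smZ => //; exact: sm_dot.
- by apply: smZ => //; exact: sm_dot.
- by apply: smZ => //; exact: sm_rhob_powR.
Qed.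

Lemma periodic_apot i t : 0 <= t <= T -> Defs.periodic (apot i t).
Proof. by move=> tT x k; rewrite /apot pU// pV// prho. Qed.

Lemma powR_div (z p : R) : 0 < z -> z `^ (p - 1) = z `^ p / z.
Proof. by move=> z0; rewrite powRD ?(gt_eqF z0) ?implybT// powR_inv1// ltW. Qed.

Let gz : gamma - 1 != 0.
Proof. by rewrite subr_eq0 gt_eqF. Qed.

Lemma dtZ f a t x : sm f -> O (t, x) -> dt (fun t x => a * f t x) t x = a * dt f t x.
Proof.
move=> sf Otx; rewrite (dtM (sm_cst O a) sf Otx) [X in _ + _ * X](_ : _ = 0) ?mulr0 ?addr0//.
by rewrite /dt derive1_cst.
Qed.

Lemma dt_apot i t x : O (t, x) -> dt (apot i) t x = dapot i t x.
Proof.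
move=> Otx; have rp := @rhob0 i; have r0 := rp _ _ Otx.
have sd1 : sm (fun t x => dot (ub t x) (ub t x)) by exact: sm_dot.
have sd2 : sm (fun t x => dot (V i t x) (V i t x)) by exact: sm_dot.
have sp := sm_rhob_powR i (gamma - 1).
have z1 := smZ oO 2^-1 sd1; have z2 := smZ oO 2^-1 sd2.
have z3 := smZ oO (- (gamma / (gamma - 1))) sp.
have -> : apot i = (fun t x => 2^-1 * dot (ub t x) (ub t x) + 2^-1 * dot (V i t x) (V i t x)
    + - (gamma / (gamma - 1)) * rhob i t x `^ (gamma - 1)).
  by apply/funext => t'; apply/funext => x'; rewrite mulNr.
rewrite (dtD (smD oO z1 z2) z3 Otx) (dtD z1 z2 Otx).
rewrite (dtZ _ sd1 Otx) (dtZ _ sd2 Otx) (dtZ _ sp Otx).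
rewrite (dt_dot oO sU sU Otx) (dt_dot oO (sV i) (sV i) Otx).
rewrite (dt_powR (srho i) Otx)// /dapot /dpress.
have -> : rhob i t x `^ (gamma - 1 - 1) = rhob i t x `^ (gamma - 1) / rhob i t x.
  exact: powR_div.
have r1 : rhob i t x != 0 by rewrite gt_eqF// r0.
by field; rewrite r1.
Qed.

Lemma grad_apot i t x : O (t, x) -> grad (apot i t) x = gapot i t x.
Proof.
move=> Otx; have rp := @rhob0 i; have r0 := rp _ _ Otx.
have sd1 : sm (fun t x => dot (ub t x) (ub t x)) by exact: sm_dot.
have sd2 : sm (fun t x => dot (V i t x) (V i t x)) by exact: sm_dot.
have sp := sm_rhob_powR i (gamma - 1).
have z1 := smZ oO 2^-1 sd1; have z2 := smZ oO 2^-1 sd2.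
have z3 := smZ oO (gamma / (gamma - 1)) sp.
rewrite /apot (gradB (smD oO z1 z2) z3 Otx) (gradD z1 z2 Otx).
rewrite (gradZ sd1 Otx) (gradZ sd2 Otx) (gradZ sp Otx).
rewrite (grad_dot oO sU sU Otx) (grad_dot oO (sV i) (sV i) Otx).
have -> : grad (fun y => rhob i t y `^ (gamma - 1)) x =
    ((gamma - 1) * rhob i t x `^ (gamma - 1 - 1)) *: grad (rhob i t) x.
  by apply/colP => k; rewrite !mxE (pd_powR (srho i) Otx).
have -> : rhob i t x `^ (gamma - 1 - 1) = rhob i t x `^ (gamma - 1) / rhob i t x.
  exact: powR_div.
rewrite /gapot /dpress; have r1 : rhob i t x != 0 by rewrite gt_eqF// r0.
move: (_ *m ub t x) (_ *m V i t x) (grad _ x) => A B C.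
by apply/colP => k; rewrite !mxE; field; rewrite r1.
Qed.

(** This and the next four definitions collect the coefficients of [th] when the weak equations are
    tested with the cut-off times the equilibrium fields. They stay whole because a weak equation
    asserts the integrability of its integrand and not of single terms. *)
Definition mass_part t x : R := \sum_i
  (r i t x * dapot i t x + dot (mom w i t x) (gapot i t x)).

Definition mom_part t x : R := \sum_i
  (dot (mom w i t x) (dtv ub t x)
   + frob (r i t x *: tensor (u i t x) (u i t x)) (vgrad (ub t) x)
   + press gamma (r i t x) * vdiv (ub t) x
   + mu s (r i t x) * dot (v i t x) (grad (vdiv (ub t)) x)
   + dot (cap w i t x) (vgrad (ub t) x *m v i t x)
   + 2^-1 * dot (glam w i t x) (v i t x) * vdiv (ub t) x
   + 2^-1 * lam s (r i t x) * dot (v i t x) (grad (vdiv (ub t)) x)).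

Definition visc_part t x : R := \sum_i
  (2 * mu s (r i t x) * frob (Dvel w i t x) (vgrad (ub t) x)
   + lam s (r i t x) * \tr (Dvel w i t x) * vdiv (ub t) x).

Definition drift_part t x : R := \sum_i
  (dot (cap w i t x) (dtv (V i) t x)
   + frob (r i t x *: tensor (v i t x) (u i t x)) (vgrad (V i t) x)).

Definition capil_part t x : R := \sum_i
  (mu s (r i t x) * dot (u i t x) (grad (vdiv (V i t)) x)
   + dot (cap w i t x) (vgrad (V i t) x *m u i t x)
   + 2^-1 * dot (glam w i t x) (u i t x) * vdiv (V i t) x
   + 2^-1 * lam s (r i t x) * dot (u i t x) (grad (vdiv (V i t)) x)).

Let th0 : th 0 = 0.
Proof. by apply: (time_bump_out bth); rewrite ltxx. Qed.

Lemma frobZr (a : R) (A B : 'M[R]_3) : frob A (a *: B) = a * frob A B.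
Proof. by rewrite !frob3 !mxE; ring. Qed.

Lemma tested_mass :
  [/\ integS (fun t x => th t * mass_part t x) &
     intS T (fun t x => derive1 th t * \sum_i r i t x * apot i t x)
     + intS T (fun t x => th t * mass_part t x) = 0].
Proof.
have [_ wm _ _] := ws.
have [|iF E] := wm (fun i t x => th t * apot i t x).
  by move=> i; apply: (cut_test_fun oO TO bth (sm_apot i)); exact: periodic_apot.
have iA : integS (fun t x => \sum_i r i t x * apot i t x).
  apply: integS_sum => i; apply: (integS_sm oO TO); [exact: integS_rho|exact: sm_apot].
have [//|iB EB] := cut_split bth iF iA (B := mass_part).
  move=> t x; rewrite /mass_part !mulr_sumr -big_split/=; apply: eq_bigr => i _.
  rewrite (cut_dt TO bth t x (sm_apot i)) (cut_grad TO bth t x (sm_apot i)) dotZr.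
  have [tT|tT] := boolP (0 < t < T).
    have Otx : O (t, x) by apply: TO; case/andP: tT => ? ?; rewrite !ltW.
    by rewrite dt_apot// grad_apot//; ring.
  by rewrite (time_bump_out bth tT); ring.
split => //; rewrite -EB; apply/eqP; rewrite -oppr_eq0 E; apply/eqP.
rewrite (eq_int3 (g := fun=> 0)); first by rewrite /int3 Rintegral0.
by move=> x _; rewrite big1// => i _; rewrite th0 mul0r mulr0.
Qed.

Lemma tested_momentum :
  [/\ integS (fun t x => th t * mom_part t x), integS (fun t x => th t * visc_part t x) &
     intS T (fun t x => derive1 th t * \sum_i dot (mom w i t x) (ub t x))
     + intS T (fun t x => th t * mom_part t x) = nu * intS T (fun t x => th t * visc_part t x)].
Proof.
have [_ _ wm _] := ws.
have [|iF iV _ E] := wm (fun i t x => th t *: ub t x).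
  by move=> i; exact: (cut_test_field oO TO bth sU).
have iA : integS (fun t x => \sum_i dot (mom w i t x) (ub t x)).
  by apply: integS_sum => i; exact: integS_mom_dot.
have [//|iB EB] := cut_split bth iF iA (B := mom_part).
  move=> t x; rewrite /mom_part !mulr_sumr -big_split/=; apply: eq_bigr => i _.
  rewrite (cut_dtv TO bth t x sU) (cut_vgrad TO bth t x sU).
  rewrite (cut_vdiv TO bth t x sU) (cut_grad_vdiv oO TO bth t x sU).
  rewrite dotDr !dotZr frobZr -scalemxAl dotZr; ring.
have [//|iW EW] := cut_plain (T := T) (B := visc_part) bth iV.
  move=> t x; rewrite /visc_part mulr_sumr; apply: eq_bigr => i _.
  by rewrite (cut_vgrad TO bth t x sU) (cut_vdiv TO bth t x sU) frobZr; ring.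
split => //; rewrite -EB -EW.
(* All species are tested with the same velocity, so by the symmetry of [b] the double sum is equal
   to its opposite. *)
have B0 : int4 (fun t x => \sum_i \sum_j b i j * r i t x * r j t x
      * dot (u i t x - u j t x) (th t *: ub t x)) = 0.
  rewrite -[RHS](@Rintegral0 R _ _ (@leb4 R) cylinder); congr (Rintegral _ _ _).
  apply/funext => -[t x] /=.
  set S := \sum_i _; suff : S = - S by move=> /eqP; rewrite -addr_eq0 -mulr2n mulrn_eq0 => /eqP.
  rewrite {1}/S exchange_big/= /S -sumrN; apply: eq_bigr => i _; rewrite -sumrN.
  apply: eq_bigr => j _; rewrite (sb j i) -[u j t x - u i t x]opprB.
  have -> (y z : 'cV[R]_3) : dot (- y) z = - dot y z by rewrite !dot3 !mxE; ring.
  ring.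
have R0 : int3 (fun x => \sum_i dot (mom w i 0 x) (th 0 *: ub 0 x)) = 0.
  rewrite (eq_int3 (g := fun=> 0)); first by rewrite /int3 Rintegral0.
  by move=> x _; rewrite big1// => i _; rewrite dotZr th0 mul0r.
move: E; rewrite R0 B0 mulr0 addr0 => /eqP; rewrite addrC subr_eq0 => /eqP <-; by [].
Qed.

Lemma tested_drift :
  [/\ integS (fun t x => th t * drift_part t x), integS (fun t x => th t * capil_part t x) &
     intS T (fun t x => derive1 th t * \sum_i dot (cap w i t x) (V i t x))
     + intS T (fun t x => th t * drift_part t x) = intS T (fun t x => th t * capil_part t x)].
Proof.
have [_ _ _ wm] := ws.
have [|iF iG E] := wm (fun i t x => th t *: V i t x).
  by move=> i; apply: (cut_test_field oO TO bth (sV i)); exact: pV.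
have iA : integS (fun t x => \sum_i dot (cap w i t x) (V i t x)).
  by apply: integS_sum => i; apply: integS_cap_dot; exact: sV.
have [//|iB EB] := cut_split bth iF iA (B := drift_part).
  move=> t x; rewrite /drift_part !mulr_sumr -big_split/=; apply: eq_bigr => i _.
  rewrite (cut_dtv TO bth t x (sV i)) (cut_vgrad TO bth t x (sV i)).
  rewrite dotDr !dotZr frobZr; ring.
have [//|iW EW] := cut_plain (T := T) (B := capil_part) bth iG.
  move=> t x; rewrite /capil_part mulr_sumr; apply: eq_bigr => i _.
  rewrite (cut_vgrad TO bth t x (sV i)) (cut_vdiv TO bth t x (sV i)).
  rewrite (cut_grad_vdiv oO TO bth t x (sV i)).
  by rewrite !dotZr -scalemxAl dotZr; ring.
split => //; rewrite -EB -EW.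
have R0 : int3 (fun x => \sum_i dot (cap w i 0 x) (th 0 *: V i 0 x)) = 0.
  rewrite (eq_int3 (g := fun=> 0)); first by rewrite /int3 Rintegral0.
  by move=> x _; rewrite big1// => i _; rewrite dotZr th0 mul0r.
by move: E; rewrite R0 => /eqP; rewrite addrC subr_eq0 => /eqP <-.
Qed.

End TestedEquations.

Lemma ae_all_imp d (S : measurableType d) (R : realType) (mu : {measure set S -> \bar R})
    (D : set S) (P Q : S -> Prop) : {ae mu, forall x, P x} ->
  (forall x, D x -> P x -> Q x) -> {ae mu, forall x, D x -> Q x}.
Proof. by move=> aeP PQ; apply: filterS aeP => x Px Dx; exact: PQ. Qed.

Lemma continuous_section (A B C : topologicalType) (f : A * B -> C) a x :
  {for (a, x), continuous f} -> {for x, continuous (fun y => f (a, y))}.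
Proof.
move=> cf; apply: (@continuous_comp _ _ _ (fun y => (a, y)) f); last exact: cf.
by apply: cvg_pair; [exact: cvg_cst|exact: cvg_id].
Qed.

(** * The gradient relations of a weak solution tested with smooth fields *)

Section TestedConstraints.
Variables (R : realType) (n : nat) (b : 'M[R]_n) (T s gamma nu eps : R) (w : state R n).
Variables (rhob : 'I_n -> R -> pt3 R -> R) (ub : R -> pt3 R -> 'cV[R]_3).
Variable O : set (R * pt3 R).
Hypotheses (T0 : 0 < T) (s1 : -1 <= s) (g1 : 1 < gamma) (oO : open O)
  (TO : forall t x, 0 <= t <= T -> O (t, x))
  (rhob0 : forall i t x, O (t, x) -> 0 < rhob i t x)
  (srho : forall i, sm O (rhob i)) (sU : smv O ub)
  (prho : forall i t, 0 <= t <= T -> Defs.periodic (rhob i t))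
  (pU : forall t, 0 <= t <= T -> Defs.periodic (ub t)).
Hypotheses (sb : forall i j, b i j = b j i) (ws : weak_solution b s gamma nu eps w).
Variable th : R -> R.
Hypothesis bth : time_bump T th.
Implicit Types (i : 'I_n) (t : R) (x : pt3 R).
Local Notation sm := (sm O).
Local Notation smv := (smv O).
Local Notation V := (vb s rhob).
Local Notation c := ((s + 1) / 2).
Local Notation integS := (integ4 (slab T)).
Local Notation measS f := (measurable_fun (slab T) (fun z => f z.1 z.2)).
Local Notation r := (rho w).
Local Notation u := (vel w).
Local Notation v := (drf w).

Let sV i : smv (V i). Proof. exact: smv_vb. Qed.
Let tT0 t : 0 < t < T -> 0 <= t <= T.
Proof. by move=> /andP[t0 tT]; rewrite !ltW. Qed.

Lemma sm_C1_periodic f t : sm f -> 0 <= t <= T -> Defs.periodic (f t) -> C1_periodic (f t).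
Proof.
move=> sf tT pf.
have cf g : sm g -> continuous (g t).
  by move=> sg x; exact: (continuous_section (sm_continuous sg (TO x tT))).
split => //; first exact: cf.
- by move=> x k; exact: sm_derivable sf (TO x tT).
- by move=> k; apply: (cf (fun t => pd k (f t))); exact: sm_pd.
Qed.

Lemma tested_time f : sm f -> (forall t, 0 <= t <= T -> Defs.periodic (f t)) ->
  intS T (fun t x => derive1 th t * f t x) + intS T (fun t x => th t * dt f t x) = 0.
Proof.
move=> sf pf; have [_ _ _ [dc cdc] _] := cut_test_fun oO TO bth sf pf.
have th0 : th 0 = 0 by apply: (time_bump_out bth); rewrite ltxx.
have thT : th T = 0 by apply: (time_bump_out bth); rewrite ltxx andbF.
have := slab_dt0 T0 dc cdc.
move=> /(_ (fun x => _) (fun x => _)) H; rewrite -intSD; last 2 first.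
- by apply: (integS_dbump bth); exact: (sm_slab_integrable T0 oO TO).
- by apply: (integS_bump bth); apply: (sm_slab_integrable T0 oO TO); exact: sm_dt.
rewrite -[RHS]H; first by apply: eq_intS => t x _ _; rewrite (cut_dt TO bth t x sf).
- by move=> x; rewrite th0 mul0r.
- by move=> x; rewrite thT mul0r.
Qed.

Lemma intS_sections0 f : integS (fun t x => th t * f t x) ->
  (forall t, 0 < t < T -> integ3 (f t) /\ int3 (f t) = 0) ->
  intS T (fun t x => th t * f t x) = 0.
Proof.
move=> itf H; rewrite intS_fubini//; last first.
  by move=> t tT; apply: integ3Zl; case: (H t tT).
rewrite -[RHS](@Rintegral0 R _ _ (@lebesgue_measure R) `]0, T[).
apply: eq_Rintegral => t /set_mem; rewrite /= in_itv/= => /H[it it0].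
by rewrite int3Zl// it0 mulr0.
Qed.

Lemma tested_divergence F : smv F -> (forall t, 0 <= t <= T -> Defs.periodic (F t)) ->
  [/\ integS (fun t x => th t * vdiv (F t) x) &
     intS T (fun t x => th t * vdiv (F t) x) = 0].
Proof.
move=> sF pF.
have iF : integS (fun t x => th t * vdiv (F t) x).
  by apply: (integS_bump bth); apply: (sm_slab_integrable T0 oO TO); exact: sm_vdiv.
split => //; apply: intS_sections0 => // t tT.
have C1 k : C1_periodic (fun x => F t x k 0).
  apply: (sm_C1_periodic (f := fun t x => F t x k 0)) (sF k) (tT0 tT) _.
  by move=> x l; rewrite pF//; exact: tT0.
have ik k : integ3 (pd k (fun x => F t x k 0)).
  by apply: continuous_cube_integrable; have [_ _ _] := C1 k; apply.
split; first exact: integ3_sum.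
by rewrite int3_sum// big1// => k _; exact: int3_pd.
Qed.

(** The index computation behind [visc_flux], isolated from the analysis: [B] is a matrix with
    symmetric part [S], and [dA k l j] is the derivative along axis [j] of its entry [(k, l)]. *)
Lemma symgrad_algebra (S B : 'M[R]_3) (L K a J : 'cV[R]_3) (d m z : R)
    (dA : 'I_3 -> 'I_3 -> 'I_3 -> R) :
  (forall k l, S k l = 2^-1 * (B k l + B l k)) ->
  (forall k, L k 0 = 2^-1 * (\sum_l dA k l l + \sum_l dA l k l)) ->
  m * dot a (2 *: L + z *: K) + dot J (2 *: (S *m a) + (z * d) *: a) =
  2^-1 * \sum_k \sum_l (m * (a k 0 * (2 * dA k l l + z * (k == l)%:R * K l 0)
      + a l 0 * (2 * dA k l k + z * (k == l)%:R * K k 0))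
    + (J l 0 * a k 0 + J k 0 * a l 0) * (2 * B k l + z * (k == l)%:R * d)).
Proof.
move=> SE LE; rewrite !vecE !SE !LE !sum3 /=.
by field.
Qed.

Section Viscous.

(** [A] will be the full gradient of [ub], as the momentum equation has it, and D(ub), as the
    completed square requires. [Dvel] is not assumed symmetric, so the two are compared through the
    common value [visc_flux]. *)
Definition visc_test (A : R -> pt3 R -> 'M[R]_3) t x : R := \sum_i
  (2 * mu s (r i t x) * frob (Dvel w i t x) (A t x)
   + (s + 1) * mu s (r i t x) * \tr (Dvel w i t x) * vdiv (ub t) x).

Definition visc_flux t x : R := \sum_i
  (mu s (r i t x) * dot (u i t x) (2 *: mdiv (sgrad (ub t)) x + (s + 1) *: grad (vdiv (ub t)) x)
   + dot (cap w i t x) (2 *: (sgrad (ub t) x *m u i t x) + ((s + 1) * vdiv (ub t) x) *: u i t x)).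

Variable A : R -> pt3 R -> 'M[R]_3.
Hypotheses (sA : smm O A) (pA : forall t, 0 <= t <= T -> Defs.periodic (A t))
  (AS : forall t x, 0 <= t <= T -> A t x + (A t x)^T = 2 *: sgrad (ub t) x)
  (dAS : forall t x, 0 <= t <= T ->
    mdiv (A t) x + mdiv (fun y => (A t y)^T) x = 2 *: mdiv (sgrad (ub t)) x).

Let f k l t x := 2 * A t x k l + (s + 1) * (k == l)%:R * vdiv (ub t) x.

Let sd : sm (fun t => vdiv (ub t)). Proof. exact: sm_vdiv. Qed.

Let sf k l : sm (f k l).
Proof. by apply: smD => //; apply: smZ => //; exact: sA. Qed.

Let pf k l t : 0 <= t <= T -> Defs.periodic (f k l t).
Proof.
move=> tT x j; rewrite /f pA//; congr (_ + _ * _).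
apply: eq_bigr => m _; apply: (@periodic_pd _ (fun y => ub t y m 0)) => y j'.
by rewrite pU.
Qed.

Let pdf k l j t x : 0 <= t <= T -> pd j (f k l t) x =
  2 * pd j (fun y => A t y k l) x + (s + 1) * (k == l)%:R * pd j (vdiv (ub t)) x.
Proof.
move=> tT; have Otx := TO x tT.
rewrite (pdD (smZ oO 2 (sA k l)) (smZ oO ((s + 1) * (k == l)%:R) sd) Otx).
by rewrite (pdZ (sA k l) Otx) (pdZ sd Otx).
Qed.

Let rhs i k l t x :=
  mu s (r i t x) * (u i t x k 0 * pd l (f k l t) x + u i t x l 0 * pd k (f k l t) x)
  + (cap w i t x l 0 * u i t x k 0 + cap w i t x k 0 * u i t x l 0) * f k l t x.

Let lhs i k l t x := mu s (r i t x) * Dvel w i t x k l * f k l t x.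

Let entry i k l : [/\ integS (fun t x => th t * lhs i k l t x),
    integS (fun t x => th t * rhs i k l t x) &
    intS T (fun t x => th t * lhs i k l t x) =
    - (2^-1 * intS T (fun t x => th t * rhs i k l t x))].
Proof.
have [/(_ i)[_ _ _ [_ _ wsg] _] _ _ _] := ws.
have [i1 i2 E] := wsg k l _ (cut_test_fun oO TO bth (@sf k l) (@pf k l)).
have [|j1 E1] := cut_plain (T := T) (B := lhs i k l) bth i1.
  by move=> t x; rewrite /lhs; ring.
have [|j2 E2] := cut_plain (T := T) (B := rhs i k l) bth i2.
  move=> t x.
  have P j : pd j (fun y => th t * f k l t y) x = th t * pd j (f k l t) x.
    exact: (cut_pd TO bth j t x (@sf k l)).
  rewrite !P /rhs; move: (pd k _ x) (pd l _ x) (f k l t x) => X Y Z; ring.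
by split => //; rewrite -E1 -E2.
Qed.

Let lhsE t x : visc_test A t x = \sum_i \sum_k \sum_l lhs i k l t x.
Proof.
apply: eq_bigr => i _; rewrite /lhs /f trmx3 frob3 !sum3 /=; ring.
Qed.

Let rhsE t x : 0 <= t <= T -> visc_flux t x = 2^-1 * \sum_i \sum_k \sum_l rhs i k l t x.
Proof.
move=> tT; rewrite mulr_sumr; apply: eq_bigr => i _.
have M k : \sum_l pd l (fun y => A t y k l) x + \sum_l pd l (fun y => A t y l k) x =
    2 * mdiv (sgrad (ub t)) x k 0.
  have := congr1 (fun M : 'cV[R]_3 => M k 0) (dAS x tT); rewrite [X in X = _]mxE [X in _ = X]mxE.
  have md (B : pt3 R -> 'M[R]_3) : mdiv B x k 0 = \sum_l pd l (fun y => B y k l) x.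
    by rewrite mxE.
  move=> <-; rewrite !md; congr (_ + _).
  apply: eq_bigr => l _; congr (pd l _ x); by apply/funext => y; rewrite mxE.
have E k l : A t x k l + A t x l k = 2 * sgrad (ub t) x k l.
  by have := congr1 (fun M : 'M[R]_3 => M k l) (AS x tT); rewrite !mxE.
have H k : grad (vdiv (ub t)) x k 0 = pd k (vdiv (ub t)) x by rewrite mxE.
have {}M k : mdiv (sgrad (ub t)) x k 0 =
    2^-1 * (\sum_l pd l (fun y => A t y k l) x + \sum_l pd l (fun y => A t y l k) x).
  by rewrite M mulKf.
have {}E k l : sgrad (ub t) x k l = 2^-1 * (A t x k l + A t x l k) by rewrite E mulKf.
rewrite /rhs; under eq_bigr => k _ do under eq_bigr => l _ do rewrite !pdf// -!H /f.
move: (sgrad (ub t) x) (mdiv _ x) (grad _ x) (vdiv (ub t) x) E M => S L K d E M.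
pose dA k l j := pd j (fun y => A t y k l) x.
have {}M k : L k 0 = 2^-1 * (\sum_l dA k l l + \sum_l dA l k l) by exact: M.
under eq_bigr => k _ do under eq_bigr => l _ do
  rewrite -[pd l (fun y => A t y k l) x]/(dA k l l) -[pd k (fun y => A t y k l) x]/(dA k l k).
move: (u i t x) (cap w i t x) (mu s (r i t x)) => a J m; clearbody dA.
exact: symgrad_algebra.
Qed.

(** Summed over the entries, the right-hand side of the weak definition of D(u) sees only the
    symmetric part of [A] and its divergence; these are prescribed by [AS] and [dAS]. *)
Lemma tested_symgrad :
  [/\ integS (fun t x => th t * visc_test A t x), integS (fun t x => th t * visc_flux t x) &
     intS T (fun t x => th t * visc_test A t x) = - intS T (fun t x => th t * visc_flux t x)].
Proof.
pose L t x := \sum_i \sum_k \sum_l th t * lhs i k l t x.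
pose H t x := 2^-1 * \sum_i \sum_k \sum_l th t * rhs i k l t x.
have LE t x : L t x = th t * visc_test A t x.
  rewrite lhsE mulr_sumr; apply: eq_bigr => i _; rewrite mulr_sumr.
  by apply: eq_bigr => k _; rewrite mulr_sumr.
have HE t x : 0 < t < T -> H t x = th t * visc_flux t x.
  move=> tT; rewrite rhsE; last exact: tT0.
  rewrite mulrCA; congr (_ * _); rewrite mulr_sumr; apply: eq_bigr => i _.
  by rewrite mulr_sumr; apply: eq_bigr => k _; rewrite mulr_sumr.
have iL i k l : integS (fun t x => th t * lhs i k l t x) by have [] := entry i k l.
have iH i k l : integS (fun t x => th t * rhs i k l t x) by have [] := entry i k l.
have iL2 i k : integS (fun t x => \sum_l th t * lhs i k l t x) by exact: integS_sum.
have iH2 i k : integS (fun t x => \sum_l th t * rhs i k l t x) by exact: integS_sum.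
have iL1 i : integS (fun t x => \sum_k \sum_l th t * lhs i k l t x) by exact: integS_sum.
have iH1 i : integS (fun t x => \sum_k \sum_l th t * rhs i k l t x) by exact: integS_sum.
have iH0 : integS (fun t x => \sum_i \sum_k \sum_l th t * rhs i k l t x) by exact: integS_sum.
split.
- by apply: eq_integS (integS_sum _ _ iL1) => t x _ _; rewrite -LE.
- by apply: eq_integS (integSZl 2^-1 iH0) => t x tT _; rewrite -HE.
rewrite -(eq_intS (f := L)); last by move=> t x _ _; exact: LE.
have -> : intS T (fun t x => th t * visc_flux t x) = intS T H.
  by apply: eq_intS => t x tT _; rewrite HE.
rewrite /L /H intSZl// !intS_sum// mulr_sumr -sumrN; apply: eq_bigr => i _.
rewrite !intS_sum// mulr_sumr -sumrN; apply: eq_bigr => k _.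
rewrite !intS_sum// mulr_sumr -sumrN; apply: eq_bigr => l _.
by have [] := entry i k l.
Qed.

End Viscous.

Lemma tested_symgrad_vgrad :
  [/\ integS (fun t x => th t * visc_test (fun t => vgrad (ub t)) t x),
     integS (fun t x => th t * visc_flux t x) &
     intS T (fun t x => th t * visc_test (fun t => vgrad (ub t)) t x) =
     - intS T (fun t x => th t * visc_flux t x)].
Proof.
apply: tested_symgrad.
- exact: smm_vgrad.
- move=> t tT x j; apply/matrixP => k l; rewrite !mxE.
  by apply: (@periodic_pd _ (fun y => ub t y k 0)) => y j'; rewrite pU.
- by move=> t x _; rewrite scalerA mulfV// scale1r.
move=> t x tT; have Otx := TO x tT; apply/colP => k; rewrite !mxE mulr_sumr -big_split/=.
apply: eq_bigr => l _; rewrite /sgrad.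
have sG := smm_vgrad oO sU.
have -> : (fun y => (2^-1 *: (vgrad (ub t) y + (vgrad (ub t) y)^T)) k l) =
    (fun y => 2^-1 * (vgrad (ub t) y k l + vgrad (ub t) y l k)).
  by apply/funext => y; rewrite !mxE.
have -> : (fun y => (vgrad (ub t) y)^T k l) = (fun y => vgrad (ub t) y l k).
  by apply/funext => y; rewrite mxE.
rewrite (pdZ (smD oO (sG k l) (sG l k)) Otx l 2^-1) (pdD (sG k l) (sG l k) Otx).
by rewrite mulVKf.
Qed.

Lemma tested_symgrad_sgrad :
  [/\ integS (fun t x => th t * visc_test (fun t => sgrad (ub t)) t x),
     integS (fun t x => th t * visc_flux t x) &
     intS T (fun t x => th t * visc_test (fun t => sgrad (ub t)) t x) =
     - intS T (fun t x => th t * visc_flux t x)].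
Proof.
apply: tested_symgrad.
- exact: smm_sgrad.
- move=> t tT x j; apply/matrixP => k l; rewrite !mxE.
  by congr (_ * (_ + _)); apply: (@periodic_pd _ (fun y => ub t y _ 0)) => y j'; rewrite pU.
- by move=> t x _; rewrite sgrad_sym scaler_nat.
move=> t x _; have -> : (fun y => (sgrad (ub t) y)^T) = sgrad (ub t).
  by apply/funext => y; rewrite sgrad_sym.
by rewrite scaler_nat.
Qed.

Section GoodSet.
Variables kst N : R.
Hypotheses (k0 : 0 < kst) (hd : density_bounds w T kst N).

(** All pointwise estimates are made on this set, of full measure by [ae_good]. The positive lower
    bound also gives [lam = (s + 1) mu] there, through [lamE]. *)
Definition good t x := forall i,
  kst <= r i t x <= N /\ forall k, glam w i t x k 0 = (s + 1) * cap w i t x k 0.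

Lemma lam_mu_grad i t : 0 <= t ->
  {ae @leb3 R, forall x, cube x -> lam s (r i t x) = (s + 1) * mu s (r i t x)}.
Proof.
move=> t0; have [/(_ i)[_ _ [/(_ t t0) r0 _ _ _] _ _] _ _ _] := ws.
by apply: (@ae_all_imp _ _ _ leb3 _ _ _ r0) => x _ rx; exact: lamE.
Qed.

(** Both fields are weak gradients, of [lam] and of [mu], and the two functions are proportional
    almost everywhere. The difference is thus orthogonal to every test function and [test_ae0]
    applies. *)
Lemma glam_cap i k t : 0 <= t ->
  {ae @leb3 R, forall x, cube x -> glam w i t x k 0 - (s + 1) * cap w i t x k 0 = 0}.
Proof.
move=> t0; have [/(_ i)[_ _ _ [/(_ t t0)[imu icap Emu] /(_ t t0)[ilam iglam Elam] _] _] _ _ _] := ws.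
apply: test_ae0.
  by apply: integ3B; [exact: iglam|apply: integ3Zl; exact: icap].
move=> chi C1chi; have [pchi cchi dchi cdchi] := C1chi.
have wt f g : integ3 f -> continuous g -> integ3 (fun x => f x * g x).
  move=> itf cg; have [M M0 gM] := compact_continuous_bounded (@compact_cube R) (fun z _ => cg z).
  apply: (integ3Mr (M := M) itf) => //.
  by apply: continuous_measurable_pt3 => //; exact: measurable_cube.
have e1 := Emu chi k C1chi; have e2 := Elam chi k C1chi.
have j1 := wt _ _ (iglam k) cchi; have j2 := wt _ _ (icap k) cchi.
have j3 := wt _ _ imu (cdchi k); have j4 := wt _ _ ilam (cdchi k).
rewrite (eq_int3 (g := fun x => glam w i t x k 0 * chi x - (s + 1) * (cap w i t x k 0 * chi x))).
  rewrite int3B//; last exact: integ3Zl.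
  rewrite int3Zl// -[int3 (fun x => glam _ _ _ _ _ _ * _)]opprK -e2.
  rewrite -[int3 (fun x => cap _ _ _ _ _ _ * _)]opprK -e1 mulrN opprK addrC.
  apply/eqP; rewrite subr_eq0; apply/eqP; rewrite -int3Zl//.
  apply: (@ae_eq_Rintegral _ _ _ leb3 cube (@measurable_cube R)).
  - by apply: integ3_measurable; exact: integ3Zl.
  - exact: integ3_measurable.
  - by apply: (@ae_imp _ _ _ leb3 _ _ _ (lam_mu_grad i t0)) => x _ /= ->; ring.
by move=> x _; ring.
Qed.

Lemma ae_good : ae_slab T good.
Proof.
have mS := @measurable_slab R T.
apply: ae_slab_forall => i; apply: ae_slabI.
  apply: ae_slab_sections => [|t tT].
    rewrite (_ : [set z | _] = (fun z => r i z.1 z.2) @^-1` `[kst, N]%classic).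
      by apply: (rho_measurable ws i mS); exact: measurable_itv.
    by apply/seteqP; split => z /=; rewrite in_itv.
  by apply: (@ae_all_imp _ _ _ leb3 _ _ _ (hd i tT)) => x.
apply: ae_slab_forall => k; apply: ae_slab_sections => [|t /andP[t0 _]].
  rewrite (_ : [set z | _] =
      (fun z => glam w i z.1 z.2 k 0 - (s + 1) * cap w i z.1 z.2 k 0) @^-1` [set 0]).
    apply: measurable_funB => //; first exact: (glam_measurable ws).
    by apply: measurable_funM; [exact: measurable_cst|exact: (cap_measurable ws)].
  apply/seteqP; split => z /= h; first by rewrite h subrr.
  by apply/eqP; rewrite -subr_eq0 h.
apply: (@ae_imp _ _ _ leb3 _ _ _ (glam_cap i k (ltW t0))) => x _ /eqP.
by rewrite subr_eq0 => /eqP.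
Qed.

Lemma integS_mu i : integS (fun t x => mu s (r i t x)).
Proof.
have [M M0 HM] := @powR_bounded R kst N k0 ((s + 3) / 2).
apply: (ae_le_integS (g := fun _ _ => M)).
- apply: (@measurableT_comp _ _ _ _ _ _ (fun z : R => z `^ ((s + 3) / 2))) (rho_measurable ws i).
  exact: measurable_powR.
- by apply: (sm_slab_integrable T0 oO TO); exact: sm_cst.
- apply: (@ae_slabS R T good _ ae_good) => t x _ _ /(_ i)[rN _].
  by rewrite ger0_norm ?powR_ge0//; exact: HM.
Qed.

Definition visc_quad t x : R := \sum_i mu s (r i t x) *
  (2 * frob (sgrad (ub t) x) (sgrad (ub t) x) + (s + 1) * vdiv (ub t) x ^+ 2).

Lemma integS_visc_quad : integS visc_quad.
Proof.
apply: integS_sum => i; apply: (integS_sm oO TO); first exact: integS_mu.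
have sd : sm (fun t => vdiv (ub t)) by exact: sm_vdiv.
have sS := smm_sgrad oO sU.
by apply: smD => //; apply: smZ => //; [exact: sm_frob|exact: smM].
Qed.

(** The relation grad mu(rho) = rho v holds at each time, so any smooth periodic field can be used
    against it and integration in time follows. It provides the identities of value zero for
    [cap_flux] and [visc_field]. *)
Lemma tested_weak_grad i F : smv F -> (forall t, 0 <= t <= T -> Defs.periodic (F t)) ->
  [/\ integS (fun t x => th t * (mu s (r i t x) * vdiv (F t) x + dot (cap w i t x) (F t x))) &
     intS T (fun t x => th t * (mu s (r i t x) * vdiv (F t) x + dot (cap w i t x) (F t x))) = 0].
Proof.
move=> sF pF.
have itf : integS (fun t x => th t * (mu s (r i t x) * vdiv (F t) x + dot (cap w i t x) (F t x))).
  apply: (integS_bump bth); apply: integSD; last exact: (integS_cap_dot T0 oO TO ws).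
  by apply: (integS_sm oO TO); [exact: integS_mu|exact: sm_vdiv].
split => //; apply: intS_sections0 => // t tT; have /andP[t0 _] := tT.
have [/(_ i)[_ _ _ [/(_ t (ltW t0))[imu icap Emu] _ _] _] _ _ _] := ws.
have C1 k : C1_periodic (fun x => F t x k 0).
  apply: (sm_C1_periodic (f := fun t x => F t x k 0)) (sF k) (tT0 tT) _.
  by move=> x l; rewrite pF//; exact: tT0.
have wt f g : integ3 f -> continuous g -> integ3 (fun x => f x * g x).
  move=> jf cg; have [M M0 gM] := compact_continuous_bounded (@compact_cube R) (fun z _ => cg z).
  apply: (integ3Mr (M := M) jf) => //.
  by apply: continuous_measurable_pt3 => //; exact: measurable_cube.
have j1 k : integ3 (fun x => mu s (r i t x) * pd k (fun y => F t y k 0) x).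
  by apply: wt => //; have [_ _ _] := C1 k; apply.
have j2 k : integ3 (fun x => cap w i t x k 0 * F t x k 0).
  by apply: wt; [exact: icap|have [] := C1 k].
have E x : mu s (r i t x) * vdiv (F t) x + dot (cap w i t x) (F t x) =
    \sum_k (mu s (r i t x) * pd k (fun y => F t y k 0) x + cap w i t x k 0 * F t x k 0).
  by rewrite big_split/= -mulr_sumr.
have j k : integ3 (fun x => mu s (r i t x) * pd k (fun y => F t y k 0) x + cap w i t x k 0 * F t x k 0).
  exact: integ3D.
split; first by apply: eq_integ3 (integ3_sum _ _ j) => x _; rewrite E.
rewrite (eq_int3 (fun x _ => E x)) int3_sum// big1// => k _.
by rewrite int3D// (Emu _ k (C1 k)) addrC subrr.
Qed.

End GoodSet.

End TestedConstraints.

(** * Pointwise bounds *)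

Section PointwiseBounds.
Variables (R : realType) (n : nat) (T s gamma : R).
Variables (rhob : 'I_n -> R -> pt3 R -> R) (ub : R -> pt3 R -> 'cV[R]_3).
Variables (O : set (R * pt3 R)) (kst N : R).
Hypotheses (T0 : 0 < T) (s1 : -1 <= s) (g1 : 1 < gamma) (k0 : 0 < kst) (oO : open O)
  (TO : forall t x, 0 <= t <= T -> O (t, x))
  (rhob0 : forall i t x, O (t, x) -> 0 < rhob i t x)
  (srho : forall i, sm O (rhob i)) (sU : smv O ub).
Implicit Types (i : 'I_n) (t : R) (x : pt3 R) (r : R) (u v : 'cV[R]_3).
Local Notation V := (vb s rhob).
Local Notation c := ((s + 1) / 2).

Definition rel_density i r u v t x : R :=
  2^-1 * r * sqnorm (u - ub t x) + 2^-1 * r * sqnorm (v - V i t x)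
  + hrel gamma r (rhob i t x).

(** The right-hand side of [density_identity] without the relative pressure and the remainder. The
    number [y] is of first order in [r - rhob]. *)
Definition quad_density nu i r u v t x : R :=
  let y := mu s r - r * mub s rhob i t x / rhob i t x in
  let d := vdiv (ub t) x in
  - r * dot (u - ub t x) (vgrad (ub t) x *m (u - ub t x))
  + ((1 + c) * y * (dot (u - ub t x) (grad (vdiv (V i t)) x)
                    - dot (v - V i t x) (grad (vdiv (ub t)) x))
     - r * dot (v - V i t x) (vgrad (ub t) x *m (v - V i t x))
     + c * r * (dot (v - V i t x) (u - ub t x) * vdiv (V i t) x
                - sqnorm (v - V i t x) * d))
  + nu * dot (u - ub t x) (2 * y *: mdiv (sgrad (ub t)) x
     + 2 * r *: (sgrad (ub t) x *m (v - V i t x))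
     + 2 * c * y *: grad (vdiv (ub t)) x + 2 * c * r * d *: (v - V i t x)).

Definition press_density i r t x : R :=
  press gamma r - press gamma (rhob i t x) - dpress gamma rhob i t x * (r - rhob i t x).

Lemma fields_bounded : exists2 M, 0 < M & forall i t x, 0 <= t <= T -> cube x ->
  [/\ `|vdiv (ub t) x| <= M, `|vdiv (V i t) x| <= M,
      forall k, [/\ `|grad (vdiv (V i t)) x k 0| <= M, `|grad (vdiv (ub t)) x k 0| <= M
        & `|mdiv (sgrad (ub t)) x k 0| <= M],
      forall k l, `|vgrad (ub t) x k l| <= M /\ `|sgrad (ub t) x k l| <= M &
      forall k, `|remT s gamma rhob i t x k 0| <= M /\ `|remD s rhob ub i t x k 0| <= M].
Proof.
have sV := smv_vb s oO rhob0 srho; have sS := smm_sgrad oO sU; have sG := smm_vgrad oO sU.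
have sd := sm_vdiv oO sU; have se i := sm_vdiv oO (sV i).
have [M1 p1 H1] := sm_bounded TO sd.
have [M2 p2 H2] := sm_bounded_family TO se.
have [M3 p3 H3] := sm_bounded_family TO (fun ik : 'I_n * 'I_3 => smv_grad oO (se ik.1) ik.2).
have [M4 p4 H4] := sm_bounded_family TO (smv_grad oO sd).
have [M5 p5 H5] := sm_bounded_family TO (smv_mdiv oO sS).
have [M6 p6 H6] := sm_bounded_family TO (fun kl : 'I_3 * 'I_3 => sG kl.1 kl.2).
have [M7 p7 H7] := sm_bounded_family TO (fun kl : 'I_3 * 'I_3 => sS kl.1 kl.2).
have [M8 p8 H8] := sm_bounded_family TO (fun ik : 'I_n * 'I_3 => smv_remT gamma s1 oO rhob0 srho ik.1 ik.2).
have [M9 p9 H9] := sm_bounded_family TO (fun ik : 'I_n * 'I_3 => smv_remD s1 oO rhob0 srho sU ik.1 ik.2).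
exists (M1 + M2 + M3 + M4 + M5 + M6 + M7 + M8 + M9); first by rewrite !addr_gt0.
move=> i t x tT cx.
have le (y M : R) : `|y| <= M -> M <= M1 + M2 + M3 + M4 + M5 + M6 + M7 + M8 + M9 ->
  `|y| <= M1 + M2 + M3 + M4 + M5 + M6 + M7 + M8 + M9 by exact: le_trans.
split; do ?[move=> k; split]; do ?[move=> k l; split].
- by apply: le (H1 t x tT cx) _; clear - p1 p2 p3 p4 p5 p6 p7 p8 p9; lra.
- by apply: le (H2 i t x tT cx) _; clear - p1 p2 p3 p4 p5 p6 p7 p8 p9; lra.
- by apply: le (H3 (i, k) t x tT cx) _; clear - p1 p2 p3 p4 p5 p6 p7 p8 p9; lra.
- by apply: le (H4 k t x tT cx) _; clear - p1 p2 p3 p4 p5 p6 p7 p8 p9; lra.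
- by apply: le (H5 k t x tT cx) _; clear - p1 p2 p3 p4 p5 p6 p7 p8 p9; lra.
- by apply: le (H6 (k, l) t x tT cx) _; clear - p1 p2 p3 p4 p5 p6 p7 p8 p9; lra.
- by apply: le (H7 (k, l) t x tT cx) _; clear - p1 p2 p3 p4 p5 p6 p7 p8 p9; lra.
- by apply: le (H8 (i, k) t x tT cx) _; clear - p1 p2 p3 p4 p5 p6 p7 p8 p9; lra.
- by apply: le (H9 (i, k) t x tT cx) _; clear - p1 p2 p3 p4 p5 p6 p7 p8 p9; lra.
Qed.

Lemma press_hrel i r t x : O (t, x) ->
  press_density i r t x = (gamma - 1) * hrel gamma r (rhob i t x).
Proof.
move=> Otx; rewrite /press_density /hrel derive1_hh ?rhob0// /hh /press /dpress.
by field; rewrite subr_eq0 gt_eqF.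
Qed.

Lemma rel_density_coercive : exists2 k, 0 < k & forall i r u v t x,
  kst <= r <= N -> 0 <= t <= T -> cube x ->
  [/\ k * (sqnorm (u - ub t x) + sqnorm (v - V i t x) + (r - rhob i t x) ^+ 2)
        <= rel_density i r u v t x,
      0 <= hrel gamma r (rhob i t x) &
      hrel gamma r (rhob i t x) <= rel_density i r u v t x].
Proof.
have [b0 [b1 [b00 b10 Hb]]] := rhob_bounds oO TO rhob0 srho.
(* One interval for the densities of the weak solution and of the equilibrium, as the bounds for
   powers compare values at both. *)
pose lo := Num.min kst b0; pose hi := Num.max N b1.
have lo0 : 0 < lo by rewrite lt_min k0.
have [k kp Hk] := @powR_tangent_lower R lo hi lo0 gamma g1.
exists (Num.min k (2^-1 * kst)); first by rewrite lt_min kp mulr_gt0// invr_gt0.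
move=> i r u v t x /andP[rk rN] tT cx.
have /andP[rb0 rb1] := Hb i t x tT cx.
have r0 : 0 < r by exact: lt_le_trans rk.
have h : k * (r - rhob i t x) ^+ 2 <= hrel gamma r (rhob i t x).
  rewrite /hrel derive1_hh; last exact: lt_le_trans rb0.
  apply: Hk; rewrite /lo /hi ge_min le_max.
    by rewrite rk rN.
  by rewrite rb0 rb1 !orbT.
have A0 := sqnorm_ge0 (u - ub t x); have B0 := sqnorm_ge0 (v - V i t x).
have x0 := sqr_ge0 (r - rhob i t x).
rewrite /rel_density; set a := sqnorm _ in A0 *; set b := sqnorm _ in B0 *.
set y := _ ^+ 2 in h x0 *; set H := hrel _ _ _ in h *.
have H0 : 0 <= H by apply: le_trans h; rewrite mulr_ge0// ltW.
have ha : Num.min k (2^-1 * kst) * a <= 2^-1 * r * a.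
  by rewrite ler_wpM2r// ge_min ler_pM2l ?rk ?orbT// invr_gt0.
have hb' : Num.min k (2^-1 * kst) * b <= 2^-1 * r * b.
  by rewrite ler_wpM2r// ge_min ler_pM2l ?rk ?orbT// invr_gt0.
have hy : Num.min k (2^-1 * kst) * y <= H.
  by apply: le_trans h; rewrite ler_wpM2r// ge_min lexx.
split => //; first by rewrite !mulrDr; lra.
have : 0 <= 2^-1 * r * a by rewrite !mulr_ge0 ?invr_ge0// ltW.
have : 0 <= 2^-1 * r * b by rewrite !mulr_ge0 ?invr_ge0// ltW.
lra.
Qed.

Lemma density_le : exists2 A, 0 < A & forall nu i r u v t x, 0 <= nu ->
  kst <= r <= N -> 0 <= t <= T -> cube x ->
  quad_density nu i r u v t x - press_density i r t x * vdiv (ub t) x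
    <= A * (1 + nu) * rel_density i r u v t x.
Proof.
have [M M0 HM] := fields_bounded.
have [k kp Hk] := rel_density_coercive.
have [b0 [b1 [b00 b10 Hb]]] := rhob_bounds oO TO rhob0 srho.
pose lo := Num.min kst b0; pose hi := Num.max N b1.
have lo0 : 0 < lo by rewrite lt_min k0.
have [Lp Lp0 HL] := @powR_lipschitz R lo hi lo0 ((s + 3) / 2).
have [Mm Mm0 HMm] := @powR_bounded R lo hi lo0 ((s + 3) / 2).
(* From [y = (mu r - mu rb) - (r - rb) * mu rb / rb]: the first part is Lipschitz with constant
   [Lp], the second has slope at most [Mm / b0]. *)
pose Lx := (Lp + Mm / b0) ^+ 2.
have Lx0 : 0 <= Lx by exact: sqr_ge0.
have c0 : 0 <= c by rewrite divr_ge0// -lerBlDr sub0r.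
(* The positivity of the constant has to be shown before any density is given, when nothing is known
   about the sign of [N]. *)
pose N1 := `|N|.
pose A1 := 8 * (1 + c) * M * (N1 + 3 * Lx + 1).
have A10 : 0 <= A1.
  rewrite /A1; apply: mulr_ge0.
    by apply: mulr_ge0; [apply: mulr_ge0 => //; exact: addr_ge0|exact: ltW].
  by apply: addr_ge0 => //; apply: addr_ge0; [exact: normr_ge0|exact: mulr_ge0].
exists (A1 / k + (gamma - 1) * M).
  by rewrite ltr_wpDl ?divr_ge0 ?mulr_gt0 ?subr_gt0// ltW.
move=> nu i r u v t x nu0 rkN tT cx; have /andP[rk rN] := rkN.
have r0 : 0 < r by exact: lt_le_trans rk.
have [dM eM KHL GS _] := HM i t x tT cx; have Otx := TO x tT.
have [hk h0 hrel_le] := Hk i r u v t x rkN tT cx.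
have /andP[rb0 rb1] := Hb i t x tT cx; have rbp := rhob0 i Otx.
pose y := mu s r - r * mub s rhob i t x / rhob i t x.
have inI : lo <= r <= hi by rewrite /lo /hi ge_min le_max rk rN.
have inIb : lo <= rhob i t x <= hi by rewrite /lo /hi ge_min le_max rb0 rb1 !orbT.
have yL : y ^+ 2 <= Lx * (r - rhob i t x) ^+ 2.
  rewrite -exprMn -[leLHS]real_normK ?num_real// -[leRHS]real_normK ?num_real//.
  rewrite lerXn2r ?nnegrE ?normr_ge0//.
  have -> : y = (mu s r - mu s (rhob i t x)) - (r - rhob i t x) * (mub s rhob i t x / rhob i t x).
    by rewrite /y /mub; field; rewrite gt_eqF.
  apply: le_trans (ler_normB _ _) _.
  rewrite [leRHS]normrM ger0_norm ?addr_ge0 ?divr_ge0 ?(ltW Mm0) ?(ltW b00)// [leRHS]mulrDl.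
  apply: lerD; first exact: HL.
  rewrite normrM mulrC; apply: ler_wpM2r => //.
  rewrite ger0_norm ?divr_ge0 ?powR_ge0 ?(ltW rbp)//.
  by apply: ler_pM; rewrite ?powR_ge0 ?invr_ge0 ?(ltW rbp)// ?HMm// lef_pV2 ?posrE.
have rN1 : 0 <= r <= N1 by rewrite (ltW r0) (le_trans rN)// ler_norm.
have Q := quadratic_bound u v (ub t x) (V i t x) rN1 c0 nu0 Lx0 (sqr_ge0 _) yL dM eM
  (fun k => let: And3 h _ _ := KHL k in h) (fun k => let: And3 _ h _ := KHL k in h)
  (fun k => let: And3 _ _ h := KHL k in h) (fun k l => (GS k l).1) (fun k l => (GS k l).2).
have {}Q : quad_density nu i r u v t x <= A1 * (1 + nu) / k * rel_density i r u v t x.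
  apply: le_trans Q _; rewrite -/A1 -[leRHS]mulrA; apply: ler_wpM2l.
    by rewrite mulr_ge0// addr_ge0.
  by rewrite ler_pdivlMl.
have D0 : 0 <= rel_density i r u v t x by exact: le_trans hrel_le.
have P : - (press_density i r t x * vdiv (ub t) x) <= (gamma - 1) * M * (1 + nu) * rel_density i r u v t x.
  rewrite (press_hrel _ _ Otx) -mulrN -!mulrA; apply: ler_wpM2l.
    by rewrite subr_ge0 ltW.
  have : `|hrel gamma r (rhob i t x) * - vdiv (ub t) x| <= rel_density i r u v t x * M.
    by rewrite normrM normrN (ger0_norm h0); apply: ler_pM.
  move=> /(le_trans (ler_norm _)) h; apply: le_trans h _.
  rewrite mulrC ler_wpM2l ?(ltW M0)//.
  by rewrite mulrDl mul1r lerDl mulr_ge0.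
apply: le_trans (lerD Q P) _; rewrite le_eqVlt; apply/orP; left; apply/eqP; ring.
Qed.

(** The order of the constants matters: [A] is fixed before [delta] and [B] after it, which
    separates the two constants of the final estimate. *)
Lemma remainder_bound : exists2 A, 0 < A & forall b delta, 0 < delta ->
  coercive b kst N delta -> exists2 B, 0 < B &
  forall nu eps (r : 'I_n -> R) (u v : 'I_n -> 'cV[R]_3) t x, 0 <= nu -> 0 < eps ->
  (forall i, kst <= r i <= N) -> 0 <= t <= T -> cube x ->
  - (\sum_i (r i / rhob i t x) * dot (u i - ub t x) (remainder s gamma nu rhob ub i t x))
  - (2 * eps)^-1 * (\sum_i \sum_j b i j * r i * r j * sqnorm (u i - u j))
  <= A * (1 + nu) * (\sum_i rel_density i (r i) (u i) (v i) t x) + eps * B * (1 + nu ^+ 2).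
Proof.
have [M M0 HM] := fields_bounded.
have [k kp Hk] := rel_density_coercive.
have [b0 [b1 [b00 b10 Hb]]] := rhob_bounds oO TO rhob0 srho.
exists (M / (2 * b0) * ((n%:R + 3) / k)).
  by rewrite mulr_gt0 ?divr_gt0 ?mulr_gt0// ltr_wpDl ?ler0n.
move=> b delta d0 cb.
(* The factor 2 is that of [(1 + nu) ^+ 2 <= 2 * (1 + nu ^+ 2)]; the added 1 makes the constant
   positive even for [n = 0]. *)
exists (2 / (4 * delta) * (3 * n%:R * (M / b0) ^+ 2) + 1).
  have d1 : 0 <= 2 / (4 * delta) by rewrite divr_ge0// mulr_ge0// ltW.
  by rewrite ltr_wpDl// mulr_ge0// mulr_ge0 ?sqr_ge0// mulr_ge0.
move=> nu eps r u v t x nu0 e0 rN tT cx; have Otx := TO x tT.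
have R0 := sum_remainder s gamma ub rhob0 nu Otx.
have RM i l : `|remainder s gamma nu rhob ub i t x l 0| <= M * (1 + nu).
  have [_ _ _ _ /(_ l)[hT hD]] := HM i t x tT cx.
  rewrite remainderE; move: (remT _ _ _ _ _ _) (remD _ _ _ _ _ _) hT hD => a a' hT hD.
  rewrite !mxE mulrDr mulr1; apply: le_trans (ler_normD _ _) _.
  apply: lerD; first exact: hT.
  by rewrite normrM ger0_norm// mulrC ler_wpM2r.
have rb0 i : b0 <= rhob i t x by have /andP[] := Hb i t x tT cx.
apply: le_trans (remainder_le u (ub t x) cb k0 d0 e0 b00 rN rb0 R0 RM) _.
have S0 : \sum_i (n%:R * sqnorm (u i - ub t x) + 3 * (r i - rhob i t x) ^+ 2) <=
    (n%:R + 3) / k * \sum_i rel_density i (r i) (u i) (v i) t x.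
  rewrite mulr_sumr; apply: ler_sum => i _.
  have [hk _ _] := Hk i (r i) (u i) (v i) t x (rN i) tT cx.
  rewrite -mulrA; apply: (@le_trans _ _ ((n%:R + 3) * (sqnorm (u i - ub t x) + sqnorm (v i - V i t x) + (r i - rhob i t x) ^+ 2))).
    have n0 : 0 <= n%:R :> R := ler0n _ _.
    have a0 := sqnorm_ge0 (u i - ub t x); have c0 := sqnorm_ge0 (v i - V i t x).
    have y0 := sqr_ge0 (r i - rhob i t x).
    move: (sqnorm (u i - _)) (sqnorm (v i - _)) (_ ^+ 2) (n%:R) n0 a0 c0 y0 => a b' y m *; nra.
  by apply: ler_wpM2l; rewrite ?addr_ge0 ?ler0n// ler_pdivlMl.
rewrite addrC; apply: lerD.
  apply: le_trans (ler_wpM2l _ S0) _.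
    by rewrite divr_ge0 ?mulr_ge0// ?addr_ge0// ltW.
  rewrite le_eqVlt; apply/orP; left; apply/eqP; field.
  by rewrite !gt_eqF.
have n0 : 0 <= n%:R :> R := ler0n _ _.
pose Z := (4 * delta)^-1 * (3 * n%:R * (M / b0) ^+ 2).
have -> : eps / (4 * delta) * (3 * n%:R * (M * (1 + nu) / b0) ^+ 2) =
    eps * (Z * (1 + nu) ^+ 2).
  by rewrite /Z; field; rewrite !gt_eqF.
have -> : eps * (2 / (4 * delta) * (3 * n%:R * (M / b0) ^+ 2) + 1) * (1 + nu ^+ 2) =
    eps * ((2 * Z + 1) * (1 + nu ^+ 2)).
  by rewrite /Z; field; rewrite !gt_eqF.
apply: ler_wpM2l; first exact: ltW.
have Z0 : 0 <= Z.
  rewrite /Z; apply: mulr_ge0; first by rewrite invr_ge0 mulr_ge0// ltW.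
  by apply: mulr_ge0; [exact: mulr_ge0|exact: sqr_ge0].
move: Z Z0 => Z Z0; have := sqr_ge0 (1 - nu); rewrite !expr2; nra.
Qed.

End PointwiseBounds.

(** * The relative energy inequality *)

Section DensityAlgebra.
Variable R : realType.
Implicit Types (a b u v : 'cV[R]_3) (A B : 'M[R]_3).

Lemma dotNl a b : dot (- a) b = - dot a b.
Proof. by rewrite !dot3 !mxE; ring. Qed.

Lemma dotNr a b : dot a (- b) = - dot a b.
Proof. by rewrite !dot3 !mxE; ring. Qed.

Lemma frob_tensor (r : R) a b A : frob (r *: tensor a b) A = r * dot a (A *m b).
Proof. by rewrite !vecE; ring. Qed.

Lemma frob_trC A B : frob A^T B = frob B^T A.
Proof. by rewrite !vecE; ring. Qed.

Definition dot_lin := (dotDl, dotZl, dotNl, dotDr, dotZr, dotNr).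

(** The left-hand side collects the tested integrands of one species, the right-hand side is the
    left-hand side of [density_identity]. The squares [2 * frob S S + z * d ^+ 2] left by the
    dissipation cancel against the divergence [divFn]. *)
Lemma tested_terms_identity (r m c z nu d e P Pb p' rb rbt divFc divFn : R)
    u v U Ut V Vt K H LD Gr (G W S : 'M[R]_3) :
  z = 2 * c -> divFc = (1 + c) * (dot U K - dot V H) ->
  divFn = 2 * dot LD U + 2 * frob S S + z * (dot U H + d ^+ 2) ->
  nu * ((m * dot u (2 *: LD + z *: H) + dot (r *: v) (2 *: (S *m u) + (z * d) *: u))
        + m * (2 * frob S S + z * d ^+ 2))
  + (m * dot u K + dot (r *: v) (W *m u) + 2^-1 * dot (z *: (r *: v)) u * e
     + 2^-1 * (z * m) * dot u K)
  - (dot (r *: u) Ut + frob (r *: tensor u u) G + P * d + m * dot v H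
     + dot (r *: v) (G *m v) + 2^-1 * dot (z *: (r *: v)) v * d
     + 2^-1 * (z * m) * dot v H)
  - (dot (r *: v) Vt + frob (r *: tensor v u) W)
  + (r * (dot U Ut + dot V Vt - p' / rb * rbt)
     + dot (r *: u) (G^T *m U + W^T *m V - (p' / rb) *: Gr))
  + p' * rbt
  - (m * divFc + dot (r *: v) (W *m U - G *m V + c *: (e *: U - d *: V)))
  - nu * (m * divFn + dot (r *: v) (2 *: (S *m U) + (z * d) *: U))
  + (dot (p' *: Gr) U + Pb * d) =
  (m * dot u K + r * dot v (W *m u) + c * r * dot v u * e + c * m * dot u K)
  - (r * dot u Ut + r * dot u (G *m u) + P * d + m * dot v H + r * dot v (G *m v)
     + c * r * dot v v * d + c * m * dot v H)
  - (r * dot v Vt + r * dot v (W *m u))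
  + (r * (dot U Ut + dot V Vt - p' / rb * rbt)
     + r * dot u (G^T *m U + W^T *m V - p' / rb *: Gr))
  + p' * rbt
  - (m * ((1 + c) * (dot U K - dot V H))
     + r * dot v (W *m U - G *m V + c *: (e *: U - d *: V)))
  + (dot (p' *: Gr) U + Pb * d)
  + nu * (2 * m * dot (u - U) LD + 2 * c * m * dot (u - U) H
     + r * dot v (2 *: (S *m (u - U)) + 2 * c * d *: (u - U))).
Proof.
move=> -> -> ->; rewrite !frob_tensor mulmxBr !dot_lin (dotC LD U).
by move: (p' / rb) => q; field.
Qed.

(** Expanded squares of [A - B] and [D - d]. The lower bound is affine in [A] and [D], which stand
    for D(u) and its trace. *)
Lemma viscous_square (m z d D : R) A B : 0 <= m -> 0 <= z ->
  2 * (2 * m * frob A B + z * m * D * d) - m * (2 * frob B B + z * d ^+ 2) <=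
  2 * m * frob A A + z * m * D ^+ 2.
Proof.
move=> m0 z0; rewrite -subr_ge0.
have sq : 0 <= \sum_k \sum_l (A k l - B k l) ^+ 2.
  by rewrite sumr_ge0// => k _; rewrite sumr_ge0// => l _; rewrite sqr_ge0.
have -> : 2 * m * frob A A + z * m * D ^+ 2 - (2 * (2 * m * frob A B + z * m * D * d)
    - m * (2 * frob B B + z * d ^+ 2)) =
    2 * m * (\sum_k \sum_l (A k l - B k l) ^+ 2) + z * m * (D - d) ^+ 2.
  by rewrite !frob3 !sum3; ring.
by rewrite addr_ge0// mulr_ge0 ?sqr_ge0// mulr_ge0.
Qed.

End DensityAlgebra.

Section EnergyInequality.
Variables (R : realType) (n : nat) (b : 'M[R]_n) (T s gamma nu eps : R) (w : state R n).
Variables (rhob : 'I_n -> R -> pt3 R -> R) (ub : R -> pt3 R -> 'cV[R]_3).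
Variable O : set (R * pt3 R).
Hypotheses (T0 : 0 < T) (s1 : -1 <= s) (g1 : 1 < gamma) (oO : open O)
  (TO : forall t x, 0 <= t <= T -> O (t, x))
  (rhob0 : forall i t x, O (t, x) -> 0 < rhob i t x)
  (srho : forall i, sm O (rhob i)) (sU : smv O ub)
  (prho : forall i t, 0 <= t <= T -> Defs.periodic (rhob i t))
  (pU : forall t, 0 <= t <= T -> Defs.periodic (ub t)).
Hypotheses (sb : forall i j, b i j = b j i) (ws : weak_solution b s gamma nu eps w).
Variable th : R -> R.
Hypothesis bth : time_bump T th.
Implicit Types (i : 'I_n) (t : R) (x : pt3 R).
Local Notation sm := (sm O).
Local Notation smv := (smv O).
Local Notation V := (vb s rhob).
Local Notation c := ((s + 1) / 2).
Local Notation integS := (integ4 (slab T)).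
Local Notation measS f := (measurable_fun (slab T) (fun z => f z.1 z.2)).
Local Notation r := (rho w).
Local Notation u := (vel w).
Local Notation v := (drf w).

Let sV i : smv (V i). Proof. exact: smv_vb. Qed.
Let tT0 t : 0 < t < T -> 0 <= t <= T.
Proof. by move=> /andP[t0 tT]; rewrite !ltW. Qed.
Let pVb i t : 0 <= t <= T -> Defs.periodic (V i t).
Proof. exact: pV. Qed.

Lemma periodic_entry (F : pt3 R -> 'cV[R]_3) k : Defs.periodic F ->
  Defs.periodic (fun x => F x k 0).
Proof. by move=> pF x l; rewrite pF. Qed.

Lemma periodic_vgrad (F : pt3 R -> 'cV[R]_3) : Defs.periodic F -> Defs.periodic (vgrad F).
Proof.
move=> pF x j; apply/matrixP => k l; rewrite !mxE.
exact: (@periodic_pd _ (fun y => F y k 0) l (periodic_entry k pF)).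
Qed.

Lemma periodic_vdiv (F : pt3 R -> 'cV[R]_3) : Defs.periodic F -> Defs.periodic (vdiv F).
Proof.
move=> pF x j; apply: eq_bigr => k _.
exact: (@periodic_pd _ (fun y => F y k 0) k (periodic_entry k pF)).
Qed.

Lemma periodic_sgrad (F : pt3 R -> 'cV[R]_3) : Defs.periodic F -> Defs.periodic (sgrad F).
Proof. by move=> pF x j; rewrite /sgrad (periodic_vgrad pF). Qed.

(** Products of first derivatives cancel in the divergence of this field, which leaves second
    derivatives only. Tested against grad mu(rho) = rho v it completes the capillary terms to
    products of differences. *)
Definition cap_flux i t x : 'cV[R]_3 :=
  vgrad (V i t) x *m ub t x - vgrad (ub t) x *m V i t x
  + c *: (vdiv (V i t) x *: ub t x - vdiv (ub t) x *: V i t x).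

(** The viscous counterpart of [cap_flux]: the squares of first derivatives in its divergence cancel
    [visc_quad], the rest replaces [u] by [u - ub] in the viscous terms. *)
Definition visc_field t x : 'cV[R]_3 :=
  2 *: (sgrad (ub t) x *m ub t x) + ((s + 1) * vdiv (ub t) x) *: ub t x.

Let sd : sm (fun t => vdiv (ub t)). Proof. exact: sm_vdiv. Qed.
Let se i : sm (fun t => vdiv (V i t)). Proof. exact: sm_vdiv. Qed.
Let sWU i : smv (fun t x => vgrad (V i t) x *m ub t x).
Proof. by apply: smv_mulmx => //; exact: smm_vgrad. Qed.
Let sGV i : smv (fun t x => vgrad (ub t) x *m V i t x).
Proof. by apply: smv_mulmx => //; exact: smm_vgrad. Qed.
Let seU i : smv (fun t x => vdiv (V i t) x *: ub t x). Proof. exact: smvZ. Qed.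
Let sdV i : smv (fun t x => vdiv (ub t) x *: V i t x). Proof. exact: smvZ. Qed.
Let sSU : smv (fun t x => sgrad (ub t) x *m ub t x).
Proof. by apply: smv_mulmx => //; exact: smm_sgrad. Qed.
Let sdU : smv (fun t x => vdiv (ub t) x *: ub t x). Proof. exact: smvZ. Qed.

Lemma smv_cap_flux i : smv (cap_flux i).
Proof.
apply: smvD => //; first exact: smvB.
by apply: (smvZ oO (sm_cst O c)); exact: smvB.
Qed.

Lemma smv_visc_field : smv visc_field.
Proof.
apply: smvD => //; first exact: (smvZ oO (sm_cst O 2)).
by apply: smvZ => //; exact: smZ.
Qed.

Lemma periodic_cap_flux i t : 0 <= t <= T -> Defs.periodic (cap_flux i t).
Proof.
move=> tT x k; have pU' := pU tT; have pV' := pVb i tT.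
by rewrite /cap_flux (periodic_vgrad pV') (periodic_vgrad pU') (periodic_vdiv pV')
  (periodic_vdiv pU') pU' pV'.
Qed.

Lemma periodic_visc_field t : 0 <= t <= T -> Defs.periodic (visc_field t).
Proof.
move=> tT x k; have pU' := pU tT.
by rewrite /visc_field (periodic_sgrad pU') (periodic_vdiv pU') pU'.
Qed.

Lemma vdiv_cap_flux i t x : 0 <= t <= T -> vdiv (cap_flux i t) x =
  (1 + c) * (dot (ub t x) (grad (vdiv (V i t)) x) - dot (V i t x) (grad (vdiv (ub t)) x)).
Proof.
move=> tT; have Otx := TO x tT.
have s2 := smvB oO (seU i) (sdV i).
rewrite (vdivD (smvB oO (sWU i) (sGV i)) (smvZ oO (sm_cst O c) s2) Otx).
rewrite (vdivB (sWU i) (sGV i) Otx) (vdivZc s2 Otx) (vdivB (seU i) (sdV i) Otx).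
rewrite (vdivZ (se i) sU Otx) (vdivZ sd (sV i) Otx).
rewrite (vdiv_mulmx oO sU (smm_vgrad oO (sV i)) Otx) (vdiv_mulmx oO (sV i) (smm_vgrad oO sU) Otx).
rewrite (mdiv_tr_vgrad oO (sV i) Otx) (mdiv_tr_vgrad oO sU Otx).
move: (grad (vdiv (V i t)) x) (grad (vdiv (ub t)) x) (vgrad (V i t) x) (vgrad (ub t) x).
move: (vdiv (V i t) x) (vdiv (ub t) x) (ub t x) (V i t x) => e d U W K H A B.
by rewrite (frob_trC A) (dotC K U) (dotC H W); ring.
Qed.

Lemma frob_sgrad t x : frob (sgrad (ub t) x) (vgrad (ub t) x) =
  frob (sgrad (ub t) x) (sgrad (ub t) x).
Proof. by rewrite /sgrad; move: (vgrad _ x) => G; rewrite !vecE; field. Qed.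

Lemma vdiv_visc_field t x : 0 <= t <= T -> vdiv (visc_field t) x =
  2 * dot (mdiv (sgrad (ub t)) x) (ub t x)
  + 2 * frob (sgrad (ub t) x) (sgrad (ub t) x)
  + (s + 1) * (dot (ub t x) (grad (vdiv (ub t)) x) + vdiv (ub t) x ^+ 2).
Proof.
move=> tT; have Otx := TO x tT.
have -> : visc_field t = (fun x => 2 *: (sgrad (ub t) x *m ub t x)
    + (s + 1) *: (vdiv (ub t) x *: ub t x)).
  by apply/funext => y; rewrite /visc_field scalerA.
rewrite (vdivD (smvZ oO (sm_cst O 2) sSU) (smvZ oO (sm_cst O (s + 1)) sdU) Otx).
rewrite (vdivZc sSU Otx) (vdivZc sdU Otx) (vdivZ sd sU Otx).
rewrite (vdiv_mulmx oO sU (smm_sgrad oO sU) Otx) sgrad_sym frob_sgrad.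
have -> : (fun y => (sgrad (ub t) y)^T) = sgrad (ub t).
  by apply/funext => y; rewrite sgrad_sym.
move: (grad _ x) (mdiv _ x) (vdiv _ x) (frob _ _) (ub t x) => H L d q U; ring.
Qed.

End EnergyInequality.

Lemma cylinder_slab_integral (R : realType) (T : R) (f : R * pt3 R -> \bar R) :
  (forall z, ~~ (0 < z.1 < T) -> f z = 0%E) ->
  (\int[leb4]_(z in cylinder) f z = \int[leb4]_(z in slab T) f z)%E.
Proof.
move=> f0; rewrite integral_mkcond [RHS]integral_mkcond.
apply: eq_integral => -[t x] _; rewrite !patchE.
have [tx|ntx] := boolP ((t, x) \in slab T).
  by rewrite mem_set//; apply: (@slab_cylinder R T); exact: set_mem.
case: ifPn => // /set_mem[/= _ cx]; apply: f0.
by apply: contra ntx => tT; rewrite mem_set.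
Qed.

Section EnergyInequality.
Variables (R : realType) (n : nat) (b : 'M[R]_n) (T s gamma nu eps : R) (w : state R n).
Variables (rhob : 'I_n -> R -> pt3 R -> R) (ub : R -> pt3 R -> 'cV[R]_3).
Variable O : set (R * pt3 R).
Hypotheses (T0 : 0 < T) (s1 : -1 <= s) (g1 : 1 < gamma) (oO : open O)
  (TO : forall t x, 0 <= t <= T -> O (t, x))
  (rhob0 : forall i t x, O (t, x) -> 0 < rhob i t x)
  (srho : forall i, sm O (rhob i)) (sU : smv O ub)
  (prho : forall i t, 0 <= t <= T -> Defs.periodic (rhob i t))
  (pU : forall t, 0 <= t <= T -> Defs.periodic (ub t)).
Hypotheses (sb : forall i j, b i j = b j i) (ws : weak_solution b s gamma nu eps w).
Variable th : R -> R.
Hypothesis bth : time_bump T th.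
Implicit Types (i : 'I_n) (t : R) (x : pt3 R).
Local Notation sm := (sm O).
Local Notation smv := (smv O).
Local Notation V := (vb s rhob).
Local Notation c := ((s + 1) / 2).
Local Notation integS := (integ4 (slab T)).
Local Notation measS f := (measurable_fun (slab T) (fun z => f z.1 z.2)).
Local Notation r := (rho w).
Local Notation u := (vel w).
Local Notation v := (drf w).

Variables kst N : R.
Hypotheses (A1 : conditionA1 b) (k0 : 0 < kst) (hd : density_bounds w T kst N)
  (eps0 : 0 < eps) (nu0 : 0 <= nu) (hdiss : dissipative b s gamma nu eps w)
  (heq : equilibrium_system T s gamma nu rhob ub).

Let sV i : smv (V i). Proof. exact: smv_vb. Qed.
Let tT0 t : 0 < t < T -> 0 <= t <= T.
Proof. by move=> /andP[t0 tT]; rewrite !ltW. Qed.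
Let mS := @measurable_slab R T.
Local Notation I f := (intS T (fun t x => th t * f t x)).
Local Notation J f := (intS T (fun t x => derive1 th t * f t x)).
Local Notation rem := (remainder s gamma nu rhob ub).

Definition rel_energy t x : R :=
  \sum_i rel_density s gamma rhob ub i (r i t x) (u i t x) (v i t x) t x.
Definition pbar i t x : R := press gamma (rhob i t x).
Definition press_sum t x : R := \sum_i pbar i t x.
Definition press_time t x : R := \sum_i dt (pbar i) t x.
Definition press_flux t x : R := \sum_i vdiv (fun y => pbar i t y *: ub t y) x.
Definition cap_test t x : R := \sum_i
  (mu s (r i t x) * vdiv (cap_flux s rhob ub i t) x
   + dot (cap w i t x) (cap_flux s rhob ub i t x)).
Definition visc_field_test t x : R := \sum_i
  (mu s (r i t x) * vdiv (visc_field s ub t) x + dot (cap w i t x) (visc_field s ub t x)).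
Definition friction t x : R := \sum_i \sum_j b i j * r i t x * r j t x
  * sqnorm (u i t x - u j t x).
Definition dissipation t x : R := \sum_i
  (2 * mu s (r i t x) * frob (Dvel w i t x) (Dvel w i t x)
   + lam s (r i t x) * (\tr (Dvel w i t x)) ^+ 2).
Definition rem_term t x : R := \sum_i (r i t x / rhob i t x)
  * dot (u i t x - ub t x) (rem i t x).

Lemma sqnormZ (a : R) (y : 'cV[R]_3) : sqnorm (a *: y) = a ^+ 2 * sqnorm y.
Proof. by rewrite /sqnorm dotZl dotZr mulrA expr2. Qed.

(** The convention for division by zero makes this hold on the vacuum set too, where both sides are
    zero. *)
Lemma kinetic_mom (a : R) (y : 'cV[R]_3) : sqnorm (a *: y) / a = a * sqnorm y.
Proof.
rewrite sqnormZ; have [->|a0] := eqVneq a 0; first by rewrite expr0n !mul0r.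
by field.
Qed.

(** [a] and [zb] are the two densities, [P] is [a^g] and [Q] is [zb^(g - 1)]. Expanding the squares
    shows that relative energy and energy differ by terms affine in density, momentum and capillary
    momentum. *)
Lemma entropy_algebra (a g P Q zb : R) (y y' U U' : 'cV[R]_3) : g - 1 != 0 ->
  2^-1 * a * sqnorm (y - U) + 2^-1 * a * sqnorm (y' - U')
  + (P / (g - 1) - Q * zb / (g - 1) - g / (g - 1) * Q * (a - zb)) =
  2^-1 * (a * sqnorm y) + 2^-1 * (a * sqnorm y') + P / (g - 1)
  - dot (a *: y) U - dot (a *: y') U'
  + a * (2^-1 * sqnorm U + 2^-1 * sqnorm U' - g / (g - 1) * Q) + Q * zb.
Proof.
move=> g0; rewrite /sqnorm !dot_lin (dotC U y) (dotC U' y').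
by field.
Qed.

Lemma eta_totE t x : eta_tot gamma w t x = \sum_i
  (2^-1 * (r i t x * sqnorm (u i t x)) + 2^-1 * (r i t x * sqnorm (v i t x))
   + hh gamma (r i t x)).
Proof. by apply: eq_bigr => i _; rewrite !kinetic_mom. Qed.

Lemma rel_energyE t x : O (t, x) -> rel_energy t x =
  eta_tot gamma w t x - \sum_i dot (mom w i t x) (ub t x)
  - \sum_i dot (cap w i t x) (V i t x) + \sum_i r i t x * apot s gamma rhob ub i t x
  + press_sum t x.
Proof.
move=> Otx; rewrite eta_totE -!sumrB -!big_split/=; apply: eq_bigr => i _.
have rb := rhob0 i Otx.
rewrite /rel_density /apot /pbar /press /mom /cap /hrel derive1_hh//.
have -> : rhob i t x `^ gamma = rhob i t x `^ (gamma - 1) * rhob i t x.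
  by rewrite powR_div// mulfVK// gt_eqF.
rewrite /hh; have -> : rhob i t x `^ gamma = rhob i t x `^ (gamma - 1) * rhob i t x.
  by rewrite powR_div// mulfVK// gt_eqF.
by apply: entropy_algebra; rewrite subr_eq0 gt_eqF.
Qed.

Lemma vec_sq_measurable (F : R -> pt3 R -> 'cV[R]_3) :
  (forall k, measS (fun t x => F t x k 0)) -> measS (fun t x => sqnorm (F t x)).
Proof.
move=> mF; apply: (@measurable_sum _ _ _ _ _ _ (fun k z => F z.1 z.2 k 0 * F z.1 z.2 k 0)) => k.
by apply: measurable_funM.
Qed.

Lemma eta_measurable : measS (eta_tot gamma w).
Proof.
have -> : (fun z : R * pt3 R => eta_tot gamma w z.1 z.2) = (fun z => \sum_i
  (2^-1 * (r i z.1 z.2 * sqnorm (u i z.1 z.2)) + 2^-1 * (r i z.1 z.2 * sqnorm (v i z.1 z.2))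
   + hh gamma (r i z.1 z.2))) by apply/funext => z; rewrite eta_totE.
apply: (@measurable_sum _ _ _ _ _ _ (fun i z => 2^-1 * (r i z.1 z.2 * sqnorm (u i z.1 z.2))
  + 2^-1 * (r i z.1 z.2 * sqnorm (v i z.1 z.2)) + hh gamma (r i z.1 z.2))) => i.
have mr := rho_measurable ws i (T := T).
apply: measurable_funD; first apply: measurable_funD.
- apply: measurable_funM => //; apply: measurable_funM => //.
  by apply: (@vec_sq_measurable (u i)) => k; exact: (vel_measurable ws).
- apply: measurable_funM => //; apply: measurable_funM => //.
  by apply: (@vec_sq_measurable (v i)) => k; exact: (drf_measurable ws).
apply: measurable_funM => //.
apply: (@measurableT_comp _ _ _ _ _ _ (fun z : R => z `^ gamma)) mr.
exact: measurable_powR.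
Qed.

Lemma integS_eta : integS (eta_tot gamma w).
Proof. exact: (C0_L1_slab_integrable T0 hdiss.1 eta_measurable). Qed.

Lemma integS_mom_sum : integS (fun t x => \sum_i dot (mom w i t x) (ub t x)).
Proof. by apply: integS_sum => i; exact: (integS_mom_dot T0 oO TO ws). Qed.

Lemma integS_cap_sum : integS (fun t x => \sum_i dot (cap w i t x) (V i t x)).
Proof. by apply: integS_sum => i; apply: (integS_cap_dot T0 oO TO ws); exact: sV. Qed.

Lemma integS_apot_sum : integS (fun t x => \sum_i r i t x * apot s gamma rhob ub i t x).
Proof.
apply: integS_sum => i; apply: (integS_sm oO TO); first exact: (integS_rho T0 ws).
exact: sm_apot.
Qed.

Lemma sm_pbar i : sm (pbar i).
Proof. exact: sm_rhob_powR. Qed.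

Lemma sm_press_sum : sm press_sum.
Proof. by apply: sm_sum => // i; exact: sm_pbar. Qed.

Lemma integS_press_sum : integS press_sum.
Proof. by apply: (sm_slab_integrable T0 oO TO); exact: sm_press_sum. Qed.

Lemma integS_rel_energy : integS rel_energy.
Proof.
apply: eq_integS (integSD (integSD (integSB (integSB integS_eta integS_mom_sum)
  integS_cap_sum) integS_apot_sum) integS_press_sum) => t x tT _.
by rewrite rel_energyE//; exact/TO/tT0.
Qed.

Lemma smv_rem i : smv (rem i).
Proof.
have sT := smv_remT gamma s1 oO rhob0 srho; have sD := smv_remD s1 oO rhob0 srho sU.
move=> k; apply: sm_ext (smD oO (sT i k) (smZ oO nu (sD i k))) => // t x _.
by rewrite remainderE; move: (remT _ _ _ _ _ _) (remD _ _ _ _ _ _) => a a'; rewrite !mxE.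
Qed.

Lemma integS_rem_term : integS rem_term.
Proof.
have srV i : sm (fun t x => (rhob i t x)^-1) by apply: smV => // t x; exact: rhob0.
have s1' i : smv (fun t x => (rhob i t x)^-1 *: rem i t x).
  by apply: smvZ => //; exact: smv_rem.
have s2 i : sm (fun t x => (rhob i t x)^-1 * dot (ub t x) (rem i t x)).
  by apply: smM => //; apply: sm_dot => //; exact: smv_rem.
apply: integS_sum => i.
apply: eq_integS (integSB (integS_mom_dot T0 oO TO ws i (s1' i))
  (integS_sm oO TO (integS_rho T0 ws i) (s2 i))) => t x _ _.
rewrite /mom; move: (rem i t x) (ub t x) (u i t x) (r i t x) ((rhob i t x)^-1) => y U a z q.
by rewrite !dot_lin; ring.
Qed.

Lemma friction_measurable : measS friction.
Proof.
apply: (@measurable_sum _ _ _ _ _ _ (fun i z => \sum_j b i j * r i z.1 z.2 * r j z.1 z.2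
  * sqnorm (u i z.1 z.2 - u j z.1 z.2))) => i.
apply: (@measurable_sum _ _ _ _ _ _ (fun j z => b i j * r i z.1 z.2 * r j z.1 z.2
  * sqnorm (u i z.1 z.2 - u j z.1 z.2))) => j.
apply: measurable_funM.
  apply: measurable_funM; last exact: (rho_measurable ws).
  by apply: measurable_funM => //; exact: (rho_measurable ws).
apply: (@vec_sq_measurable (fun t x => u i t x - u j t x)) => k.
have -> : (fun z : R * pt3 R => (u i z.1 z.2 - u j z.1 z.2) k 0) =
    (fun z => u i z.1 z.2 k 0 - u j z.1 z.2 k 0) by apply/funext => z; rewrite !mxE.
by apply: measurable_funB; exact: (vel_measurable ws).
Qed.

Lemma Dvel_measurable i k l : measS (fun t x => Dvel w i t x k l).
Proof.
have [/(_ i)[_ [_ _ _ mD _] _ _ _] _ _ _] := ws.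
apply: measurable_funS (mD k l); [exact: measurable_cylinder|exact: slab_cylinder].
Qed.

Lemma dissipation_measurable : measS dissipation.
Proof.
apply: (@measurable_sum _ _ _ _ _ _ (fun i z =>
  2 * mu s (r i z.1 z.2) * frob (Dvel w i z.1 z.2) (Dvel w i z.1 z.2)
   + lam s (r i z.1 z.2) * (\tr (Dvel w i z.1 z.2)) ^+ 2)) => i.
have mD k l : measS (fun t x => Dvel w i t x k l) by exact: Dvel_measurable.
apply: measurable_funD.
  apply: measurable_funM.
    apply: measurable_funM => //.
    apply: (@measurableT_comp _ _ _ _ _ _ (fun z : R => z `^ ((s + 3) / 2))) (rho_measurable ws i (T := T)).
    exact: measurable_powR.
  apply: (@measurable_sum _ _ _ _ _ _ (fun k z => \sum_l Dvel w i z.1 z.2 k l * Dvel w i z.1 z.2 k l)) => k.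
  apply: (@measurable_sum _ _ _ _ _ _ (fun l z => Dvel w i z.1 z.2 k l * Dvel w i z.1 z.2 k l)) => l.
  exact: measurable_funM.
(* The definition of [lam] contains a derivative, so the measurability of the product of [lam] with
   the trace is taken from its integrability, and one more factor is multiplied in. *)
have [/(_ i)[_ _ _ _ /(_ T T0)[_ _ _ ilam _]] _ _ _] := ws.
have mtr : measS (fun t x => \tr (Dvel w i t x)).
  by apply: (@measurable_sum _ _ _ _ _ _ (fun k z => Dvel w i z.1 z.2 k k)) => k; exact: mD.
have -> : (fun z : R * pt3 R => lam s (r i z.1 z.2) * (\tr (Dvel w i z.1 z.2)) ^+ 2) =
    (fun z => (lam s (r i z.1 z.2) * \tr (Dvel w i z.1 z.2)) * \tr (Dvel w i z.1 z.2)).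
  by apply/funext => z; rewrite expr2 mulrA.
by apply: measurable_funM => //; exact: integS_measurable ilam.
Qed.

Let iP f : integS f -> integS (fun t x => th t * f t x).
Proof. exact: integS_bump. Qed.

Let JE f : integS f -> (forall t, 0 < t < T -> integ3 (f t)) ->
  J f = \int[@lebesgue_measure R]_(t in `]0, T[) (derive1 th t * int3 (f t)).
Proof.
move=> itf i3; rewrite intS_fubini; last 2 first.
- exact: integS_dbump bth itf.
- by move=> t tT; apply: integ3Zl; exact: i3.
apply: eq_Rintegral => t /set_mem; rewrite /= in_itv/= => tT.
by rewrite int3Zl//; exact: i3.
Qed.

Let D f t x := th t * f t x.

(** Friction and dissipation enter only through the lower bounds [g] and [h], whose weighted
    integrals are finite; the inequality becomes one between real numbers. *)
Lemma dissipation_tested (g h : R -> pt3 R -> R) :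
  integS g -> integS (fun t x => th t * h t x) ->
  ae_slab T (fun t x => g t x <= (2 * eps)^-1 * friction t x) ->
  ae_slab T (fun t x => h t x <= dissipation t x /\ 0 <= dissipation t x) ->
  ae_slab T (fun t x => 0 <= friction t x) ->
  - J (eta_tot gamma w) + I g + nu * I h <= 0.
Proof.
move=> ig ih gf hq f0; have [_ _ thp _] := bth.
have e2 : 0 < 2 * eps by rewrite mulr_gt0.
have th0 : th 0 = 0 by apply: (time_bump_out bth); rewrite ltxx.
have thT t : T <= t -> th t = 0.
  by move=> Tt; apply: (time_bump_out bth); rewrite negb_and -!leNgt Tt orbT.
have := hdiss.2 th (derive1 th) (time_bump_W1inf T0 bth) (fun t _ => thp t) (ex_intro _ T thT).
have -> : Sigma_tot gamma w 0 * th 0 = 0 by rewrite th0 mulr0.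
have -> : \int[@lebesgue_measure R]_(t in halfline) (Sigma_tot gamma w t * derive1 th t) =
    J (eta_tot gamma w).
  rewrite (@Rintegral_halfline _ T); last first.
    by move=> t tT; rewrite (time_bump_derive_out bth tT) mulr0.
  rewrite JE; first by apply: eq_Rintegral => t _; rewrite mulrC.
    exact: integS_eta.
  by move=> t /andP[t0 _]; apply: C0_L1_integrable hdiss.1 (ltW t0).
rewrite (@cylinder_slab_integral _ T); last first.
  move=> z zT; congr EFin; rewrite big1// => i _; rewrite big1// => j _.
  by rewrite (time_bump_out bth zT) mulr0.
rewrite [X in (_ + nu%:E * X)%E](@cylinder_slab_integral _ T); last first.
  by move=> z zT; congr EFin; rewrite big1// => i _; rewrite (time_bump_out bth zT) mulr0.
have mth : measS (fun t (_ : pt3 R) => th t).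
  by apply: (@time_factor_measurable R T th); apply: derivable_continuous; case: bth.
have L1 : ((intS T (fun t x => th t * (2 * eps * g t x)))%:E <=
   \int[leb4]_(z in slab T) (\sum_i \sum_j b i j * r i z.1 z.2 * r j z.1 z.2
            * sqnorm (u i z.1 z.2 - u j z.1 z.2) * th z.1)%:E)%E.
  have E (z : R * pt3 R) : \sum_i \sum_j b i j * r i z.1 z.2 * r j z.1 z.2
      * sqnorm (u i z.1 z.2 - u j z.1 z.2) * th z.1 = friction z.1 z.2 * th z.1.
    by rewrite mulr_suml; apply: eq_bigr => i _; rewrite mulr_suml.
  under eq_integral => z _ do rewrite E.
  apply: (@intS_le_integral R T (fun t x => friction t x * th t)).
  - by apply: measurable_funM => //; exact: friction_measurable.
  - by apply: iP; exact: integSZl.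
  - apply: (@ae_slabS R T _ _ (ae_slabI gf f0)) => t x _ _ [h1 h2].
    by split; rewrite ?mulr_ge0// mulrC ler_wpM2r// -ler_pdivlMl.
have L2 : ((intS T (fun t x => th t * h t x))%:E <=
   \int[leb4]_(z in slab T) (\sum_i
      (2 * mu s (r i z.1 z.2) * frob (Dvel w i z.1 z.2) (Dvel w i z.1 z.2) +
       lam s (r i z.1 z.2) * \tr (Dvel w i z.1 z.2) ^+ 2) * th z.1)%:E)%E.
  under eq_integral => z _ do rewrite -mulr_suml -[\sum_i _]/(dissipation z.1 z.2).
  apply: (@intS_le_integral R T (fun t x => dissipation t x * th t)).
  - by apply: measurable_funM => //; exact: dissipation_measurable.
  - exact: ih.
  - apply: (@ae_slabS R T _ _ hq) => t x _ _ [h1 h2].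
    by split; rewrite ?mulr_ge0// mulrC ler_wpM2r.
move=> H; rewrite -lee_fin; apply: le_trans H; rewrite !EFinD; apply: leeD; first apply: leeD.
- by rewrite EFinN.
- apply: (@le_trans _ _ ((2 * eps)^-1%:E * (intS T (fun t x => th t * (2 * eps * g t x)))%:E)%E); last first.
    by apply: lee_wpmul2l L1; rewrite lee_fin invr_ge0 ltW.
  rewrite -EFinM lee_fin le_eqVlt; apply/orP; left; apply/eqP.
  rewrite -intSZl; last by apply: iP; exact: integSZl.
  by apply: eq_intS => t x _ _; field; rewrite gt_eqF.
- by rewrite EFinM; apply: lee_wpmul2l L2; rewrite lee_fin.
Qed.

End EnergyInequality.

(** * Addition of all tested equations *)

Section CoreInequality.
Variables (R : realType) (n : nat) (b : 'M[R]_n) (T s gamma nu eps : R) (w : state R n).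
Variables (rhob : 'I_n -> R -> pt3 R -> R) (ub : R -> pt3 R -> 'cV[R]_3).
Variable O : set (R * pt3 R).
Hypotheses (T0 : 0 < T) (s1 : -1 <= s) (g1 : 1 < gamma) (oO : open O)
  (TO : forall t x, 0 <= t <= T -> O (t, x))
  (rhob0 : forall i t x, O (t, x) -> 0 < rhob i t x)
  (srho : forall i, sm O (rhob i)) (sU : smv O ub)
  (prho : forall i t, 0 <= t <= T -> Defs.periodic (rhob i t))
  (pU : forall t, 0 <= t <= T -> Defs.periodic (ub t)).
Hypotheses (sb : forall i j, b i j = b j i) (ws : weak_solution b s gamma nu eps w).
Variable th : R -> R.
Hypothesis bth : time_bump T th.
Implicit Types (i : 'I_n) (t : R) (x : pt3 R).
Local Notation sm := (sm O).
Local Notation smv := (smv O).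
Local Notation V := (vb s rhob).
Local Notation c := ((s + 1) / 2).
Local Notation integS := (integ4 (slab T)).
Local Notation measS f := (measurable_fun (slab T) (fun z => f z.1 z.2)).
Local Notation r := (rho w).
Local Notation u := (vel w).
Local Notation v := (drf w).

Variables kst N : R.
Hypotheses (A1 : conditionA1 b) (k0 : 0 < kst) (hd : density_bounds w T kst N)
  (eps0 : 0 < eps) (nu0 : 0 <= nu) (hdiss : dissipative b s gamma nu eps w)
  (heq : equilibrium_system T s gamma nu rhob ub).
Variables a1 a2 b1 : R.
Local Notation e := (rel_energy s gamma w rhob ub).
Local Notation rem := (remainder s gamma nu rhob ub).
Local Notation remt := (rem_term s gamma nu w rhob ub).
Hypotheses
  (Hrem : forall t x, 0 < t < T -> cube x -> (forall i, kst <= r i t x <= N) ->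
    - remt t x - (2 * eps)^-1 * friction b w t x <= a1 * e t x + b1)
  (Hden : forall i z y y' t x, kst <= z <= N -> 0 <= t <= T -> cube x ->
    quad_density s rhob ub nu i z y y' t x - press_density gamma rhob i z t x * vdiv (ub t) x
    <= a2 * rel_density s gamma rhob ub i z y y' t x).

Let sV i : smv (V i). Proof. exact: smv_vb. Qed.
Let tT0 t : 0 < t < T -> 0 <= t <= T.
Proof. by move=> /andP[t0 tT]; rewrite !ltW. Qed.
Local Notation I f := (intS T (fun t x => th t * f t x)).
Local Notation J f := (intS T (fun t x => derive1 th t * f t x)).
Local Notation good := (good s w kst N).

Lemma species_identity i t x : 0 < t < T -> good t x ->
  nu * ((mu s (r i t x) * dot (u i t x) (2 *: mdiv (sgrad (ub t)) x + (s + 1) *: grad (vdiv (ub t)) x)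
         + dot (cap w i t x) (2 *: (sgrad (ub t) x *m u i t x) + ((s + 1) * vdiv (ub t) x) *: u i t x))
        + mu s (r i t x) * (2 * frob (sgrad (ub t) x) (sgrad (ub t) x) + (s + 1) * vdiv (ub t) x ^+ 2))
  + (mu s (r i t x) * dot (u i t x) (grad (vdiv (V i t)) x)
     + dot (cap w i t x) (vgrad (V i t) x *m u i t x)
     + 2^-1 * dot (glam w i t x) (u i t x) * vdiv (V i t) x
     + 2^-1 * lam s (r i t x) * dot (u i t x) (grad (vdiv (V i t)) x))
  - (dot (mom w i t x) (dtv ub t x)
     + frob (r i t x *: tensor (u i t x) (u i t x)) (vgrad (ub t) x)
     + press gamma (r i t x) * vdiv (ub t) x
     + mu s (r i t x) * dot (v i t x) (grad (vdiv (ub t)) x)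
     + dot (cap w i t x) (vgrad (ub t) x *m v i t x)
     + 2^-1 * dot (glam w i t x) (v i t x) * vdiv (ub t) x
     + 2^-1 * lam s (r i t x) * dot (v i t x) (grad (vdiv (ub t)) x))
  - (dot (cap w i t x) (dtv (V i) t x)
     + frob (r i t x *: tensor (v i t x) (u i t x)) (vgrad (V i t) x))
  + (r i t x * dapot s gamma rhob ub i t x + dot (mom w i t x) (gapot s gamma rhob ub i t x))
  + dt (pbar gamma rhob i) t x
  - (mu s (r i t x) * vdiv (cap_flux s rhob ub i t) x
     + dot (cap w i t x) (cap_flux s rhob ub i t x))
  - nu * (mu s (r i t x) * vdiv (visc_field s ub t) x + dot (cap w i t x) (visc_field s ub t x))
  + vdiv (fun y => pbar gamma rhob i t y *: ub t y) x =
  quad_density s rhob ub nu i (r i t x) (u i t x) (v i t x) t x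
  - press_density gamma rhob i (r i t x) t x * vdiv (ub t) x
  - r i t x / rhob i t x * dot (u i t x - ub t x) (rem i t x).
Proof.
move=> tT gd; have tT' := tT0 tT; have Otx := TO x tT'.
have [/andP[rk _] gl] := gd i; have r0 : 0 < r i t x by exact: lt_le_trans rk.
have rb0 := rhob0 i Otx.
have glE : glam w i t x = (s + 1) *: (r i t x *: v i t x).
  by apply/colP => k; rewrite gl /cap !mxE.
have ptE : dt (pbar gamma rhob i) t x = dpress gamma rhob i t x * dt (rhob i) t x.
  exact: (dt_press gamma rhob0 srho i Otx).
have pfE : vdiv (fun y => pbar gamma rhob i t y *: ub t y) x =
    dot (dpress gamma rhob i t x *: grad (rhob i t) x) (ub t x)
    + press gamma (rhob i t x) * vdiv (ub t) x.
  rewrite (vdivZ (sm_pbar gamma oO rhob0 srho i) sU Otx) addrC dotC; congr (dot _ _ + _).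
  exact: (grad_press gamma rhob0 srho i Otx).
rewrite ptE pfE glE (lamE s1 (ltW r0)).
have z2 : s + 1 = 2 * c by field.
have := tested_terms_identity (r i t x) (mu s (r i t x)) nu (vdiv (V i t) x)
  (press gamma (r i t x)) (press gamma (rhob i t x)) (dpress gamma rhob i t x)
  (rhob i t x) (dt (rhob i) t x) (u i t x) (v i t x) (dtv ub t x) (dtv (V i) t x)
  (grad (rhob i t) x) (vgrad (ub t) x) (vgrad (V i t) x) z2
  (vdiv_cap_flux s oO TO rhob0 srho sU i x tT') (vdiv_visc_field s oO TO sU x tT').
move=> E; apply: (etrans E) => {E}.
have E := (@density_identity R (r i t x) _ (mu s (r i t x)) _ (press gamma (r i t x))
  (press gamma (rhob i t x)) _ _ _ _ _ _ (u i t x) (v i t x)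
  _ _ _ _ _ _ _ _ _ _ _ _ _ _ _ (lt0r_neq0 rb0) (vgrad_vb_sym s oO rhob0 srho i Otx) (sgrad_sym ub t x)
  (equilibrium_mass TO srho sU heq i x tT) (equilibrium_momentum oO TO rhob0 srho sU heq i x tT)
  (equilibrium_drift oO TO rhob0 srho sU heq i x tT)
  (divS_vb s1 oO TO rhob0 srho i x tT') (divD_ub s1 oO TO rhob0 srho sU i x tT')
  (divK_ub s1 oO TO rhob0 srho sU i x tT')).
by rewrite /quad_density /press_density; exact: E.
Qed.

(** By [Hrem] this is a lower bound of the friction divided by [2 * eps], and unlike the friction it
    is known to be integrable. *)
Definition rem_lower t x : R := - remt t x - (a1 * e t x + b1).
Definition diss_lower t x : R :=
  2 * visc_test s w ub (fun t => sgrad (ub t)) t x - visc_quad s w ub t x.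
(** [cap_test], [visc_field_test] and [press_flux] have integral zero against the cut-off; with them
    the sum becomes quadratic at every good point, up to the remainder. *)
Definition total_density t x : R :=
  nu * (visc_flux s w ub t x + visc_quad s w ub t x) + capil_part s w rhob t x
  - mom_part s gamma w ub t x - drift_part s w rhob t x + mass_part s gamma w rhob ub t x
  + press_time gamma rhob t x - cap_test s w rhob ub t x - nu * visc_field_test s w ub t x
  + press_flux gamma rhob ub t x.

Lemma total_density_le t x : 0 < t < T -> cube x -> good t x ->
  - rem_lower t x + total_density t x <= (a1 + a2) * e t x + b1.
Proof.
move=> tT cx gd.
have -> : total_density t x = \sum_i (quad_density s rhob ub nu i (r i t x) (u i t x) (v i t x) t x
    - press_density gamma rhob i (r i t x) t x * vdiv (ub t) x) - remt t x.
  rewrite /rem_term /total_density /visc_flux /visc_quad /capil_part /mom_part /drift_part.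
  rewrite /mass_part /press_time /cap_test /visc_field_test /press_flux.
  rewrite -big_split/= 2![nu * _]mulr_sumr -big_split/= -!sumrB -!big_split/= -!sumrB -big_split/=.
  by apply: eq_bigr => i _; exact: species_identity.
have : \sum_i (quad_density s rhob ub nu i (r i t x) (u i t x) (v i t x) t x
    - press_density gamma rhob i (r i t x) t x * vdiv (ub t) x) <= a2 * e t x.
  rewrite mulr_sumr; apply: ler_sum => i _; apply: Hden => //; last exact: tT0.
  by case: (gd i).
rewrite /rem_lower; move: (\sum_i _) (remt t x) (e t x) => q z y; lra.
Qed.

Let P f := integS (fun t x => th t * f t x).

Let PD f g : P f -> P g -> P (fun t x => f t x + g t x).
Proof.
by move=> pf pg; apply: eq_integS (integSD pf pg) => t x _ _; rewrite mulrDr.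
Qed.

Let PZ a f : P f -> P (fun t x => a * f t x).
Proof.
by move=> pf; apply: eq_integS (integSZl a pf) => t x _ _; rewrite mulrCA.
Qed.

Let PB f g : P f -> P g -> P (fun t x => f t x - g t x).
Proof.
by move=> pf pg; apply: eq_integS (integSB pf pg) => t x _ _; rewrite mulrBr.
Qed.

Let ID f g : P f -> P g -> I (fun t x => f t x + g t x) = I f + I g.
Proof.
by move=> pf pg; rewrite -intSD//; apply: eq_intS => t x _ _; rewrite mulrDr.
Qed.

Let IB f g : P f -> P g -> I (fun t x => f t x - g t x) = I f - I g.
Proof.
by move=> pf pg; rewrite -intSB//; apply: eq_intS => t x _ _; rewrite mulrBr.
Qed.

Let IZ a f : P f -> I (fun t x => a * f t x) = a * I f.
Proof.
by move=> pf; rewrite -intSZl//; apply: eq_intS => t x _ _; rewrite mulrCA.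
Qed.

Let ie : integS e. Proof. exact: (integS_rel_energy T0 g1 oO TO rhob0 srho sU ws hdiss). Qed.
Let iP f : integS f -> P f. Proof. exact: integS_bump. Qed.
Let icst (a : R) : integS (fun _ _ => a).
Proof. by apply: (sm_slab_integrable T0 oO TO); exact: sm_cst. Qed.

Let Psum (F : 'I_n -> R -> pt3 R -> R) : (forall i, P (F i) /\ I (F i) = 0) ->
  P (fun t x => \sum_i F i t x) /\ I (fun t x => \sum_i F i t x) = 0.
Proof.
move=> HF; have iF i : integS (fun t x => th t * F i t x) by case: (HF i).
split; first by apply: eq_integS (integS_sum _ _ iF) => t x _ _; rewrite mulr_sumr.
rewrite (eq_intS (g := fun t x => \sum_i th t * F i t x)); last first.
  by move=> t x _ _; rewrite mulr_sumr.
by rewrite intS_sum// big1// => i _; case: (HF i).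
Qed.

Lemma cap_test0 : P (cap_test s w rhob ub) /\ I (cap_test s w rhob ub) = 0.
Proof.
apply: (Psum (F := fun i t x => mu s (r i t x) * vdiv (cap_flux s rhob ub i t) x
   + dot (cap w i t x) (cap_flux s rhob ub i t x))) => i.
by have [] := tested_weak_grad T0 s1 oO TO ws bth k0 hd i
  (smv_cap_flux s oO rhob0 srho sU i) (@periodic_cap_flux _ _ _ s _ _ prho pU i).
Qed.

Lemma visc_field_test0 : P (visc_field_test s w ub) /\ I (visc_field_test s w ub) = 0.
Proof.
apply: (Psum (F := fun i t x => mu s (r i t x) * vdiv (visc_field s ub t) x
   + dot (cap w i t x) (visc_field s ub t x))) => i.
by have [] := tested_weak_grad T0 s1 oO TO ws bth k0 hd i
  (smv_visc_field s oO sU) (@periodic_visc_field _ _ s _ pU).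
Qed.

Let ppbar i t : 0 <= t <= T -> Defs.periodic (pbar gamma rhob i t).
Proof. by move=> tT x k; rewrite /pbar prho. Qed.

Lemma press_flux0 : P (press_flux gamma rhob ub) /\ I (press_flux gamma rhob ub) = 0.
Proof.
apply: (Psum (F := fun i t x => vdiv (fun y => pbar gamma rhob i t y *: ub t y) x)) => i.
have spU : smv (fun t x => pbar gamma rhob i t x *: ub t x).
  by apply: smvZ => //; exact: sm_pbar.
have [|] := tested_divergence T0 oO TO bth spU; last by [].
by move=> t tT x k; rewrite (ppbar i tT) (pU tT).
Qed.

Lemma press_time0 : J (press_sum gamma rhob) + I (press_time gamma rhob) = 0.
Proof.
have sp i := sm_pbar gamma oO rhob0 srho i.
have i1 i : integS (fun t x => derive1 th t * pbar gamma rhob i t x).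
  by apply: (integS_dbump bth); apply: (sm_slab_integrable T0 oO TO).
have i2 i : integS (fun t x => th t * dt (pbar gamma rhob i) t x).
  by apply: (integS_bump bth); apply: (sm_slab_integrable T0 oO TO); exact: sm_dt.
rewrite (eq_intS (g := fun t x => \sum_i derive1 th t * pbar gamma rhob i t x)); last first.
  by move=> t x _ _; rewrite mulr_sumr.
rewrite [X in _ + X](eq_intS (g := fun t x => \sum_i th t * dt (pbar gamma rhob i) t x)); last first.
  by move=> t x _ _; rewrite mulr_sumr.
rewrite !intS_sum// -big_split big1// => i _.
exact: (tested_time T0 oO TO bth (sp i) (@ppbar i)).
Qed.

Lemma P_press_time : P (press_time gamma rhob).
Proof.
apply: iP; apply: (sm_slab_integrable T0 oO TO); apply: sm_sum => // i.
by apply: sm_dt => //; exact: sm_pbar.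
Qed.

(** On the good set [lam] is [(s + 1) mu], so the viscous term of the momentum equation is
    [visc_test] for the full gradient. *)
Lemma visc_part_flux : I (visc_part s w ub) = - I (visc_flux s w ub).
Proof.
have [i1 _ <-] := tested_symgrad_vgrad oO TO sU pU ws bth.
have [_ i2 _] := tested_momentum T0 oO TO sU pU sb ws bth.
apply: ae_eq_intS; [exact: (integS_measurable i2)|exact: (integS_measurable i1)|].
apply: (@ae_slabS _ _ _ _ (ae_good s1 ws hd)) => t x _ _ gd.
congr (_ * _); apply: eq_bigr => i _; have [/andP[rk _] _] := gd i.
by rewrite (lamE s1)// ltW// (lt_le_trans k0).
Qed.

Lemma rel_energy_time : J e = J (eta_tot gamma w)
  - J (fun t x => \sum_i dot (mom w i t x) (ub t x))
  - J (fun t x => \sum_i dot (cap w i t x) (V i t x))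
  + J (fun t x => \sum_i r i t x * apot s gamma rhob ub i t x) + J (press_sum gamma rhob).
Proof.
have d f : integS f -> integS (fun t x => derive1 th t * f t x) by exact: integS_dbump.
have j1 := d _ (integS_eta T0 ws hdiss); have j2 := d _ (integS_mom_sum T0 oO TO sU ws).
have j3 := d _ (integS_cap_sum T0 oO TO rhob0 srho ws).
have j4 := d _ (integS_apot_sum T0 oO TO rhob0 srho sU ws).
have j5 := d _ (integS_press_sum gamma T0 oO TO rhob0 srho).
rewrite -(intSB j1 j2) -(intSB (integSB j1 j2) j3) -(intSD (integSB (integSB j1 j2) j3) j4).
rewrite -(intSD (integSD (integSB (integSB j1 j2) j3) j4) j5).
apply: eq_intS => t x tT _.
rewrite (rel_energyE s w ub g1 rhob0 (TO x (tT0 tT))).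
by rewrite !mulrDr !mulrN.
Qed.

(** The accounting of [core_inequality]. Letters beginning with [a] are integrals against the
    derivative of the cut-off, capital ones against the cut-off; the hypotheses are the energy
    inequality and the tested equations. *)
Let final (a0 am ac ar ap G Q W S M Vp C D Ms Pt : R) :
  - a0 + G + nu * (2 * S - Q) <= 0 -> S = - W -> am + M = nu * Vp -> Vp = - W ->
  ac + D = C -> ar + Ms = 0 -> ap + Pt = 0 ->
  - (a0 - am - ac + ar + ap) <=
  - G + (nu * (W + Q) + C - M - D + Ms + Pt - 0 - nu * 0 + 0).
Proof.
move=> H E1 E2 E3 E4 E5 E6; rewrite E1 in H; rewrite E3 in E2.
have {}E2 : M = - (nu * W) - am by rewrite -mulrN -E2; ring.
have H' : - a0 + G - 2 * (nu * W) - nu * Q <= 0 by apply: le_trans H; rewrite le_eqVlt; apply/orP; left; apply/eqP; ring.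
by rewrite mulrDr mulr0; lra.
Qed.

Lemma core_inequality : - J e <= I (fun t x => (a1 + a2) * e t x + b1).
Proof.
have irem : integS remt by exact: (integS_rem_term T0 s1 oO TO rhob0 srho sU ws).
have ilow : integS rem_lower.
  apply: integSB; last by apply: integSD => //; exact: integSZl.
  by apply: eq_integS (integSZl (-1) irem) => t x _ _; rewrite mulN1r.
have [p1 m1] := tested_mass T0 g1 oO TO rhob0 srho sU prho pU ws bth.
have [p2 p3 m2] := tested_momentum T0 oO TO sU pU sb ws bth.
have [p4 p5 m3] := tested_drift T0 oO TO rhob0 srho prho ws bth.
have [p6 p7 m4] := tested_symgrad_sgrad oO TO sU pU ws bth.
have p8 : P (visc_quad s w ub).
  by apply: iP; exact: (integS_visc_quad T0 s1 oO TO sU ws k0 hd).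
have [p9 m5] := cap_test0; have [p10 m6] := visc_field_test0.
have [p11 m7] := press_flux0; have p12 := P_press_time.
have pl : P diss_lower by apply: PB => //; exact: PZ.
have ag := ae_good s1 ws hd.
have hdis := dissipation_tested T0 ws bth eps0 nu0 hdiss ilow pl.
have {}hdis : - J (eta_tot gamma w) + I rem_lower + nu * I diss_lower <= 0.
  apply: hdis.
  - apply: (@ae_slabS _ _ _ _ ag) => t x tT cx gd.
    have := Hrem tT cx (fun i => (gd i).1); rewrite /rem_lower.
    by rewrite lerBlDr addrC -lerBlDr.
  - apply: (@ae_slabS _ _ _ _ ag) => t x tT cx gd.
    have m0 i : 0 <= mu s (r i t x) by exact: powR_ge0.
    have z0 : 0 <= s + 1 by rewrite -lerBlDr sub0r.
    have lE i : lam s (r i t x) = (s + 1) * mu s (r i t x).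
      by have [/andP[rk _] _] := gd i; rewrite (lamE s1)// ltW// (lt_le_trans k0).
    split.
      rewrite /diss_lower /visc_test /visc_quad mulr_sumr -sumrB.
      by apply: ler_sum => i _; rewrite lE; exact: viscous_square.
    apply: sumr_ge0 => i _; rewrite lE; apply: addr_ge0; apply: mulr_ge0.
    + exact: mulr_ge0.
    + by apply: sumr_ge0 => k _; apply: sumr_ge0 => l _; rewrite -expr2 sqr_ge0.
    + exact: mulr_ge0.
    + exact: sqr_ge0.
  - apply: (@ae_slabS _ _ _ _ ag) => t x tT cx gd.
    apply: sumr_ge0 => i _; apply: sumr_ge0 => j _.
    apply: (@friction_term_ge0 _ _ b (fun i => r i t x) (fun i => u i t x)) => // i'.
    by have [/andP[rk _] _] := gd i'; rewrite ltW// (lt_le_trans k0).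
rewrite (IB (PZ 2 p6) p8) (IZ 2 p6) in hdis.
have q1 := PD p7 p8; have q2 := PZ nu q1; have q3 := PD q2 p5; have q4 := PB q3 p2.
have q5 := PB q4 p4; have q6 := PD q5 p1; have q7 := PD q6 p12; have q8 := PB q7 p9.
have q9 := PZ nu p10; have q10 := PB q8 q9; have q11 := PD q10 p11.
have El : I (fun t x => - rem_lower t x + total_density t x) = - I rem_lower + I total_density.
  have pn : P (fun t x => - rem_lower t x).
    by apply: eq_integS (PZ (-1) (iP ilow)) => t x _ _; rewrite mulN1r.
  rewrite (ID pn q11); congr (_ + _).
  rewrite -mulN1r -(IZ (-1) (iP ilow)); apply: eq_intS => t x _ _; by rewrite mulN1r.
(* The integrals are gathered into one density, because the pointwise estimate concerns only the
   whole sum. *)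
apply: (@le_trans _ _ (I (fun t x => - rem_lower t x + total_density t x))); last first.
  apply: ae_le_intS.
  - apply: eq_integS (integSD (PZ (-1) (iP ilow)) q11) => t x _ _.
    by rewrite -mulrDr mulN1r.
  - exact: (iP (integSD (integSZl (a1 + a2) ie) (icst b1))).
  - apply: (@ae_slabS _ _ _ _ ag) => t x tT cx gd.
    by apply: ler_wpM2l; [case: bth|exact: total_density_le].
rewrite El /total_density (ID q10 p11) (IB q8 q9) (IZ nu p10) (IB q7 p9) (ID q6 p12).
rewrite (ID q5 p1) (IB q4 p4) (IB q3 p2) (ID q2 p5) (IZ nu q1) (ID p7 p8) m5 m6 m7.
rewrite rel_energy_time; apply: final hdis m4 m2 visc_part_flux m3 m1 press_time0.
Qed.

End CoreInequality.

Lemma ae_forall_fin d (S : measurableType d) (R : realType) (mu : {measure set S -> \bar R})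
    (I : finType) (P : I -> S -> Prop) :
  (forall i, {ae mu, forall x, P i x}) -> {ae mu, forall x, forall i, P i x}.
Proof.
move=> aeP; suff H (l : seq I) : {ae mu, forall x, forall i, i \in l -> P i x}.
  by apply: filterS (H (enum I)) => x Hx i; apply: Hx; rewrite mem_enum.
elim: l => [|a l IH]; first exact: aeW.
apply: filterS2 (aeP a) IH => x Pa IHx i; rewrite inE => /predU1P[->//|]; exact: IHx.
Qed.

(** * From the weak inequality to an estimate at every time *)

Section RelativeEnergy.
Variables (R : realType) (n : nat) (b : 'M[R]_n) (T s gamma nu eps : R) (w : state R n).
Variables (rhob : 'I_n -> R -> pt3 R -> R) (ub : R -> pt3 R -> 'cV[R]_3).
Variable O : set (R * pt3 R).
Hypotheses (T0 : 0 < T) (s1 : -1 <= s) (g1 : 1 < gamma) (oO : open O)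
  (TO : forall t x, 0 <= t <= T -> O (t, x))
  (rhob0 : forall i t x, O (t, x) -> 0 < rhob i t x)
  (srho : forall i, sm O (rhob i)) (sU : smv O ub)
  (prho : forall i t, 0 <= t <= T -> Defs.periodic (rhob i t))
  (pU : forall t, 0 <= t <= T -> Defs.periodic (ub t)).
Hypotheses (sb : forall i j, b i j = b j i) (ws : weak_solution b s gamma nu eps w).
Implicit Types (i : 'I_n) (t : R) (x : pt3 R).
Local Notation sm := (sm O).
Local Notation smv := (smv O).
Local Notation V := (vb s rhob).
Local Notation c := ((s + 1) / 2).
Local Notation integS := (integ4 (slab T)).
Local Notation measS f := (measurable_fun (slab T) (fun z => f z.1 z.2)).
Local Notation r := (rho w).
Local Notation u := (vel w).
Local Notation v := (drf w).

Variables kst N : R.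
Hypotheses (A1 : conditionA1 b) (k0 : 0 < kst) (hd : density_bounds w T kst N)
  (eps0 : 0 < eps) (nu0 : 0 <= nu) (hdiss : dissipative b s gamma nu eps w).
Local Notation e := (rel_energy s gamma w rhob ub).

Let sV i : smv (V i). Proof. exact: smv_vb. Qed.

Lemma within_continuous_eq (f g : R -> R) : (forall t, t \in `[0, T] -> f t = g t) ->
  {within `[0, T]%classic, continuous f} -> {within `[0, T]%classic, continuous g}.
Proof. by move=> fg; apply: subspace_eq_continuous => t /set_mem; exact: fg. Qed.

Lemma within_continuous_sum (I : Type) (l : seq I) (f : I -> R -> R) :
  (forall a, {within `[0, T]%classic, continuous (f a)}) ->
  {within `[0, T]%classic, continuous (fun t => \sum_(a <- l) f a t)}.
Proof.
move=> cf; elim: l => [|a l IH].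
  rewrite (_ : (fun t => _) = (fun=> 0)); last by apply/funext => t; rewrite big_nil.
  by apply: continuous_subspaceT; exact: cst_continuous.
rewrite (_ : (fun t => _) = (fun t => f a t + \sum_(a <- l) f a t)); last first.
  by apply/funext => t; rewrite big_cons.
exact: within_continuousD.
Qed.

Lemma sm_section_measurable g t : sm g -> 0 <= t <= T -> measurable_fun cube (g t).
Proof.
move=> sg tT; apply: continuous_measurable_pt3; last exact: measurable_cube.
by move=> x; exact: (continuous_section (sm_continuous sg (TO x tT))).
Qed.

Lemma C0_sm f g : C0_Lp 1 f -> sm g ->
  {within `[0, T]%classic, continuous (fun t => int3 (fun x => f t x * g t x))} /\
  forall t, 0 <= t <= T -> integ3 (fun x => f t x * g t x).
Proof.
move=> fC sg; have [M M0 HM] := sm_bounded TO sg.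
have [L L0 HL] := sm_time_lipschitz oO TO sg.
have mg t : 0 <= t <= T -> measurable_fun cube (g t) by exact: sm_section_measurable.
split; first exact: (weighted_continuous fC mg HM HL).
by move=> t tT; apply: (integ3_weighted fC mg HM).
Qed.

Lemma C0_cst (a : R) : C0_Lp 1 (fun (_ : R) (_ : pt3 R) => a).
Proof.
split=> [t _|t0 _].
  split; first exact: measurable_cst.
  have := @continuous_cube_integrable R (fun=> `|a|) (@cst_continuous _ _ _).
  move=> /integrableP[_]; apply: le_lt_trans; rewrite le_eqVlt; apply/orP; left; apply/eqP.
  by apply: eq_integral => x _ /=; rewrite powRr1// normr_id.
rewrite (_ : (fun t => _) = (fun=> 0%E)); first exact: cvg_cst.
apply/funext => t; rewrite -[RHS](@integral0 _ _ _ (@leb3 R) cube).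
by apply: eq_integral => x _; rewrite subrr normr0 powR0// oner_eq0.
Qed.

Lemma dot_C0_sm (F H : R -> pt3 R -> 'cV[R]_3) : (forall k, C0_Lp 1 (fun t x => F t x k 0)) ->
  smv H ->
  {within `[0, T]%classic, continuous (fun t => int3 (fun x => dot (F t x) (H t x)))} /\
  forall t, 0 <= t <= T -> integ3 (fun x => dot (F t x) (H t x)).
Proof.
move=> FC sH; have i3 k t : 0 <= t <= T -> integ3 (fun x => F t x k 0 * H t x k 0).
  by move=> tT; have [_] := C0_sm (FC k) (sH k); apply.
split; last by move=> t tT; apply: integ3_sum => k; exact: i3.
have : {within `[0, T]%classic, continuous
    (fun t => \sum_k int3 (fun x => F t x k 0 * H t x k 0))}.
  by apply: within_continuous_sum => k; have [] := C0_sm (FC k) (sH k).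
apply: within_continuous_eq => t; rewrite in_itv/= => tT.
by rewrite -int3_sum// => k; exact: i3.
Qed.

Lemma sum_C0_sm (I : finType) (f : I -> R -> pt3 R -> R) :
  (forall a, {within `[0, T]%classic, continuous (fun t => int3 (f a t))} /\
    forall t, 0 <= t <= T -> integ3 (f a t)) ->
  {within `[0, T]%classic, continuous (fun t => int3 (fun x => \sum_a f a t x))} /\
  forall t, 0 <= t <= T -> integ3 (fun x => \sum_a f a t x).
Proof.
move=> H; split; last by move=> t tT; apply: integ3_sum => a; exact: (H a).2.
have : {within `[0, T]%classic, continuous (fun t => \sum_a int3 (f a t))}.
  by apply: within_continuous_sum => a; exact: (H a).1.
apply: within_continuous_eq => t; rewrite in_itv/= => tT.
by rewrite -int3_sum// => a; exact: (H a).2.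
Qed.

(** Each term of [rel_energyE] is the energy, a smooth function, or a continuous curve in L^1 times
    a smooth weight. Continuity up to the end points lets the weak Gronwall lemma start from the
    initial time. *)
Lemma rel_energy_continuous :
  {within `[0, T]%classic, continuous (fun t => int3 (e t))} /\
  forall t, 0 <= t <= T -> integ3 (e t).
Proof.
have sa i : sm (apot s gamma rhob ub i) by exact: sm_apot.
have sp : sm (press_sum gamma rhob) by exact: sm_press_sum.
have [c2 i2] := sum_C0_sm (fun i => dot_C0_sm (mom_C0 ws i) sU).
have [c3 i3] := sum_C0_sm (fun i => dot_C0_sm (cap_C0 ws i) (sV i)).
have [c4 i4] := sum_C0_sm (fun i => C0_sm (rho_C0 ws i) (sa i)).
have [c5 i5] := C0_sm (C0_cst 1) sp.
have c1 := C0_L1_int_continuous (T := T) hdiss.1.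
have i1 t : 0 <= t <= T -> integ3 (eta_tot gamma w t).
  by move=> /andP[t0 _]; exact: C0_L1_integrable hdiss.1 t0.
pose F t x := eta_tot gamma w t x - \sum_i dot (mom w i t x) (ub t x)
  - \sum_i dot (cap w i t x) (V i t x) + \sum_i r i t x * apot s gamma rhob ub i t x
  + 1 * press_sum gamma rhob t x.
have FE t : 0 <= t <= T -> e t = F t.
  move=> tT; apply/funext => x; rewrite /F mul1r.
  exact: (rel_energyE s w ub g1 rhob0 (TO x tT)).
split; last first.
  move=> t tT; rewrite FE//; apply: integ3D; last exact: i5.
  apply: integ3D; last exact: i4; apply: integ3B; last exact: i3.
  by apply: integ3B; [exact: i1|exact: i2].
have := within_continuousD (within_continuousD (within_continuousB
  (within_continuousB c1 c2) c3) c4) c5.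
apply: within_continuous_eq => t; rewrite in_itv/= => tT.
have j1 := i1 t tT; have j2 := i2 t tT; have j3 := i3 t tT; have j4 := i4 t tT; have j5 := i5 t tT.
rewrite FE// /F int3D//; last by apply: integ3D => //; apply: integ3B => //; exact: integ3B.
rewrite int3D//; last by apply: integ3B => //; exact: integ3B.
by rewrite int3B//; [rewrite int3B|exact: integ3B].
Qed.

Lemma int3_cst (a : R) : int3 (fun=> a) = a.
Proof.
rewrite /int3 (@Rintegral_cst _ _ _ (@leb3 R) cube (@measurable_cube R)).
have H : fine (leb3 (@cube R)) = 1 by rewrite leb3_cube.
by rewrite -[RHS]mulr1; congr (_ * _); exact: H.
Qed.

Lemma rel_energy_gronwall (a1 a2 b1 : R) : 0 <= a1 + a2 -> 0 <= b1 ->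
  equilibrium_system T s gamma nu rhob ub ->
  (forall t x, 0 < t < T -> cube x -> (forall i, kst <= r i t x <= N) ->
    - rem_term s gamma nu w rhob ub t x - (2 * eps)^-1 * friction b w t x
    <= a1 * e t x + b1) ->
  (forall i z y y' t x, kst <= z <= N -> 0 <= t <= T -> cube x ->
    quad_density s rhob ub nu i z y y' t x - press_density gamma rhob i z t x * vdiv (ub t) x
    <= a2 * rel_density s gamma rhob ub i z y y' t x) ->
  forall t, 0 <= t <= T ->
  int3 (e t) <= (int3 (e 0) + b1 * t) * expR ((a1 + a2) * t).
Proof.
move=> a0 b10 heq Hrem Hden.
have [cE iE] := rel_energy_continuous.
apply: (weak_gronwall T0 a0 b10 cE) => th bth.
have core := core_inequality T0 s1 g1 oO TO rhob0 srho sU prho pU sb ws bth A1 k0 hd eps0 nu0 hdiss heq Hrem Hden.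
have ie : integS e by exact: (integS_rel_energy T0 g1 oO TO rhob0 srho sU ws hdiss).
have tT0 t : 0 < t < T -> 0 <= t <= T by move=> /andP[t0 tT]; rewrite !ltW.
have icst : integS (fun _ _ => b1) by apply: (sm_slab_integrable T0 oO TO); exact: sm_cst.
have i3c : integ3 (fun=> b1) by apply: continuous_cube_integrable; exact: cst_continuous.
have E1 : intS T (fun t x => derive1 th t * e t x) =
    \int[@lebesgue_measure R]_(t in `]0, T[) (derive1 th t * int3 (e t)).
  rewrite intS_fubini; last 2 first.
  - exact: integS_dbump bth ie.
  - by move=> t tT; apply: integ3Zl; apply: iE; exact: tT0.
  apply: eq_Rintegral => t /set_mem; rewrite /= in_itv/= => tT.
  by rewrite int3Zl//; apply: iE; exact: tT0.
have E2 : intS T (fun t x => th t * ((a1 + a2) * e t x + b1)) =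
    \int[@lebesgue_measure R]_(t in `]0, T[) (th t * ((a1 + a2) * int3 (e t) + b1)).
  have i3 t : 0 < t < T -> integ3 (fun x => (a1 + a2) * e t x + b1).
    by move=> tT; apply: integ3D => //; apply: integ3Zl; apply: iE; exact: tT0.
  rewrite intS_fubini; last 2 first.
  - exact: integS_bump bth (integSD (integSZl (a1 + a2) ie) icst).
  - by move=> t tT; apply: integ3Zl; exact: i3.
  apply: eq_Rintegral => t /set_mem; rewrite /= in_itv/= => tT.
  have ie' := iE t (tT0 t tT).
  by rewrite int3Zl ?int3D ?int3Zl ?int3_cst//; [exact: integ3Zl|exact: i3].
by rewrite -E1 -E2.
Qed.

(** The end points are included, where no density bound is assumed: if the density vanishes at a
    point, its factor in front of the squares makes the two integrands agree. *)
Lemma Psi_rel_energy t : 0 <= t <= T -> Psi s gamma w rhob ub t = (int3 (e t))%:E.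
Proof.
move=> tT; have [_ /(_ t tT) iE] := rel_energy_continuous.
rewrite int3_EFin; last exact: iE.
apply: (@eq_integral _ _ _ (@leb3 R)) => x _; congr EFin; apply: eq_bigr => i _.
have K (a : R) (y U : 'cV[R]_3) :
    2^-1 * a * sqnorm (a^-1 *: (a *: y) - U) = 2^-1 * a * sqnorm (y - U).
  by have [->|a0] := eqVneq a 0; [rewrite mulr0 !mul0r|rewrite scalerA mulVf// scale1r].
have rb := lt0r_neq0 (rhob0 i (TO x tT)).
have K2 (U : 'cV[R]_3) : (rhob i t x)^-1 *: (rhob i t x *: U) = U.
  by rewrite scalerA mulVf// scale1r.
by rewrite /rel_density /mom /cap !K2 !K.
Qed.

Hypothesis rel0 : forall i z y y' t x, kst <= z <= N -> 0 <= t <= T -> cube x ->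
  0 <= rel_density s gamma rhob ub i z y y' t x.

Lemma rel_energy_ge0 t : 0 < t < T -> 0 <= int3 (e t).
Proof.
move=> tT; have tT' : 0 <= t <= T by case/andP: tT => ? ?; rewrite !ltW.
have [_ /(_ t tT') iE] := rel_energy_continuous.
have i0 : integ3 (fun=> 0 : R) by apply: continuous_cube_integrable; exact: cst_continuous.
rewrite -(int3_cst 0); apply: (@ae_le_Rintegral _ _ _ (@leb3 R) cube (@measurable_cube R)) => //.
have H := @ae_forall_fin _ _ _ (@leb3 R) _ _ (fun i => hd i tT).
apply: (@ae_all_imp _ _ _ (@leb3 R) _ _ _ H) => x cx rx.
by apply: sumr_ge0 => i _; exact: rel0.
Qed.

(** The density bounds hold for positive times only, so the sign at time 0 is obtained by continuity
    from [rel_energy_ge0]. *)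
Lemma rel_energy0_ge0 : 0 <= int3 (e 0).
Proof.
have [cE _] := rel_energy_continuous.
rewrite leNgt; apply/negP => E0.
have c0 := (@subspace_continuousP _ _ _ (fun t => int3 (e t))).1 cE 0.
have {}c0 : int3 (e t) @[t --> within `[0, T]%classic (nbhs (0 : R))] --> int3 (e 0).
  by apply: c0; rewrite /= in_itv/= lexx ltW.
have /nbhs_ballP[d /= d0 Hd] : nbhs (0 : R) (fun t => `[0, T]%classic t -> int3 (e t) < 0).
  exact: (cvgr_lt (int3 (e 0)) c0 0 E0).
pose t := Num.min (d / 2) (T / 2).
have h (a : R) : 0 < a -> a / 2 < a by lra.
have t0 : 0 < t by rewrite lt_min !divr_gt0.
have tT : t < T by rewrite gt_min (h T)// orbT.
have td : t < d by rewrite gt_min h.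
have : int3 (e t) < 0.
  apply: Hd; last by rewrite in_itv/= !ltW.
  by rewrite -ball_normE/= sub0r normrN gtr0_norm.
by rewrite ltNge rel_energy_ge0// t0.
Qed.

End RelativeEnergy.

(** The quantifiers carry the dependence of the constants: [C] is fixed before [delta], [D] after
    it, both before [nu], [eps] and the weak solution. The function [p] witnesses that [Psi] is
    finite. *)
Lemma stability_estimate (R : realType) (n : nat) (b : 'M[R]_n) (T s gamma kst N : R)
    (rhob : 'I_n -> R -> pt3 R -> R) (ub : R -> pt3 R -> 'cV[R]_3) (O : set (R * pt3 R)) :
  0 < T -> -1 <= s -> 1 < gamma -> open O -> (forall t x, 0 <= t <= T -> O (t, x)) ->
  (forall i t x, O (t, x) -> 0 < rhob i t x) -> (forall i, sm O (rhob i)) -> smv O ub ->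
  (forall i t, 0 <= t <= T -> Defs.periodic (rhob i t)) ->
  (forall t, 0 <= t <= T -> Defs.periodic (ub t)) ->
  conditionA1 b -> 0 < kst ->
  exists2 C, 0 < C & forall delta, 0 < delta -> coercive b kst N delta ->
  exists2 D, 0 < D & forall nu eps (w : state R n), 0 <= nu -> 0 < eps ->
    equilibrium_system T s gamma nu rhob ub -> weak_solution b s gamma nu eps w ->
    dissipative b s gamma nu eps w -> density_bounds w T kst N ->
  exists p : R -> R, [/\ forall t, 0 <= t <= T -> Psi s gamma w rhob ub t = (p t)%:E,
    0 <= p 0 &
    forall t, 0 <= t <= T ->
      p t <= (p 0 + eps * D * (nu ^+ 2 + 1)) * expR (C * (nu ^+ 2 + nu + 1) * t)].
Proof.
move=> T0 s1 g1 oO TO rhob0 srho sU prho pU A1 k0.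
have [sb _ _] := A1.
have [k kp rel1] := rel_density_coercive s ub N g1 k0 oO TO rhob0 srho.
have [A2 A20 dens] := density_le N s1 g1 k0 oO TO rhob0 srho sU.
have [A A0 remb] := remainder_bound N s1 g1 k0 oO TO rhob0 srho sU.
(* The growth rate is [(A + A2) * (1 + nu)], and [1 + nu] is at most [nu ^+ 2 + nu + 1]. *)
exists (A + A2); first exact: addr_gt0.
move=> delta d0 cd; have [B B0 {}remb] := remb b delta d0 cd.
(* Gronwall's lemma yields the source times [t], which is bounded by the source times [T]. *)
exists (B * T); first exact: mulr_gt0.
move=> nu eps w nu0 eps0 heq ws hdiss hd.
have rel0 i z y y' t x : kst <= z <= N -> 0 <= t <= T -> cube x ->
    0 <= rel_density s gamma rhob ub i z y y' t x.
  by move=> hz tT cx; have [_ /le_trans H /H] := rel1 i z y y' t x hz tT cx.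
pose E t := int3 (rel_energy s gamma w rhob ub t).
have E0 : 0 <= E 0 by exact: (rel_energy0_ge0 T0 g1 oO TO rhob0 srho sU ws hd hdiss rel0).
have nu1 : 0 <= 1 + nu by rewrite addr_ge0.
have b10 : 0 <= eps * B * (1 + nu ^+ 2).
  by rewrite mulr_ge0// ?addr_ge0 ?sqr_ge0// mulr_ge0 ?ltW.
have a0 : 0 <= A * (1 + nu) + A2 * (1 + nu) by rewrite addr_ge0 ?mulr_ge0 ?(ltW A0) ?(ltW A20).
have tT' t : 0 < t < T -> 0 <= t <= T by case/andP => ? ?; rewrite !ltW.
have HR : forall t x, 0 < t < T -> cube x -> (forall i, kst <= rho w i t x <= N) ->
    - rem_term s gamma nu w rhob ub t x - (2 * eps)^-1 * friction b w t x
    <= A * (1 + nu) * rel_energy s gamma w rhob ub t x + eps * B * (1 + nu ^+ 2).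
  move=> t x /tT' tT cx hr.
  exact: (remb nu eps (fun i => rho w i t x) (fun i => vel w i t x)
    (fun i => drf w i t x) t x nu0 eps0 hr tT cx).
have HD : forall i z y y' t x, kst <= z <= N -> 0 <= t <= T -> cube x ->
    quad_density s rhob ub nu i z y y' t x - press_density gamma rhob i z t x * vdiv (ub t) x
    <= A2 * (1 + nu) * rel_density s gamma rhob ub i z y y' t x.
  by move=> i z y y' t x; exact: dens.
have G := rel_energy_gronwall T0 s1 g1 oO TO rhob0 srho sU prho pU sb ws A1 k0 hd eps0 nu0
  hdiss a0 b10 heq HR HD.
exists E; split=> // [t tT|t tT].
  exact: (Psi_rel_energy g1 oO TO rhob0 srho sU ws hdiss tT).
have {G} := G t tT; rewrite -/(E t) -/(E 0) => G; apply: (le_trans G).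
have [t0 tT1] := andP tT.
apply: ler_pM => //.
- by rewrite addr_ge0// mulr_ge0.
- rewrite lerD2l (_ : eps * (B * T) * (nu ^+ 2 + 1) = eps * B * (1 + nu ^+ 2) * T); last by ring.
  exact: ler_wpM2l.
- rewrite ler_expR; apply: ler_wpM2r => //.
  rewrite -mulrDl; apply: ler_wpM2l; first by rewrite addr_ge0// ltW.
  by rewrite addrC -addrA lerDr sqr_ge0.
Qed.

(** * Passage from the given data to their smooth extensions *)

Lemma smooth_data_extension (R : realType) (n : nat) (T : R)
    (rhob : 'I_n -> R -> pt3 R -> R) (ub : R -> pt3 R -> 'cV[R]_3) :
  smooth_data T rhob ub ->
  exists (rhob' : 'I_n -> R -> pt3 R -> R) (ub' : R -> pt3 R -> 'cV[R]_3) (O : set (R * pt3 R)),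
    [/\ open O /\ forall t x, 0 <= t <= T -> O (t, x),
        forall i t x, O (t, x) -> 0 < rhob' i t x,
        (forall i, sm O (rhob' i)) /\ smv O ub',
        (forall i t, Defs.periodic (rhob' i t)) /\ forall t, Defs.periodic (ub' t) &
        forall t, 0 <= t <= T -> (forall i, rhob i t = rhob' i t) /\ ub t = ub' t].
Proof.
move=> [sr su rp].
have [g Hg] := choice sr; have [h Hh] := choice su.
exists g, (fun t x => \col_k h k t x), [set z | forall i, 0 < g i z.1 z.2].
have eqg i t x : 0 <= t <= T -> rhob i t x = g i t x by have [_ _] := Hg i; apply.
have eqh k t x : 0 <= t <= T -> ub t x k 0 = h k t x by have [_ _] := Hh k; apply.
split.
- split; last by move=> t x tT i /=; rewrite -eqg//; exact: rp.
  rewrite openE => z /= gz.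
  apply: (@filter_forall _ _ (fun i => [set y : R * pt3 R | 0 < g i y.1 y.2]) (nbhs z)) => i.
  have [sg _ _] := Hg i.
  have cg : {for z, continuous (fun p : R * pt3 R => g i p.1 p.2)}.
    exact: differentiable_continuous (sg [::] z).
  exact: (cvgr_gt (g i z.1 z.2) cg 0 (gz i)).
- by move=> i t x; apply.
- split=> [i|k]; first by apply: smooth_smooth_on; have [] := Hg i.
  have [sh _ _] := Hh k.
  rewrite (_ : (fun t x => _) = h k); first exact: smooth_smooth_on.
  by apply/funext => t; apply/funext => x; rewrite mxE.
- split=> [i|t x k]; first by have [] := Hg i.
  by apply/matrixP => l j; rewrite !mxE; have [_ ph _] := Hh l; exact: ph.
- move=> t tT; split=> [i|]; first by apply/funext => x; exact: eqg.
  by apply/funext => x; apply/matrixP => k j; rewrite ord1 mxE; exact: eqh.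
Qed.

Lemma vb_eq (R : realType) (n : nat) (s t : R) (rhob rhob' : 'I_n -> R -> pt3 R -> R) i :
  rhob i t = rhob' i t -> vb s rhob i t = vb s rhob' i t.
Proof. by rewrite /vb => ->. Qed.

Lemma Psi_eq (R : realType) (n : nat) (s gamma t : R) (w : state R n)
    (rhob rhob' : 'I_n -> R -> pt3 R -> R) (ub ub' : R -> pt3 R -> 'cV[R]_3) :
  (forall i, rhob i t = rhob' i t) -> ub t = ub' t ->
  Psi s gamma w rhob ub t = Psi s gamma w rhob' ub' t.
Proof.
move=> er eu; rewrite /Psi; apply: (@eq_integral _ _ _ (@leb3 R)) => x _.
by congr EFin; apply: eq_bigr => i _; rewrite (vb_eq s (er i)) er eu.
Qed.

Lemma dt_near_eq (R : realType) (f g : R -> pt3 R -> R) (a c t : R) x :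
  (forall r, a < r < c -> f r = g r) -> a < t < c -> dt f t x = dt g t x.
Proof.
move=> fg tac; rewrite /dt !derive1E; apply: near_eq_derive.
near=> r; rewrite /= fg//; near: r.
by apply: filterS (near_in_itvoo tac) => r; rewrite in_itv.
Unshelve. all: by end_near. Qed.

(** The equations are posed at interior times, where a time derivative sees only nearby interior
    times; everything else depends on a single time slice. *)
Lemma equilibrium_system_eq (R : realType) (n : nat) (T s gamma nu : R)
    (rhob rhob' : 'I_n -> R -> pt3 R -> R) (ub ub' : R -> pt3 R -> 'cV[R]_3) :
  (forall t, 0 <= t <= T -> (forall i, rhob i t = rhob' i t) /\ ub t = ub' t) ->
  equilibrium_system T s gamma nu rhob ub -> equilibrium_system T s gamma nu rhob' ub'.
Proof.
move=> E heq i t x tT.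
have tT' r : 0 < r < T -> 0 <= r <= T by case/andP => ? ?; rewrite !ltW.
have er r j : 0 < r < T -> rhob' j r = rhob j r by move=> /tT'/E[->].
have eu r : 0 < r < T -> ub' r = ub r by move=> /tT'/E[_ ->].
have ev r j : 0 < r < T -> vb s rhob' j r = vb s rhob j r by move=> /(er _ j); exact: vb_eq.
have edt (F G : R -> pt3 R -> 'cV[R]_3) :
    (forall r, 0 < r < T -> F r = G r) -> dtv F t x = dtv G t x.
  move=> FG; apply/matrixP => k j; rewrite !mxE; apply: dt_near_eq tT => r rT.
  by rewrite FG.
(* The remainder as a function of the slices at time [t], so that equality of the slices is
   enough. *)
pose F (a : 'I_n -> pt3 R -> R) U := remainder s gamma nu (fun j _ => a j) (fun=> U) i t x.
have ea : (fun j => rhob' j t) = (fun j => rhob j t) by apply/funext => j; exact: er.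
have erem : remainder s gamma nu rhob' ub' i t x = remainder s gamma nu rhob ub i t x.
  exact: (f_equal2 F ea (eu t tT)).
have d1 : dt (rhob' i) t x = dt (rhob i) t x.
  exact: (dt_near_eq (f := rhob' i) (g := rhob i) x (fun r rT => er r i rT) tT).
have d2 : dtv (fun r y => rhob' i r y *: ub' r y) t x =
    dtv (fun r y => rhob i r y *: ub r y) t x.
  by apply: edt => r rT; rewrite (er r i rT) (eu r rT).
have d3 : dtv (fun r y => rhob' i r y *: vb s rhob' i r y) t x =
    dtv (fun r y => rhob i r y *: vb s rhob i r y) t x.
  by apply: edt => r rT; rewrite (er r i rT) (ev r i rT).
rewrite d1 d2 d3 erem (er t i tT) (ev t i tT) (eu t tT).
exact: heq.
Qed.
Theorem theorem4p3 (R : realType) (n : nat) (b : 'M[R]_n) (kst N : R)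
    (hb : conditionA1 b) (hk : 0 < kst) :
  (exists delta : R, 0 < delta /\ coercive b kst N delta) /\
  forall (T K s gamma : R)
    (rhob : 'I_n -> R -> pt3 R -> R) (ub : R -> pt3 R -> 'cV[R]_3),
    0 < T -> 0 < K -> 1 < gamma -> -1 <= s -> s + 2 <= gamma ->
    smooth_data T rhob ub ->
  exists C : R, 0 < C /\
  forall delta : R, 0 < delta -> coercive b kst N delta ->
  exists Cdelta : R, 0 < Cdelta /\
  forall nu : R, 0 <= nu ->
    equilibrium_system T s gamma nu rhob ub ->
  forall w : R -> state R n,
    (forall eps : R, 0 < eps ->
       weak_solution b s gamma nu eps (w eps) /\
       dissipative b s gamma nu eps (w eps)) ->
    finite_mass_energy gamma w ->
    (forall eps : R, 0 < eps -> mass_energy_le gamma (w eps) T K) ->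
    (forall eps : R, 0 < eps -> density_bounds (w eps) T kst N) ->
  (forall eps t : R, 0 < eps -> 0 <= t <= T ->
     (Psi s gamma (w eps) rhob ub t <=
      (Psi s gamma (w eps) rhob ub 0%R + (eps * Cdelta * (nu ^+ 2 + 1))%:E)
      * (expR (C * (nu ^+ 2 + nu + 1) * t))%:E)%E) /\
  (Psi s gamma (w eps) rhob ub 0 @[eps --> (0 : R)^'+] --> 0%E ->
   ereal_sup [set Psi s gamma (w eps) rhob ub t | t in `[0, T]]
     @[eps --> (0 : R)^'+] --> 0%E).
Proof.
split; first exact: conditionA1_coercive.
move=> T K s gamma rhob ub T0 _ g1 s1 _ hsm.
have [rhob' [ub' [Q []]]] := smooth_data_extension hsm.
move=> [oO TO] rhob0 [srho sU] [prho pU] E.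
have [C C0 HC] := stability_estimate N T0 s1 g1 oO TO rhob0 srho sU
  (fun i t _ => prho i t) (fun t _ => pU t) hb hk.
exists C; split=> // delta d0 cd.
have [D D0 HD] := HC delta d0 cd.
exists D; split=> // nu nu0 heq w hw _ _ hd.
have tT0 : 0 <= (0 : R) <= T by rewrite lexx ltW.
have {HC HD} est eps : 0 < eps -> exists p : R -> R,
    [/\ forall t, 0 <= t <= T -> Psi s gamma (w eps) rhob ub t = (p t)%:E,
    0 <= p 0 &
    forall t, 0 <= t <= T ->
      p t <= (p 0 + eps * D * (nu ^+ 2 + 1)) * expR (C * (nu ^+ 2 + nu + 1) * t)].
  move=> eps0; have [ws hdiss] := hw eps eps0.
  have [p [pE p0 pb]] := HD nu eps (w eps) nu0 eps0 (equilibrium_system_eq E heq) ws hdiss (hd eps eps0).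
  exists p; split=> // t tT; have [er eu] := E t tT.
  by rewrite (Psi_eq s gamma (w eps) er eu) pE.
split=> [eps t eps0 tT|cv0].
  have [p [pE p0 pb]] := est eps eps0.
  by rewrite !pE// -EFinD -EFinM lee_fin; exact: pb.
(* The exponential is largest at [T], which makes the bound uniform in time. *)
pose M := expR (C * (nu ^+ 2 + nu + 1) * T).
have nn : 0 <= C * (nu ^+ 2 + nu + 1).
  by rewrite mulr_ge0 ?(ltW C0)// !addr_ge0// sqr_ge0.
(* The supremum lies between the value at time 0, one of its members, and the uniform bound; both
   tend to zero with [eps]. *)
apply: (@squeeze_cvge _ _ _ _ (fun eps => Psi s gamma (w eps) rhob ub 0) _
  (fun eps => (Psi s gamma (w eps) rhob ub 0 + (eps * D * (nu ^+ 2 + 1))%:E) * M%:E)%E _ _ cv0).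
- near=> eps.
  have eps0 : 0 < eps by near: eps; exact: nbhs_right_gt.
  have [p [pE p0 pb]] := est eps eps0.
  apply/andP; split.
    by apply: ereal_sup_ubound; exists 0 => //; rewrite /= in_itv/=.
  apply: ge_ereal_sup => y [t /=]; rewrite in_itv/= => tT <-.
  rewrite !pE// -EFinD -EFinM lee_fin; apply: (le_trans (pb t tT)).
  apply: ler_wpM2l; last by rewrite ler_expR; apply: ler_wpM2l => //; case/andP: tT.
  by rewrite addr_ge0// !mulr_ge0 ?ltW// ltr_wpDl// sqr_ge0.
- rewrite -[X in _ --> X](mul0e M%:E) -[X in _ --> (X * _)%E](adde0 0%E).
  apply: cvgeM => //; last exact: cvg_cst.
  apply: cvgeD => //.
  apply: cvg_EFin; first by near=> eps.
  have : (fun eps : R => eps * D * (nu ^+ 2 + 1)) x @[x --> (0 : R)^'+]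
      --> (0 : R) * D * (nu ^+ 2 + 1).
    apply: cvg_at_right_filter; apply: cvgMl; apply: cvgMl; exact: cvg_id.
  by rewrite !mul0r.
Unshelve. all: by end_near. Qed.
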